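(* Let $X$ be an $n$-dimensional normal random vector with mean $\mu$ and non-singular covariance matrix $\Sigma$, and let $X(1),X(2),\dots$ be i.i.d. copies of $X$. For $N\ge1$ set $\bar X=\frac1N\sum_{k=1}^NX(k)$, $\bar\Sigma=\frac1N\sum_{k=1}^NX(k)X(k)^{\mathrm T}-\bar X\bar X^{\mathrm T}$ and $\tilde X^{(2)}(k)=\Sigma^{1/2}\bar\Sigma^{-1/2}[X(k)-\bar X]+\mu$. (i) $X$ has the second order asymptotic universal moment matching property. Moreover, for every smooth $f:\mathbb{R}^n\to\mathbb{R}$ with compact support, $$\mathrm{Var}\Big[\frac1N\sum_{k=1}^Nf(\tilde X^{(2)}(k))\Big]=\frac{A_N}{N}\Big(\mathrm{Var}[f(X)]-\mathbb{E}[\partial f(X)]\,\Sigma\,\mathbb{E}[\partial f(X)]^{\mathrm T}-\frac12\mathrm{tr}\big[(\Sigma\,\mathbb{E}[\partial^2f(X)])^2\big]\Big),$$ with $A_N=1+\mathrm{O}(N^{-1/2})$ as $N\to\infty$. (ii) Conversely, let $X$ be a continuous $n$-dimensional random vector with $\mathbb{E}(|X|^2)<\infty$, non-singular covariance matrix and differentiable density $p$. If $X$ has the second order asymptotic universal moment matching property, then $X$ is a normal distribution.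
   Context: For a random vector $X$ with density $p$, $\mathbb{E}|X|^2<\infty$, mean $\mu$ and non-singular covariance $\Sigma$, let $X(1),\dots,X(N)$ be i.i.d. copies of $X$, $\bar X$ the sample mean, $\bar\Sigma=\frac1N\sum_kX(k)X(k)^{\mathrm T}-\bar X\bar X^{\mathrm T}$, and $\tilde X^{(2)}(k)=\Sigma^{1/2}\bar\Sigma^{-1/2}[X(k)-\bar X]+\mu$ (second order moment matched samples; $M^{1/2}$ denotes the symmetric positive definite square root and $M^{-1/2}$ its inverse). $X$ is said to have the second order asymptotic universal moment matching property if for every smooth function $f$ with compact support $\mathrm{supp}(f)\subseteq\mathrm{supp}(p)^{o}$ (interior of the support of $p$) there are constants $A_N$ with $\lim_{N\to\infty}A_N=1$ such that $\mathrm{Var}\big[\frac1N\sum_{k=1}^Nf(\tilde X^{(2)}(k))\big]\le\frac{A_N}{N}\mathrm{Var}[f(X)]$. Here $\partial f$ is the row vector of first partial derivatives and $\partial^2f$ the Hessian matrix. $A_N=1+\mathrm{O}(N^{-1/2})$ means $|A_N-1|\le CN^{-1/2}$ for some constant $C$ and all large $N$. *)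

(* Defs.v *)
From HB Require Import structures.
From mathcomp Require Import all_boot all_order all_algebra.
From mathcomp Require Import all_classical all_reals all_analysis.

Set Implicit Arguments.
Unset Strict Implicit.
Unset Printing Implicit Defensive.

Import Order.TTheory GRing.Theory Num.Theory.
Import numFieldNormedType.Exports.
Local Open Scope classical_set_scope.
Local Open Scope ring_scope.

Section defs.
Context {R : realType} {n : nat}.

Local Notation vec := 'cV[R]_n.

(** Identification of R^n with [n.-tuple R], which carries the product
    (= Borel) sigma-algebra of mathcomp-analysis. *)
Definition col_of_tuple (t : n.-tuple R) : vec := \col_i tnth t i.
Definition tuple_of_col (v : vec) : n.-tuple R := [tuple v i 0 | i < n].

Definition vmeasurable (B : set vec) : Prop :=
  measurable (col_of_tuple @^-1` B).

(** Iterated Lebesgue integral over R^n of a nonnegative function (by Tonelli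
    this is the integral against n-dimensional Lebesgue measure). *)
Fixpoint iint_tuple (m : nat) : (m.-tuple R -> \bar R) -> \bar R :=
  match m with
  | 0 => fun g => g [tuple]
  | m'.+1 => fun g =>
      (\int[@lebesgue_measure R]_x iint_tuple (fun y : m'.-tuple R => g [tuple of x :: y]))%E
  end.

Definition lebesgue_int (g : vec -> \bar R) : \bar R :=
  iint_tuple (fun t : n.-tuple R => g (col_of_tuple t)).

Definition evec (i : 'I_n) : vec := delta_mx i 0.

Definition posdef (M : 'M[R]_n) : Prop :=
  M^T = M /\ forall v : vec, v != 0 -> 0 < (v^T *m M *m v) 0 0.

(** The symmetric positive definite square root M^{1/2} (0 if M is not
    symmetric positive definite). *)
Definition sqrtmx (M : 'M[R]_n) : 'M[R]_n :=
  xget 0 [set S | posdef S /\ S *m S = M].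

Definition gauss_pdf (mu : vec) (Sigma : 'M[R]_n) (x : vec) : R :=
  (Num.sqrt ((pi *+ 2) ^+ n * \det Sigma))^-1 *
  expR (- (((x - mu)^T *m invmx Sigma *m (x - mu)) 0 0) / 2).

Definition supp (g : vec -> R) : set vec := closure [set x | g x != 0].

Definition iter_deriv (vs : seq vec) (f : vec -> R) : vec -> R :=
  foldr (fun v g => 'D_v g) f vs.

Definition smooth (f : vec -> R) : Prop :=
  forall vs : seq vec, continuous (iter_deriv vs f) /\
    forall (x v : vec), derivable (iter_deriv vs f) x v.

Definition grad (f : vec -> R) (x : vec) : 'rV[R]_n :=
  \row_i 'D_(evec i) f x.
Definition hessian (f : vec -> R) (x : vec) : 'M[R]_n :=
  \matrix_(i, j) 'D_(evec i) ('D_(evec j) f) x.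

Context {d : measure_display} {T : measurableType d} (P : probability T R).

Definition random_vector (X : T -> vec) : Prop :=
  measurable_fun [set: T] (fun w => tuple_of_col (X w)).

Definition has_density (X : T -> vec) (p : vec -> R) : Prop :=
  random_vector X /\ (forall x, 0 <= p x) /\
  measurable_fun [set: n.-tuple R] (fun t => p (col_of_tuple t)) /\
  forall B, vmeasurable B ->
    P (X @^-1` B) = lebesgue_int (fun x => (\1_B x * p x)%:E).

Definition mean_vec (X : T -> vec) : vec :=
  \col_i fine ('E_P[fun w => X w i ord0])%E.
Definition cov_mx (X : T -> vec) : 'M[R]_n :=
  \matrix_(i, j) fine (covariance P (fun w => X w i ord0) (fun w => X w j ord0)).

Definition mean_grad (X : T -> vec) (f : vec -> R) : 'rV[R]_n :=
  \row_i fine ('E_P[fun w => grad f (X w) ord0 i])%E.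
Definition mean_hessian (X : T -> vec) (f : vec -> R) : 'M[R]_n :=
  \matrix_(i, j) fine ('E_P[fun w => hessian f (X w) i j])%E.

Definition iid_copies (X : T -> vec) (Xs : nat -> T -> vec) : Prop :=
  random_vector X /\ (forall k, random_vector (Xs k)) /\
  (forall k B, vmeasurable B -> P (Xs k @^-1` B) = P (X @^-1` B)) /\
  (forall (s : seq nat) (B : nat -> set vec), uniq s ->
     (forall k, vmeasurable (B k)) ->
     P (\bigcap_(k in [set` s]) (Xs k @^-1` B k)) =
       (\prod_(k <- s) P (Xs k @^-1` B k))%E).

(** Sample mean, sample covariance and second order moment matched samples
    built from the first N copies X(1),...,X(N) := Xs 0, ..., Xs (N-1). *)
Definition sample_mean (Xs : nat -> T -> vec) (N : nat) (w : T) : vec :=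
  N%:R^-1 *: \sum_(k < N) Xs k w.
Definition sample_cov (Xs : nat -> T -> vec) (N : nat) (w : T) : 'M[R]_n :=
  N%:R^-1 *: \sum_(k < N) (Xs k w *m (Xs k w)^T)
  - sample_mean Xs N w *m (sample_mean Xs N w)^T.
Definition mm2_sample (X : T -> vec) (Xs : nat -> T -> vec) (N k : nat)
  (w : T) : vec :=
  sqrtmx (cov_mx X) *m invmx (sqrtmx (sample_cov Xs N w))
    *m (Xs k w - sample_mean Xs N w) + mean_vec X.

Definition mm2_estimator (X : T -> vec) (Xs : nat -> T -> vec)
  (f : vec -> R) (N : nat) (w : T) : R :=
  N%:R^-1 * \sum_(k < N) f (mm2_sample X Xs N k w).

Definition UMM2 (X : T -> vec) (Xs : nat -> T -> vec) (p : vec -> R) : Prop :=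
  forall f : vec -> R, smooth f -> compact (supp f) ->
    supp f `<=` interior (supp p) ->
    exists A : nat -> R, A m @[m --> \oo] --> (1:R) /\
      forall N : nat, (0 < N)%N ->
        ('V_P[mm2_estimator X Xs f N] <=
           (A N / N%:R)%:E * 'V_P[fun w => f (X w)])%E.

End defs.

Definition one_plus_O_invsqrt {R : realType} (A : nat -> R) : Prop :=
  exists (C : R) (N0 : nat), forall N : nat, (N0 <= N)%N ->
    `|A N - 1| <= C / Num.sqrt N%:R.

(* Main.v *)
(** Expand the matched samples around the true mean and covariance. The
    estimator equals [E f(X) + (1/N) sum_k l(X(k))] up to an error of the order
    of the squared deviations of the sample moments, where
    [l = f - E f(X) - linear_part] and [linear_part] is a combination of the
    centred coordinates of x and of their centred products.

    (i) For Gaussian X, Stein's identity shows that [linear_part] is the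
    orthogonal projection of f(X) on these functions, so that the variance of
    l(X) is the bracket of the statement; fourth moments bound the error.

    (ii) Correlate the estimator with
    [(1/N) sum_k (f(X(k)) - E f(X)) zeta_k], where the cutoff [zeta_k] depends
    on the other samples only and keeps their moments close to the true ones.
    By Cauchy-Schwarz, moment matching forces [0 <= E (f * linear_part)(X)] for
    every admissible f. For f a combination of bumps shrinking to points of
    {p > 0} the limit is a quadratic form in the weights; as it is nonnegative,
    every weight annihilating the functions [y_i p] and
    [(y_i y_j - Sigma_ij) p], where [y = x - E X], also annihilates the gradient of p, which is
    therefore p times a quadratic polynomial. Integrating along lines,
    [p(x + h) = p(x) exp(rho0 + rho1 / 2 + rho2 / 3)]. Averaging h and -h and
    using that p has mass one gives [rho1 <= 0]; being affine in x it is
    constant, so the cubic term vanishes and p is the exponential of a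
    quadratic polynomial. A degenerate direction would make p invariant under a
    translation, against the finiteness of the mean. *)
Require Import Defs.
From HB Require Import structures.
From mathcomp Require Import all_boot all_order all_algebra.
From mathcomp Require Import all_classical all_reals all_analysis.
From mathcomp Require Import measurable_realfun ring lra.

Set Implicit Arguments.
Unset Strict Implicit.
Unset Printing Implicit Defensive.

Import Order.TTheory GRing.Theory Num.Theory.
Import numFieldNormedType.Exports.
Local Open Scope classical_set_scope.
Local Open Scope ring_scope.

(** * Quadratic forms and matrix square roots *)

(** Square roots are treated without spectral theory. Existence comes from a fixed-point iteration,
    which also exhibits the root as a limit of measurable maps. The difference [E] of two roots
    solves [E S' + S E = H], and a solution is controlled by the coercivity of one coefficient
    alone; uniqueness, Lipschitz bounds, the derivative [lyap] and the second order remainder all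
    come from that single estimate. In (ii) the vector has second moments only: squared deviations
    of the sample covariance need not be integrable, so the expansion behind (i) has no usable
    error. What survives is the effect of one sample: [N] times the change of the estimator when
    X(k) is removed is [influence] at X(k), up to an error of small mean, and against a centred
    function of X(k) the remaining estimator averages out. Hence the partial sums over a predicate,
    still divided by [N]. As [linear_part] is linear in f, the inequality of (ii) is quadratic in f.
    It need not come from a symmetric form, so null weights are exploited by perturbing them: the
    first order term must vanish. *)

Section quadratic_forms.
Context {R : realType}.

Lemma discriminant_le (a b c : R) :
  (forall t : R, 0 <= a + 2 * t * b + t ^+ 2 * c) -> b ^+ 2 <= a * c.
Proof.
move=> H; have a0 : 0 <= a by have := H 0; rewrite expr0n /= !(mulr0, mul0r, addr0).
have [c0|c0] := eqVneq c 0.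
  rewrite c0 mulr0; have [->|b0] := eqVneq b 0; first by rewrite expr0n.
  have := H (- (a + 1) / (2 * b)); rewrite c0 mulr0 addr0.
  have -> : a + 2 * (- (a + 1) / (2 * b)) * b = -1 by field.
  by rewrite lerNr oppr0 ler10.
have {c0}c0 : 0 < c.
  rewrite lt_neqAle eq_sym c0 /= leNgt; apply/negP => c1.
  (* For [c < 0], adding the hypotheses at [s] and [- s] removes [b]; this [s >= 1] makes
     [s ^+ 2 * - c] exceed [a]. *)
  set s := (a + 1) / - c + 1.
  have s1 : 1 <= s by rewrite /s lerDr divr_ge0 ?addr_ge0 // oppr_ge0 ltW.
  have s2 : s * (- c) = a + 1 - c by rewrite /s mulrDl divfK ?oppr_eq0 ?lt_eqF // mul1r.
  have H1 := H s; have H2 := H (- s).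
  have H3 : s * (s * - c) >= s * - c by rewrite ler_peMl // mulr_ge0 ?oppr_ge0 ?(ltW c1) //; lra.
  by rewrite sqrrN in H2; rewrite expr2 in H1 H2; nra.
have := H (- b / c).
have -> : a + 2 * (- b / c) * b + (- b / c) ^+ 2 * c = (a * c - b ^+ 2) / c.
  by field; rewrite gt_eqF.
by rewrite ler_pdivlMr // mul0r subr_ge0.
Qed.

Context {n : nat}.
Implicit Types (S A B : 'M[R]_n) (u v w : 'cV[R]_n).

Definition bform S u v : R := (u^T *m S *m v) 0 0.
Definition qform S v : R := bform S v v.

Lemma bformDr S u v w : bform S u (v + w) = bform S u v + bform S u w.
Proof. by rewrite /bform mulmxDr mxE. Qed.
Lemma bformDl S u v w : bform S (u + v) w = bform S u w + bform S v w.
Proof. by rewrite /bform raddfD /= !mulmxDl mxE. Qed.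
Lemma bformZr S a u v : bform S u (a *: v) = a * bform S u v.
Proof. by rewrite /bform -scalemxAr mxE. Qed.
Lemma bformZl S a u v : bform S (a *: u) v = a * bform S u v.
Proof. by rewrite /bform linearZ /= -!scalemxAl mxE. Qed.
Lemma bform_sym S u v : S^T = S -> bform S u v = bform S v u.
Proof.
move=> sS; rewrite /bform; have -> : v^T *m S *m u = (u^T *m S *m v)^T.
  by rewrite !trmx_mul trmxK sS mulmxA.
by rewrite [RHS]mxE.
Qed.
Lemma qformD S u v : S^T = S ->
  qform S (u + v) = qform S u + 2 * bform S u v + qform S v.
Proof.
move=> sS; rewrite /qform !(bformDl, bformDr) (bform_sym v u sS); ring.
Qed.
Lemma qformZ S a v : qform S (a *: v) = a ^+ 2 * qform S v.
Proof. by rewrite /qform bformZl bformZr; ring. Qed.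

Definition psd S := S^T = S /\ forall v, 0 <= qform S v.

Lemma psd_CS S u v : psd S -> (bform S u v) ^+ 2 <= qform S u * qform S v.
Proof.
case=> sS S0; apply: discriminant_le => t.
have := S0 (u + t *: v); rewrite qformD // bformZr qformZ.
by rewrite mulrA mulrC -mulrA.
Qed.

Lemma qform1E v : qform 1%:M v = \sum_i v i 0 ^+ 2.
Proof.
rewrite /qform /bform mulmx1 mxE; apply: eq_bigr => i _.
by rewrite mxE expr2.
Qed.

Lemma qform1_ge0 v : 0 <= qform 1%:M v.
Proof. by rewrite qform1E; apply: sumr_ge0 => i _; rewrite sqr_ge0. Qed.

Lemma qform1_eq0 v : (qform 1%:M v == 0) = (v == 0).
Proof.
rewrite qform1E; apply/eqP/eqP => [H|->].
  apply/matrixP => i j; rewrite ord1 mxE; apply/eqP; rewrite -sqrf_eq0; apply/eqP.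
  by apply: (psumr_eq0P _ H) => // k _; rewrite sqr_ge0.
by rewrite big1 // => i _; rewrite mxE expr0n.
Qed.

Lemma qform1_gt0 v : (0 < qform 1%:M v) = (v != 0).
Proof. by rewrite lt_neqAle qform1_ge0 andbT eq_sym qform1_eq0. Qed.

Lemma psd1 : psd 1%:M.
Proof. by split; [rewrite trmx1|exact: qform1_ge0]. Qed.

Lemma posdef_psd S : posdef S -> psd S.
Proof.
case=> sS S0; split=> // v; have [->|v0] := eqVneq v 0.
  by rewrite /qform /bform mulmx0 mxE.
exact/ltW/S0.
Qed.

Lemma posdef_unit S : posdef S -> S \in unitmx.
Proof.
case=> sS S0; rewrite -row_free_unit -kermx_eq0.
apply/eqP/row_matrixP => i; rewrite row0; set r := row i _.
have rS : r *m S = 0 by rewrite /r -row_mul mulmx_ker row0.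
apply/eqP; rewrite -[r]trmxK trmx_eq0; apply/negPn/negP => r0.
by have := S0 _ r0; rewrite trmxK rS mul0mx mxE ltxx.
Qed.

(** By Cauchy-Schwarz a vector with [qform S v = 0] is orthogonal to every vector for the form, so
    it lies in the kernel of [S]. *)
Lemma psd_unit_posdef S : psd S -> S \in unitmx -> posdef S.
Proof.
move=> pS uS; have [sS S0] := pS; split => // v v0.
change (0 < qform S v); rewrite lt_neqAle S0 andbT eq_sym; apply/negP => /eqP q0.
have H u : bform S u v = 0.
  apply/eqP; rewrite -sqrf_eq0 eq_le sqr_ge0 andbT.
  by rewrite (le_trans (psd_CS u v pS)) // q0 mulr0.
case/negP: v0; rewrite -(mulKmx uS v).
suff -> : S *m v = 0 by rewrite mulmx0.
apply/matrixP => i j; rewrite ord1 [RHS]mxE.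
have := H (delta_mx i 0); rewrite /bform -mulmxA trmx_delta -rowE mxE //.
Qed.

Lemma posdef_inv S : posdef S -> posdef (invmx S).
Proof.
move=> pS; have uS := posdef_unit pS; have [sS S0] := pS.
have sI : (invmx S)^T = invmx S by rewrite trmx_inv sS.
split=> // v v0.
have -> : v^T *m invmx S *m v = (invmx S *m v)^T *m S *m (invmx S *m v).
  by rewrite trmx_mul sI -!mulmxA (mulKVmx uS).
apply: S0; apply: contra v0 => /eqP H.
by rewrite -(mulKVmx uS v) H mulmx0.
Qed.

Lemma qform_le_norm S v : `|qform S v| <= (\sum_i \sum_j `|S i j|) * qform 1%:M v.
Proof.
rewrite /qform /bform mxE (le_trans (ler_norm_sum _ _ _)) // .
rewrite exchange_big mulr_suml; apply: ler_sum => j _.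
rewrite mxE normrM mulr_suml (le_trans (ler_wpM2r (normr_ge0 _) (ler_norm_sum _ _ _))) //.
rewrite !mulr_suml; apply: ler_sum => i _; rewrite mxE normrM.
rewrite [`|v i 0| * _]mulrC -mulrA; apply: ler_wpM2l => //.
rewrite -/(bform _ _ _) -/(qform _ _).
have le1 k : `|v k 0| ^+ 2 <= qform 1%:M v.
  rewrite real_normK ?num_real // qform1E (bigD1 k) //= lerDl.
  by apply: sumr_ge0 => l _; rewrite sqr_ge0.
move: (le1 i) (le1 j) (sqr_ge0 (`|v i 0| - `|v j 0|)).
set a := `|v i 0|; set b := `|v j 0|; set q := qform _ _; nra.
Qed.

(** A quantitative substitute for the smallest eigenvalue: Cauchy-Schwarz between [v] and
    [invmx S *m v] gives [|v|^4 <= qform S v * qform (invmx S) v], and the last factor is at most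
    [C |v|^2]. *)
Lemma posdef_lb S : posdef S ->
  exists2 c : R, 0 < c & forall v, c * qform 1%:M v <= qform S v.
Proof.
move=> pS; have uS := posdef_unit pS; have [sS S0] := pS.
have psS := posdef_psd pS.
set C := 1 + \sum_i \sum_j `|invmx S i j|.
have C0 : 0 < C by rewrite ltr_pwDl // sumr_ge0 // => i _; rewrite sumr_ge0.
exists C^-1; first by rewrite invr_gt0.
move=> v; rewrite ler_pdivrMl //.
have [->|v0] := eqVneq v 0; first by rewrite /qform /bform !mulmx0 !mxE mulr0.
have q0 : 0 < qform 1%:M v by rewrite qform1_gt0.
have := psd_CS v (invmx S *m v) psS.
have -> : bform S v (invmx S *m v) = qform 1%:M v.
  by rewrite /qform /bform -mulmxA (mulKVmx uS) mulmx1.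
have -> : qform S (invmx S *m v) = qform (invmx S) v.
  by rewrite /qform /bform -mulmxA (mulKVmx uS) trmx_mul trmx_inv sS.
have Hq : qform (invmx S) v <= C * qform 1%:M v.
  apply: (le_trans (ler_norm _)); apply: (le_trans (qform_le_norm _ _)).
  by apply: ler_wpM2r; [exact: ltW|rewrite /C lerDr].
move=> H; rewrite -(ler_pM2r q0) -expr2 (le_trans H) //.
by rewrite (le_trans (ler_wpM2l (psS.2 v) Hq)) // mulrA [_ * C]mulrC.
Qed.

End quadratic_forms.

Section matrix_limits.
Context {R : realType} {I : Type} (F : set_system I) {FF : ProperFilter F}.

Lemma cvg_sumr (J : Type) (s : seq J) (P : pred J) (f : J -> I -> R) (l : J -> R) :
  (forall j, P j -> f j x @[x --> F] --> l j) ->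
  (\sum_(j <- s | P j) f j x) @[x --> F] --> \sum_(j <- s | P j) l j.
Proof.
move=> H; elim: s => [|j s IH].
  by rewrite big_nil; under eq_fun do rewrite big_nil; exact: cvg_cst.
rewrite big_cons; under eq_fun do rewrite big_cons.
by case: ifPn => // Pj; apply: cvgD => //; exact: H.
Qed.

Definition mcvg m n (M : I -> 'M[R]_(m, n)) (L : 'M[R]_(m, n)) :=
  forall i j, M x i j @[x --> F] --> L i j.

Lemma mcvg_cst m n (L : 'M[R]_(m, n)) : mcvg (fun=> L) L.
Proof. by move=> i j; exact: cvg_cst. Qed.

Lemma mcvgD m n (M N : I -> 'M[R]_(m, n)) L K :
  mcvg M L -> mcvg N K -> mcvg (fun x => M x + N x) (L + K).
Proof.
move=> h1 h2 i j; rewrite mxE; under eq_fun do rewrite mxE.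
by apply: cvgD; [exact: h1|exact: h2].
Qed.

Lemma mcvgZ m n (a : I -> R) (l : R) (M : I -> 'M[R]_(m, n)) L :
  a x @[x --> F] --> l ->
  mcvg M L -> mcvg (fun x => a x *: M x) (l *: L).
Proof.
move=> h1 h2 i j; rewrite mxE; under eq_fun do rewrite mxE.
by apply: cvgM; [exact: h1|exact: h2].
Qed.

Lemma mcvgN m n (M : I -> 'M[R]_(m, n)) L : mcvg M L -> mcvg (fun x => - M x) (- L).
Proof.
move=> h i j; rewrite mxE; under eq_fun do rewrite mxE.
by apply: cvgN; exact: h.
Qed.

Lemma mcvg_mul m n p (M : I -> 'M[R]_(m, n)) (N : I -> 'M[R]_(n, p)) L K :
  mcvg M L -> mcvg N K -> mcvg (fun x => M x *m N x) (L *m K).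
Proof.
move=> h1 h2 i j; rewrite mxE; under eq_fun do rewrite mxE.
by apply: cvg_sumr => k _; apply: cvgM; [exact: h1|exact: h2].
Qed.

Lemma mcvg_tr m n (M : I -> 'M[R]_(m, n)) L : mcvg M L -> mcvg (fun x => (M x)^T) L^T.
Proof. by move=> h i j; rewrite mxE; under eq_fun do rewrite mxE; exact: h. Qed.

End matrix_limits.

(** * Square roots by a fixed-point iteration *)

Section square_root.
Context {R : realType} {n : nat}.
Implicit Types (S A B M : 'M[R]_n) (u v w : 'cV[R]_n).

Definition norm2 v : R := Num.sqrt (qform 1%:M v).

Lemma norm2_ge0 v : 0 <= norm2 v. Proof. exact: sqrtr_ge0. Qed.
Lemma norm2_sqr v : norm2 v ^+ 2 = qform 1%:M v.
Proof. by rewrite sqr_sqrtr // qform1_ge0. Qed.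

Lemma bform1_le u v : `|bform 1%:M u v| <= norm2 u * norm2 v.
Proof.
rewrite -sqrtrM ?qform1_ge0 // -sqrtr_sqr ler_wsqrtr //.
exact: psd_CS (psd1).
Qed.

Lemma norm2D u v : norm2 (u + v) <= norm2 u + norm2 v.
Proof.
rewrite -(ler_pXn2r (n := 2)) ?nnegrE ?addr_ge0 ?norm2_ge0 //.
rewrite norm2_sqr qformD ?trmx1 // sqrrD !norm2_sqr.
have := bform1_le u v; have := ler_norm (bform 1%:M u v); lra.
Qed.

Lemma norm2Z a v : norm2 (a *: v) = `|a| * norm2 v.
Proof. by rewrite /norm2 qformZ sqrtrM ?sqr_ge0 // sqrtr_sqr. Qed.

Lemma entry_le_norm2 v i : `|v i 0| <= norm2 v.
Proof.
rewrite -sqrtr_sqr ler_wsqrtr // qform1E (bigD1 i) //= lerDl.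
by apply: sumr_ge0 => l _; rewrite sqr_ge0.
Qed.

(** The Euclidean operator norm, as a predicate. The entrywise norm loses a factor [n] at each
    product, which would ruin the contraction of the iteration below. *)
Definition opbound M (b : R) := forall v, norm2 (M *m v) <= b * norm2 v.

Lemma opboundD M N a b : opbound M a -> opbound N b -> opbound (M + N) (a + b).
Proof.
move=> h1 h2 v; rewrite mulmxDl mulrDl (le_trans (norm2D _ _)) //.
by rewrite lerD.
Qed.
Lemma opboundZ M a b : opbound M a -> opbound (b *: M) (`|b| * a).
Proof.
by move=> h v; rewrite -scalemxAl norm2Z -mulrA ler_wpM2l.
Qed.
Lemma opboundM M N a b : 0 <= a -> opbound M a -> opbound N b ->
  opbound (M *m N) (a * b).
Proof.
move=> a0 h1 h2 v; rewrite -mulmxA (le_trans (h1 _)) // -mulrA.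
by rewrite ler_wpM2l.
Qed.
Lemma opbound0 : opbound 0 0.
Proof. by move=> v; rewrite mul0mx mul0r /norm2 /qform /bform mulmx0 mxE sqrtr0. Qed.
Lemma opboundW M a b : a <= b -> opbound M a -> opbound M b.
Proof. by move=> ab h v; rewrite (le_trans (h v)) // ler_wpM2r // norm2_ge0. Qed.

Lemma norm2_delta i : norm2 (delta_mx i 0) = 1.
Proof.
rewrite /norm2 qform1E (bigD1 i) //= big1 ?mxE ?eqxx ?expr1n ?addr0 ?sqrtr1 //.
by move=> j ji; rewrite mxE (negbTE ji) expr0n.
Qed.

Lemma opbound_entry M b i j : opbound M b -> `|M i j| <= b.
Proof.
move=> h; have := h (delta_mx j 0); rewrite norm2_delta mulr1.
apply: le_trans; have -> : M i j = (M *m (delta_mx j 0 : 'cV[R]_n)) i 0.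
  rewrite mxE (bigD1 j) //= mxE !eqxx mulr1 big1 ?addr0 // => k kj.
  by rewrite mxE (negbTE kj) mulr0.
exact: entry_le_norm2.
Qed.

(** The square of [norm2 (B *m v)] is [bform B v (B *m v)]; Cauchy-Schwarz for the form [B] bounds
    the square of this by [b |v|^2 * b |B v|^2]. *)
Lemma opbound_psd B b : psd B -> (forall v, qform B v <= b * qform 1%:M v) ->
  0 <= b -> opbound B b.
Proof.
move=> pB h b0 v.
have h1 : bform B v (B *m v) = norm2 (B *m v) ^+ 2.
  by rewrite norm2_sqr /qform /bform mulmx1 trmx_mul pB.1 !mulmxA.
have := psd_CS v (B *m v) pB; rewrite h1 => h2.
have h3 : norm2 (B *m v) ^+ 2 ^+ 2 <= (b * norm2 v * norm2 (B *m v)) ^+ 2.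
  rewrite (le_trans h2) // !exprMn !norm2_sqr expr2.
  rewrite -[leRHS]mulrA mulrACA; apply: ler_pM => //; exact: pB.2.
have := norm2_ge0 (B *m v); rewrite le_eqVlt => /predU1P[<-|h4].
  by rewrite mulr_ge0 // norm2_ge0.
rewrite -(ler_pM2r h4) -expr2 -(ler_pXn2r (n := 2)) ?nnegrE ?sqr_ge0 //.
by rewrite !mulr_ge0 // norm2_ge0.
Qed.

(* Fixed-point iteration for Y = (B + Y^2) / 2, whose solution is 1 - (1 - B)^(1/2). *)
Fixpoint sqrt_iter B k : 'M[R]_n :=
  if k is k'.+1 then 2^-1 *: (B + sqrt_iter B k' *m sqrt_iter B k') else 0.

Section converge.
Variables (B : 'M[R]_n) (b : R).
Hypotheses (sB : B^T = B) (b0 : 0 <= b) (b1 : b < 1) (hB : opbound B b).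

Lemma sqrt_iter_sym k : (sqrt_iter B k)^T = sqrt_iter B k.
Proof.
elim: k => [|k IH] /=; first by rewrite trmx0.
by rewrite linearZ /= raddfD /= trmx_mul IH sB.
Qed.

Lemma sqrt_iter_opbound k : opbound (sqrt_iter B k) b.
Proof.
elim: k => [|k IH] /=; first exact: opboundW b0 opbound0.
apply: opboundW (opboundZ _ (opboundD hB (opboundM b0 IH IH))).
rewrite ger0_norm ?invr_ge0 //; have : b * b <= b by rewrite ler_piMr // ltW.
lra.
Qed.

(** [Z^2 - Y^2 = Z (Z - Y) + (Z - Y) Y] needs no commutation, and the iterates have norm at most
    [b]; with the factor [2^-1] each step contracts by [b]. *)
Lemma sqrt_iter_diff k : opbound (sqrt_iter B k.+1 - sqrt_iter B k) (b ^+ k.+1).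
Proof.
elim: k => [|k IH].
  rewrite /= subr0 mul0mx addr0 expr1.
  apply: opboundW (opboundZ _ hB); rewrite ger0_norm ?invr_ge0 //; by rewrite ler_piMl // invf_le1 ?ltr0n ?ler1n.
have -> : sqrt_iter B k.+2 - sqrt_iter B k.+1 =
  2^-1 *: (sqrt_iter B k.+1 *m (sqrt_iter B k.+1 - sqrt_iter B k) +
           (sqrt_iter B k.+1 - sqrt_iter B k) *m sqrt_iter B k).
  rewrite mulmxBr mulmxBl addrA subrK.
  rewrite -[sqrt_iter B k.+2]/(2^-1 *: (B + sqrt_iter B k.+1 *m sqrt_iter B k.+1)).
  rewrite -[X in _ - X = _]/(2^-1 *: (B + sqrt_iter B k *m sqrt_iter B k)).
  by rewrite -scalerBr opprD addrACA subrr add0r.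
have bk0 : 0 <= b ^+ k.+1 by rewrite exprn_ge0.
apply: opboundW (opboundZ _ (opboundD (opboundM b0 (sqrt_iter_opbound _) IH)
   (opboundM bk0 IH (sqrt_iter_opbound _)))).
rewrite ger0_norm ?invr_ge0 // [b ^+ k.+2]exprS; set c := b ^+ k.+1; have -> : b * c + c * b = 2 * (b * c) by ring. by rewrite mulKf.
Qed.

Lemma sqrt_iter_cvg i j : cvgn (fun k => sqrt_iter B k i j).
Proof.
pose u k := sqrt_iter B k i j.
have : cvgn (series (telescope u)).
  apply: normed_cvg; apply: (@series_le_cvg _ _ (geometric b b)).
  - by move=> k; exact: normr_ge0.
  - by move=> k; exact: (mulr_ge0 b0 (exprn_ge0 _ b0)).
  - move=> k; rewrite /telescope /geometric /= -exprS.
    have := opbound_entry i j (sqrt_iter_diff k).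
    by rewrite mxE [X in _ + X]mxE.
  - by apply: is_cvg_geometric_series; rewrite ger0_norm.
rewrite telescopeK => h.
have -> : (fun k => sqrt_iter B k i j) = (fun k => (u k - u 0%N) + u 0%N).
  by apply/funext => k; rewrite subrK.
by apply: is_cvgD => //; exact: is_cvg_cst.
Qed.

Definition sqrt_lim := \matrix_(i, j) limn (fun k => sqrt_iter B k i j).

Lemma sqrt_iter_mcvg : mcvg \oo (sqrt_iter B) sqrt_lim.
Proof. by move=> i j; rewrite mxE; exact: sqrt_iter_cvg. Qed.

Lemma mcvgn_unique (M : nat -> 'M[R]_n) L K :
  mcvg \oo M L -> mcvg \oo M K -> L = K.
Proof.
move=> h1 h2; apply/matrixP => i j.
by rewrite -(cvg_lim _ (h1 i j)) // -(cvg_lim _ (h2 i j)).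
Qed.

Lemma sqrt_limE : (1%:M - sqrt_lim) *m (1%:M - sqrt_lim) = 1%:M - B.
Proof.
have h : sqrt_lim = 2^-1 *: (B + sqrt_lim *m sqrt_lim).
  apply: (@mcvgn_unique (fun k => sqrt_iter B k.+1)).
    move=> i j; have := @sqrt_iter_mcvg i j.
    by rewrite -(cvg_shiftS (fun k => sqrt_iter B k i j)).
  apply: mcvgZ; first exact: cvg_cst.
  apply: mcvgD; first exact: mcvg_cst.
  by apply: mcvg_mul; exact: sqrt_iter_mcvg.
rewrite mulmxBl mul1mx mulmxBr mulmx1.
have -> : sqrt_lim *m sqrt_lim = 2 *: sqrt_lim - B.
  by rewrite {3}h scalerA divff // scale1r addrC addKr.
rewrite scaler_nat mulr2n; apply/matrixP => i j; rewrite !mxE; ring.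
Qed.

Lemma sqrt_lim_posdef : posdef (1%:M - sqrt_lim).
Proof.
split.
  rewrite raddfB /= trmx1; congr (_ - _); apply: mcvgn_unique sqrt_iter_mcvg.
  by have := mcvg_tr sqrt_iter_mcvg; under eq_fun do rewrite sqrt_iter_sym.
move=> v v0; apply: (@lt_le_trans _ _ ((1 - b) * qform 1%:M v)).
  by rewrite mulr_gt0 ?subr_gt0 // qform1_gt0.
have h : mcvg \oo (fun k => v^T *m (1%:M - sqrt_iter B k) *m v)
    (v^T *m (1%:M - sqrt_lim) *m v).
  apply: mcvg_mul; last exact: mcvg_cst.
  apply: mcvg_mul; first exact: mcvg_cst.
  by apply: mcvgD; [exact: mcvg_cst|apply: mcvgN; exact: sqrt_iter_mcvg].
rewrite -(cvg_lim _ (h 0 0)) //; apply: limr_ge; first by apply/cvg_ex; eexists; exact: h.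
near=> k.
have -> : (v^T *m (1%:M - sqrt_iter B k) *m v) 0 0 =
    qform 1%:M v - bform 1%:M v (sqrt_iter B k *m v).
  by rewrite mulmxBr mulmxBl /qform /bform !mulmx1 mulmxA !mxE.
rewrite mulrBl mul1r lerD2l lerN2.
apply: (le_trans (ler_norm _)); apply: (le_trans (bform1_le _ _)).
apply: (le_trans (ler_wpM2l (norm2_ge0 _) (sqrt_iter_opbound k v))).
by rewrite mulrCA -expr2 norm2_sqr /qform /bform mulmx1.
Unshelve. all: by end_near. Qed.

End converge.
End square_root.

Section matrix_norm.
Context {R : realType}.

Lemma mxnorm_entry m n (M : 'M[R]_(m, n)) i j : `|M i j| <= `|M|.
Proof.
rewrite [leRHS]/Num.norm /= mx_normrE.
exact: (le_bigmax _ (fun ij : 'I_m * 'I_n => `|M ij.1 ij.2|) (i, j)).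
Qed.

Lemma mxnorm_le m n (M : 'M[R]_(m, n)) (c : R) :
  0 <= c -> (forall i j, `|M i j| <= c) -> `|M| <= c.
Proof.
move=> c0 h; rewrite [leLHS]/Num.norm /= mx_normrE; by apply: bigmax_le => // -[i j] _; exact: h.
Qed.

Lemma mxnormM m n p (A : 'M[R]_(m, n)) (B : 'M[R]_(n, p)) :
  `|A *m B| <= n%:R * `|A| * `|B|.
Proof.
apply: mxnorm_le => [|i j]; first by rewrite !mulr_ge0.
rewrite mxE (le_trans (ler_norm_sum _ _ _)) //.
apply: (@le_trans _ _ (\sum_(k < n) `|A| * `|B|)).
  by apply: ler_sum => k _; rewrite normrM ler_pM // mxnorm_entry.
by rewrite sumr_const card_ord -mulrA [leRHS]mulr_natl.
Qed.

Lemma mxnormM_le m n p (A : 'M[R]_(m, n)) (B : 'M[R]_(n, p)) a b :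
  `|A| <= a -> `|B| <= b -> `|A *m B| <= n%:R * a * b.
Proof.
move=> h1 h2; apply: (le_trans (mxnormM _ _)).
rewrite -!mulrA ler_wpM2l // ler_pM //.
Qed.

Lemma mxnorm_tr m n (A : 'M[R]_(m, n)) : `|A^T| = `|A|.
Proof.
apply/le_anti/andP; split; apply: mxnorm_le => // i j.
  by rewrite mxE mxnorm_entry.
by have := mxnorm_entry A^T j i; rewrite mxE.
Qed.

Lemma mxtrace_le n (A : 'M[R]_n) : `|\tr A| <= n%:R * `|A|.
Proof.
rewrite (le_trans (ler_norm_sum _ _ _)) //.
rewrite (le_trans (ler_sum _ (fun i _ => mxnorm_entry A i i))) //.
by rewrite sumr_const card_ord [leRHS]mulr_natl.
Qed.

Lemma mxnorm1 n : `|1%:M : 'M[R]_n| <= 1.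
Proof.
apply: mxnorm_le => // i j; rewrite mxE; case: eqP => _ /=.
  by rewrite normr1.
by rewrite normr0.
Qed.

Lemma sum_mxnorm n (A : 'M[R]_n) :
  \sum_i \sum_j `|A i j| <= n%:R ^+ 2 * `|A|.
Proof.
rewrite (le_trans (ler_sum _ (fun i _ => ler_sum _ (fun j _ => mxnorm_entry A i j)))) //.
by rewrite !sumr_const !card_ord -[in leLHS]mulr_natl -[X in _ * X]mulr_natl mulrA expr2.
Qed.

Lemma qform_le_mxnorm n (A : 'M[R]_n) (v : 'cV[R]_n) :
  `|qform A v| <= n%:R ^+ 2 * `|A| * qform 1%:M v.
Proof.
apply: (le_trans (qform_le_norm _ _)); apply: ler_wpM2r (sum_mxnorm _).
exact: qform1_ge0.
Qed.

End matrix_norm.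

(** * Existence, uniqueness and stability of the positive definite root *)

Section sqrtmx_theory.
Context {R : realType} {n : nat}.
Implicit Types (S A B M E H : 'M[R]_n) (u v w : 'cV[R]_n).

(* [1%:M - A / L] has its spectrum in [0, 1), for this L. *)
Definition sqrt_scale A : R := 1 + \sum_i \sum_j (1 + A i j ^+ 2).
Definition sqrt_shift A : 'M[R]_n := 1%:M - (sqrt_scale A)^-1 *: A.

Lemma sqrt_scale_gt0 A : 0 < sqrt_scale A.
Proof.
rewrite ltr_pwDl //; apply: sumr_ge0 => i _; apply: sumr_ge0 => j _.
by rewrite addr_ge0 // sqr_ge0.
Qed.

Lemma qformB A B v : qform (A - B) v = qform A v - qform B v.
Proof. by rewrite /qform /bform mulmxBr mulmxBl !mxE. Qed.
Lemma qformDm A B v : qform (A + B) v = qform A v + qform B v.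
Proof. by rewrite /qform /bform mulmxDr mulmxDl !mxE. Qed.
Lemma qformZm a A v : qform (a *: A) v = a * qform A v.
Proof. by rewrite /qform /bform -scalemxAr -scalemxAl !mxE. Qed.

Lemma sqrt_shift_bound A : posdef A ->
  (sqrt_shift A)^T = sqrt_shift A /\
  exists b, [/\ 0 <= b, b < 1 & opbound (sqrt_shift A) b].
Proof.
move=> pA; have L0 := sqrt_scale_gt0 A; have [sA _] := pA.
have sB : (sqrt_shift A)^T = sqrt_shift A.
  by rewrite /sqrt_shift raddfB /= linearZ /= trmx1 sA.
split=> //; have [c c0 hc] := posdef_lb pA.
exists (Num.max 0 (1 - c / sqrt_scale A)); split.
- by rewrite le_max lexx.
- by rewrite gt_max ltr01 /= ltrBlDr ltrDl divr_gt0.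
apply: opbound_psd; last by rewrite le_max lexx.
  split=> // v; rewrite /sqrt_shift qformB qformZm subr_ge0 ler_pdivrMl //.
  apply: (le_trans (ler_norm _)); apply: (le_trans (qform_le_norm _ _)).
  apply: ler_wpM2r; first exact: qform1_ge0.
  apply: ler_wpDl => //; apply: ler_sum => i _; apply: ler_sum => j _.
  (* [2 |a| <= 1 + a^2]: the scale dominates the sum of the absolute values of the entries while
     being a polynomial in them. *)
  have := sqr_ge0 (`|A i j| - 1); rewrite sqrrB real_normK ?num_real // mulr1.
  have := sqr_ge0 (A i j); rewrite expr1n mulr2n; move: (`|_|) (_ ^+ 2) => a b; lra.
move=> v; apply: (@le_trans _ _ ((1 - c / sqrt_scale A) * qform 1%:M v)).
  rewrite /sqrt_shift qformB qformZm mulrBl mul1r lerD2l lerN2.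
  by rewrite mulrAC mulrC ler_wpM2l ?invr_ge0 ?(ltW L0).
by rewrite ler_wpM2r ?qform1_ge0 // le_max lexx orbT.
Qed.

Lemma posdefZ a A : 0 < a -> posdef A -> posdef (a *: A).
Proof.
move=> a0 [sA pA]; split; first by rewrite linearZ /= sA.
move=> v v0; rewrite -[ltRHS]/(qform (a *: A) v) qformZm mulr_gt0 //.
exact: pA.
Qed.

Lemma posdef_sqrt_ex A : posdef A -> exists S, posdef S /\ S *m S = A.
Proof.
move=> pA; have [sB [b [b0 b1 hB]]] := sqrt_shift_bound pA.
have L0 := sqrt_scale_gt0 A.
exists (Num.sqrt (sqrt_scale A) *: (1%:M - sqrt_lim (sqrt_shift A))); split.
  by apply: posdefZ; [rewrite sqrtr_gt0|exact: (sqrt_lim_posdef sB b0 b1 hB)].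
rewrite -scalemxAl -scalemxAr scalerA -expr2 sqr_sqrtr ?(ltW L0) //.
rewrite (sqrt_limE b0 b1 hB) /sqrt_shift opprB addrC subrK.
by rewrite scalerA divff ?scale1r // gt_eqF.
Qed.

Lemma sqrtmxP A : posdef A -> posdef (sqrtmx A) /\ sqrtmx A *m sqrtmx A = A.
Proof.
by move=> /posdef_sqrt_ex h; have := xgetPex (0 : 'M[R]_n) h.
Qed.

Lemma sqr_posdef S : posdef S -> posdef (S *m S).
Proof.
move=> pS; have [sS S0] := pS; split; first by rewrite trmx_mul sS.
move=> v v0; have : S *m v != 0.
  by apply: contra v0 => /eqP h; rewrite -(mulKmx (posdef_unit pS) v) h mulmx0.
rewrite -qform1_gt0 /qform /bform trmx_mul mulmx1 sS !mulmxA.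
by [].
Qed.

(** The value on degenerate samples, needed for measurability: a positive definite root would make
    [A] positive definite, so [xget] falls back on its default. *)
Lemma sqrtmx_npd A : ~ posdef A -> sqrtmx A = 0.
Proof.
move=> h; apply: xgetPN => S [pS SA]; apply: h; rewrite -SA; exact: sqr_posdef.
Qed.

Definition coercive (c : R) S := forall v, c * qform 1%:M v <= qform S v.

Lemma mxtrace_qform E S : \tr (E *m S *m E^T) = \sum_i qform S (row i E)^T.
Proof.
apply: eq_bigr => i _; rewrite /qform /bform trmxK -row_mul mxE [RHS]mxE.
by apply: eq_bigr => j _; rewrite !mxE.
Qed.

(* Pairing the equation with E^T kills the unknown sign of the cross term. *)
Lemma lyapunov_le c S S' E H : 0 < c -> coercive c S -> psd S' ->
  E *m S' + S *m E = H -> c * `|E| <= n%:R ^+ 2 * `|H|.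
Proof.
move=> c0 hS pS' eH.
pose fro := \sum_j qform 1%:M (row j E^T)^T.
have froE : fro = \sum_i \sum_j E i j ^+ 2.
  rewrite exchange_big /=; apply: eq_bigr => j _; rewrite qform1E.
  by apply: eq_bigr => i _; rewrite !mxE.
have h1 : c * fro <= \tr (E^T *m H).
  rewrite -eH mulmxDr raddfD /= mxtrace_mulC.
  rewrite mxtrace_qform.
  have -> : \tr (E^T *m (S *m E)) = \sum_j qform S (row j E^T)^T.
    by rewrite mulmxA -{2}(trmxK E) mxtrace_qform.
  rewrite mulr_sumr; apply: ler_wpDl; last by apply: ler_sum => j _; exact: hS.
  by apply: sumr_ge0 => i _; exact: pS'.2.
have h2 : `|E| ^+ 2 <= fro.
  have f0 : 0 <= fro by apply: sumr_ge0 => j _; exact: qform1_ge0.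
  rewrite -(sqr_sqrtr f0) ler_pXn2r ?nnegrE ?sqrtr_ge0 //.
  apply: mxnorm_le => [|i j]; first exact: sqrtr_ge0.
  rewrite -sqrtr_sqr ler_wsqrtr // froE (bigD1 i) //= (bigD1 j) //= -addrA lerDl.
  rewrite addr_ge0 // ?sumr_ge0 // => [k _|k _]; first exact: sqr_ge0.
  by apply: sumr_ge0 => l _; exact: sqr_ge0.
have h3 : \tr (E^T *m H) <= n%:R ^+ 2 * (`|E| * `|H|).
  apply: (le_trans (ler_norm _)); apply: (le_trans (mxtrace_le _)).
  rewrite expr2 -mulrA ler_wpM2l // mulrA.
  by rewrite -[`|E|]mxnorm_tr mxnormM.
have : c * `|E| ^+ 2 <= n%:R ^+ 2 * (`|E| * `|H|).
  by rewrite (le_trans _ h3) // (le_trans _ h1) // ler_wpM2l // ltW.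
have : 0 <= `|E| by []; rewrite le_eqVlt => /predU1P[<- _|E0].
  by rewrite mulr0 mulr_ge0 // sqr_ge0.
rewrite expr2 => h4; rewrite -(ler_pM2r E0) -mulrA (le_trans h4) //.
by rewrite -[leRHS]mulrA [`|H| * _]mulrC.
Qed.

Lemma lyapunov_unique c S S' E : 0 < c -> coercive c S -> psd S' ->
  E *m S' + S *m E = 0 -> E = 0.
Proof.
move=> c0 h1 h2 h3; have := lyapunov_le c0 h1 h2 h3.
rewrite normr0 mulr0 pmulr_rle0 // normr_le0 => /eqP //.
Qed.

(** Uniqueness of the root: if [T *m T = S *m S], then [E = T - S] solves [E *m T + S *m E = 0]. *)
Lemma sqrtmx_sqr S : posdef S -> sqrtmx (S *m S) = S.
Proof.
move=> pS; have [pT TE] := sqrtmxP (sqr_posdef pS).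
have [c c0 hc] := posdef_lb pS.
apply/eqP; rewrite -subr_eq0; apply/eqP.
apply: (lyapunov_unique c0 hc (posdef_psd pT)).
by rewrite mulmxBl mulmxBr TE addrA subrK subrr.
Qed.

(** Makes [sqrtmx A] the limit of an explicit recursion in the entries of [A]; its measurability as
    a function of the sample rests on this. *)
Lemma sqrt_iter_sqrtmx A : posdef A ->
  mcvg \oo (sqrt_iter (sqrt_shift A))
    (1%:M - (Num.sqrt (sqrt_scale A))^-1 *: sqrtmx A).
Proof.
move=> pA; have [sB [b [b0 b1 hB]]] := sqrt_shift_bound pA.
have L0 := sqrt_scale_gt0 A; have sL0 : 0 < Num.sqrt (sqrt_scale A) by rewrite sqrtr_gt0.
suff -> : 1%:M - (Num.sqrt (sqrt_scale A))^-1 *: sqrtmx A = sqrt_lim (sqrt_shift A).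
  exact: (sqrt_iter_mcvg b0 b1 hB).
set Y := sqrt_lim _; set s := Num.sqrt _ in sL0 *.
have sA : (s *: (1%:M - Y)) *m (s *: (1%:M - Y)) = A.
  rewrite -scalemxAl -scalemxAr scalerA -expr2 sqr_sqrtr ?(ltW L0) //.
  rewrite (sqrt_limE b0 b1 hB) /sqrt_shift opprB addrC subrK.
  by rewrite scalerA divff ?scale1r // gt_eqF.
have -> : sqrtmx A = s *: (1%:M - Y).
  rewrite -[in LHS]sA sqrtmx_sqr //.
  by apply: posdefZ => //; exact: (sqrt_lim_posdef sB b0 b1 hB).
by rewrite scalerA mulVf ?gt_eqF // scale1r opprB addrC subrK.
Qed.

End sqrtmx_theory.

Lemma le_of_eq {R : numDomainType} (x y : R) : x = y -> x <= y.
Proof. by move->. Qed.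

(** * The Lyapunov equation *)

Section lyapunov.
Context {R : realType} {n : nat}.
Implicit Types (S A B M E H : 'M[R]_n) (u v w : 'cV[R]_n).

Definition lyap_mx S := lin_mx (mulmxr S) + lin_mx (mulmx S) : 'M[R]_(n * n).

(** Inverse of [E -> E *m S + S *m E], through its matrix on vectorized arguments, so that linearity
    in [H] is immediate. It is the derivative of the square root at [S *m S] in the direction
    [H]. *)
Definition lyap S H : 'M[R]_n := vec_mx (mxvec H *m invmx (lyap_mx S)).

Lemma lyap_mxE S E : mxvec E *m lyap_mx S = mxvec (E *m S + S *m E).
Proof. by rewrite mulmxDr !mul_vec_lin /= raddfD. Qed.

Lemma lyap_mx_unit S : posdef S -> lyap_mx S \in unitmx.
Proof.
move=> pS; rewrite -row_free_unit -kermx_eq0.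
apply/eqP/row_matrixP => i; rewrite row0; set r := row i _.
have rS : r *m lyap_mx S = 0 by rewrite /r -row_mul mulmx_ker row0.
have [c c0 hc] := posdef_lb pS.
rewrite -[r]vec_mxK; suff -> : vec_mx r = 0 by rewrite raddf0.
apply: (lyapunov_unique c0 hc (posdef_psd pS)).
apply: (can_inj mxvecK); rewrite -lyap_mxE vec_mxK rS raddf0 //.
Qed.

Lemma lyapP S H : posdef S -> lyap S H *m S + S *m lyap S H = H.
Proof.
move=> pS; apply: (can_inj mxvecK).
by rewrite -lyap_mxE /lyap vec_mxK mulmxKV // lyap_mx_unit.
Qed.

Lemma lyapD S H H' : lyap S (H + H') = lyap S H + lyap S H'.
Proof. by rewrite /lyap raddfD /= mulmxDl raddfD. Qed.
Lemma lyapZ S a H : lyap S (a *: H) = a *: lyap S H.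
Proof. by rewrite /lyap linearZ /= -scalemxAl linearZ. Qed.
Lemma lyap0 S : lyap S 0 = 0.
Proof. by rewrite /lyap raddf0 mul0mx raddf0. Qed.
Lemma lyapN S H : lyap S (- H) = - lyap S H.
Proof. by rewrite -scaleN1r lyapZ scaleN1r. Qed.
Lemma lyapB S H H' : lyap S (H - H') = lyap S H - lyap S H'.
Proof. by rewrite lyapD lyapN. Qed.
Lemma lyap_sum S (I : Type) (s : seq I) (P : pred I) (F : I -> 'M[R]_n) :
  lyap S (\sum_(i <- s | P i) F i) = \sum_(i <- s | P i) lyap S (F i).
Proof.
by elim/big_rec2: _ => [|i x y _ <-]; [exact: lyap0|rewrite lyapD].
Qed.

Lemma lyap_eq S E H : posdef S -> E *m S + S *m E = H -> lyap S H = E.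
Proof.
move=> pS eH; have [c c0 hc] := posdef_lb pS; apply/eqP; rewrite -subr_eq0; apply/eqP.
apply: (lyapunov_unique c0 hc (posdef_psd pS)).
by rewrite mulmxBl mulmxBr addrACA -opprD lyapP // eH subrr.
Qed.

Lemma lyap_sym S H : posdef S -> H^T = H -> (lyap S H)^T = lyap S H.
Proof.
move=> pS sH; symmetry; apply: lyap_eq => //.
have [sS _] := pS; have := congr1 trmx (lyapP H pS).
by rewrite raddfD /= !trmx_mul sS sH addrC.
Qed.

(* Only the symmetric part of [lyap S H *m S], which is [2^-1 *: H], is seen by a symmetric matrix. *)
Lemma mxtrace_lyap S H M : posdef S -> H^T = H -> M^T = M ->
  \tr (lyap S H *m S *m M) = 2^-1 * \tr (H *m M).
Proof.
move=> pS sH sM; have [sS _] := pS.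
have h : \tr (S *m lyap S H *m M) = \tr (lyap S H *m S *m M).
  rewrite -mxtrace_tr !trmx_mul sM sS (lyap_sym pS sH) mxtrace_mulC //.
have := congr1 (fun X => \tr (X *m M)) (lyapP H pS).
rewrite mulmxDl raddfD /= h => <-; by field.
Qed.

End lyapunov.

(** * Expansion of the recoloring matrix *)

Section whitening.
Context {R : realType} {n : nat}.
Variable Sigma : 'M[R]_n.
Hypothesis pSigma : posdef Sigma.
Implicit Types (S A B M E H : 'M[R]_n) (u v w : 'cV[R]_n).

Let S := sqrtmx Sigma.
Let pS : posdef S. Proof. exact: (sqrtmxP pSigma).1. Qed.
Let SS : S *m S = Sigma. Proof. exact: (sqrtmxP pSigma).2. Qed.

Definition recolor A : 'M[R]_n := S *m invmx (sqrtmx A).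

Lemma recolor_id : recolor Sigma = 1%:M.
Proof. by rewrite /recolor mulmxV // posdef_unit. Qed.

(** The first bound on [dl] keeps [A] positive definite as a perturbation of [Sigma]. For the
    second, [sqrtmx A - S] solves a Lyapunov equation in which the coercivity is supplied by [S]
    alone, so nothing about [sqrtmx A] has to be known beforehand; half of the coercivity of [S] is
    kept. *)
Lemma near_posdef : exists dl c : R, [/\ 0 < dl, 0 < c &
  forall A, A^T = A -> `|A - Sigma| <= dl -> posdef A /\ coercive c (sqrtmx A)].
Proof.
have [c1 c10 h1] := posdef_lb pSigma.
have [c c0 h2] := posdef_lb pS.
pose N : R := n%:R ^+ 2 + 1.
have N0 : 0 < N by rewrite ltr_wpDl // sqr_ge0.
exists (Num.min (c1 / (2 * N)) (c ^+ 2 / (2 * N ^+ 2))), (c / 2); split.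
- by rewrite lt_min !divr_gt0 // ?mulr_gt0 // exprn_gt0.
- by rewrite divr_gt0.
move=> A sA; rewrite le_min => /andP[hA1 hA2].
have q0 (v : 'cV[R]_n) := qform1_ge0 v.
have nN : n%:R ^+ 2 <= N by rewrite lerDl.
have pA : posdef A.
  split=> // v v0; change (0 < qform A v).
  have -> : A = Sigma + (A - Sigma) by rewrite addrC subrK.
  rewrite qformDm; have qv : 0 < qform 1%:M v by rewrite qform1_gt0.
  have h3 : `|qform (A - Sigma) v| <= c1 / 2 * qform 1%:M v.
    apply: (le_trans (qform_le_mxnorm _ _)); apply: ler_wpM2r => //.
    apply: (@le_trans _ _ (N * (c1 / (2 * N)))); first by rewrite ler_pM ?sqr_ge0.
    by apply: le_of_eq; field; rewrite gt_eqF.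
  have := h1 v; move: h3; rewrite ler_norml => /andP[h3 _] h4.
  have : 0 < c1 / 2 * qform 1%:M v by rewrite mulr_gt0 // divr_gt0.
  lra.
split=> // v; have [pRA RA] := sqrtmxP pA.
have hD : c * `|sqrtmx A - S| <= N * `|A - Sigma|.
  apply: (@le_trans _ _ (n%:R ^+ 2 * `|A - Sigma|)); last exact: ler_wpM2r.
  apply: (lyapunov_le c0 h2 (posdef_psd pRA)).
  by rewrite mulmxBl mulmxBr RA SS addrA subrK.
have h5 : N * `|sqrtmx A - S| <= c / 2.
  rewrite -(ler_pM2l c0) mulrCA.
  apply: (le_trans (ler_wpM2l (ltW N0) hD)).
  apply: (@le_trans _ _ (N * (N * (c ^+ 2 / (2 * N ^+ 2))))).
    by rewrite !(ler_pM2l N0).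
  suff -> : N * (N * (c ^+ 2 / (2 * N ^+ 2))) = c * (c / 2) by [].
  by field; rewrite gt_eqF.
have -> : sqrtmx A = S + (sqrtmx A - S) by rewrite addrC subrK.
rewrite qformDm.
have h6 : `|qform (sqrtmx A - S) v| <= c / 2 * qform 1%:M v.
  apply: (le_trans (qform_le_mxnorm _ _)); apply: ler_wpM2r => //.
  by apply: le_trans h5; exact: ler_wpM2r.
have := h2 v; move: h6; rewrite ler_norml => /andP[h6 _] h7; lra.
Qed.

(** The Lyapunov inequality with [E = invmx M], [S' = 0] and right-hand side 1. *)
Lemma coercive_inv_le c M : 0 < c -> posdef M -> coercive c M ->
  `|invmx M| <= c^-1 * n%:R ^+ 2.
Proof.
move=> c0 pM hM; rewrite mulrC ler_pdivlMr // mulrC.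
apply: le_trans (lyapunov_le (E := invmx M) (S' := 0) (H := 1%:M) c0 hM _ _) _.
- by split=> [|v]; rewrite ?trmx0 // /qform /bform mulmx0 mul0mx mxE.
- by rewrite mulmx0 add0r mulmxV // posdef_unit.
- by rewrite -[leRHS]mulr1 ler_wpM2l ?sqr_ge0 // mxnorm1.
Qed.

Lemma invmxB A B : A \in unitmx -> B \in unitmx ->
  invmx A - invmx B = - (invmx A *m (A - B) *m invmx B).
Proof.
move=> uA uB; rewrite mulmxBr mulmxBl mulVmx // mul1mx -mulmxA mulmxV // mulmx1.
by rewrite opprB.
Qed.

(** Two matrices near [Sigma] are compared, but the linear term is taken at [Sigma]. For part (i)
    one of them is [Sigma]; the converse compares the covariances with and without one sample, and
    needs the small factor [|A - A'|] in the error. *)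
Lemma recolor_taylor : exists dl C : R, [/\ 0 < dl, 0 <= C &
  forall A A', A^T = A -> A'^T = A' -> `|A - Sigma| <= dl -> `|A' - Sigma| <= dl ->
  [/\ `|recolor A| <= C, `|recolor A - recolor A'| <= C * `|A - A'|,
     `|lyap S (A - A')| <= C * `|A - A'| &
     `|recolor A - recolor A' + lyap S (A - A') *m invmx S|
       <= C * `|A - A'| * (`|A - Sigma| + `|A' - Sigma|)]].
Proof.
have [dl [c [dl0 c0 hdl]]] := near_posdef.
have [_ hS] : posdef Sigma /\ coercive c S.
  by apply: hdl; [exact: pSigma.1|rewrite subrr normr0 ltW].
pose N : R := n%:R.
have N0 : 0 <= N by exact: ler0n.
pose C1 : R := `|S| + c^-1 * N ^+ 2.
have ci : 0 <= c^-1 * N ^+ 2 by rewrite mulr_ge0 ?sqr_ge0 // invr_ge0 ltW.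
have C10 : 0 <= C1 by rewrite addr_ge0.
have SC1 : `|S| <= C1 by rewrite lerDl.
have SiC1 : `|invmx S| <= C1.
  by apply: le_trans (coercive_inv_le c0 pS hS) _; rewrite lerDr.
have key A : A^T = A -> `|A - Sigma| <= dl ->
    [/\ posdef (sqrtmx A), sqrtmx A *m sqrtmx A = A, coercive c (sqrtmx A) & `|invmx (sqrtmx A)| <= C1].
  move=> sA hA; have [pA cA] := hdl A sA hA; have [pR RR] := sqrtmxP pA; split => //.
  by apply: le_trans (coercive_inv_le c0 pR cA) _; rewrite lerDr.
have lip A A' : A^T = A -> A'^T = A' -> `|A - Sigma| <= dl -> `|A' - Sigma| <= dl ->
    `|sqrtmx A - sqrtmx A'| <= C1 * `|A - A'|.
  move=> sA sA' hA hA'; have [pR RR cR _] := key A sA hA; have [pR' RR' cR' _] := key A' sA' hA'.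
  apply: (@le_trans _ _ (c^-1 * N ^+ 2 * `|A - A'|)); last by rewrite ler_wpM2r // lerDr.
  rewrite -mulrA ler_pdivlMl //.
  apply: (lyapunov_le c0 cR' (posdef_psd pR)).
  by rewrite mulmxBl mulmxBr RR RR' addrA subrK.
have sSigma := pSigma.1.
have hSigma : `|Sigma - Sigma| <= dl by rewrite subrr normr0 ltW.
pose C2 := N * (N * (N * C1 * C1) * C1) * C1 * C1.
exists dl, (N * C1 * C1 + N * (N * (N * C1 * C1) * C1) * C1 + C1
   + (N * (N * (N * C1 * C1) * C1) * C1 + N * C1 * (N * (N * C1 * C1) * C1)
     + N * (C1 * (N * C1 * C1)) * C1)).
split=> //; first by rewrite !addr_ge0 // !mulr_ge0.
move=> A A' sA sA' hA hA'; have [pR RR cR iR] := key A sA hA; have [pR' RR' cR' iR'] := key A' sA' hA'.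
have uR := posdef_unit pR; have uR' := posdef_unit pR'; have uS := posdef_unit pS.
set R0 := sqrtmx A in pR RR cR iR uR *; set R1 := sqrtmx A' in pR' RR' cR' iR' uR' *.
set al := `|A - A'|; set a := `|A - Sigma|; set a' := `|A' - Sigma|.
have al0 : 0 <= al := normr_ge0 _; have a0 : 0 <= a := normr_ge0 _; have a'0 : 0 <= a' := normr_ge0 _.
have hD : `|R0 - R1| <= C1 * al by exact: lip.
have hR0 : `|R0 - S| <= C1 * a by exact: lip.
have hR1 : `|R1 - S| <= C1 * a' by exact: lip.
have hR1' : `|S - R1| <= C1 * a' by rewrite distrC.
have hR0' : `|S - R0| <= C1 * a by rewrite distrC.
have eqT : recolor A - recolor A' = - (S *m invmx R0 *m (R0 - R1) *m invmx R1).
  by rewrite /recolor -mulmxBr invmxB // mulmxN !mulmxA.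
have b1 : `|recolor A| <= N * C1 * C1 by exact: mxnormM_le.
have b2 : `|recolor A - recolor A'| <= N * (N * (N * C1 * C1) * C1) * C1 * al.
  rewrite eqT normrN.
  apply: le_trans (mxnormM_le (mxnormM_le (mxnormM_le SC1 iR) hD) iR') _.
  by apply: le_of_eq; rewrite /N; ring.
set K := lyap S (A - A').
(* The remainder of the square root solves a Lyapunov equation again, now with a right-hand side
   quadratic in the deviations. *)
have eK : (R0 - R1 - K) *m S + S *m (R0 - R1 - K) =
    - ((R0 - R1) *m (R0 - S) + (R1 - S) *m (R0 - R1)).
  have e1 : K *m S + S *m K = R0 *m R0 - R1 *m R1 by rewrite lyapP // RR RR'.
  rewrite mulmxBl (mulmxBr S) addrACA -opprD e1.
  rewrite !(mulmxBl, mulmxBr).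
  move: (R0 *m S) (R1 *m S) (S *m R0) (S *m R1) (R0 *m R0) (R0 *m R1) (R1 *m R0) (R1 *m R1).
  by move=> x1 x2 x3 x4 x5 x6 x7 x8; apply/matrixP => i j; rewrite !mxE; ring.
have b4 : `|R0 - R1 - K| <= C1 * (N * C1 * C1) * al * (a + a').
  apply: (@le_trans _ _ (c^-1 * N ^+ 2 * (N * (C1 * al) * (C1 * a) + N * (C1 * a') * (C1 * al)))).
    rewrite -mulrA ler_pdivlMl //.
    apply: (le_trans (lyapunov_le c0 hS (posdef_psd pS) eK)).
    apply: ler_wpM2l; first exact: sqr_ge0.
    rewrite normrN (le_trans (ler_normD _ _)) // lerD //; exact: mxnormM_le.
  have -> : C1 * (N * C1 * C1) * al * (a + a') =
      C1 * (N * (C1 * al) * (C1 * a) + N * (C1 * a') * (C1 * al)) by ring.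
  by apply: ler_wpM2r; [rewrite addr_ge0 // !mulr_ge0|rewrite lerDr].
have b3 : `|K| <= C1 * al.
  apply: (@le_trans _ _ (c^-1 * N ^+ 2 * al)); last by rewrite ler_wpM2r // lerDr.
  rewrite -mulrA ler_pdivlMl //.
  by apply: (lyapunov_le c0 hS (posdef_psd pS)); exact: lyapP.
(* [R0] and [R1] are replaced by [S], and [R0 - R1] by [K]; each of the three replacements costs a
   product of two small factors. *)
have eq4 : recolor A - recolor A' + K *m invmx S =
   - ((S - R0) *m invmx R0 *m (R0 - R1) *m invmx R1)
   - (R0 - R1) *m (invmx R1 *m (S - R1) *m invmx S)
   - (R0 - R1 - K) *m invmx S.
  rewrite eqT.
  have -> : invmx R1 *m (S - R1) *m invmx S = invmx R1 - invmx S.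
    by rewrite (invmxB uR' uS) -[S - R1]opprB mulmxN mulNmx.
  rewrite [(S - R0) *m invmx R0]mulmxBl mulmxV //; move: (R0 - R1) => D.
  rewrite (mulmxBl (S *m _)) mul1mx (mulmxBl _ D) (mulmxBr D) (mulmxBl D).
  move: (S *m invmx R0 *m D *m invmx R1) (D *m invmx R1) (D *m invmx S) (K *m invmx S).
  by move=> x1 x2 x3 x4; apply/matrixP => i j; rewrite !mxE; ring.
have tr3 (x y z : 'M[R]_n) : `|- x - y - z| <= `|x| + `|y| + `|z|.
  by rewrite -!opprD normrN (le_trans (ler_normD _ _)) // lerD2r ler_normD.
have P0 : 0 <= N * C1 * C1 by rewrite !mulr_ge0.
have P1 : 0 <= N * (N * (N * C1 * C1) * C1) * C1 by rewrite !mulr_ge0.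
have P2 : 0 <= N * C1 * (N * (N * C1 * C1) * C1) by rewrite !mulr_ge0.
have P3 : 0 <= N * (C1 * (N * C1 * C1)) * C1 by rewrite !mulr_ge0.
set p0 := N * C1 * C1 in P0 P1 P2 P3 b1 b2 *.
set p1 := N * (N * p0 * C1) * C1 in P1 b2 *.
set p2 := N * C1 * (N * p0 * C1) in P2 *.
set p3 := N * (C1 * p0) * C1 in P3 *.
split.
- apply: (le_trans b1); lra.
- by apply: (le_trans b2); apply: ler_wpM2r => //; lra.
- by apply: (le_trans b3); apply: ler_wpM2r => //; lra.
rewrite eq4 (le_trans (tr3 _ _ _)) //.
have t1 : `|(S - R0) *m invmx R0 *m (R0 - R1) *m invmx R1| <= p1 * al * a.
  apply: le_trans (mxnormM_le (mxnormM_le (mxnormM_le hR0' iR) hD) iR') _.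
  by apply: le_of_eq; rewrite /p1 /p0 /N; ring.
have t2 : `|(R0 - R1) *m (invmx R1 *m (S - R1) *m invmx S)| <= p2 * al * a'.
  apply: le_trans (mxnormM_le hD (mxnormM_le (mxnormM_le iR' hR1') SiC1)) _.
  by apply: le_of_eq; rewrite /p2 /p0 /N; ring.
have t3 : `|(R0 - R1 - K) *m invmx S| <= p3 * al * (a + a').
  apply: le_trans (mxnormM_le b4 SiC1) _.
  by apply: le_of_eq; rewrite /p3 /p0 /N; ring.
have Q1 : 0 <= p1 * al * a' by rewrite !mulr_ge0.
have Q2 : 0 <= p2 * al * a by rewrite !mulr_ge0.
have Q3 : 0 <= (p0 + p1 + C1) * al * (a + a') by rewrite !mulr_ge0 ?addr_ge0.
lra.
Qed.

End whitening.

(** * Smooth functions and the matching map *)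

Section line_derivatives.
Context {R : realType} {V : normedModType R}.
Implicit Types (f g : V -> R) (x u v : V).

Lemma is_derive_line f x v (t : R) : derivable f (x + t *: v) v ->
  is_derive t 1 (fun s : R => f (x + s *: v)) ('D_v f (x + t *: v)).
Proof.
move=> df.
have e : (fun h : R => h^-1 *: (((fun s : R => f (x + s *: v)) \o shift t) (h *: 1) -
    f (x + t *: v))) =
    (fun h : R => h^-1 *: ((f \o shift (x + t *: v)) (h *: v) - f (x + t *: v))).
  apply/funext => h /=; congr (_ *: (f _ - _)).
  by rewrite [h *: 1]mulr1 scalerDl addrCA.
apply: DeriveDef; first by rewrite /derivable e.
by rewrite /derive e.
Qed.

Lemma derivable_line f x v : derivable f x v <-> derivable (fun s : R => f (x + s *: v)) 0 1.
Proof.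
rewrite derivable1P; suff -> : (fun h : R => f (h *: v + x)) = (fun s : R => f (x + s *: v)) by [].
by apply/funext => h; rewrite addrC.
Qed.

Lemma derive_line f x v : derivable f x v -> 'D_v f x = 'D_1 (fun s : R => f (x + s *: v)) 0.
Proof.
move=> df; have := @is_derive_line f x v 0; rewrite scale0r addr0 => /(_ df) h.
by rewrite derive_val.
Qed.

Lemma mvt_line f x v : (forall y, derivable f y v) ->
  exists2 t : R, 0 <= t <= 1 & f (x + v) - f x = 'D_v f (x + t *: v).
Proof.
move=> df; have h (t : R) : t \in `]0, 1[%R -> is_derive t 1 (fun s : R => f (x + s *: v))
   ('D_v f (x + t *: v)) by move=> _; exact: is_derive_line.
have [|t] := MVT ltr01 h.
  apply: derivable_within_continuous => t _.
  by have := @is_derive_line f x v t (df _) => ?.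
rewrite in_itv /= => /andP[t0 t1]; rewrite scale1r scale0r addr0 subr0 mulr1 => e.
by exists t => //; rewrite !ltW.
Qed.

Lemma is_derive_scale f x v (c : R) : derivable f x v ->
  is_derive x (c *: v) f (c * 'D_v f x).
Proof.
move=> df; have := @is_derive_line f x v 0; rewrite scale0r addr0 => /(_ df) h.
have h2 : is_derive (0 : R) 1 (fun s : R => c * s) c.
  have : is_derive (0 : R) 1 (c \*: id) (c *: 1) by exact: is_deriveZ.
  by rewrite [c *: 1]mulr1.
have h1 : is_derive (c * 0 : R) 1 (fun s : R => f (x + s *: v)) ('D_v f x).
  by rewrite mulr0.
have h3 := @is_derive1_comp _ _ _ _ _ _ h1 h2.
have e : (fun s : R => f (x + s *: v)) \o (fun s => c * s) = (fun s : R => f (x + s *: (c *: v))).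
  by apply/funext => s /=; rewrite scalerA [s * c]mulrC.
rewrite e in h3.
have d : derivable f x (c *: v) := (derivable_line _ _ _).2 (@ex_derive _ _ _ _ _ _ _ h3).
by apply: DeriveDef => //; rewrite derive_line // derive_val mulrC.
Qed.

Definition C1 f := (forall x v, derivable f x v) /\ (forall v, continuous ('D_v f)).

(** The increment along [h *: (u + v)] is split at [h *: u]. The second leg starts at a moving
    point, so the mean value theorem and the continuity of ['D_v f] are needed there. *)
Lemma deriveDv f x u v : C1 f -> 'D_(u + v) f x = 'D_u f x + 'D_v f x.
Proof.
move=> [df cf].
have h1 : h^-1 *: (f (h *: (u + v) + x) - f x) @[h --> (0:R)^'] --> 'D_(u + v) f x.
  exact: (df x (u + v)).
have h2 : h^-1 *: (f (h *: u + x) - f x) @[h --> (0:R)^'] --> 'D_u f x.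
  exact: (df x u).
apply: (cvg_unique _ h1) => //.
have -> : (fun h : R => h^-1 *: (f (h *: (u + v) + x) - f x)) =
  (fun h : R => h^-1 *: (f (h *: u + x) - f x) + h^-1 *: (f (h *: (u + v) + x) - f (h *: u + x))).
  by apply/funext => h; rewrite -scalerDr; congr (_ *: _); rewrite [RHS]addrC addrA subrK.
apply: cvgD; first exact: h2.
apply/cvgrPdist_le => e e0.
have /cvgrPdist_le /(_ e e0) := cf v x.
rewrite -nbhs_ballE => -[dl /= dl0 hd].
have M0 : 0 < `|u| + `|v| + 1 by rewrite ltr_pwDr // addr_ge0.
near=> h.
have h0 : h != 0 by near: h; exact: nbhs_dnbhs_neq.
have hs : `|h| < dl / (`|u| + `|v| + 1).
  near: h; apply: (@cvgr0_norm_lt _ _ _ _ _ (fun h => h)); last by rewrite divr_gt0.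
  exact: cvg_within.
have [t /andP[t0 t1] et] := @mvt_line f (h *: u + x) (h *: v) (fun y => df y _).
have -> : h *: (u + v) + x = h *: u + x + h *: v by rewrite scalerDr addrAC.
rewrite et; have dv := @is_derive_scale f (h *: u + x + t *: (h *: v)) v h (df _ _).
rewrite derive_val.
have -> z : h^-1 *: (h * z : R) = z by rewrite [LHS]mulKf.
apply: hd; rewrite -ball_normE /ball_ /=.
have -> : x - (h *: u + x + t *: (h *: v)) = - (h *: u + t *: (h *: v)).
  by rewrite [h *: u + x]addrC -addrA opprD addrA subrr sub0r.
rewrite normrN (le_lt_trans (ler_normD _ _)) // !normrZ (ger0_norm t0).
apply: (@le_lt_trans _ _ (`|h| * (`|u| + `|v| + 1))); last by rewrite -ltr_pdivlMr.
have : t * (`|h| * `|v|) <= `|h| * `|v| by rewrite ler_piMl // mulr_ge0.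
have := normr_ge0 h; nra.
Unshelve. all: by end_near. Qed.

Lemma C1_scale f x v c : C1 f -> 'D_(c *: v) f x = c * 'D_v f x.
Proof. by move=> [df _]; have h := is_derive_scale c (df x v); rewrite derive_val. Qed.

Lemma C1_sum (I : Type) (s : seq I) (P : pred I) (F : I -> V) f x : C1 f ->
  'D_(\sum_(i <- s | P i) F i) f x = \sum_(i <- s | P i) 'D_(F i) f x.
Proof.
by move=> cf; elim/big_rec2: _ => [|i a b _ <-]; [exact: derive0|rewrite deriveDv].
Qed.

Lemma near_derive0 f x v : (\forall y \near x, f y = 0) -> 'D_v f x = 0.
Proof.
move=> h; have [->|v0] := eqVneq v 0; first exact: derive0.
rewrite (@near_eq_derive _ _ _ _ (cst 0)) ?derive_cst //.
Qed.

Lemma cont_compact_bounded f (K : set V) : continuous f -> compact K ->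
  (forall x, ~ K x -> f x = 0) -> exists2 C : R, 0 <= C & forall x, `|f x| <= C.
Proof.
move=> cf cK f0.
have cfK : compact (f @` K) by apply: continuous_compact => //; exact: continuous_subspaceT.
have [M [_ hM]] := compact_bounded cfK.
have M1 : M < `|M| + 1 by rewrite (le_lt_trans (ler_norm M)) // ltrDl.
exists (`|M| + 1); first by rewrite addr_ge0.
move=> x; have [Kx|Kx] := pselect (K x); last by rewrite f0 // normr0 addr_ge0.
by apply: (hM _ M1); exists x.
Qed.

End line_derivatives.

Section smooth_functions.
Context {R : realType} {n : nat}.
Notation vec := 'cV[R]_n.
Implicit Types (f : vec -> R) (x u v : vec).

Lemma smooth_derive f v : smooth f -> smooth ('D_v f).
Proof. by move=> sf vs; have := sf (rcons vs v); rewrite /iter_deriv foldr_rcons. Qed.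

Lemma smooth_C1 f : smooth f -> C1 f.
Proof.
move=> sf; split=> [x v|v]; first exact: (sf [::]).2.
exact: (sf [:: v]).1.
Qed.

Lemma smooth_cont f : smooth f -> continuous f.
Proof. by move=> sf; exact: (sf [::]).1. Qed.

Lemma vec_sum v : v = \sum_i v i 0 *: evec i.
Proof.
apply/matrixP => i j; rewrite ord1 summxE (bigD1 i) //= !mxE !eqxx mulr1.
rewrite big1 ?addr0 // => k ki; rewrite !mxE eq_sym (negbTE ki) mulr0 //.
Qed.

Lemma derive_grad f x v : C1 f -> 'D_v f x = (grad f x *m v) 0 0.
Proof.
move=> cf; rewrite {1}(vec_sum v) C1_sum // mxE.
by apply: eq_bigr => i _; rewrite C1_scale // mxE mulrC.
Qed.

Lemma supp_derive f v : supp ('D_v f) `<=` supp f.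
Proof.
rewrite /supp [X in X `<=` _]closureE; apply: smallest_sub; first exact: closed_closure.
move=> x /= h; apply: contrapT => nx.
suff : 'D_v f x = 0 by move/eqP; apply/negP.
apply: near_derive0.
have : \forall y \near x, (~` closure [set x0 | f x0 != 0]) y.
  apply: open_nbhs_nbhs; split=> //; apply: closed_openC; exact: closed_closure.
apply: filterS => y ny; apply/eqP; apply: contrapT => /negP fy.
by apply: ny; exact: subset_closure.
Qed.

Lemma notin_supp f x : ~ supp f x -> f x = 0.
Proof.
move=> nx; apply/eqP; apply: contrapT => /negP fy.
by apply: nx; exact: subset_closure.
Qed.

Lemma compact_supp_derive f v : compact (supp f) -> compact (supp ('D_v f)).
Proof.
move=> cf; apply: (subclosed_compact _ cf); first exact: closed_closure.
exact: supp_derive.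
Qed.

Lemma smooth_bounded f : smooth f -> compact (supp f) ->
  exists2 C : R, 0 <= C & forall x, `|f x| <= C.
Proof.
move=> sf cf; apply: (cont_compact_bounded (smooth_cont sf) cf) => x; exact: notin_supp.
Qed.

Lemma smooth_grad_bounded f : smooth f -> compact (supp f) ->
  exists2 C : R, 0 <= C & forall x, `|grad f x| <= C.
Proof.
move=> sf cf.
have h i : exists2 C : R, 0 <= C & forall x, `|'D_(evec i) f x| <= C.
  by apply: smooth_bounded; [exact: smooth_derive|exact: compact_supp_derive].
have {h}/choice [C hC] : forall i, exists C : R, 0 <= C /\ forall x, `|'D_(evec i) f x| <= C.
  by move=> i; have [C C0 hC] := h i; exists C.
have C0 : 0 <= \sum_i C i by apply: sumr_ge0 => i _; case: (hC i).
exists (\sum_i C i) => // x.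
apply: mxnorm_le => // i j; rewrite mxE (le_trans ((hC j).2 x)) //.
rewrite (bigD1 j) //= lerDl; apply: sumr_ge0 => k _; by case: (hC k).
Qed.

Lemma smooth_lipschitz f : smooth f -> compact (supp f) ->
  exists2 C : R, 0 <= C & forall x y, `|f x - f y| <= C * `|x - y|.
Proof.
move=> sf cf; have [C C0 hC] := smooth_grad_bounded sf cf.
exists (n%:R * C) => [|x y]; first by rewrite mulr_ge0.
have [df _] := smooth_C1 sf.
have [t _] := @mvt_line _ _ f y (x - y) (fun z => df z _).
rewrite [y + (x - y)]addrC subrK => ->; rewrite derive_grad; last exact: smooth_C1.
exact: (le_trans (mxnorm_entry _ _ _) (mxnormM_le (hC _) (lexx _))).
Qed.

(** Linearization at a third point [x]: the mean value theorem evaluates the gradient on the segment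
    from [v] to [u], at distance at most [|u - x| + |v - x|] from [x]. In the application [u] and
    [v] are the images of [x] under two matching maps. *)
Lemma smooth_taylor f : smooth f -> compact (supp f) ->
  exists2 C : R, 0 <= C & forall x u v,
   `|f u - f v - (grad f x *m (u - v)) 0 0| <= C * `|u - v| * (`|u - x| + `|v - x|).
Proof.
move=> sf cf.
have {}h i : exists C : R, 0 <= C /\
    forall x y, `|'D_(evec i) f x - 'D_(evec i) f y| <= C * `|x - y|.
  have [//|C C0 hC] := smooth_lipschitz (smooth_derive (evec i) sf).
    exact: compact_supp_derive.
  by exists C.
have [C hC] := choice h.
have C0 : 0 <= \sum_i C i by apply: sumr_ge0 => i _; case: (hC i).
exists (n%:R * \sum_i C i) => [|x u v]; first by rewrite mulr_ge0.
have cf1 := smooth_C1 sf; have [df _] := cf1.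
have [t /andP[t0 t1]] := @mvt_line _ _ f v (u - v) (fun z => df z _).
rewrite [v + (u - v)]addrC subrK => ->; rewrite derive_grad //.
set z := v + t *: (u - v).
have -> : (grad f z *m (u - v)) 0 0 - (grad f x *m (u - v)) 0 0 =
  ((grad f z - grad f x) *m (u - v)) 0 0 by rewrite mulmxBl !mxE.
apply: (le_trans (mxnorm_entry _ _ _)).
have zx : `|z - x| <= `|u - x| + `|v - x|.
  have -> : z - x = (1 - t) *: (v - x) + t *: (u - x).
    by rewrite /z; apply/matrixP => i j; rewrite !mxE; ring.
  rewrite (le_trans (ler_normD _ _)) // !normrZ (ger0_norm t0) ger0_norm ?subr_ge0 //.
  have := normr_ge0 (v - x); have := normr_ge0 (u - x); nra.
have hg : `|grad f z - grad f x| <= (\sum_i C i) * (`|u - x| + `|v - x|).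
  apply: mxnorm_le => [|i j]; first by rewrite mulr_ge0 // addr_ge0.
  rewrite !mxE (le_trans ((hC j).2 _ _)) //; apply: ler_pM => //; first by case: (hC j).
  by rewrite (bigD1 j) //= lerDl; apply: sumr_ge0 => k _; case: (hC k).
apply: le_trans (mxnormM_le hg (lexx _)) _.
by apply: le_of_eq; ring.
Qed.

(** * Expansion of the moment-matching map *)

Section moment_matching_map.
Variables (mu : vec) (Sigma : 'M[R]_n).
Hypothesis pSigma : posdef Sigma.

(* The moment-matching map built from a sample mean m and a sample covariance A. *)
Definition mmap (A : 'M[R]_n) (m x : vec) : vec := recolor Sigma A *m (x - m) + mu.

Definition mmap_dev (A : 'M[R]_n) (m : vec) : R := `|A - Sigma| + `|m - mu|.

Lemma mmap_id x : mmap Sigma mu x = x.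
Proof. by rewrite /mmap recolor_id // mul1mx subrK. Qed.

(** The map is affine in [x], hence the factor [1 + |x - mu|]. Its error keeps the shape of
    [recolor_taylor]: distance of the two parameters times their distance to the true moments. *)
Lemma mmap_taylor : exists dl C : R, [/\ 0 < dl, 0 <= C &
  forall A A' m m' x, A^T = A -> A'^T = A' ->
    mmap_dev A m <= dl -> mmap_dev A' m' <= dl ->
    let rho := `|A - A'| + `|m - m'| in
    let eta := mmap_dev A m + mmap_dev A' m' in
    `|mmap A m x - mmap A' m' x| <= C * rho * (1 + `|x - mu|) /\
    `|mmap A m x - mmap A' m' x + ((m - m') + lyap (sqrtmx Sigma) (A - A') *m
        invmx (sqrtmx Sigma) *m (x - mu))| <= C * rho * eta * (1 + `|x - mu|)].
Proof.
have [dl [C [dl0 C0 H]]] := recolor_taylor pSigma.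
pose N : R := n%:R; have N0 : 0 <= N by exact: ler0n.
(* The minimum with 1 forces [|m - mu| <= 1], so that [|x - m|] is at most [1 + |x - mu|]. *)
exists (Num.min dl 1), (3 * (1 + N * C + 1) * (1 + C)); split.
- by rewrite lt_min dl0 ltr01.
- by rewrite !mulr_ge0 ?addr_ge0 ?mulr_ge0.
move=> A A' m m' x sA sA'; rewrite !le_min => /andP[h1 k1] /andP[h2 k2] rho eta.
have hA : `|A - Sigma| <= dl by apply: le_trans h1; rewrite lerDl.
have hA' : `|A' - Sigma| <= dl by apply: le_trans h2; rewrite lerDl.
have km : `|m - mu| <= 1 by apply: le_trans k1; rewrite lerDr.
have [T1 T2 T3 T4] := H A A' sA sA' hA hA'.
have sS := pSigma.1.
have [T1' _ _ _] := H A' A' sA' sA' hA' hA'.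
have hS : `|Sigma - Sigma| <= dl by rewrite subrr normr0 ltW.
have [_ U2 _ _] := H A' Sigma sA' sS hA' hS.
rewrite recolor_id // in U2.
set T := recolor Sigma A in T1 T2 T4 *; set T' := recolor Sigma A' in T1' T2 T4 U2 *.
set K := lyap _ _ in T3 T4 *; set Si := invmx _ in T4 *.
set y := x - mu; have y0 : 0 <= `|y| by [].
have e1 : mmap A m x - mmap A' m' x = (T - T') *m (y - (m - mu)) - T' *m (m - m').
  rewrite /mmap -/T -/T' opprD addrACA subrr addr0 /y opprB addrA subrK mulmxBl.
  rewrite -[in RHS]addrA -opprD -mulmxDr; congr (_ - T' *m _).
  by apply/matrixP => i j; rewrite !mxE; ring.
have r1 : `|A - A'| <= rho by rewrite lerDl.
have r2 : `|m - m'| <= rho by rewrite lerDr.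
have r0 : 0 <= rho by rewrite addr_ge0.
have n1 : `|T - T'| <= C * rho by rewrite (le_trans T2) // ler_wpM2l.
have ym : `|y - (m - mu)| <= 1 + `|y|.
  by rewrite (le_trans (ler_normB _ _)) // addrC lerD2r.
have eta0 : 0 <= eta by rewrite !addr_ge0.
split.
  rewrite e1 (le_trans (ler_normB _ _)) //.
  have q1 := mxnormM_le n1 ym; have q2 := mxnormM_le T1' r2.
  rewrite -/N in q1 q2; apply: (le_trans (lerD q1 q2)).
  have P1 : 0 <= C * rho by rewrite mulr_ge0.
  have P2 : 0 <= N * C * rho by rewrite !mulr_ge0.
  have P3 : 0 <= C * rho * `|y| by rewrite !mulr_ge0.
  have P4 : 0 <= N * C * rho * `|y| by rewrite !mulr_ge0.
  have P5 : 0 <= N * C * C * rho by rewrite !mulr_ge0.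
  have P6 : 0 <= N * C * C * rho * `|y| by rewrite !mulr_ge0.
  have P7 : 0 <= rho * `|y| by rewrite !mulr_ge0.
  nra.
have e2 : mmap A m x - mmap A' m' x + ((m - m') + K *m Si *m y) =
   (T - T' + K *m Si) *m y - (T - T') *m (m - mu) - (T' - 1%:M) *m (m - m').
  rewrite e1 mulmxBr (mulmxDl (T - T')) (mulmxBl T' 1%:M) mul1mx.
  move: ((T - T') *m y) (K *m Si *m y) ((T - T') *m (m - mu)) (T' *m (m - m')) (m - m').
  by move=> z1 z2 z3 z4 z5; apply/matrixP => i j; rewrite !mxE; ring.
have tr3 (a b c : vec) : `|a - b - c| <= `|a| + `|b| + `|c|.
  by rewrite (le_trans (ler_normB _ _)) // lerD2r ler_normB.
have eA : `|A - Sigma| + `|A' - Sigma| <= eta by rewrite /eta /mmap_dev lerD // lerDl.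
have eA' : `|A' - Sigma| <= eta by rewrite (le_trans _ eA) // lerDr.
have em : `|m - mu| <= eta by rewrite /eta /mmap_dev addrAC -addrA -[leLHS]add0r lerD ?addr_ge0 // lerDr.
have n4 : `|T - T' + K *m Si| <= C * rho * eta.
  by apply: (le_trans T4); apply: ler_pM => //; rewrite ?mulr_ge0 ?addr_ge0 // ler_wpM2l.
have q1 := mxnormM_le n4 (lexx `|y|); have q2 := mxnormM_le n1 em.
have q3 : `|(T' - 1%:M) *m (m - m')| <= n%:R * (C * eta) * rho.
  by apply: mxnormM_le r2; rewrite (le_trans U2) // ler_wpM2l.
rewrite e2 (le_trans (tr3 _ _ _)) //.
rewrite -/N in q1 q2 q3; apply: (le_trans (lerD (lerD q1 q2) q3)).
set re := rho * eta; have re0 : 0 <= re by rewrite mulr_ge0.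
have -> : N * (C * rho * eta) * `|y| = N * C * re * `|y| by rewrite /re; ring.
have -> : N * (C * rho) * eta = N * C * re by rewrite /re; ring.
have -> : N * (C * eta) * rho = N * C * re by rewrite /re; ring.
rewrite -[_ * rho * eta]mulrA -/re.
have P1 : 0 <= C * re by rewrite mulr_ge0.
have P2 : 0 <= N * C * re by rewrite !mulr_ge0.
have P3 : 0 <= C * re * `|y| by rewrite !mulr_ge0.
have P4 : 0 <= N * C * re * `|y| by rewrite !mulr_ge0.
have P5 : 0 <= N * C * C * re by rewrite !mulr_ge0.
have P6 : 0 <= N * C * C * re * `|y| by rewrite !mulr_ge0.
have P7 : 0 <= re * `|y| by rewrite !mulr_ge0.
nra.
Qed.

Lemma mmap_dev_id : mmap_dev Sigma mu = 0.
Proof. by rewrite /mmap_dev !subrr !normr0 addr0. Qed.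

(** The weight is quadratic in [x] because the Taylor error of [f] multiplies two displacements; its
    sample average involves second moments only. *)
Lemma smooth_mmap_taylor f : smooth f -> compact (supp f) ->
  exists dl C : R, [/\ 0 < dl, 0 <= C &
  forall A A' m m' x, A^T = A -> A'^T = A' ->
    mmap_dev A m <= dl -> mmap_dev A' m' <= dl ->
    `|f (mmap A m x) - f (mmap A' m' x) + (grad f x *m ((m - m') +
       lyap (sqrtmx Sigma) (A - A') *m invmx (sqrtmx Sigma) *m (x - mu))) 0 0|
    <= C * (`|A - A'| + `|m - m'|) * (mmap_dev A m + mmap_dev A' m') * (1 + `|x - mu|) ^+ 2].
Proof.
move=> sf cf; have [dl [C [dl0 C0 H]]] := mmap_taylor.
have [Cg Cg0 Hg] := smooth_grad_bounded sf cf.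
have [Ct Ct0 Ht] := smooth_taylor sf cf.
pose N : R := n%:R; have N0 : 0 <= N by exact: ler0n.
exists dl, (N * Cg * C + Ct * C * C); split => //.
  by rewrite addr_ge0 // !mulr_ge0.
move=> A A' m m' x sA sA' h1 h2.
have sS := pSigma.1.
have hS : mmap_dev Sigma mu <= dl by rewrite mmap_dev_id ltW.
have [a1 a2] := H A A' m m' x sA sA' h1 h2.
have [b1 _] := H A Sigma m mu x sA sS h1 hS.
have [b2 _] := H A' Sigma m' mu x sA' sS h2 hS.
rewrite mmap_id -!/(mmap_dev _ _) in b1 b2.
set z := mmap A m x in a1 a2 b1 *; set z' := mmap A' m' x in a1 a2 b2 *.
set w := (m - m') + _ in a2 *.
set rho := `|A - A'| + _ in a1 a2 *.
set e := mmap_dev A m in b1 a2 *; set e' := mmap_dev A' m' in b2 a2 *.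
have -> : f z - f z' + (grad f x *m w) 0 0 =
  (f z - f z' - (grad f x *m (z - z')) 0 0) + (grad f x *m (z - z' + w)) 0 0.
  have -> : (grad f x *m (z - z' + w)) 0 0 = (grad f x *m (z - z')) 0 0 + (grad f x *m w) 0 0.
    by rewrite mulmxDr mxE.
  by ring.
have q1 := Ht x z z'.
have q2 : `|(grad f x *m (z - z' + w)) 0 0| <= N * Cg * (C * rho * (e + e') * (1 + `|x - mu|)).
  exact: (le_trans (mxnorm_entry _ _ _) (mxnormM_le (Hg x) a2)).
have r0 : 0 <= rho by rewrite addr_ge0.
have e0 : 0 <= e by rewrite addr_ge0.
have e'0 : 0 <= e' by rewrite addr_ge0.
have y1 : 1 <= 1 + `|x - mu| by rewrite lerDl.
set Y := 1 + `|x - mu| in a1 a2 b1 b2 q2 y1 *.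
have Y0 : 0 <= Y by exact: le_trans y1.
apply: (le_trans (ler_normD _ _)).
have q3 : `|f z - f z' - (grad f x *m (z - z')) 0 0| <= Ct * (C * rho * Y) * (C * e * Y + C * e' * Y).
  apply: (le_trans q1); apply: ler_pM => //; rewrite ?mulr_ge0 ?addr_ge0 //.
    exact: ler_wpM2l.
  exact: lerD.
apply: (le_trans (lerD q3 q2)).
have -> : Ct * (C * rho * Y) * (C * e * Y + C * e' * Y) =
  Ct * C * C * rho * (e + e') * Y ^+ 2 by ring.
have -> : N * Cg * (C * rho * (e + e') * Y) = N * Cg * C * rho * (e + e') * Y by ring.
have : N * Cg * C * rho * (e + e') * Y <= N * Cg * C * rho * (e + e') * Y ^+ 2.
  apply: ler_wpM2l; first by rewrite !mulr_ge0 // addr_ge0.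
  by rewrite expr2 ler_peMl.
by move=> q4; rewrite addrC (le_trans (lerD q4 (lexx _))) // le_of_eq //; ring.
Qed.

End moment_matching_map.
End smooth_functions.

(** * Measurability, expectation and independence *)

Section entrywise_measurability.
Context {R : realType} {d : measure_display} {T : measurableType d}.
Implicit Types f g : T -> R.

Definition mmeas m n (F : T -> 'M[R]_(m, n)) :=
  forall i j, measurable_fun [set: T] (fun w => F w i j).

Lemma measurable_sumr (I : Type) (s : seq I) (P : pred I) (F : I -> T -> R) :
  (forall i, P i -> measurable_fun [set: T] (F i)) ->
  measurable_fun [set: T] (fun w => \sum_(i <- s | P i) F i w).
Proof.
move=> h; elim: s => [|i s IH]; first by under eq_fun do rewrite big_nil; exact: measurable_cst.
under eq_fun do rewrite big_cons.
by case Pi: (P i) => //; apply: measurable_funD => //; exact: h.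
Qed.

Lemma measurable_prodr (I : Type) (s : seq I) (P : pred I) (F : I -> T -> R) :
  (forall i, P i -> measurable_fun [set: T] (F i)) ->
  measurable_fun [set: T] (fun w => \prod_(i <- s | P i) F i w).
Proof.
move=> h; elim: s => [|i s IH]; first by under eq_fun do rewrite big_nil; exact: measurable_cst.
under eq_fun do rewrite big_cons.
by case Pi: (P i) => //; apply: measurable_funM => //; exact: h.
Qed.

Lemma measurable_invr g : measurable_fun [set: T] g ->
  measurable_fun [set: T] (fun w => (g w)^-1).
Proof.
(* Away from 0 the inverse is [x exp (- ln (x^2))]; at 0 both sides vanish under the convention
   [0^-1 = 0]. *)
move=> mg; have -> : (fun w => (g w)^-1) = (fun w => g w * expR (- ln (g w ^+ 2))).
  apply/funext => w; have [->|g0] := eqVneq (g w) 0; first by rewrite invr0 mul0r.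
  have g2 : g w ^+ 2 \in Num.pos by rewrite posrE exprn_even_gt0.
  by rewrite expRN (lnK g2) [g w ^+ 2]expr2 invfM mulrA mulfV // mul1r.
apply: measurable_funM => //; apply: (measurableT_comp (@measurable_expR R)).
apply: measurable_funN; apply: (measurableT_comp (@measurable_ln R)).
exact: measurable_funX.
Qed.

Lemma mmeas_cst m n (A : 'M[R]_(m, n)) : mmeas (fun=> A).
Proof. by move=> i j; exact: measurable_cst. Qed.

Lemma mmeasD m n (F G : T -> 'M[R]_(m, n)) : mmeas F -> mmeas G -> mmeas (fun w => F w + G w).
Proof.
by move=> hF hG i j; under eq_fun do rewrite mxE; apply: measurable_funD; [exact: hF|exact: hG].
Qed.

Lemma mmeasN m n (F : T -> 'M[R]_(m, n)) : mmeas F -> mmeas (fun w => - F w).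
Proof.
by move=> hF i j; under eq_fun do rewrite mxE; apply: measurable_funN; exact: hF.
Qed.

Lemma mmeasB m n (F G : T -> 'M[R]_(m, n)) : mmeas F -> mmeas G -> mmeas (fun w => F w - G w).
Proof. by move=> hF hG; apply: mmeasD => //; exact: mmeasN. Qed.

Lemma mmeasZ m n g (F : T -> 'M[R]_(m, n)) :
  measurable_fun [set: T] g -> mmeas F -> mmeas (fun w => g w *: F w).
Proof.
by move=> hg hF i j; under eq_fun do rewrite mxE; apply: measurable_funM => //; exact: hF.
Qed.

Lemma mmeas_sum m n (I : Type) (s : seq I) (P : pred I) (F : I -> T -> 'M[R]_(m, n)) :
  (forall i, P i -> mmeas (F i)) -> mmeas (fun w => \sum_(i <- s | P i) F i w).
Proof.
move=> h i j; under eq_fun do rewrite summxE.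
by apply: measurable_sumr => k Pk; exact: h.
Qed.

Lemma mmeasM m n p (F : T -> 'M[R]_(m, n)) (G : T -> 'M[R]_(n, p)) :
  mmeas F -> mmeas G -> mmeas (fun w => F w *m G w).
Proof.
move=> hF hG i j; under eq_fun do rewrite mxE.
by apply: measurable_sumr => k _; apply: measurable_funM; [exact: hF|exact: hG].
Qed.

Lemma mmeas_tr m n (F : T -> 'M[R]_(m, n)) : mmeas F -> mmeas (fun w => (F w)^T).
Proof. by move=> hF i j; under eq_fun do rewrite mxE; exact: hF. Qed.

Lemma measurable_det n (F : T -> 'M[R]_n) : mmeas F ->
  measurable_fun [set: T] (fun w => \det (F w)).
Proof.
move=> hF; rewrite /determinant; apply: measurable_sumr => s _.
apply: measurable_funM; first exact: measurable_cst.
by apply: measurable_prodr => i _; exact: hF.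
Qed.

Lemma measurable_norm m n (F : T -> 'M[R]_(m, n)) : mmeas F ->
  measurable_fun [set: T] (fun w => `|F w|).
Proof.
move=> hF; rewrite [X in measurable_fun _ X](_ : _ =
    (fun w => \big[Num.max/0]_(ij : 'I_m * 'I_n) `|F w ij.1 ij.2|)); last first.
  by apply/funext => w; rewrite [LHS]/Num.norm /= mx_normrE.
elim: (index_enum _) => [|ij s IH].
  by under eq_fun do rewrite big_nil; exact: measurable_cst.
under eq_fun do rewrite big_cons.
apply: measurable_maxr => //; apply: measurableT_comp => //; exact: hF.
Qed.

Lemma measurable_if_det0 n (F : T -> 'M[R]_n) f g : mmeas F ->
  measurable_fun [set: T] f -> measurable_fun [set: T] g ->
  measurable_fun [set: T] (fun w => if \det (F w) == 0 then f w else g w).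
Proof.
move=> hF hf hg; apply: measurable_fun_ifT => //.
by apply: measurable_fun_eqr; [exact: measurable_det|exact: measurable_cst].
Qed.

Lemma mmeas_inv n (F : T -> 'M[R]_n) : mmeas F -> mmeas (fun w => invmx (F w)).
Proof.
move=> hF i j.
(* On singular matrices [invmx] returns its argument. *)
have -> : (fun w => invmx (F w) i j) = (fun w => if \det (F w) == 0 then F w i j
   else (\det (F w))^-1 * cofactor (F w) j i).
  apply/funext => w; rewrite /invmx unitmxE unitfE.
  by case: eqP => // _; rewrite !mxE.
apply: measurable_if_det0 => //; apply: measurable_funM.
  exact/measurable_invr/measurable_det.
rewrite /cofactor; apply: measurable_funM; first exact: measurable_cst.
apply: measurable_det => k l; under eq_fun do rewrite !mxE.
exact: hF.
Qed.

(** Where the determinant is nonzero a positive semidefinite matrix is positive definite and the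
    root is the limit of the iteration; elsewhere it is the default 0. *)
Lemma mmeas_sqrtmx n (F : T -> 'M[R]_n) : (forall w, psd (F w)) -> mmeas F ->
  mmeas (fun w => sqrtmx (F w)).
Proof.
move=> pF hF i j.
pose sc w := sqrt_scale (F w).
have msc : measurable_fun [set: T] sc.
  apply: measurable_funD; first exact: measurable_cst.
  apply: measurable_sumr => k _; apply: measurable_sumr => l _.
  by apply: measurable_funD; [exact: measurable_cst|apply: measurable_funX; exact: hF].
pose h k w := if \det (F w) == 0 then 0 else
   Num.sqrt (sc w) * (1%:M - sqrt_iter (sqrt_shift (F w)) k) i j.
apply: (@measurable_fun_cvg _ _ _ _ h).
  move=> k; apply: measurable_if_det0 => //; apply: measurable_funM.
    have -> : (fun w => Num.sqrt (sc w)) = (fun w => sc w `^ (2^-1)).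
      by apply/funext => w; rewrite powR12_sqrt // ltW // sqrt_scale_gt0.
    exact: (measurableT_comp (measurable_powR 2^-1) msc).
  suff hk l : mmeas (fun w => sqrt_iter (sqrt_shift (F w)) l).
    exact: (mmeasB (mmeas_cst 1%:M) (hk k)).
  have hs : mmeas (fun w => sqrt_shift (F w)).
    apply: mmeasB; first exact: mmeas_cst.
    apply: mmeasZ => //; exact: measurable_invr.
  elim: l => [|l IH] /=; first exact: mmeas_cst.
  apply: mmeasZ => //; apply: mmeasD => //; exact: mmeasM.
move=> w _; rewrite /h; have [d0|d0] := eqVneq (\det (F w)) 0.
  rewrite sqrtmx_npd ?mxE; first exact: cvg_cst.
  by move=> /posdef_unit; rewrite unitmxE unitfE d0 eqxx.
have pd : posdef (F w) by apply: psd_unit_posdef => //; rewrite unitmxE unitfE.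
have sL0 : 0 < Num.sqrt (sc w) by rewrite sqrtr_gt0 sqrt_scale_gt0.
have h0 : mcvg \oo (fun=> 1%:M) (1%:M : 'M[R]_n) by exact: mcvg_cst.
have h2 := @mcvgD _ _ _ eventually_filter _ _ _ _ _ _ h0
  (@mcvgN _ _ _ eventually_filter _ _ _ _ (sqrt_iter_sqrtmx pd)).
rewrite opprB [_%:M + _]addrC subrK in h2; have h1 := h2 i j.
have -> : sqrtmx (F w) i j =
    Num.sqrt (sc w) * ((Num.sqrt (sqrt_scale (F w)))^-1 *: sqrtmx (F w)) i j.
  by rewrite mxE mulVKf ?gt_eqF.
by apply: cvgM; [exact: cvg_cst|exact: h1].
Qed.

(** [F] is rounded down to the grid of mesh [1 / (k + 1)]. The rounded map takes countably many
    values on measurable pieces, so [f] of it is measurable, and continuity gives pointwise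
    convergence. *)
Lemma measurable_cont_comp n (f : 'cV[R]_n -> R) (F : T -> 'cV[R]_n) :
  continuous f -> mmeas F -> measurable_fun [set: T] (fun w => f (F w)).
Proof.
move=> cf hF.
pose D k w : 'cV[int]_n := \col_i Num.floor (k.+1%:R * F w i 0).
pose G k (z : 'cV[int]_n) : 'cV[R]_n := \col_i (k.+1%:R^-1 * (z i 0)%:~R).
apply: (@measurable_fun_cvg _ _ _ _ (fun k w => f (G k (D k w)))).
  move=> k _ Y mY; rewrite setTI.
  have mD z : measurable [set w | D k w = z].
    have -> : [set w | D k w = z] =
      \bigcap_(i in [set: 'I_n]) ((fun w => k.+1%:R * F w i 0) @^-1`
        `[(z i 0)%:~R, (z i 0 + 1)%:~R[%classic).
      apply/seteqP; split => [w <- i _ /=|w h].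
        by rewrite in_itv /= mxE floor_itv.
      apply/matrixP => i j; rewrite ord1 mxE; apply/eqP.
      have := h i I; rewrite /= in_itv /= => /andP[h1 h2].
      exact/eqP/floor_def/andP.
    apply: fin_bigcap_measurable => // i _.
    rewrite -[X in measurable X]setTI; apply: (measurable_funM _ (hF i 0)) => //.
  have -> : (fun w => f (G k (D k w))) @^-1` Y =
     \bigcup_m (if @unpickle 'cV[int]_n m is Some z then
       (if f (G k z) \in Y then [set w | D k w = z] else set0) else set0).
    apply/seteqP; split => [w /= Yw|w [m _]].
      by exists (pickle (D k w)) => //; rewrite pickleK mem_set.
    by case: unpickle => // z; case: ifPn => // /set_mem Yz /= ->.
  apply: bigcupT_measurable => m; case: unpickle => // z.
  by case: ifPn => // _; exact: mD.
move=> w _; apply: continuous_cvg; first exact: cf.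
apply/cvgrPdist_lt => e e0; near=> k.
have ke : k.+1%:R^-1 < e by near: k; exact: near_infty_natSinv_lt (PosNum e0).
apply: le_lt_trans ke; apply: mxnorm_le => // i j; rewrite !mxE ord1.
set x := F w i 0; have k0 : 0 < k.+1%:R :> R by [].
rewrite -(ler_pM2l k0) mulfV ?gt_eqF // -{1}(ger0_norm (ltW k0)) -normrM mulrBr.
rewrite mulVKf ?gt_eqF //.
have /andP[h1 h2] := floor_itv (k.+1%:R * x).
rewrite ger0_norm ?subr_ge0 //.
by move: h2; rewrite intrD; set a := _%:~R; lra.
Unshelve. all: by end_near. Qed.

End entrywise_measurability.

Definition L1 {d} {T : measurableType d} {R : realType} (mu : set T -> \bar R) (f : T -> R) :=
  mu.-integrable [set: T] (EFin \o f).
Definition Ex {d} {T : measurableType d} {R : realType} (mu : {measure set T -> \bar R}) (f : T -> R) : R :=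
  \int[mu]_(w in [set: T]) f w.

Section integrable_functions.
Context {R : realType} {d : measure_display} {T : measurableType d}.
Variable mu : {measure set T -> \bar R}.
Implicit Types f g : T -> R.

Lemma L1_meas f : L1 mu f -> measurable_fun [set: T] f.
Proof. by move=> /integrableP[/measurable_EFinP]. Qed.

Lemma L1_dom f g : measurable_fun [set: T] f -> L1 mu g -> (forall w, `|f w| <= g w) -> L1 mu f.
Proof.
move=> mf ig fg; apply: (le_integrable measurableT _ _ ig) => /=.
  exact/measurable_EFinP.
by move=> w _; rewrite lee_fin (le_trans (fg w)) // ler_norm.
Qed.

Lemma L1D f g : L1 mu f -> L1 mu g -> L1 mu (fun w => f w + g w).
Proof. by move=> hf hg; apply: (integrableD measurableT hf hg). Qed.

Lemma L1Z c f : L1 mu f -> L1 mu (fun w => c * f w).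
Proof. by move=> hf; apply: (integrableZl measurableT c hf). Qed.

Lemma L1N f : L1 mu f -> L1 mu (fun w => - f w).
Proof. by move=> hf; apply: (integrableN hf). Qed.

Lemma L1B f g : L1 mu f -> L1 mu g -> L1 mu (fun w => f w - g w).
Proof. by move=> hf hg; apply: L1D => //; exact: L1N. Qed.

Lemma L1_sum (I : Type) (s : seq I) (Q : pred I) (F : I -> T -> R) :
  (forall i, Q i -> L1 mu (F i)) -> L1 mu (fun w => \sum_(i <- s | Q i) F i w).
Proof.
move=> h; elim: s => [|i s IH]; first by under eq_fun do rewrite big_nil; exact: integrable0.
under eq_fun do rewrite big_cons.
by case Qi: (Q i) => //; apply: L1D => //; exact: h.
Qed.

Lemma L1_abs f : L1 mu f -> L1 mu (fun w => `|f w|).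
Proof. by move=> hf; apply: (integrable_norm hf). Qed.

Lemma ExD f g : L1 mu f -> L1 mu g -> Ex mu (fun w => f w + g w) = Ex mu f + Ex mu g.
Proof. by move=> hf hg; exact: RintegralD. Qed.

Lemma ExB f g : L1 mu f -> L1 mu g -> Ex mu (fun w => f w - g w) = Ex mu f - Ex mu g.
Proof. by move=> hf hg; exact: RintegralB. Qed.

Lemma ExZ c f : L1 mu f -> Ex mu (fun w => c * f w) = c * Ex mu f.
Proof. by move=> hf; exact: RintegralZl. Qed.


Lemma Ex_sum (I : Type) (s : seq I) (Q : pred I) (F : I -> T -> R) :
  (forall i, Q i -> L1 mu (F i)) ->
  Ex mu (fun w => \sum_(i <- s | Q i) F i w) = \sum_(i <- s | Q i) Ex mu (F i).
Proof.
move=> h; elim: s => [|i s IH].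
  by rewrite big_nil; under eq_fun do rewrite big_nil; rewrite /Ex /Rintegral integral0.
rewrite big_cons; under eq_fun do rewrite big_cons.
case Qi: (Q i) => //; rewrite ExD ?IH //; first exact: h.
exact: L1_sum.
Qed.

Lemma Ex_le f g : L1 mu f -> L1 mu g -> (forall w, f w <= g w) -> Ex mu f <= Ex mu g.
Proof. by move=> hf hg h; apply: le_Rintegral. Qed.

Lemma Ex_ge0 f : (forall w, 0 <= f w) -> 0 <= Ex mu f.
Proof. by move=> h; apply: Rintegral_ge0. Qed.

Lemma Ex_abs f : L1 mu f -> `|Ex mu f| <= Ex mu (fun w => `|f w|).
Proof. by move=> h; apply: le_normr_Rintegral. Qed.

Lemma L1_mul f g : measurable_fun [set: T] f -> measurable_fun [set: T] g ->
  L1 mu (fun w => f w ^+ 2) -> L1 mu (fun w => g w ^+ 2) -> L1 mu (fun w => f w * g w).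
Proof.
move=> mf mg hf hg.
apply: (L1_dom (measurable_funM mf mg) (L1D hf hg)) => w.
rewrite normrM; have := sqr_ge0 (`|f w| - `|g w|).
rewrite sqrrB !real_normK ?num_real // mulr2n.
have := sqr_ge0 (f w); have := sqr_ge0 (g w); lra.
Qed.

Lemma L1_mul_bounded f g c : measurable_fun [set: T] f -> (forall w, `|f w| <= c) ->
  L1 mu g -> L1 mu (fun w => f w * g w).
Proof.
move=> mf hf hg; apply: (L1_dom _ (L1Z c (L1_abs hg))).
  by apply: measurable_funM => //; exact: L1_meas.
by move=> w; rewrite normrM ler_wpM2r.
Qed.

Lemma Ex_CS f g : measurable_fun [set: T] f -> measurable_fun [set: T] g ->
  L1 mu (fun w => f w ^+ 2) -> L1 mu (fun w => g w ^+ 2) ->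
  Ex mu (fun w => f w * g w) ^+ 2 <= Ex mu (fun w => f w ^+ 2) * Ex mu (fun w => g w ^+ 2).
Proof.
move=> mf mg hf hg; apply: discriminant_le => t.
have hfg := L1_mul mf mg hf hg.
have : 0 <= Ex mu (fun w => (f w + t * g w) ^+ 2) by apply: Ex_ge0 => w; exact: sqr_ge0.
have -> : (fun w => (f w + t * g w) ^+ 2) =
  (fun w => (f w ^+ 2 + 2 * t * (f w * g w)) + t ^+ 2 * g w ^+ 2).
  by apply/funext => w; ring.
rewrite ExD ?ExD ?ExZ //; try exact: L1Z.
by apply: L1D => //; exact: L1Z.
Qed.

Lemma Ex_dominated (F : nat -> T -> R) f g :
  (forall k, measurable_fun [set: T] (F k)) ->
  (forall w, F k w @[k --> \oo] --> f w) -> L1 mu g -> (forall k w, `|F k w| <= g w) ->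
  L1 mu f /\ (Ex mu (F k) @[k --> \oo] --> Ex mu f).
Proof.
move=> mF Ff ig Fg.
have mf : measurable_fun [set: T] f by apply: (measurable_fun_cvg mF) => w _; exact: Ff.
have L1F k : L1 mu (F k) by exact: L1_dom (mF k) ig (Fg k).
have [|||||h1 _ h2] := @dominated_convergence _ _ _ mu setT measurableT (fun k => EFin \o F k)
   (EFin \o f) (EFin \o g).
- by move=> k; exact/measurable_EFinP.
- exact/measurable_EFinP.
- apply: aeW => w _; apply: cvg_EFin; first exact: nearW.
  exact: Ff.
- exact: ig.
- by apply: aeW => w k _ /=; rewrite lee_fin.
split => //; have e : (\int[mu]_(x in [set: T]) (EFin \o f) x)%E = (Ex mu f)%:E.
  by rewrite /Ex /Rintegral fineK // integrable_fin_num.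
by rewrite e in h2; exact: fine_cvg h2.
Qed.

End integrable_functions.

Section real_expectation.
Context {R : realType} {d : measure_display} {T : measurableType d} (P : probability T R).
Implicit Types f g : T -> R.

Lemma fine_expectation f : fine 'E_P[f]%E = Ex P f.
Proof. by rewrite unlock. Qed.

Lemma expectation_Ex f : L1 P f -> 'E_P[f]%E = (Ex P f)%:E.
Proof. by move=> h; rewrite -fine_expectation fineK // unlock; exact: integrable_fin_num. Qed.

Lemma L1_cst c : L1 P (fun=> c).
Proof. exact: finite_measure_integrable_cst. Qed.

Lemma L1_bounded f c : measurable_fun [set: T] f -> (forall w, `|f w| <= c) -> L1 P f.
Proof. by move=> mf h; apply: L1_dom (L1_cst c) h. Qed.

Lemma Ex_cst c : Ex P (fun=> c) = c.
Proof. by rewrite -fine_expectation -[X in 'E_P[X]%E]/(cst c) expectation_cst. Qed.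
Lemma L1_sqr f : measurable_fun [set: T] f -> L1 P (fun w => f w ^+ 2) -> L1 P f.
Proof.
move=> mf h; apply: (L1_dom mf (L1D (L1_cst 1) h)) => w.
have := sqr_ge0 (`|f w| - 1); rewrite sqrrB expr1n mulr1 real_normK ?num_real //.
have := sqr_ge0 (f w); have := normr_ge0 (f w); rewrite mulr2n; lra.
Qed.

Lemma Ex_sqr_le f : measurable_fun [set: T] f -> L1 P (fun w => f w ^+ 2) ->
  Ex P f ^+ 2 <= Ex P (fun w => f w ^+ 2).
Proof.
move=> mf hf.
have := @Ex_CS _ _ _ P f (cst 1) mf (measurable_cst _) hf.
have -> : (fun w => cst 1 w ^+ 2) = (fun=> 1) :> (T -> R) by apply/funext => w; rewrite expr1n.
have -> : (fun w => f w * cst 1 w) = f by apply/funext => w; rewrite mulr1.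
by rewrite Ex_cst mulr1; apply; exact: L1_cst.
Qed.

Lemma variance_Ex f : measurable_fun [set: T] f -> L1 P (fun w => f w ^+ 2) ->
  'V_P[f]%E = (Ex P (fun w => (f w - Ex P f) ^+ 2))%:E.
Proof.
move=> mf hf; have h1 := L1_sqr mf hf.
rewrite /variance unlock fine_expectation.
have -> : ((f \- cst (Ex P f)) * (f \- cst (Ex P f)))%R = (fun w => (f w - Ex P f) ^+ 2).
  by apply/funext => w; rewrite expr2.
apply: expectation_Ex.
have -> : (fun w => (f w - Ex P f) ^+ 2) =
   (fun w => f w ^+ 2 + ((- (2 * Ex P f)) * f w + Ex P f ^+ 2)).
  by apply/funext => w; ring.
by apply: L1D => //; apply: L1D; [exact: L1Z|exact: L1_cst].
Qed.

Lemma Ex_var f : L1 P f -> L1 P (fun w => f w ^+ 2) ->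
  Ex P (fun w => (f w - Ex P f) ^+ 2) = Ex P (fun w => f w ^+ 2) - Ex P f ^+ 2.
Proof.
move=> h1 hf.
have -> : (fun w => (f w - Ex P f) ^+ 2) =
   (fun w => f w ^+ 2 + ((- (2 * Ex P f)) * f w + Ex P f ^+ 2)).
  by apply/funext => w; ring.
rewrite ExD ?ExD ?ExZ ?Ex_cst //; try exact: L1Z; try exact: L1_cst; first by ring.
by apply: L1D; [exact: L1Z|exact: L1_cst].
Qed.

End real_expectation.

(** * Products of independent variables *)

Section product_expectation.
Context {R : realType} {d : measure_display} {T : measurableType d} (P : probability T R).
Variables (U V : T -> R).
Hypotheses (L1U : L1 P U) (L1V : L1 P V).
Hypothesis UV : forall A B : set R, measurable A -> measurable B ->
  P (U @^-1` A `&` V @^-1` B) = (P (U @^-1` A) * P (V @^-1` B))%E.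

Let mU := L1_meas L1U.
Let mV := L1_meas L1V.
Let Um : {mfun T >-> R} := HB.pack U (isMeasurableFun.Build _ _ _ _ U mU).
Let Vm : {mfun T >-> R} := HB.pack V (isMeasurableFun.Build _ _ _ _ V mV).
Let W w := (U w, V w).
Let mW : measurable_fun [set: T] W. Proof. exact: measurable_fun_pair. Qed.
Let Wm : {mfun T >-> (R * R)%type} := HB.pack W (isMeasurableFun.Build _ _ _ _ W mW).
Let muU := distribution P Um.
Let muV := distribution P Vm.

(** Independence on rectangles identifies the joint law with the product of the marginal laws, after
    which Tonelli and Fubini apply. *)
Let joint (A : set (R * R)) : measurable A -> (muU \x muV)%E A = distribution P Wm A.
Proof.
by apply: product_measure_unique => A' B mA mB; exact: UV.
Qed.

Let mxy : measurable_fun [set: R * R] (fun z : R * R => z.1 * z.2).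
Proof. by apply: measurable_funM; [exact: measurable_fst|exact: measurable_snd]. Qed.

Lemma L1_indep_mul : L1 P (fun w => U w * V w).
Proof.
apply/integrableP; split; first by apply/measurable_EFinP; exact: measurable_funM.
have -> : (\int[P]_x `|(EFin \o (fun w => (U w * V w)%R)) x|)%E =
  (\int[muU \x muV]_z `|(z.1 * z.2)%R%:E|)%E.
  rewrite (@eq_measure_integral _ _ _ _ (distribution P Wm)); last first.
    by move=> A mA _; exact: joint.
  rewrite ge0_integral_distribution //.
  by apply: measurableT_comp => //; exact/measurable_EFinP.
rewrite fubini_tonelli1 //; last first.
  by apply: measurableT_comp => //; exact/measurable_EFinP.
rewrite /fubini_F.
have -> : (\int[muU]_x \int[muV]_y `|((x, y).1 * (x, y).2)%R%:E|)%E =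
   (\int[muU]_x (`|x%:E| * \int[muV]_y `|y%:E|))%E.
  apply: eq_integral => x _ /=.
  rewrite -ge0_integralZl //; last by apply: measurableT_comp.
  by apply: eq_integral => y _ /=; rewrite normrM EFinM.
have fV : (\int[muV]_y `|y%:E| < +oo)%E.
  have [_] := integrableP _ _ _ L1V; rewrite ge0_integral_distribution //.
  by apply: measurableT_comp.
have fU : (\int[muU]_y `|y%:E| < +oo)%E.
  have [_] := integrableP _ _ _ L1U; rewrite ge0_integral_distribution //.
  by apply: measurableT_comp.
have V0 : (0 <= \int[muV]_y `|y%:E|)%E by apply: integral_ge0.
rewrite ge0_integralZr //; last by apply: measurableT_comp.
by rewrite lte_mul_pinfty // ?integral_ge0 // ge0_fin_numE ?integral_ge0.
Qed.

Lemma Ex_indep_mul : Ex P (fun w => U w * V w) = Ex P U * Ex P V.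
Proof.
have iU : muU.-integrable setT EFin.
  apply: (@integrable_pushforward _ _ _ _ _ U mU P setT EFin) => //.
have iV : muV.-integrable setT EFin.
  apply: (@integrable_pushforward _ _ _ _ _ V mV P setT EFin) => //.
have eU : (\int[muU]_x x%:E = (Ex P U)%:E)%E.
  rewrite (@integral_pushforward _ _ _ _ _ U mU P setT EFin) //.
  by rewrite /Ex /Rintegral fineK // integrable_fin_num.
have eV : (\int[muV]_x x%:E = (Ex P V)%:E)%E.
  rewrite (@integral_pushforward _ _ _ _ _ V mV P setT EFin) //.
  by rewrite /Ex /Rintegral fineK // integrable_fin_num.
have mz : measurable_fun [set: R * R] (fun z : R * R => (z.1 * z.2)%:E) by exact/measurable_EFinP.
have iW : (distribution P Wm).-integrable setT (fun z : R * R => (z.1 * z.2)%:E).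
  by apply: (@integrable_pushforward _ _ _ _ _ W mW P setT) => //; exact: L1_indep_mul.
have iUV : (muU \x muV)%E.-integrable setT (fun z : R * R => (z.1 * z.2)%:E).
  move/integrableP : iW => [_ h]; apply/integrableP; split => //.
  rewrite (@eq_measure_integral _ _ _ _ (distribution P Wm)) //.
  by move=> A mA _; exact: joint.
have e1 : (\int[P]_w (U w * V w)%:E)%E = (\int[muU \x muV]_z (z.1 * z.2)%R%:E)%E.
  rewrite (@eq_measure_integral _ _ _ _ (distribution P Wm)); last first.
    by move=> A mA _; exact: joint.
  by rewrite (@integral_pushforward _ _ _ _ _ W mW P setT) //; exact: L1_indep_mul.
rewrite {1}/Ex /Rintegral e1 -integral12_prod_meas1 // /fubini_F.
have -> : (\int[muU]_x \int[muV]_y ((x, y).1 * (x, y).2)%R%:E)%E =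
   (\int[muU]_x ((Ex P V)%:E * x%:E))%E.
  apply: eq_integral => x _ /=; under eq_integral do rewrite EFinM.
  by rewrite integralZl // eV muleC.
by rewrite integralZl // eU -EFinM /= mulrC.
Qed.

End product_expectation.

(** * Independence of one copy from all the others *)

Section iid.
Context {R : realType} {n : nat} {d : measure_display} {T : measurableType d}.
Variables (P : probability T R) (X : T -> 'cV[R]_n) (Xs : nat -> T -> 'cV[R]_n).
Hypothesis iidX : iid_copies P X Xs.

Definition vborel (phi : 'cV[R]_n -> R) :=
  measurable_fun [set: n.-tuple R] (fun t => phi (col_of_tuple t)).

Lemma tuple_of_colK : cancel (@tuple_of_col R n) (@col_of_tuple R n).
Proof.
by move=> v; apply/matrixP => i j; rewrite ord1 mxE tnth_mktuple.
Qed.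

Lemma random_vector_mmeas (Y : T -> 'cV[R]_n) : random_vector Y -> mmeas Y.
Proof.
move=> mY i j; rewrite ord1.
have -> : (fun w => Y w i 0) = (fun w => tnth (tuple_of_col (Y w)) i).
  by apply/funext => w; rewrite tnth_mktuple.
exact: (measurableT_comp (measurable_tnth i) mY).
Qed.

Lemma vborel_comp (phi : 'cV[R]_n -> R) Y : vborel phi -> random_vector Y ->
  measurable_fun [set: T] (fun w => phi (Y w)).
Proof.
move=> mphi mY.
have -> : (fun w => phi (Y w)) = (fun t => phi (col_of_tuple t)) \o (fun w => tuple_of_col (Y w)).
  by apply/funext => w /=; rewrite tuple_of_colK.
exact: measurableT_comp.
Qed.

Lemma mmeas_col_of_tuple : mmeas (@col_of_tuple R n).
Proof. by move=> i j; under eq_fun do rewrite mxE; exact: measurable_tnth. Qed.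

Lemma vborel_cont phi : continuous phi -> vborel phi.
Proof. by move=> cf; apply: measurable_cont_comp => //; exact: mmeas_col_of_tuple. Qed.

Lemma vborel_coord i j : vborel (fun x => x i j).
Proof. exact: mmeas_col_of_tuple. Qed.

Let rvX : random_vector X. Proof. by case: iidX. Qed.
Let rvXs k : random_vector (Xs k). Proof. by case: iidX => _ []. Qed.

Lemma preimage_measurable (Y : T -> 'cV[R]_n) (B : set 'cV[R]_n) :
  random_vector Y -> vmeasurable B -> measurable (Y @^-1` B).
Proof.
move=> mY mB.
have -> : Y @^-1` B = (fun w => tuple_of_col (Y w)) @^-1` (@col_of_tuple R n @^-1` B).
  by apply/seteqP; split => w /=; rewrite tuple_of_colK.
by rewrite -[X in measurable X]setTI; apply: mY.
Qed.

Section copies.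
Variable k : nat.
Let Xt w := tuple_of_col (X w).
Let Yt w := tuple_of_col (Xs k w).
Let Xm : {mfun T >-> n.-tuple R} := HB.pack Xt (isMeasurableFun.Build _ _ _ _ Xt rvX).
Let Ym : {mfun T >-> n.-tuple R} := HB.pack Yt (isMeasurableFun.Build _ _ _ _ Yt (rvXs k)).

Let same_law A : measurable A -> distribution P Xm A = distribution P Ym A.
Proof.
move=> mA; have [_ [_ [h _]]] := iidX.
have e : @col_of_tuple R n @^-1` (tuple_of_col @^-1` A) = A.
  apply/seteqP; split => t /=.
    by rewrite (_ : tuple_of_col _ = t) //; apply: eq_from_tnth => i; rewrite tnth_mktuple mxE.
  by move=> At; rewrite (_ : tuple_of_col _ = t) //; apply: eq_from_tnth => i; rewrite tnth_mktuple mxE.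
have hh := h k (tuple_of_col @^-1` A); rewrite /vmeasurable e in hh.
exact: esym (hh mA).
Qed.

Lemma L1_copy phi : vborel phi -> L1 P (fun w => phi (X w)) -> L1 P (fun w => phi (Xs k w)).
Proof.
move=> mphi /integrableP [_ h]; apply/integrableP; split.
  apply/measurable_EFinP; exact: vborel_comp.
apply: le_lt_trans h; rewrite le_eqVlt; apply/orP; left; apply/eqP.
have m' : measurable_fun [set: n.-tuple R] (fun t => `|(phi (col_of_tuple t))%:E|%E).
  by apply: measurableT_comp => //; exact/measurable_EFinP.
transitivity (\int[distribution P Ym]_t `|(phi (col_of_tuple t))%:E|)%E.
  rewrite ge0_integral_distribution //; apply: eq_integral => w _ /=.
  by rewrite tuple_of_colK.
rewrite (@eq_measure_integral _ _ _ _ (distribution P Xm)) //; last first.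
  by move=> A mA _; first [exact: same_law|exact: esym (same_law mA)].
rewrite ge0_integral_distribution //; apply: eq_integral => w _ /=.
by rewrite tuple_of_colK.
Qed.

Lemma Ex_copy phi : vborel phi -> L1 P (fun w => phi (X w)) ->
  Ex P (fun w => phi (Xs k w)) = Ex P (fun w => phi (X w)).
Proof.
move=> mphi L1X; have L1Y := L1_copy mphi L1X.
have m' : measurable_fun [set: n.-tuple R] (fun t => (phi (col_of_tuple t))%:E).
  exact/measurable_EFinP.
congr fine; transitivity (\int[distribution P Ym]_t (phi (col_of_tuple t))%:E)%E.
  rewrite integral_distribution //; first by apply: eq_integral => w _ /=; rewrite tuple_of_colK.
  apply: eq_integrable L1Y => // w _ /=; by rewrite tuple_of_colK.
rewrite (@eq_measure_integral _ _ _ _ (distribution P Xm)) //; last first.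
  by move=> A mA _; first [exact: same_law|exact: esym (same_law mA)].
rewrite integral_distribution //; first by apply: eq_integral => w _ /=; rewrite tuple_of_colK.
by apply: eq_integrable L1X => // w _ /=; rewrite tuple_of_colK.
Qed.
End copies.

(* A pi-system generating the sigma-algebra of the copies other than the k-th one. *)
Definition others k : set (set T) :=
  [set A | exists (s : seq nat) (B : nat -> set 'cV[R]_n),
    [/\ uniq s, k \notin s, (forall j, vmeasurable (B j)) &
     A = \bigcap_(j in [set` s]) (Xs j @^-1` B j)]].

(** The same points with the smaller sigma-algebra: depending on the other copies only becomes plain
    measurability of a function on this type. *)
Definition othersType k := g_sigma_algebraType (others k).

Lemma vmeasurableT : vmeasurable [set: 'cV[R]_n].
Proof. by rewrite /vmeasurable preimage_setT. Qed.

Lemma others_setI k : setI_closed (others k).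
Proof.
move=> _ _ [s1 [B1 [u1 k1 m1 ->]]] [s2 [B2 [u2 k2 m2 ->]]].
exists (undup (s1 ++ s2)), (fun j => (if j \in s1 then B1 j else setT) `&`
   (if j \in s2 then B2 j else setT)); split.
- exact: undup_uniq.
- by rewrite mem_undup mem_cat negb_or k1.
- move=> j; rewrite /vmeasurable preimage_setI.
  apply: measurableI; case: ifP => _; try exact: vmeasurableT.
    exact: m1.
  exact: m2.
apply/seteqP; split => [w [h1 h2] j _ /=|w h].
  by split; case: ifPn => // js; [exact: h1|exact: h2].
split=> j js; have [] := h j; rewrite /= ?mem_undup ?mem_cat ?js ?orbT //.
Qed.

Lemma others_measurable k A : <<s others k >> A -> d.-measurable A.
Proof.
apply: smallest_sub; first exact: sigma_algebra_measurable.
move=> _ [s [B [us ks mB ->]]]; apply: bigcap_measurableType => j _.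
exact: preimage_measurable.
Qed.

(** Dynkin induction on [A]. For a generator, with index list [s] not containing [k], it is the
    product formula for the list [k :: s]. *)
Lemma others_event k A B : <<s others k >> A -> vmeasurable B ->
  P (Xs k @^-1` B `&` A) = (P (Xs k @^-1` B) * P A)%E.
Proof.
move=> + mB; set E := Xs k @^-1` B.
have mE : measurable E by exact: preimage_measurable.
have finE : P E \is a fin_num by exact: fin_num_measure.
move: A; apply: (@dynkin_induction _ (othersType k) (others k)) => //.
- exact: others_setI.
- by rewrite setIT probability_setT mule1.
- move=> _ [s [C [us ks mC ->]]]; have [_ [_ [_ h]]] := iidX.
  pose C' j := if j == k then B else C j.
  have mC' j : vmeasurable (C' j) by rewrite /C'; case: eqP.
  have eC : forall j, j \in s -> C' j = C j.
    by move=> j js; rewrite /C'; case: eqP => // jk; move: ks; rewrite -jk js.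
  have := h (k :: s) C'; rewrite /= ks us => /(_ erefl mC').
  rewrite big_cons {2}/C' eqxx -/E => h1.
  have <- : \bigcap_(j in [set` k :: s]) (Xs j @^-1` C' j) =
      E `&` \bigcap_(j in [set` s]) (Xs j @^-1` C j).
    apply/seteqP; split => [w hw|w [hE hw] j /=].
      split; first by have := hw k; rewrite /C' eqxx; apply; rewrite /= inE eqxx.
      move=> j /= js; rewrite -(eC j js); apply: hw => /=.
      by rewrite inE js orbT.
    rewrite inE => /predU1P[->|js]; first by rewrite /C' eqxx.
    by rewrite (eC j js); exact: hw.
  rewrite h1 (h s C us mC); congr (_ * _)%E; apply: eq_big_seq => j js.
  by rewrite eC.
- move=> A mA hA; have mA' : d.-measurable A by exact: others_measurable mA.
  have -> : P (E `&` ~` A) = (P E - P (E `&` A))%E.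
    rewrite -setDE measureD //; last by rewrite ltey_eq finE.
  rewrite hA; have -> : P (~` A) = (1 - P A)%E by exact: probability_setC.
  have finA : P A \is a fin_num by exact: fin_num_measure.
  rewrite -(fineK finA) -(fineK finE).
  by rewrite muleBr ?fin_num_adde_defr // mule1.
- move=> F mF tF hF; have mF' i : d.-measurable (F i) by exact: others_measurable (mF i).
  rewrite setI_bigcupr measure_bigcup; last 2 first.
  + by move=> i _; exact: measurableI.
  + move=> i j _ _ [w [[_ Fi] [_ Fj]]]; apply: tF => //.
    by exists w.
  transitivity (\sum_(0 <= i <oo | i \in [set: nat]) ((fine (P E))%:E * P (F i)))%E.
    by apply: eq_eseriesr => i _; rewrite fineK //; exact: hF.
  by rewrite nneseriesZl // fineK // measure_bigcup.
Qed.

Lemma others_meas k (V : T -> R) :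
  measurable_fun [set: othersType k] (V : othersType k -> R) -> measurable_fun [set: T] V.
Proof.
move=> mV _ Y mY; have := mV measurableT Y mY => /= h.
exact: others_measurable h.
Qed.

Lemma mmeas_others k j : j != k -> mmeas (Xs j : othersType k -> 'cV[R]_n).
Proof.
move=> jk i i' _ Y mY; rewrite setTI; apply: sub_gen_smallest.
exists [:: j], (fun=> [set x : 'cV[R]_n | Y (x i i')]); split => //.
- by rewrite inE eq_sym.
- move=> _; have := @vborel_coord i i' measurableT Y mY.
  by rewrite setTI.
- apply/seteqP; split => [w Yw l /=|w]; first by rewrite inE => /eqP ->.
  by move=> /(_ j); apply; rewrite /= inE.
Qed.

Lemma indep_mul k phi (V : T -> R) : vborel phi ->
  measurable_fun [set: othersType k] (V : othersType k -> R) ->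
  L1 P (fun w => phi (Xs k w)) -> L1 P V ->
  L1 P (fun w => phi (Xs k w) * V w) /\
  Ex P (fun w => phi (Xs k w) * V w) = Ex P (fun w => phi (Xs k w)) * Ex P V.
Proof.
move=> mphi mV L1p L1V.
have h (A B : set R) : measurable A -> measurable B ->
    P ((fun w => phi (Xs k w)) @^-1` A `&` V @^-1` B) =
    (P ((fun w => phi (Xs k w)) @^-1` A) * P (V @^-1` B))%E.
  move=> mA mB; apply: (@others_event k (V @^-1` B) (phi @^-1` A)).
    by have := mV measurableT B mB; rewrite setTI.
  by have := mphi measurableT A mA; rewrite setTI.
by split; [exact: L1_indep_mul|exact: Ex_indep_mul].
Qed.

End iid.

(** * Moments of sums of copies and a law of large numbers *)

Section iid_sums.
Context {R : realType} {n : nat} {d : measure_display} {T : measurableType d}.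
Variables (P : probability T R) (X : T -> 'cV[R]_n) (Xs : nat -> T -> 'cV[R]_n).
Hypothesis iidX : iid_copies P X Xs.

Let rvX : random_vector X. Proof. by case: iidX. Qed.
Let rvXs k : random_vector (Xs k). Proof. by case: iidX => _ []. Qed.

Lemma vborel_others phi k j : vborel phi -> j != k ->
  measurable_fun [set: othersType (n := n) Xs k]
    ((fun w => phi (Xs j w)) : othersType Xs k -> R).
Proof.
move=> mphi jk.
have -> : (fun w => phi (Xs j w)) = (fun t => phi (col_of_tuple t)) \o (fun w => tuple_of_col (Xs j w)).
  by apply/funext => w /=; rewrite tuple_of_colK.
apply: (measurableT_comp mphi).
apply/measurable_fun_tnthP => i.
have -> : @tnth n R ^~ i \o (fun w => tuple_of_col (Xs j w)) = (fun w => Xs j w i 0).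
  by apply/funext => w /=; rewrite tnth_mktuple.
exact: (mmeas_others jk).
Qed.


Section centered.
Variables (psi : 'cV[R]_n -> R) (Q : pred nat).
Hypotheses (mpsi : vborel psi) (L1psi : L1 P (fun w => psi (X w))).
Hypothesis Epsi : Ex P (fun w => psi (X w)) = 0.

Let S N w := \sum_(j < N | Q j) psi (Xs j w).

Let SS N w : S N.+1 w = S N w + (if Q N then psi (Xs N w) else 0).
Proof. by rewrite /S big_mkcond big_ord_recr /= -big_mkcond. Qed.

Let mSo N : measurable_fun [set: othersType Xs N] (S N : othersType Xs N -> R).
Proof.
apply: measurable_sumr => j _; apply: vborel_others => //.
by rewrite neq_ltn ltn_ord.
Qed.

Let mS N : measurable_fun [set: T] (S N).
Proof. exact: (others_meas iidX (@mSo N)). Qed.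

Let psiE k : Ex P (fun w => psi (Xs k w)) = 0.
Proof. by rewrite (Ex_copy iidX). Qed.

Let L1S N : L1 P (S N).
Proof. by apply: L1_sum => j _; exact: (L1_copy iidX). Qed.

Let ES N : Ex P (S N) = 0.
Proof.
rewrite Ex_sum => [|j _]; last exact: (L1_copy iidX).
by rewrite big1 // => j _; exact: psiE.
Qed.

Let vborelX k : vborel (fun x => psi x ^+ k).
Proof. exact: measurable_funX. Qed.

Let mSXo N k : measurable_fun [set: othersType Xs N] ((fun w => S N w ^+ k) : othersType Xs N -> R).
Proof. exact: measurable_funX. Qed.

(** Induction on [N]: the new term is centred and independent of the preceding sum. The predicate
    [Q] will be used to leave samples out. *)
Lemma sum_sqr N : L1 P (fun w => psi (X w) ^+ 2) ->
  L1 P (fun w => S N w ^+ 2) /\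
  Ex P (fun w => S N w ^+ 2) = (\sum_(j < N | Q j) 1) * Ex P (fun w => psi (X w) ^+ 2).
Proof.
move=> L2; set v := Ex P (fun w => psi (X w) ^+ 2).
elim: N => [|N [L1N IH]].
  under eq_fun do rewrite /S big_ord0 expr0n.
  by rewrite Ex_cst big_ord0 mul0r; split => //; exact: L1_cst.
have eN : \sum_(j < N.+1 | Q j) 1 = \sum_(j < N | Q j) 1 + (if Q N then 1 else 0) :> R.
  by rewrite big_mkcond big_ord_recr /= -big_mkcond.
rewrite eN; have [QN|QN] := boolP (Q N); last first.
  have -> : (fun w => S N.+1 w ^+ 2) = (fun w => S N w ^+ 2).
    by apply/funext => w; rewrite SS (negbTE QN) addr0.
  by rewrite addr0.
have L2k : L1 P (fun w => psi (Xs N w) ^+ 2) by exact: (L1_copy iidX N (@vborelX 2)).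
have [c1 c2] := indep_mul iidX mpsi (@mSo N) (L1_copy iidX N mpsi L1psi) (L1S N).
have -> : (fun w => S N.+1 w ^+ 2) =
   (fun w => S N w ^+ 2 + (2 * (psi (Xs N w) * S N w) + psi (Xs N w) ^+ 2)).
  by apply/funext => w; rewrite SS QN; ring.
have c3 : L1 P (fun w => 2 * (psi (Xs N w) * S N w)) by exact: L1Z.
split; first by apply: L1D => //; exact: L1D.
rewrite ExD ?ExD ?ExZ ?c2 ?psiE //; last exact: L1D.
by rewrite mul0r mulr0 add0r (Ex_copy iidX N (@vborelX 2) L2) -/v mulrDl mul1r IH.
Qed.

Lemma sum_sqr_le N : L1 P (fun w => psi (X w) ^+ 2) ->
  L1 P (fun w => S N w ^+ 2) /\
  Ex P (fun w => S N w ^+ 2) <= N%:R * Ex P (fun w => psi (X w) ^+ 2).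
Proof.
move=> L2; have [h1 ->] := @sum_sqr N L2; split => //.
apply: ler_wpM2r; first by apply: Ex_ge0 => w; exact: sqr_ge0.
rewrite -[N in leRHS]card_ord -sum1_card natr_sum big_mkcond /=.
by apply: ler_sum => i _; case: (Q i).
Qed.

(** In the expansion of the fourth power, the terms with a single factor [psi (Xs N w)] or a single
    factor of the preceding sum have mean zero. *)
Lemma sum_pow4_le N : L1 P (fun w => psi (X w) ^+ 4) ->
  L1 P (fun w => S N w ^+ 4) /\
  Ex P (fun w => S N w ^+ 4) <= N%:R ^+ 2 *
    (3 * Ex P (fun w => psi (X w) ^+ 2) ^+ 2 + Ex P (fun w => psi (X w) ^+ 4)).
Proof.
move=> L4; have mX : measurable_fun [set: T] (fun w => psi (X w)) by exact: vborel_comp.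
have low k (f : T -> R) : measurable_fun [set: T] f -> L1 P (fun w => f w ^+ 4) -> (k <= 4)%N ->
    L1 P (fun w => f w ^+ k).
  move=> mf h k4; apply: (L1_dom (measurable_funX _ mf) (L1D (L1_cst P 1) h)) => w.
  have a0 := normr_ge0 (f w).
  have -> : f w ^+ 4 = `|f w| ^+ 4 by rewrite -normrX ger0_norm // exprn_even_ge0.
  rewrite normrX.
  have [a1|a1] := leP `|f w| 1.
    by rewrite (le_trans (exprn_ile1 k a0 a1)) // lerDl exprn_ge0.
  by rewrite (le_trans (ler_weXn2l (ltW a1) k4)) // lerDr.
have L2 := low 2 _ mX L4 isT; have L3 := low 3 _ mX L4 isT.
set m2 := Ex P (fun w => psi (X w) ^+ 2); set m4 := Ex P (fun w => psi (X w) ^+ 4).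
have m20 : 0 <= m2 by apply: Ex_ge0 => w; exact: sqr_ge0.
have m40 : 0 <= m4 by apply: Ex_ge0 => w; exact: exprn_even_ge0.
set C := 3 * _ + _; have C0 : 0 <= C by rewrite addr_ge0 // mulr_ge0 // sqr_ge0.
elim: N => [|N [L1N IH]].
  under eq_fun do rewrite /S big_ord0 expr0n.
  by rewrite Ex_cst expr0n mul0r; split => //; exact: L1_cst.
have [QN|QN] := boolP (Q N); last first.
  have -> : (fun w => S N.+1 w ^+ 4) = (fun w => S N w ^+ 4).
    by apply/funext => w; rewrite SS (negbTE QN) addr0.
  by split => //; rewrite (le_trans IH) // ler_wpM2r // ler_pXn2r ?nnegrE // ler_nat.
have Lk k : L1 P (fun w => psi (X w) ^+ k) -> L1 P (fun w => psi (Xs N w) ^+ k).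
  by move=> h; exact: (L1_copy iidX N (@vborelX k)).
have LS k : (k <= 4)%N -> L1 P (fun w => S N w ^+ k) by exact: low.
have [_ hS2] := sum_sqr_le N L2.
have [c1 e1] := indep_mul iidX mpsi (@mSXo N 3) (L1_copy iidX N mpsi L1psi) (LS 3 isT).
have [c2 e2] := indep_mul iidX (@vborelX 2) (@mSXo N 2) (Lk 2 L2) (LS 2 isT).
have [c3 e3] := indep_mul iidX (@vborelX 3) (@mSo N) (Lk 3 L3) (L1S N).
have L4k := Lk 4 L4.
have -> : (fun w => S N.+1 w ^+ 4) =
   (fun w => S N w ^+ 4 + (4 * (psi (Xs N w) * S N w ^+ 3) +
     (6 * (psi (Xs N w) ^+ 2 * S N w ^+ 2) + (4 * (psi (Xs N w) ^+ 3 * S N w) +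
      psi (Xs N w) ^+ 4)))).
  by apply/funext => w; rewrite SS QN; ring.
have d1 := L1Z 4 c1; have d2 := L1Z 6 c2; have d3 := L1Z 4 c3.
have d34 := L1D d3 L4k; have d24 := L1D d2 d34; have d14 := L1D d1 d24.
split; first exact: L1D.
rewrite (ExD L1N d14) (ExD d1 d24) (ExD d2 d34) (ExD d3 L4k).
rewrite (ExZ 4 c1) (ExZ 6 c2) (ExZ 4 c3) e1 e2 e3 psiE ES.
rewrite (Ex_copy iidX N (@vborelX 2) L2) (Ex_copy iidX N (@vborelX 4) L4).
rewrite -/m2 -/m4 mul0r !mulr0 !add0r.
have h6 : m2 * Ex P (fun w => S N w ^+ 2) <= N%:R * m2 ^+ 2.
  by rewrite expr2 mulrCA ler_wpM2l.
have N0 : 0 <= N%:R :> R by [].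
have q1 : 0 <= N%:R * m4 by rewrite mulr_ge0.
have q2 : 0 <= N%:R * m2 ^+ 2 by rewrite mulr_ge0 // sqr_ge0.
have q3 : 0 <= m2 ^+ 2 by exact: sqr_ge0.
(* The increment [(2 N + 1) C] has to absorb [6 N m2^2 + m4], which explains the coefficient 3 in
   [C]. *)
have -> : N.+1%:R ^+ 2 * C = N%:R ^+ 2 * C + (2 * N%:R * C + C) by rewrite -natr1; ring.
apply: lerD => //; apply: (@le_trans _ _ (6 * (N%:R * m2 ^+ 2) + m4)).
  by rewrite lerD2r; apply: ler_wpM2l.
rewrite /C; nra.
Qed.

End centered.

Lemma vborelB phi psi : vborel (n := n) (R := R) phi -> vborel psi -> vborel (fun x => phi x - psi x).
Proof. by move=> h1 h2; exact: measurable_funB. Qed.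
Lemma vborel_cst (c : R) : vborel (n := n) (fun=> c).
Proof. exact: measurable_cst. Qed.

(** In the converse the products of two coordinates are merely integrable, so the law of large
    numbers is proved in mean under a first moment, and uniformly in the subset [Q]. The truncated
    part is handled by its variance, the rest by its small mean. *)
Lemma lln phi (e : R) : vborel phi -> L1 P (fun w => phi (X w)) -> 0 < e ->
  exists N0, forall N (Q : pred nat), (N0 <= N)%N ->
   L1 P (fun w => `|N%:R^-1 * \sum_(j < N | Q j) (phi (Xs j w) - Ex P (fun w => phi (X w)))|) /\
   Ex P (fun w => `|N%:R^-1 * \sum_(j < N | Q j) (phi (Xs j w) - Ex P (fun w => phi (X w)))|) <= e.
Proof.
move=> mphi L1phi e0; set m := Ex P (fun w => phi (X w)).
pose trunc k x := if `|phi x| <= k%:R then phi x else 0.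
have mt k : vborel (trunc k).
  apply: measurable_fun_ifT; [|exact: mphi|exact: measurable_cst].
  apply: measurable_fun_ler; [|exact: measurable_cst].
  by apply: measurableT_comp => //; exact: mphi.
have tle k x : `|trunc k x| <= k%:R.
  by rewrite /trunc; case: ifPn => // _; rewrite normr0.
have mXphi := vborel_comp mphi rvX.
have [|w|||_] := @Ex_dominated _ _ _ P (fun k w => `|phi (X w) - trunc k (X w)|) (fun=> 0)
   (fun w => `|phi (X w)|).
- move=> k; apply: measurableT_comp => //; apply: measurable_funB => //.
  exact: (vborel_comp (@mt k) rvX).
- apply: cvg_near_cst.
  near=> k; rewrite /trunc ifT ?subrr ?normr0 //.
  by near: k; exact: nbhs_infty_ger.
- exact: L1_abs.
- move=> k w; rewrite normr_id /trunc; case: ifPn => _; last by rewrite subr0.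
  by rewrite subrr normr0.
rewrite Ex_cst => /cvgrPdist_lt /(_ (e / 4)).
have e4 : 0 < e / 4 by rewrite divr_gt0.
move=> /(_ e4) [k _ /(_ k (leqnn k))] /=; rewrite sub0r normrN.
set t := Ex P _ => hk.
have t0 : 0 <= t by exact: Ex_ge0.
rewrite ger0_norm // in hk.
pose m' := Ex P (fun w => trunc k (X w)).
have L1t : L1 P (fun w => trunc k (X w)).
  by apply: (@L1_bounded _ _ _ P _ k%:R) => //; exact: (vborel_comp (@mt k) rvX).
pose psi x := trunc k x - m'.
have mpsi : vborel psi by apply: vborelB; [exact: mt|exact: vborel_cst].
have L1psi : L1 P (fun w => psi (X w)) by apply: L1B => //; exact: L1_cst.
have Epsi : Ex P (fun w => psi (X w)) = 0.
  by rewrite ExB ?Ex_cst ?subrr //; exact: L1_cst.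
have m'k : `|m'| <= k%:R.
  apply: (le_trans (Ex_abs L1t)); rewrite -[leRHS](Ex_cst P); apply: Ex_le => //.
    exact: L1_abs.
  exact: L1_cst.
have psik x : psi x ^+ 2 <= (2 * k%:R) ^+ 2.
  rewrite -[psi x ^+ 2]real_normK ?num_real // ler_pXn2r ?nnegrE ?mulr_ge0 //.
  by rewrite (le_trans (ler_normB _ _)) // mulr2n mulrDl mul1r lerD.
have mpsi2 : measurable_fun [set: T] (fun w => psi (X w) ^+ 2).
  exact: measurable_funX (vborel_comp mpsi rvX).
have L2psi : L1 P (fun w => psi (X w) ^+ 2).
  apply: (@L1_bounded _ _ _ P _ ((2 * k%:R) ^+ 2)) => // w.
  by rewrite ger0_norm ?sqr_ge0.
set K := (2 * k%:R) ^+ 2 in psik *.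
have K0 : 0 <= K by exact: sqr_ge0.
have Ek : Ex P (fun w => psi (X w) ^+ 2) <= K.
  rewrite -[leRHS](Ex_cst P); apply: Ex_le => //; exact: L1_cst.
pose rest x := (phi x - trunc k x) - (m - m').
have mrest : vborel rest.
  by apply: vborelB; [apply: vborelB => //; exact: mt|exact: vborel_cst].
have L1pt : L1 P (fun w => phi (X w) - trunc k (X w)) by exact: L1B.
have L1rest : L1 P (fun w => rest (X w)) by apply: L1B => //; exact: L1_cst.
have Erest : Ex P (fun w => `|rest (X w)|) <= 2 * t.
  apply: (@le_trans _ _ (Ex P (fun w => `|phi (X w) - trunc k (X w)| + `|m - m'|))).
    apply: Ex_le => [||w]; first exact: L1_abs.
      by apply: L1D; [exact: L1_abs|exact: L1_cst].
    exact: ler_normB.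
  rewrite ExD ?Ex_cst; [|exact: L1_abs|exact: L1_cst].
  rewrite mulr2n mulrDl mul1r lerD2l /m /m' -ExB //; exact: Ex_abs.
exists (Num.truncn (4 * (4 * K / e / e))).+1 => N Q hN.
have N0 : 0 < N%:R :> R by rewrite ltr0n; exact: leq_trans hN.
have hN' : 4 * (4 * K / e / e) <= N%:R.
  by rewrite ltW // (lt_le_trans (truncnS_gt _)) // ler_nat.
set A := fun w => N%:R^-1 * \sum_(j < N | Q j) psi (Xs j w).
set B := fun w => N%:R^-1 * \sum_(j < N | Q j) `|rest (Xs j w)|.
have eAB w : `|N%:R^-1 * \sum_(j < N | Q j) (phi (Xs j w) - m)| <= `|A w| + B w.
  rewrite /A /B (_ : \sum_(j < N | Q j) (phi (Xs j w) - m) =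
    \sum_(j < N | Q j) psi (Xs j w) + \sum_(j < N | Q j) rest (Xs j w)); last first.
    rewrite -big_split /=; apply: eq_bigr => j _; rewrite /psi /rest; ring.
  rewrite mulrDr (le_trans (ler_normD _ _)) // lerD2l normrM ger0_norm ?invr_ge0 //.
  by rewrite ler_wpM2l ?invr_ge0 // ler_norm_sum.
have [L1S2 ES2] := sum_sqr_le Q mpsi L1psi Epsi N L2psi.
(* From the square of [e / 2 - |A|]: a first moment is traded for a second one, up to [e / 4]. *)
have hA w : `|A w| <= e / 4 + (N%:R^-2 / e) * (\sum_(j < N | Q j) psi (Xs j w)) ^+ 2.
  have -> : (N%:R^-2 / e) * (\sum_(j < N | Q j) psi (Xs j w)) ^+ 2 = `|A w| ^+ 2 / e.
    by rewrite real_normK ?num_real // /A exprMn exprVn mulrAC.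
  have : 0 <= (e / 2 - `|A w|) ^+ 2 / e by rewrite divr_ge0 ?sqr_ge0 // ltW.
  have -> : (e / 2 - `|A w|) ^+ 2 / e = e / 4 + `|A w| ^+ 2 / e - `|A w|.
    by field; rewrite gt_eqF.
  by rewrite subr_ge0.
have L1B' : L1 P B.
  apply: L1Z; apply: L1_sum => j _.
  have := L1_copy iidX j (phi := fun x => `|rest x|) _ (L1_abs L1rest).
  by apply; apply: measurableT_comp => //; exact: mrest.
have EB : Ex P B <= 2 * t.
  rewrite /B ExZ; last first.
    apply: L1_sum => j _.
    have := L1_copy iidX j (phi := fun x => `|rest x|) _ (L1_abs L1rest).
    by apply; apply: measurableT_comp => //; exact: mrest.
  rewrite Ex_sum; last first.
    move=> j _; have := L1_copy iidX j (phi := fun x => `|rest x|) _ (L1_abs L1rest).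
    by apply; apply: measurableT_comp => //; exact: mrest.
  rewrite (eq_bigr (fun=> Ex P (fun w => `|rest (X w)|))); last first.
    move=> j _; apply: (Ex_copy iidX j (phi := fun x => `|rest x|) _ (L1_abs L1rest)).
    by apply: measurableT_comp => //; exact: mrest.
  rewrite mulrC ler_pdivrMr // big_mkcond /=.
  apply: (@le_trans _ _ (\sum_(j < N) (2 * t))).
    by apply: ler_sum => j _; case: ifP => // _; rewrite mulr_ge0.
  by rewrite sumr_const card_ord mulr_natr.
have L1tot : L1 P (fun w => `|N%:R^-1 * \sum_(j < N | Q j) (phi (Xs j w) - m)|).
  apply: L1_abs; apply: L1Z; apply: L1_sum => j _; apply: L1B; last exact: L1_cst.
  exact: (L1_copy iidX).
split; first exact: L1tot.
have L1A' : L1 P (fun w => e / 4 + (N%:R^-2 / e) * (\sum_(j < N | Q j) psi (Xs j w)) ^+ 2).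
  by apply: L1D; [exact: L1_cst|exact: L1Z].
apply: (@le_trans _ _ (Ex P (fun w => (e / 4 + (N%:R^-2 / e) * (\sum_(j < N | Q j) psi (Xs j w)) ^+ 2) + B w))).
  apply: Ex_le => // [|w]; first exact: L1D.
  by rewrite (le_trans (eAB w)) // lerD2r.
rewrite (ExD L1A' L1B') (ExD (L1_cst P (e / 4)) (L1Z _ L1S2)) Ex_cst (ExZ _ L1S2).
have h1 : N%:R^-2 / e * Ex P (fun w => (\sum_(j < N | Q j) psi (Xs j w)) ^+ 2) <= e / 4.
  apply: (@le_trans _ _ (N%:R^-2 / e * (N%:R * K))).
    apply: ler_wpM2l; first by rewrite divr_ge0 ?invr_ge0 ?exprn_ge0 // ltW.
    by rewrite (le_trans ES2) // ler_wpM2l.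
  have -> : N%:R^-2 / e * (N%:R * K) = (K / e) / N%:R.
    by field; rewrite !gt_eqF.
  rewrite ler_pdivrMr // -ler_pdivrMl //; apply: le_trans hN'.
  have -> : (e / 4)^-1 * (K / e) = 4 * K / e / e by field; rewrite gt_eqF.
  by rewrite ler_peMl ?ler1n // !divr_ge0 ?mulr_ge0 // ltW.
lra.
Unshelve. all: by end_near. Qed.

End iid_sums.

(** * Lebesgue measure on tuples and densities *)

Section lebesgue_tuple.
Context {R : realType}.
Local Open Scope ereal_scope.

Let mu1 : {sigma_finite_measure set (measurableTypeR R) -> \bar R} := @lebesgue_measure R.

Lemma lebesgue_measure_shift (h : R) (A : set R) : measurable A ->
  pushforward mu1 ((fun x => x + h)%R : _ -> measurableTypeR R) A = mu1 A.
Proof.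
move=> mA.
have mh : measurable_fun [set: R] (fun x => x + h)%R.
  by apply: measurable_funD; [exact: measurable_id|exact: measurable_cst].
pose sh : {mfun measurableTypeR R >-> measurableTypeR R} :=
  HB.pack (fun x : R => x + h)%R (isMeasurableFun.Build _ _ (measurableTypeR R) (measurableTypeR R) (fun x : R => x + h)%R mh).
rewrite -[LHS]/(pushforward mu1 sh A).
symmetry; apply: lebesgue_measure_unique => // _ [[a b]] _ <-.
rewrite /pushforward /=.
transitivity (mu1 `](a - h)%R, (b - h)%R]%classic).
  rewrite /mu1 lebesgue_measure_itv [RHS]lebesgue_measure_itv /= !lte_fin ltrD2r.
  by case: ifP => // _; rewrite -!EFinD opprB addrA subrK.
rewrite /pushforward /=; congr lebesgue_measure.
by apply/seteqP; split => x /=; rewrite !in_itv /= ltrBlDr lerBrDr.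
Qed.

Lemma integral_shift (h : R) (g : R -> \bar R) : measurable_fun [set: R] g ->
  (forall x, 0 <= g x) ->
  \int[mu1]_x g (x + h)%R = \int[mu1]_x g x.
Proof.
move=> mg g0.
have mh : measurable_fun [set: R] (fun x => x + h)%R.
  by apply: measurable_funD; [exact: measurable_id|exact: measurable_cst].
transitivity (\int[pushforward mu1 ((fun x => x + h)%R : _ -> measurableTypeR R)]_x g x).
  by rewrite ge0_integral_pushforward // preimage_setT.
by apply: eq_measure_integral => A mA _; exact: lebesgue_measure_shift.
Qed.

Definition tcons m (z : R * m.-tuple R) : m.+1.-tuple R := [tuple of z.1 :: z.2].

Lemma measurable_tcons m : measurable_fun [set: R * m.-tuple R] (@tcons m).
Proof. by apply: measurable_cons. Qed.

Definition tuncons m (t : m.+1.-tuple R) : R * m.-tuple R := (thead t, [tuple of behead t]).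

Lemma measurable_tuncons m : measurable_fun [set: m.+1.-tuple R] (@tuncons m).
Proof.
apply: measurable_fun_pair; last exact: measurable_behead.
exact: measurable_tnth.
Qed.

Lemma tconsK m : cancel (@tcons m) (@tuncons m).
Proof.
by move=> [x y]; rewrite /tcons /tuncons /= theadE; congr (_, _); apply/val_inj.
Qed.

Section cons_measure.
Variables (m : nat) (mu : {sigma_finite_measure set (m.-tuple R) -> \bar R}).

Definition cons_measure : set (m.+1.-tuple R) -> \bar R :=
  pushforward (mu1 \x mu) (@tcons m).

HB.instance Definition _ := Measure.copy cons_measure
  (measure_function_pushforward__canonical__measure_function_Measure
    (mu1 \x mu) (@measurable_tcons m)).

Let cons_measure_sigma_finite : sigma_finite [set: m.+1.-tuple R] cons_measure.
Proof.
have /sigma_finiteP[F [FT ndF Foo]] := sigma_finiteT mu1.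
have /sigma_finiteP[G [GT ndG Goo]] := sigma_finiteT mu.
exists (fun k => @tuncons m @^-1` (F k `*` G k)).
  apply/seteqP; split => // t _.
  have [i _ Fi] : (\bigcup_i F i) (tuncons t).1 by rewrite -FT.
  have [j _ Gj] : (\bigcup_j G j) (tuncons t).2 by rewrite -GT.
  exists (maxn i j) => //; split => /=.
    by move: Fi; exact/subsetPset/ndF/leq_maxl.
  by move: Gj; exact/subsetPset/ndG/leq_maxr.
move=> k; have [mF Fk] := Foo k; have [mG Gk] := Goo k; split.
  by rewrite -[X in measurable X]setTI; apply: measurable_tuncons => //; exact: measurableX.
rewrite /cons_measure /pushforward /=.
have -> : @tcons m @^-1` (@tuncons m @^-1` (F k `*` G k)) = F k `*` G k.
  by apply/seteqP; split => z; rewrite /preimage /mkset tconsK.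
by rewrite product_measure1E // lte_mul_pinfty // ge0_fin_numE.
Qed.

HB.instance Definition _ := Measure_isSigmaFinite.Build _ _ _ cons_measure
  cons_measure_sigma_finite.

End cons_measure.

(** The iterated integral is an integral against a genuine sigma-finite measure, built by pushing
    product measures forward along [tcons]. This opens dominated convergence and Radon-Nikodym
    derivatives to it. *)
Lemma iint_tuple_measure m : exists mu : {sigma_finite_measure set (m.-tuple R) -> \bar R},
  forall g, measurable_fun [set: m.-tuple R] g -> (forall t, 0 <= g t) ->
    iint_tuple g = \int[mu]_t g t.
Proof.
elim: m => [|m [mu IH]].
  exists (dirac [tuple] : {sigma_finite_measure set (0.-tuple R) -> \bar R}) => g mg g0 /=.
  by rewrite integral_dirac // diracT mul1e.
have mT := @measurable_tcons m.
exists (cons_measure mu) => g mg g0 /=.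
have -> : \int[cons_measure mu]_t g t = \int[mu1 \x mu]_z (g \o @tcons m) z.
  by rewrite /cons_measure ge0_integral_pushforward // preimage_setT.
have mgC : measurable_fun [set: R * m.-tuple R] (g \o @tcons m) by exact: measurableT_comp.
rewrite fubini_tonelli1 //; last by move=> x; exact: g0.
apply: eq_integral => x _; rewrite IH //.
exact: (measurable_fun_pair2 _ mgC).
Qed.

Definition lebesgue_tuple m : {sigma_finite_measure set (m.-tuple R) -> \bar R} :=
  projT1 (cid (iint_tuple_measure m)).

Lemma iint_tupleE m (g : m.-tuple R -> \bar R) :
  measurable_fun [set: m.-tuple R] g -> (forall t, 0 <= g t) ->
  iint_tuple g = \int[lebesgue_tuple m]_t g t.
Proof. exact: projT2 (cid (iint_tuple_measure m)) g. Qed.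

Lemma measurable_iint_cons m (g : m.+1.-tuple R -> \bar R) :
  measurable_fun [set: m.+1.-tuple R] g -> (forall t, 0 <= g t) ->
  measurable_fun [set: R] (fun x => iint_tuple (fun y => g [tuple of x :: y])).
Proof.
move=> mg g0.
have mgC : measurable_fun [set: R * m.-tuple R] (g \o @tcons m).
  exact: measurableT_comp (@measurable_tcons m).
have := @measurable_fun_fubini_tonelli_F _ _ _ _ _ (lebesgue_tuple m) _ mgC (fun x => g0 _).
rewrite /fubini_F; congr measurable_fun; apply/funext => x; rewrite iint_tupleE //.
exact: (measurable_fun_pair2 _ mgC).
Qed.

Definition tadd m (t h : m.-tuple R) : m.-tuple R := [tuple (tnth t i + tnth h i)%R | i < m].

Lemma measurable_tadd m (h : m.-tuple R) : measurable_fun [set: m.-tuple R] (@tadd m ^~ h).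
Proof.
apply/measurable_fun_tnthP => i.
have -> : @tnth m R ^~ i \o @tadd m ^~ h = (fun t => (tnth t i + tnth h i)%R).
  by apply/funext => t /=; rewrite tnth_mktuple.
by apply: measurable_funD => //; exact: measurable_tnth.
Qed.

Lemma iint_tuple_shift m (g : m.-tuple R -> \bar R) h :
  measurable_fun [set: m.-tuple R] g -> (forall t, 0 <= g t) ->
  iint_tuple (fun t => g (tadd t h)) = iint_tuple g.
Proof.
elim: m g h => [|m IH] g h mg g0 /=; first by congr g; exact: tuple0.
pose G x := iint_tuple (fun y => g [tuple of x :: y]).
have mG : measurable_fun [set: R] G by exact: measurable_iint_cons.
have mgx x : measurable_fun [set: m.-tuple R] (fun y => g [tuple of x :: y]).
  apply: (measurableT_comp mg); exact: measurable_cons.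
have -> : (fun x => iint_tuple (fun y => g (tadd [tuple of x :: y] h))) =
    (fun x => G (x + thead h)%R).
  apply/funext => x; rewrite /G -[RHS](IH _ [tuple of behead h]) //; congr iint_tuple.
  apply/funext => y; congr g; apply: eq_from_tnth => i; rewrite tnth_mktuple.
  case: (unliftP ord0 i) => [j ->|->].
    by rewrite !tnthS [tnth h _](_ : _ = tnth [tuple of behead h] j) ?tnth_mktuple // [in LHS](tuple_eta h) tnthS.
  by rewrite !tnth0.
apply: integral_shift => // x; rewrite /G iint_tupleE //; exact: integral_ge0.
Qed.

Lemma integral_tuple_shift m (g : m.-tuple R -> \bar R) h :
  measurable_fun [set: m.-tuple R] g -> (forall t, 0 <= g t) ->
  \int[lebesgue_tuple m]_t g (tadd t h) = \int[lebesgue_tuple m]_t g t.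
Proof.
move=> mg g0; rewrite -!iint_tupleE ?iint_tuple_shift //.
exact: measurableT_comp (measurable_tadd h).
Qed.

(* Cubes are half-open so that their one-dimensional factors have a convenient length. *)
Definition tcube m (c : m.-tuple R) (e : R) : set (m.-tuple R) :=
  [set t | forall i, (tnth c i - e < tnth t i <= tnth c i + e)%R].

Lemma measurable_tcube m (c : m.-tuple R) e : measurable (tcube c e).
Proof.
have -> : tcube c e = \bigcap_(i in [set: 'I_m])
    ((@tnth m R ^~ i) @^-1` `](tnth c i - e)%R, (tnth c i + e)%R]%classic).
  apply/seteqP; split => [t h i _ /=|t h i]; first by rewrite in_itv /= h.
  by have := h i I; rewrite /= in_itv.
apply: fin_bigcap_measurable => // i _.
by rewrite -[X in measurable X]setTI; apply: measurable_tnth.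
Qed.

Lemma lebesgue_tcube m (c : m.-tuple R) e : (0 <= e)%R ->
  lebesgue_tuple m (tcube c e) = ((2 * e) ^+ m)%:E.
Proof.
move=> e0; have mc := measurable_tcube c e.
transitivity (\int[lebesgue_tuple m]_t (\1_(tcube c e) t)%:E).
  by rewrite integral_indic // setIT.
rewrite -iint_tupleE //; last by apply/measurable_EFinP; exact: measurable_indic.
clear mc; elim: m c => [|m IH] c /=.
  by rewrite expr0 indicE mem_set // => -[].
have e1 : forall x, iint_tuple (fun y : m.-tuple R => (\1_(tcube c e) [tuple of x :: y])%:E) =
    ((2 * e) ^+ m)%:E * (\1_`](thead c - e)%R, (thead c + e)%R]%classic x)%:E.
  move=> x; have [xc|xc] := boolP (x \in `](thead c - e)%R, (thead c + e)%R]%classic).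
    rewrite [X in _ * X%:E]indicE xc mule1 -(IH [tuple of behead c]).
    congr iint_tuple; apply/funext => y; congr EFin; rewrite !indicE; congr (nat_of_bool _)%:R.
    apply/idP/idP; rewrite !inE => h.
      by move=> i; have := h (lift ord0 i); rewrite tnthS [tnth c _](_ : _ = tnth [tuple of behead c] i) // [in LHS](tuple_eta c) tnthS.
    move=> i; case: (unliftP ord0 i) => [j ->|->].
      by rewrite tnthS {1 2}(tuple_eta c) !tnthS; exact: h.
    by move: xc; rewrite inE /= in_itv /= tnth0 {3 4}(tuple_eta c) !tnth0.
  rewrite [X in _ * X%:E]indicE (negbTE xc) mule0.
  have -> : (fun y : m.-tuple R => (\1_(tcube c e) [tuple of x :: y] : R)%:E) = (fun y => 0).
    apply/funext => y; rewrite indicE; case: (boolP (_ \in _)) => // /set_mem h.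
    case/negP: xc; rewrite inE /= in_itv /=.
    by have := h ord0; rewrite tnth0 {1 2}(tuple_eta c) !tnth0.
  by rewrite iint_tupleE // integral0.
under eq_integral do rewrite e1.
rewrite ge0_integralZl_EFin //; last 2 first.
- by apply/measurable_EFinP; exact: measurable_indic.
- by rewrite exprn_ge0 // mulr_ge0.
rewrite integral_indic // setIT /= lebesgue_measure_itv /= lte_fin.
case: ifPn => [_|].
  by rewrite -EFinB -EFinM; congr EFin; rewrite exprS; ring.
rewrite -leNgt => h; have -> : e = 0%R by lra.
by rewrite mule0 mulr0 exprS mul0r.
Qed.

End lebesgue_tuple.

(** * Change of variables, from nonnegative to integrable functions *)

Section transfer.
Context {R : realType} {n : nat} {d1 d2 : measure_display}
  {T1 : measurableType d1} {T2 : measurableType d2}.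
Variables (mu1 : {measure set T1 -> \bar R}) (mu2 : {measure set T2 -> \bar R}).
Variables (a : T1 -> 'cV[R]_n) (b : T2 -> 'cV[R]_n) (u : T1 -> R) (v : T2 -> R).
Hypotheses (u0 : forall x, 0 <= u x) (v0 : forall y, 0 <= v y).
Hypothesis transfer_ge0 : forall phi, vborel phi -> (forall x, 0 <= phi x) ->
  (\int[mu1]_x (phi (a x) * u x)%:E = \int[mu2]_y (phi (b y) * v y)%:E)%E.
Hypothesis measurable_v : forall phi, vborel phi -> measurable_fun [set: T2] (fun y => phi (b y) * v y).
Hypothesis measurable_u : forall phi, vborel phi -> measurable_fun [set: T1] (fun y => phi (a y) * u y).

(** Applied to the density formula, in both directions, and to translations of Lebesgue measure; the
    weights [u] and [v] allow a density on either side. *)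
Lemma L1_transfer phi : vborel phi -> L1 mu1 (fun x => phi (a x) * u x) ->
  L1 mu2 (fun y => phi (b y) * v y).
Proof.
move=> mphi /integrableP [_ h]; apply/integrableP; split.
  by apply/measurable_EFinP; exact: measurable_v.
apply: le_lt_trans h; rewrite le_eqVlt; apply/orP; left; apply/eqP.
have mabs : vborel (fun x => `|phi x|) by apply: measurableT_comp => //; exact: mphi.
have := transfer_ge0 mabs (fun x => normr_ge0 _) => e.
transitivity (\int[mu2]_y (`|phi (b y)| * v y)%:E)%E.
  by apply: eq_integral => y _ /=; rewrite normrM (ger0_norm (v0 _)).
by rewrite -e; apply: eq_integral => y _ /=; rewrite normrM (ger0_norm (u0 _)).
Qed.

Lemma Ex_transfer phi : vborel phi -> L1 mu1 (fun x => phi (a x) * u x) ->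
  Ex mu1 (fun x => phi (a x) * u x) = Ex mu2 (fun y => phi (b y) * v y).
Proof.
move=> mphi L1a; have L1b := L1_transfer mphi L1a.
(* [ph 1] and [ph (-1)] are the positive and the negative part of [phi]. *)
pose ph s x := Num.max (s * phi x) 0.
have mph s : vborel (ph s).
  apply: measurable_maxr; last exact: measurable_cst.
  by apply: measurable_funM; [exact: measurable_cst|exact: mphi].
have ph0 s x : 0 <= ph s x by rewrite /ph le_max lexx orbT.
have phle s x : `|s| = 1 -> `|ph s x| <= `|phi x|.
  move=> s1; rewrite ger0_norm // /ph ge_max normr_ge0 andbT (le_trans (ler_norm _)) //.
  by rewrite normrM s1 mul1r.
have phE x : phi x = ph 1 x - ph (-1) x.
  rewrite /ph mul1r mulN1r; have [h|h] := boolP (0 <= phi x).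
    have -> : Num.max (phi x) 0 = phi x by apply/max_idPl.
    have -> : Num.max (- phi x) 0 = 0 by apply/max_idPr; rewrite oppr_le0.
    by rewrite subr0.
  have {}h : phi x <= 0 by rewrite ltW // ltNge.
  have -> : Num.max (phi x) 0 = 0 by apply/max_idPr.
  have -> : Num.max (- phi x) 0 = - phi x by apply/max_idPl; rewrite oppr_ge0.
  by rewrite sub0r opprK.
have La s : `|s| = 1 -> L1 mu1 (fun x => ph s (a x) * u x).
  move=> s1; apply: (L1_dom (@measurable_u _ (@mph s)) (L1_abs L1a)) => x.
  by rewrite !normrM ler_wpM2r // phle.
have Lb s : `|s| = 1 -> L1 mu2 (fun x => ph s (b x) * v x).
  move=> s1; apply: (L1_dom (@measurable_v _ (@mph s)) (L1_abs L1b)) => x.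
  by rewrite !normrM ler_wpM2r // phle.
have e s : Ex mu1 (fun x => ph s (a x) * u x) = Ex mu2 (fun x => ph s (b x) * v x).
  by congr fine; exact: transfer_ge0 (@mph s) (ph0 s).
have n1 : `|1| = 1 :> R by rewrite normr1.
have nN1 : `|-1| = 1 :> R by rewrite normrN1.
have -> : (fun x => phi (a x) * u x) = (fun x => ph 1 (a x) * u x - ph (-1) (a x) * u x).
  by apply/funext => x; rewrite [in LHS]phE mulrBl.
have -> : (fun x => phi (b x) * v x) = (fun x => ph 1 (b x) * v x - ph (-1) (b x) * v x).
  by apply/funext => x; rewrite [in LHS]phE mulrBl.
rewrite (ExB (La 1 n1) (La (-1) nN1)) (ExB (Lb 1 n1) (Lb (-1) nN1)).
by congr (_ - _); exact: e.
Qed.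

End transfer.

Section density.
Context {R : realType} {n : nat} {d : measure_display} {T : measurableType d}.
Variables (P : probability T R) (X : T -> 'cV[R]_n) (p : 'cV[R]_n -> R).
Hypothesis dX : has_density P X p.

Let rvX : random_vector X. Proof. by case: dX. Qed.
Let p0 x : 0 <= p x. Proof. by case: dX => _ []. Qed.
Let mp : vborel p. Proof. by case: dX => _ [_ []]. Qed.
Let lam := @lebesgue_tuple R n.
Let pt (t : n.-tuple R) := (p (col_of_tuple t))%:E.
Let mpt : measurable_fun [set: n.-tuple R] pt. Proof. exact/measurable_EFinP. Qed.
Let Xt w := tuple_of_col (X w).
Let Xm : {mfun T >-> n.-tuple R} := HB.pack Xt (isMeasurableFun.Build _ _ _ _ Xt rvX).
Let D := distribution P Xm.

Lemma col_of_tupleK : cancel (@col_of_tuple R n) (@tuple_of_col R n).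
Proof. by move=> t; apply: eq_from_tnth => i; rewrite tnth_mktuple mxE. Qed.

Let law A : measurable A -> D A = (\int[lam]_(t in A) pt t)%E.
Proof.
move=> mA; have [_ [_ [_ h]]] := dX.
have e : @col_of_tuple R n @^-1` (tuple_of_col @^-1` A) = A.
  by apply/seteqP; split => t; rewrite /preimage /mkset col_of_tupleK.
have hA := h (tuple_of_col @^-1` A); rewrite /vmeasurable e in hA.
rewrite [LHS](hA mA) /lebesgue_int.
have -> : (fun t : n.-tuple R => (\1_(tuple_of_col @^-1` A) (col_of_tuple t) * p (col_of_tuple t))%:E)
   = (fun t => ((\1_A t)%:E * pt t)%E).
  apply/funext => t; rewrite EFinM; congr (_%:E * _)%E; rewrite !indicE; congr (nat_of_bool _)%:R.
  by apply/idP/idP; rewrite !inE /preimage /mkset col_of_tupleK.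
rewrite iint_tupleE; last 2 first.
- by apply: emeasurable_funM => //; apply/measurable_EFinP; exact: measurable_indic.
- by move=> t; rewrite mule_ge0 // lee_fin.
rewrite [RHS]integral_mkcond; apply: eq_integral => t _.
by rewrite muleC epatch_indic.
Qed.

(** The law of [X] and the measure with density [p] agree on measurable sets, so [p] is almost
    everywhere the Radon-Nikodym derivative of the law, and the change of variables for the latter
    applies. *)
Lemma density_integral (g : n.-tuple R -> \bar R) :
  measurable_fun [set: n.-tuple R] g -> (forall t, 0 <= g t)%E ->
  (\int[P]_w g (tuple_of_col (X w)) = \int[lam]_t (g t * pt t))%E.
Proof.
move=> mg g0.
have dom : D `<< lam.
  apply/null_content_dominatesP => A mA A0; rewrite law //.
  by apply: null_set_integral => //; exact: measurable_funTS.
transitivity (\int[D]_t g t)%E; first by rewrite ge0_integral_distribution.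
rewrite -(Radon_Nikodym_SigmaFinite.change_of_variables dom g0 measurableT mg).
apply: ae_eq_integral => //.
- apply: emeasurable_funM => //.
  exact: measurable_int (Radon_Nikodym_SigmaFinite.f_integrable dom).
- exact: emeasurable_funM.
have : ae_eq lam setT (Radon_Nikodym_SigmaFinite.f D lam) pt.
  apply: integral_ae_eq => //.
  - exact: Radon_Nikodym_SigmaFinite.f_integrable.
  - move=> A _ mA; rewrite -(law mA); symmetry; exact: (Radon_Nikodym_SigmaFinite.f_integral dom mA).
by apply: filterS => t e _; rewrite e.
Qed.

Let one_ge0 (w : T) : 0 <= (fun=> 1 : R) w. Proof. exact: ler01. Qed.
Let pc0 (t : n.-tuple R) : 0 <= p (col_of_tuple t). Proof. exact: p0. Qed.

Let transfer1 phi : vborel phi -> (forall x, 0 <= phi x) ->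
  (\int[P]_w (phi (X w) * 1)%:E = \int[lam]_t (phi (col_of_tuple t) * p (col_of_tuple t))%:E)%E.
Proof.
move=> mphi phi0.
have mg : measurable_fun [set: n.-tuple R] (fun t => (phi (col_of_tuple t))%:E) by exact/measurable_EFinP.
rewrite -(density_integral mg); last by move=> t; rewrite lee_fin.
by apply: eq_integral => w _; rewrite mulr1 tuple_of_colK.
Qed.

Let mv phi : vborel phi -> measurable_fun [set: n.-tuple R] (fun t => phi (col_of_tuple t) * p (col_of_tuple t)).
Proof. by move=> mphi; exact: measurable_funM. Qed.

Let mu phi : vborel phi -> measurable_fun [set: T] (fun w => phi (X w) * (fun=> 1 : R) w).
Proof. by move=> mphi; under eq_fun do rewrite mulr1; exact: (vborel_comp mphi rvX). Qed.

Lemma density_L1 phi : vborel phi -> L1 P (fun w => phi (X w)) ->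
  L1 lam (fun t => phi (col_of_tuple t) * p (col_of_tuple t)).
Proof.
move=> mphi h; apply: (L1_transfer one_ge0 pc0 transfer1 mv mphi).
by under eq_fun do rewrite mulr1.
Qed.

Lemma density_L1_inv phi : vborel phi ->
  L1 lam (fun t => phi (col_of_tuple t) * p (col_of_tuple t)) -> L1 P (fun w => phi (X w)).
Proof.
move=> mphi h; have -> : (fun w => phi (X w)) = (fun w => phi (X w) * 1).
  by apply/funext => w; rewrite mulr1.
apply: (L1_transfer pc0 one_ge0 (fun f mf f0 => esym (transfer1 mf f0)) mu mphi) => //.
Qed.

Lemma density_Ex phi : vborel phi -> L1 P (fun w => phi (X w)) ->
  Ex P (fun w => phi (X w)) = Ex lam (fun t => phi (col_of_tuple t) * p (col_of_tuple t)).
Proof.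
move=> mphi h; rewrite -(Ex_transfer one_ge0 pc0 transfer1 mv mu mphi).
  by congr (Ex P); apply/funext => w; rewrite mulr1.
by under eq_fun do rewrite mulr1.
Qed.

End density.

Section lebesgue_shift.
Context {R : realType} {n : nat}.
Notation lam := (@lebesgue_tuple R n).
Variable h : 'cV[R]_n.

Let one_ge0 (t : n.-tuple R) : 0 <= (fun=> 1 : R) t. Proof. exact: ler01. Qed.

Let col_tadd (t : n.-tuple R) : col_of_tuple (tadd t (tuple_of_col h)) = col_of_tuple t + h.
Proof. by apply/matrixP => i j; rewrite ord1 !mxE !tnth_mktuple. Qed.

Lemma vborel_shift (phi : 'cV[R]_n -> R) : vborel phi -> vborel (fun x => phi (x + h)).
Proof.
move=> mphi; rewrite /vborel.
have -> : (fun t => phi (col_of_tuple t + h)) =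
    (fun t => phi (col_of_tuple t)) \o (fun t => tadd t (tuple_of_col h)).
  by apply/funext => t /=; rewrite col_tadd.
exact: measurableT_comp (measurable_tadd _).
Qed.

Let transfer2 phi : vborel phi -> (forall x, 0 <= phi x) ->
  (\int[lam]_t (phi (col_of_tuple t) * 1)%:E = \int[lam]_t (phi (col_of_tuple t + h) * 1)%:E)%E.
Proof.
move=> mphi phi0.
have mg : measurable_fun [set: n.-tuple R] (fun t => (phi (col_of_tuple t) * 1)%:E).
  by under eq_fun do rewrite mulr1; exact/measurable_EFinP.
rewrite -(integral_tuple_shift (tuple_of_col h) mg); last by move=> t; rewrite mulr1 lee_fin.
by apply: eq_integral => t _; rewrite col_tadd.
Qed.

Let mv phi : vborel phi -> measurable_fun [set: n.-tuple R] (fun t => phi (col_of_tuple t) * (fun=> 1 : R) t).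
Proof. by move=> mphi; under eq_fun do rewrite mulr1. Qed.
Let mv' phi : vborel phi -> measurable_fun [set: n.-tuple R] (fun t => phi (col_of_tuple t + h) * (fun=> 1 : R) t).
Proof. by move=> mphi; under eq_fun do rewrite mulr1; exact: vborel_shift. Qed.

Lemma L1_shift phi : vborel phi -> L1 lam (fun t => phi (col_of_tuple t)) ->
  L1 lam (fun t => phi (col_of_tuple t + h)).
Proof.
move=> mphi L.
have := L1_transfer one_ge0 one_ge0 transfer2 mv' mphi.
have e (f : n.-tuple R -> R) : (fun t => f t * 1) = f by apply/funext => t; rewrite mulr1.
by rewrite !e => /(_ L).
Qed.

Lemma Ex_shift phi : vborel phi -> L1 lam (fun t => phi (col_of_tuple t)) ->
  Ex lam (fun t => phi (col_of_tuple t + h)) = Ex lam (fun t => phi (col_of_tuple t)).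
Proof.
move=> mphi L.
have := Ex_transfer one_ge0 one_ge0 transfer2 mv' mv mphi.
have e (f : n.-tuple R -> R) : (fun t => f t * 1) = f by apply/funext => t; rewrite mulr1.
by rewrite !e => /(_ L).
Qed.

End lebesgue_shift.

(** * Gaussian vectors *)

Section step.
Context {R : realType}.

(** Increments along a fixed sequence turn derivatives into limits of sequences, the form in which
    dominated convergence is available. *)
Definition stepR (k : nat) : R := k.+1%:R^-1.
Lemma stepR_gt0 k : 0 < stepR k. Proof. by rewrite invr_gt0. Qed.
Lemma stepR_le1 k : stepR k <= 1. Proof. by rewrite invf_le1 // ler1n. Qed.
Lemma stepR_cvg : stepR k @[k --> \oo] --> (0 : R). Proof. exact: cvg_harmonic. Qed.


Lemma derivable_step (V : normedModType R) (f : V -> R) x v : derivable f x v ->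
  (stepR m)^-1 * (f (x + stepR m *: v) - f x) @[m --> \oo] --> 'D_v f x.
Proof.
move=> df; have h1 : h^-1 *: (f (h *: v + x) - f x) @[h --> (0:R)^'] --> 'D_v f x by exact: df.
have h2 : stepR m @[m --> \oo] --> (0 : R)^'.
  move=> A [e e0 hA]; have := stepR_cvg => /cvgrPdist_lt /(_ e e0) [N _ hN]; exists N => // m Nm.
  by apply: hA; [exact: hN|rewrite gt_eqF // stepR_gt0].
have := cvg_comp _ _ h2 h1; rewrite /comp.
by under eq_fun do rewrite [_ *: v + x]addrC.
Qed.

End step.

Section gaussian.
Context {R : realType} {n : nat} {d : measure_display} {T : measurableType d}.
Variables (P : probability T R) (X : T -> 'cV[R]_n) (mu : 'cV[R]_n) (Sigma : 'M[R]_n).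
Hypothesis pSigma : posdef Sigma.
Hypothesis dX : has_density P X (gauss_pdf mu Sigma).
Implicit Types (x h : 'cV[R]_n) (f g : 'cV[R]_n -> R).

Let G := invmx Sigma.
Let sG : G^T = G. Proof. by rewrite /G trmx_inv pSigma.1. Qed.
Let rvX : random_vector X. Proof. by case: dX. Qed.
Notation lam := (@lebesgue_tuple R n).
Let p := gauss_pdf mu Sigma.
Let mp : vborel p. Proof. by case: dX => _ [_ []]. Qed.

(* Density ratio of the translate by h (Cameron-Martin). *)
Definition tilt h x : R := expR (bform G h (x - mu) - 2^-1 * qform G h).

Lemma gauss_pdf_shift h x : gauss_pdf mu Sigma (x - h) = tilt h x * gauss_pdf mu Sigma x.
Proof.
rewrite /gauss_pdf /tilt mulrCA -expRD; congr (_ * expR _).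
rewrite -!/(bform _ _ _) -!/(qform _ _) -/G.
have -> : x - h - mu = (x - mu) + (-1) *: h by rewrite scaleN1r addrAC.
by rewrite qformD // qformZ bformZr (bform_sym _ _ sG); field.
Qed.

Lemma vborelM f g : vborel f -> vborel g -> vborel (fun x => f x * g x).
Proof. by move=> hf hg; exact: measurable_funM. Qed.
Lemma vborelD f g : vborel f -> vborel g -> vborel (fun x => f x + g x).
Proof. by move=> hf hg; exact: measurable_funD. Qed.

Lemma vborel_bform h : vborel (fun x => bform G h (x - mu)).
Proof.
have -> : (fun x => bform G h (x - mu)) = (fun x => \sum_i (h^T *m G) 0 i * (x i 0 - mu i 0)).
  by apply/funext => x; rewrite /bform mxE; apply: eq_bigr => i _; rewrite !mxE.
apply: measurable_sumr => i _; apply: measurable_funM; first exact: measurable_cst.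
by apply: measurable_funB; [exact: mmeas_col_of_tuple|exact: measurable_cst].
Qed.

Lemma vborel_tilt h : vborel (tilt h).
Proof.
apply: (measurableT_comp (@measurable_expR R)).
by apply: measurable_funB; [exact: vborel_bform|exact: measurable_cst].
Qed.

(** Translation invariance of Lebesgue measure moves the shift from [g] to the density. *)
Lemma cameron_martin h g : vborel g -> L1 P (fun w => g (X w + h)) ->
  L1 P (fun w => g (X w) * tilt h (X w)) /\
  Ex P (fun w => g (X w + h)) = Ex P (fun w => g (X w) * tilt h (X w)).
Proof.
move=> mg L.
have mgt : vborel (fun x => g x * tilt h x) by apply: vborelM => //; exact: vborel_tilt.
have mgh : vborel (fun x => g (x + h)) by exact: vborel_shift.
have L1a := density_L1 dX mgh L.
have mpsi : vborel (fun x => g (x + h) * p x) by exact: vborelM.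
have e : (fun t : n.-tuple R => g (col_of_tuple t - h + h) * p (col_of_tuple t - h)) =
   (fun t => g (col_of_tuple t) * tilt h (col_of_tuple t) * p (col_of_tuple t)).
  by apply/funext => t; rewrite subrK /p gauss_pdf_shift mulrA.
have L1b := L1_shift (- h) mpsi L1a; rewrite e in L1b.
have L1c := density_L1_inv dX mgt L1b; split => //.
rewrite (density_Ex dX mgh L) (density_Ex dX mgt L1c).
by have := Ex_shift (- h) mpsi L1a; rewrite e.
Qed.

(** Exponential weights form a convenient class of moderate growth: products add the rates, shifts
    cost a constant factor, and every rate is integrable for the Gaussian law. *)
Definition growth (k : R) x : R := expR (k * \sum_i `|x i 0 - mu i 0|).

Definition grows f := exists C k : R, [/\ 0 <= C, 0 <= k & forall x, `|f x| <= C * growth k x].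


Lemma growth_le k l x : k <= l -> growth k x <= growth l x.
Proof. by move=> kl; rewrite ler_expR ler_wpM2r // sumr_ge0. Qed.

Lemma growthD k l x : growth (k + l) x = growth k x * growth l x.
Proof. by rewrite /growth mulrDl expRD. Qed.

Lemma growth_shift k h x : 0 <= k ->
  growth k (x + h) <= expR (k * \sum_i `|h i 0|) * growth k x.
Proof.
move=> k0; rewrite /growth -expRD ler_expR -mulrDr ler_wpM2l // -big_split /=.
apply: ler_sum => i _; rewrite mxE addrAC addrC; exact: ler_normD.
Qed.

Lemma vborel_growth k : vborel (growth k).
Proof.
apply: (measurableT_comp (@measurable_expR R)).
apply: measurable_funM; first exact: measurable_cst.
apply: measurable_sumr => i _; apply: measurableT_comp => //.
by apply: measurable_funB; [exact: mmeas_col_of_tuple|exact: measurable_cst].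
Qed.

(** [cameron_martin] for the constant 1 and the shift [Sigma *m v]: the tilt, known to be
    integrable, is this exponential up to a constant factor. No Gaussian integral has to be
    computed. *)
Lemma L1_linear_exp (v : 'cV[R]_n) : L1 P (fun w => expR ((v^T *m (X w - mu)) 0 0)).
Proof.
have [h _] := @cameron_martin (Sigma *m v) (fun=> 1) (vborel_cst 1) (L1_cst P 1).
have : L1 P (fun w => expR (2^-1 * qform G (Sigma *m v)) * (1 * tilt (Sigma *m v) (X w))) by exact: L1Z.
congr L1; apply/funext => w; rewrite mul1r /tilt -expRD addrC subrK; congr expR.
by rewrite /bform trmx_mul pSigma.1 mulmxK // posdef_unit.
Qed.

Lemma growth_L1 k : 0 <= k -> L1 P (fun w => growth k (X w)).
Proof.
move=> k0.
pose E (s : R) i w := expR (s * n%:R * k * (X w i 0 - mu i 0)).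
have LE s i : L1 P (E s i).
  have := L1_linear_exp ((s * n%:R * k) *: delta_mx i 0); congr L1; apply/funext => w.
  rewrite linearZ /= trmx_delta -scalemxAl -rowE !mxE; congr (expR (_ * _)).
have LS : L1 P (fun w => 1 + \sum_i (E 1 i w + E (-1) i w)).
  by apply: L1D; [exact: L1_cst|apply: L1_sum => i _; exact: L1D].
apply: (L1_dom (vborel_comp (@vborel_growth k) rvX) LS) => w.
rewrite ger0_norm ?expR_ge0 //.
have E0 s i : 0 <= E s i w by exact: expR_ge0.
have habs i : expR (n%:R * k * `|X w i 0 - mu i 0|) <= E 1 i w + E (-1) i w.
  rewrite /E mul1r mulN1r; have [h|h] := leP 0 (X w i 0 - mu i 0).
    by rewrite ger0_norm // lerDl expR_ge0.
  by rewrite ltr0_norm // !mulNr -mulrN lerDr expR_ge0.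
(* Treated apart because it contains dimension zero, where there is no coordinate to select. *)
have [S0|S1] := leP (\sum_i `|X w i 0 - mu i 0|) 0.
  rewrite -[leLHS]addr0; apply: lerD.
    by rewrite -expR0 ler_expR mulr_ge0_le0.
  by apply: sumr_ge0 => i _; rewrite addr_ge0.
(* the largest coordinate is at least the average *)
have [i hi] : exists i, \sum_i `|X w i 0 - mu i 0| <= n%:R * `|X w i 0 - mu i 0|.
  apply: contrapT => /forallNP H; have : \sum_i `|X w i 0 - mu i 0| < \sum_i `|X w i 0 - mu i 0|.
    have n0 : (0 < n)%N.
      by rewrite lt0n; apply: contraTneq S1 => n0; rewrite -leNgt big1 // => -[j jn]; exfalso; rewrite n0 in jn.
    have n0' : 0 < n%:R :> R by rewrite ltr0n.
    rewrite -(ltr_pM2l n0') [ltLHS]mulr_sumr; set S := \sum_i `|X w i 0 - mu i 0| in H *.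
    apply: (@lt_le_trans _ _ (\sum_(i < n) S)); last by rewrite sumr_const card_ord mulr_natl.
    apply: ltr_sum => [|j _]; first by apply/hasP; exists (Ordinal n0) => //; exact: mem_index_enum.
    by rewrite ltNge; apply/negP; exact: H.
  by rewrite ltxx.
apply: (@le_trans _ _ (expR (n%:R * k * `|X w i 0 - mu i 0|))).
  by rewrite ler_expR [n%:R * k]mulrC -mulrA ler_wpM2l.
apply: (le_trans (habs i)); rewrite (bigD1 i) //= [leRHS]addrCA lerDl.
by rewrite addr_ge0 // sumr_ge0 // => j _; rewrite addr_ge0.
Qed.

Lemma grows_L1 g : vborel g -> grows g -> L1 P (fun w => g (X w)).
Proof.
move=> mg [C [k [C0 k0 h]]].
apply: (L1_dom (vborel_comp mg rvX) (L1Z C (growth_L1 k0))) => w; exact: h.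
Qed.

Lemma growsD f g : grows f -> grows g -> grows (fun x => f x + g x).
Proof.
move=> [C [k [C0 k0 hf]]] [D [l [D0 l0 hg]]].
exists (C + D), (k + l); split; rewrite ?addr_ge0 // => x.
rewrite (le_trans (ler_normD _ _)) // mulrDl lerD //.
  by rewrite (le_trans (hf x)) // ler_wpM2l // growth_le // lerDl.
by rewrite (le_trans (hg x)) // ler_wpM2l // growth_le // lerDr.
Qed.

Lemma growsM f g : grows f -> grows g -> grows (fun x => f x * g x).
Proof.
move=> [C [k [C0 k0 hf]]] [D [l [D0 l0 hg]]].
exists (C * D), (k + l); split; rewrite ?addr_ge0 ?mulr_ge0 // => x.
by rewrite normrM growthD mulrACA ler_pM.
Qed.

Lemma grows_bounded f C : (forall x, `|f x| <= C) -> grows f.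
Proof.
move=> h; exists `|C|, 0; split=> // x.
by rewrite /growth mul0r expR0 mulr1 (le_trans (h x)) // ler_norm.
Qed.

Lemma grows_cst c : grows (fun=> c).
Proof. exact: (@grows_bounded _ `|c|). Qed.

Lemma grows_sum (I : Type) (s : seq I) (Q : pred I) (F : I -> 'cV[R]_n -> R) :
  (forall i, Q i -> grows (F i)) -> grows (fun x => \sum_(i <- s | Q i) F i x).
Proof.
move=> h; elim: s => [|i s IH]; first by under eq_fun do rewrite big_nil; exact: grows_cst.
under eq_fun do rewrite big_cons.
by case Qi: (Q i) => //; apply: growsD => //; exact: h.
Qed.

Lemma grows_coord i : grows (fun x => x i 0 - mu i 0).
Proof.
exists 1, 1; split=> // x; rewrite mul1r /growth mul1r.
apply: (@le_trans _ _ (\sum_i `|x i 0 - mu i 0|)).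
  by rewrite (bigD1 i) //= lerDl sumr_ge0.
by apply: le_trans (expR_ge1Dx _); rewrite lerDr.
Qed.

Lemma expRB1_le (s : R) : `|expR s - 1| <= `|s| * expR `|s|.
Proof.
have h1 := expR_ge1Dx s; have h2 := expR_ge1Dx (- s).
have [s0|s0] := leP 0 s.
  rewrite (ger0_norm s0) ger0_norm; last by lra.
  have := ler_wpM2l (expR_ge0 s) h2; rewrite -expRD subrr expR0; lra.
have e1 : 1 <= expR (- s) by lra.
have es : expR s <= 1 by rewrite -expR0 ler_expR ltW.
rewrite (ltr0_norm s0) ler0_norm; last by lra.
have : - s * 1 <= - s * expR (- s) by rewrite ler_wpM2l // oppr_ge0 ltW.
lra.
Qed.

(* g is regular enough in the direction h for the Stein identity to hold, with derivative dg *)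
Definition stein_regular h g (dg : 'cV[R]_n -> R) :=
  [/\ vborel g, grows g,
     (exists C k : R, [/\ 0 <= C, 0 <= k & forall m x, `|g (x + stepR m *: h) - g x| <= stepR m * (C * growth k x)]) &
     forall x, (stepR m)^-1 * (g (x + stepR m *: h) - g x) @[m --> \oo] --> dg x].

Lemma bformZl_tilt h t x : bform G (t *: h) (x - mu) - 2^-1 * qform G (t *: h) =
  t * (bform G h (x - mu) - 2^-1 * t * qform G h).
Proof. by rewrite bformZl qformZ; ring. Qed.

Lemma grows_bform h : grows (fun x => bform G h (x - mu)).
Proof.
have -> : (fun x => bform G h (x - mu)) = (fun x => \sum_i (h^T *m G) 0 i * (x i 0 - mu i 0)).
  by apply/funext => x; rewrite /bform mxE; apply: eq_bigr => i _; rewrite !mxE.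
by apply: grows_sum => i _; apply: growsM; [exact: grows_cst|exact: grows_coord].
Qed.

(** The derivative of [cameron_martin] in the length of the shift. Difference quotients of [g] on
    one side and of the tilt on the other have equal means, and both are dominated by functions of
    exponential growth. *)
Lemma stein h g dg : stein_regular h g dg ->
  L1 P (fun w => dg (X w)) /\ L1 P (fun w => g (X w) * bform G h (X w - mu)) /\
  Ex P (fun w => dg (X w)) = Ex P (fun w => g (X w) * bform G h (X w - mu)).
Proof.
move=> [mg gg [C [k [C0 k0 hC]]] lim].
have L1gb : L1 P (fun w => g (X w) * bform G h (X w - mu)).
  apply: (grows_L1 (g := fun x => g x * bform G h (x - mu))).
    by apply: vborelM => //; exact: vborel_bform.
  by apply: growsM => //; exact: grows_bform.
pose D1 m x := (stepR m)^-1 * (g (x + stepR m *: h) - g x).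
have mD1 m : vborel (D1 m).
  apply: vborelM; first exact: measurable_cst.
  by apply: vborelB => //; exact: vborel_shift.
have D1le m x : `|D1 m x| <= C * growth k x.
  rewrite /D1 normrM ger0_norm ?invr_ge0 ?(ltW (stepR_gt0 m)) //.
  by rewrite mulrC ler_pdivrMr ?stepR_gt0 // mulrC.
have [L1dg c1] := Ex_dominated (fun m => vborel_comp (@mD1 m) rvX) (fun w => lim (X w))
   (L1Z C (growth_L1 k0)) (fun m w => D1le m (X w)).
split => //; split => //.
have [B [l [B0 l0 hB]]] := grows_bform h.
have [A [a [A0 a0 hA]]] := gg.
pose q := `|2^-1 * qform G h|.
pose D2 m x := g x * ((stepR m)^-1 * (tilt (stepR m *: h) x - 1)).
have mD2 m : vborel (D2 m).
  apply: vborelM => //; apply: vborelM; first exact: measurable_cst.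
  by apply: vborelB; [exact: vborel_tilt|exact: measurable_cst].
have L1s m : L1 P (fun w => g (X w + stepR m *: h)).
  apply: (grows_L1 (g := fun x => g (x + stepR m *: h))); first exact: vborel_shift.
  exists (A * expR (a * \sum_i `|(stepR m *: h) i 0|)), a; split => //; first by rewrite mulr_ge0 // expR_ge0.
  move=> x; rewrite (le_trans (hA _)) // -mulrA ler_wpM2l //; exact: growth_shift.
have L1g := grows_L1 mg gg.
have e m : Ex P (fun w => D1 m (X w)) = Ex P (fun w => D2 m (X w)).
  have [L1t et] := cameron_martin mg (L1s m).
  rewrite /D1 /D2 ExZ; last exact: L1B.
  rewrite ExB // et.
  have -> : (fun w => g (X w) * ((stepR m)^-1 * (tilt (stepR m *: h) (X w) - 1))) =
    (fun w => (stepR m)^-1 * (g (X w) * tilt (stepR m *: h) (X w) - g (X w))).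
    by apply/funext => w; ring.
  by rewrite ExZ ?ExB //; exact: L1B.
pose u x := `|bform G h (x - mu)| + q.
have u0 x : 0 <= u x by rewrite /u /q addr_ge0.
have ule m x : `|bform G h (x - mu) - 2^-1 * stepR m * qform G h| <= u x.
  rewrite (le_trans (ler_normB _ _)) // lerD2l mulrAC normrM /q.
  by rewrite (ger0_norm (ltW (stepR_gt0 m))) ler_piMr // stepR_le1.
have [K0 HK] : exists K, 0 <= K /\ forall x, u x <= K * \sum_i `|x i 0 - mu i 0| + q.
  exists (\sum_i `|(h^T *m G) 0 i|); split; first exact: sumr_ge0.
  move=> x; rewrite lerD2r /bform mxE (le_trans (ler_norm_sum _ _ _)) // mulr_sumr.
  apply: ler_sum => i _; rewrite normrM [(x - mu) i 0]mxE [(- mu) i 0]mxE; apply: ler_wpM2r => //.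
  by rewrite (bigD1 i) //= lerDl sumr_ge0.
case: HK => K00 HK.
have eu x : expR (u x) <= expR q * growth K0 x.
  by rewrite /growth -expRD ler_expR addrC HK.
have D2le m x : `|D2 m x| <= (A * growth a x) * ((B * growth l x + q) * (expR q * growth K0 x)).
  rewrite /D2 normrM; apply: ler_pM => //.
  rewrite normrM ger0_norm ?invr_ge0 ?(ltW (stepR_gt0 m)) //.
  rewrite /tilt bformZl_tilt; set s := bform G h (x - mu) - _.
  have hs : `|s| <= u x by exact: ule.
  apply: (@le_trans _ _ (`|s| * expR `|stepR m * s|)).
    rewrite mulrC ler_pdivrMr ?stepR_gt0 // (le_trans (expRB1_le _)) //.
    by rewrite [`|stepR m * s| * _]mulrC normrM (ger0_norm (ltW (stepR_gt0 m))) le_of_eq //; ring.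
  apply: ler_pM => //; rewrite ?expR_ge0 //.
    by rewrite (le_trans hs) // lerD2r.
  apply: le_trans (eu x); rewrite ler_expR normrM (ger0_norm (ltW (stepR_gt0 m))).
  by rewrite (le_trans _ hs) // ler_piMl // stepR_le1.
have gdom : grows (fun x => (A * growth a x) * ((B * growth l x + q) * (expR q * growth K0 x))).
  have gg' j : 0 <= j -> grows (growth j).
    by move=> j0; exists 1, j; split => // x; rewrite mul1r ger0_norm // expR_ge0.
  apply: growsM; first by apply: growsM; [exact: grows_cst|exact: gg'].
  apply: growsM; last by apply: growsM; [exact: grows_cst|exact: gg'].
  by apply: growsD; [apply: growsM; [exact: grows_cst|exact: gg']|exact: grows_cst].
have vdom : vborel (fun x => (A * growth a x) * ((B * growth l x + q) * (expR q * growth K0 x))).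
  apply: vborelM; first by apply: vborelM; [exact: measurable_cst|exact: vborel_growth].
  apply: vborelM; last by apply: vborelM; [exact: measurable_cst|exact: vborel_growth].
  apply: vborelD; last exact: measurable_cst.
  by apply: vborelM; [exact: measurable_cst|exact: vborel_growth].
have lim2 x : D2 m x @[m --> \oo] --> g x * bform G h (x - mu).
  apply: cvgM; first exact: cvg_cst.
  pose F t := expR (t * (bform G h (x - mu) - 2^-1 * t * qform G h)).
  have dF : is_derive (0 : R) 1 F (bform G h (x - mu)).
    rewrite /F; apply: is_derive_eq.
    by rewrite /GRing.scale /= !mul0r expR0; ring.
  have [dF1 dF2] := dF.
  have c := derivable_step dF1; rewrite dF2 in c.
  have -> : (fun m => (stepR m)^-1 * (tilt (stepR m *: h) x - 1)) =
    (fun m => (stepR m)^-1 * (F (0 + stepR m *: 1) - F 0)); last exact: c.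
  by apply/funext => m; rewrite /tilt bformZl_tilt add0r /F mul0r expR0 /GRing.scale /= mulr1.
have [_ c2] := Ex_dominated (fun m => vborel_comp (@mD2 m) rvX) (fun w => lim2 (X w))
   (grows_L1 vdom gdom) (fun m w => D2le m (X w)).
have ee : (fun m => Ex P (fun w => D1 m (X w))) = (fun m => Ex P (fun w => D2 m (X w))) by apply/funext.
rewrite ee in c1; exact: (cvg_unique _ c1 c2).
Qed.

Lemma stein_cst h c : stein_regular h (fun=> c) (fun=> 0).
Proof.
split; [exact: measurable_cst|exact: grows_cst| |].
  by exists 0, 0; split => // m x; rewrite subrr normr0 !mulr_ge0 // ?expR_ge0 // ltW // stepR_gt0.
by move=> x; under eq_fun do rewrite subrr mulr0; exact: cvg_cst.
Qed.

Lemma stein_coord h i : stein_regular h (fun x => x i 0 - mu i 0) (fun=> h i 0).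
Proof.
have e m x : (x + stepR m *: h) i 0 - mu i 0 - (x i 0 - mu i 0) = stepR m * h i 0 by rewrite !mxE; ring.
split; first by apply: vborelB; [exact: vborel_coord|exact: measurable_cst].
- exact: grows_coord.
- exists `|h i 0|, 0; split => // m x; rewrite e normrM (ger0_norm (ltW (stepR_gt0 m))).
  by rewrite ler_pM2l ?stepR_gt0 // /growth mul0r expR0 mulr1.
- move=> x; have -> : (fun m => (stepR m)^-1 * ((x + stepR m *: h) i 0 - mu i 0 - (x i 0 - mu i 0))) = cst (h i 0).
    by apply/funext => m; rewrite e mulKf // gt_eqF // stepR_gt0.
  exact: cvg_cst.
Qed.

Lemma stein_smooth h f : smooth f -> compact (supp f) -> stein_regular h f ('D_h f).
Proof.
move=> sf cf; have [B B0 hB] := smooth_bounded sf cf.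
have [L L0 hL] := smooth_lipschitz sf cf.
split; first exact: (vborel_cont (smooth_cont sf)).
- exact: (grows_bounded hB).
- exists (L * `|h|), 0; split => //; first by rewrite mulr_ge0.
  move=> m x; rewrite (le_trans (hL _ _)) // addrAC subrr add0r normrZ (ger0_norm (ltW (stepR_gt0 m))).
  by rewrite /growth mul0r expR0 mulr1 mulrCA.
- by move=> x; apply: derivable_step; exact: (smooth_C1 sf).1.
Qed.

Lemma stein_mul h g1 d1 g2 d2 : stein_regular h g1 d1 -> stein_regular h g2 d2 ->
  stein_regular h (fun x => g1 x * g2 x) (fun x => d1 x * g2 x + g1 x * d2 x).
Proof.
move=> [m1 [A1 [a1 [A10 a10 G1]]] [C1 [k1 [C10 k10 H1]]] l1] [m2 [A2 [a2 [A20 a20 G2]]] [C2 [k2 [C20 k20 H2]]] l2].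
have e m x : g1 (x + stepR m *: h) * g2 (x + stepR m *: h) - g1 x * g2 x =
   (g1 (x + stepR m *: h) - g1 x) * g2 x + g1 (x + stepR m *: h) * (g2 (x + stepR m *: h) - g2 x) by ring.
pose q := expR (a1 * \sum_i `|h i 0|).
have G1' m x : `|g1 (x + stepR m *: h)| <= A1 * q * growth a1 x.
  rewrite (le_trans (G1 _)) // -mulrA ler_wpM2l // (le_trans (growth_shift _ _ a10)) //.
  rewrite ler_wpM2r ?expR_ge0 // ler_expR ler_wpM2l // ler_sum // => i _.
  by rewrite mxE normrM (ger0_norm (ltW (stepR_gt0 m))) ler_piMl // stepR_le1.
split; first exact: vborelM.
- by apply: growsM; [exists A1, a1|exists A2, a2].
- have q0 : 0 <= q by exact: expR_ge0.
  exists (C1 * A2 + A1 * q * C2), ((k1 + a2) + (a1 + k2)); split; rewrite ?addr_ge0 ?mulr_ge0 //.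
  move=> m x; rewrite e (le_trans (ler_normD _ _)) // [leRHS](_ : _ = stepR m * (C1 * A2 * growth (k1 + a2 + (a1 + k2)) x) + stepR m * (A1 * q * C2 * growth (k1 + a2 + (a1 + k2)) x)); last by ring.
  rewrite lerD // normrM.
    apply: (@le_trans _ _ ((stepR m * (C1 * growth k1 x)) * (A2 * growth a2 x))); first exact: ler_pM.
    rewrite -!mulrA ler_pM2l ?stepR_gt0 // ler_wpM2l // mulrCA ler_wpM2l // -growthD growth_le //.
    by rewrite lerDl addr_ge0.
  apply: (@le_trans _ _ ((A1 * q * growth a1 x) * (stepR m * (C2 * growth k2 x)))); first exact: ler_pM.
  rewrite mulrCA ler_pM2l ?stepR_gt0 // mulrACA -!mulrA !ler_wpM2l //.
  by rewrite -growthD growth_le // lerDr addr_ge0.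
- move=> x; under eq_fun do rewrite e mulrDr mulrA mulrCA.
  have c1 : g1 (x + stepR m *: h) @[m --> \oo] --> g1 x.
    have : stepR m * ((stepR m)^-1 * (g1 (x + stepR m *: h) - g1 x)) @[m --> \oo] --> 0 * d1 x.
      by apply: cvgM; [exact: stepR_cvg|exact: l1].
    rewrite mul0r => c; rewrite -[g1 x]addr0.
    have -> : (fun m => g1 (x + stepR m *: h)) = (fun m => g1 x + stepR m * ((stepR m)^-1 * (g1 (x + stepR m *: h) - g1 x))).
      by apply/funext => m; rewrite mulVKf ?subrKC // gt_eqF // stepR_gt0.
    by apply: cvgD => //; exact: cvg_cst.
  by apply: cvgD; apply: cvgM => //; exact: cvg_cst.
Qed.

End gaussian.

Section stein_closure.
Context {R : realType} {n : nat}.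
Variable mu : 'cV[R]_n.
Implicit Types (h x : 'cV[R]_n) (g dg : 'cV[R]_n -> R).

Lemma stein_add h g1 d1 g2 d2 : stein_regular mu h g1 d1 -> stein_regular mu h g2 d2 ->
  stein_regular mu h (fun x => g1 x + g2 x) (fun x => d1 x + d2 x).
Proof.
move=> [m1 G1 [C1 [k1 [C10 k10 H1]]] l1] [m2 G2 [C2 [k2 [C20 k20 H2]]] l2].
split; [exact: measurable_funD|exact: growsD| |].
  exists (C1 + C2), (k1 + k2); split; rewrite ?addr_ge0 // => m x.
  have -> : g1 (x + stepR m *: h) + g2 (x + stepR m *: h) - (g1 x + g2 x) =
    (g1 (x + stepR m *: h) - g1 x) + (g2 (x + stepR m *: h) - g2 x) by ring.
  rewrite (le_trans (ler_normD _ _)) // mulrDl mulrDr lerD //.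
    rewrite (le_trans (H1 m x)) // ler_pM2l ?stepR_gt0 // ler_wpM2l // growth_le // lerDl //.
  by rewrite (le_trans (H2 m x)) // ler_pM2l ?stepR_gt0 // ler_wpM2l // growth_le // lerDr.
move=> x; have -> : (fun m => (stepR m)^-1 * (g1 (x + stepR m *: h) + g2 (x + stepR m *: h) - (g1 x + g2 x))) =
  (fun m => (stepR m)^-1 * (g1 (x + stepR m *: h) - g1 x) + (stepR m)^-1 * (g2 (x + stepR m *: h) - g2 x)).
  by apply/funext => m; ring.
by apply: cvgD; [exact: l1|exact: l2].
Qed.

Lemma stein_scale h c g dg : stein_regular mu h g dg ->
  stein_regular mu h (fun x => c * g x) (fun x => c * dg x).
Proof.
move=> hg; have := stein_mul (stein_cst mu h c) hg.
by congr stein_regular; apply/funext => x; rewrite mul0r add0r.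
Qed.

Lemma stein_sum h (I : Type) (s : seq I) (G D : I -> 'cV[R]_n -> R) :
  (forall i, stein_regular mu h (G i) (D i)) ->
  stein_regular mu h (fun x => \sum_(i <- s) G i x) (fun x => \sum_(i <- s) D i x).
Proof.
move=> H; elim: s => [|i s IH].
  have := stein_cst mu h 0; congr stein_regular; apply/funext => x; by rewrite big_nil.
have := stein_add (H i) IH; congr stein_regular; apply/funext => x; by rewrite big_cons.
Qed.

Variables (a : 'I_n -> R) (F : 'M[R]_n) (c : R).
Hypothesis sF : F^T = F.

(** For covariance [Sigma] and [c = \sum_i \sum_j F i j * Sigma i j] this is a combination of
    Hermite polynomials of degrees one and two. *)
Definition quad x : R := \sum_i a i * (x i 0 - mu i 0) +
  2^-1 * (\sum_i \sum_j F i j * ((x i 0 - mu i 0) * (x j 0 - mu j 0)) - c).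
Definition dquad h x : R := \sum_i a i * h i 0 +
  \sum_i \sum_j F i j * h i 0 * (x j 0 - mu j 0).

Lemma stein_quad h : stein_regular mu h quad (dquad h).
Proof.
have yy i j := stein_mul (stein_coord mu h i) (stein_coord mu h j).
have s1 := stein_sum (index_enum 'I_n) (fun i => stein_scale (a i) (stein_coord mu h i)).
have s2 := stein_sum (index_enum 'I_n) (fun i => stein_sum (index_enum 'I_n) (fun j => stein_scale (F i j) (yy i j))).
have := stein_add s1 (stein_scale 2^-1 (stein_add s2 (stein_cst mu h (- c)))).
congr stein_regular; apply/funext => x; congr (_ + _); rewrite addr0.
under eq_bigr do under eq_bigr do rewrite mulrDr.
under eq_bigr do rewrite big_split /=; rewrite big_split /= [X in _ + X]exchange_big /=.
have -> : \sum_j \sum_i F i j * ((x i 0 - mu i 0) * h j 0) = \sum_i \sum_j F i j * (h i 0 * (x j 0 - mu j 0)).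
  apply: eq_bigr => i _; apply: eq_bigr => j _.
  by rewrite -[in LHS]sF mxE [_ * h i 0]mulrC.
have dbl (z : R) : 2^-1 * (z + z) = z by field.
rewrite dbl.
by apply: eq_bigr => i _; apply: eq_bigr => j _; rewrite mulrA.
Qed.

Lemma stein_dquad h h' : stein_regular mu h' (dquad h) (fun=> \sum_i \sum_j F i j * h i 0 * h' j 0).
Proof.
have s2 := stein_sum (index_enum 'I_n) (fun i => stein_sum (index_enum 'I_n) (fun j =>
  stein_scale (F i j * h i 0) (stein_coord mu h' j))).
have := stein_add (stein_cst mu h' (\sum_i a i * h i 0)) s2.
by congr stein_regular; apply/funext => x; rewrite add0r.
Qed.

End stein_closure.

(** * Gaussian covariances by Stein's identity *)

Section gaussian_moments.
Context {R : realType} {n : nat} {d : measure_display} {T : measurableType d}.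
Variables (P : probability T R) (X : T -> 'cV[R]_n) (mu : 'cV[R]_n) (Sigma : 'M[R]_n).
Hypothesis pSigma : posdef Sigma.
Hypothesis dX : has_density P X (gauss_pdf mu Sigma).
Implicit Types (x h : 'cV[R]_n) (f g : 'cV[R]_n -> R).

Let rvX : random_vector X. Proof. by case: dX. Qed.
(** The direction for which the weight in Stein's identity is exactly the [i]-th centred
    coordinate. *)
Let es i : 'cV[R]_n := Sigma *m evec i.

Let esE i j : es i j 0 = Sigma j i.
Proof. by rewrite /es /evec -colE mxE. Qed.

Lemma gstein i g dg : stein_regular mu (es i) g dg ->
  L1 P (fun w => dg (X w)) /\ L1 P (fun w => g (X w) * (X w i 0 - mu i 0)) /\
  Ex P (fun w => g (X w) * (X w i 0 - mu i 0)) = Ex P (fun w => dg (X w)).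
Proof.
move=> hg; have [h1 [h2 h3]] := stein pSigma dX hg.
have e : (fun w => g (X w) * bform (invmx Sigma) (es i) (X w - mu)) = (fun w => g (X w) * (X w i 0 - mu i 0)).
  apply/funext => w; congr (_ * _); rewrite /bform /es trmx_mul pSigma.1 mulmxK ?posdef_unit //.
  by rewrite /evec trmx_delta -rowE !mxE.
by rewrite e in h2 h3.
Qed.

Lemma gauss_L1 h g dg : stein_regular mu h g dg -> L1 P (fun w => g (X w)).
Proof. by case=> mg gg _ _; exact: (grows_L1 pSigma dX mg gg). Qed.

Lemma gauss_mean i : Ex P (fun w => X w i 0 - mu i 0) = 0.
Proof.
have [_ [_ h]] := gstein (stein_cst mu (es i) 1).
rewrite Ex_cst in h; rewrite -[RHS]h; congr Ex; apply/funext => w; by rewrite mul1r.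
Qed.

Lemma gauss_cov i j : Ex P (fun w => (X w i 0 - mu i 0) * (X w j 0 - mu j 0)) = Sigma i j.
Proof. by have [_ [_ ->]] := gstein (stein_coord mu (es j) i); rewrite Ex_cst esE. Qed.

Lemma mean_vec_gauss : mean_vec P X = mu.
Proof.
apply/matrixP => i j; rewrite ord1 mxE fine_expectation.
have := gauss_mean i; rewrite ExB ?Ex_cst; last 2 first.
- have := L1D (gauss_L1 (stein_coord mu 0 i)) (L1_cst P (mu i 0)).
  by congr L1; apply/funext => w; rewrite subrK.
- exact: L1_cst.
by move/eqP; rewrite subr_eq0 => /eqP.
Qed.

Lemma cov_mx_gauss : cov_mx P X = Sigma.
Proof.
apply/matrixP => i j; rewrite mxE covariance.unlock fine_expectation -[RHS]gauss_cov.
congr Ex; apply/funext => w /=.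
have e k : fine 'E_P[fun w => X w k ord0]%E = mu k 0 by rewrite -[in RHS]mean_vec_gauss mxE.
by rewrite !e.
Qed.

(** Stein's identity once for the linear terms and twice for the products. The second use leaves
    [Sigma i j] times the mean of [g], which the centring constant of [quad] cancels. *)
Lemma gauss_quad g (d1 : 'cV[R]_n -> 'cV[R]_n -> R) (d2 : 'cV[R]_n -> 'cV[R]_n -> 'cV[R]_n -> R) a F :
  (forall h, stein_regular mu h g (d1 h)) -> (forall h h', stein_regular mu h' (d1 h) (d2 h h')) ->
  L1 P (fun w => g (X w) * quad mu a F (\sum_i \sum_j F i j * Sigma i j) (X w)) /\
  Ex P (fun w => g (X w) * quad mu a F (\sum_i \sum_j F i j * Sigma i j) (X w)) =
  \sum_i a i * Ex P (fun w => d1 (es i) (X w)) +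
  2^-1 * \sum_i \sum_j F i j * Ex P (fun w => d2 (es j) (es i) (X w)).
Proof.
move=> h1 h2.
have [L0 L1g] : L1 P (fun w => g (X w)) /\ forall i, L1 P (fun w => g (X w) * (X w i 0 - mu i 0)).
  by split => [|i]; [exact: gauss_L1 (h1 0)|have [_ []] := gstein (h1 (es i))].
have E1 i : Ex P (fun w => g (X w) * (X w i 0 - mu i 0)) = Ex P (fun w => d1 (es i) (X w)).
  by have [_ [_ ->]] := gstein (h1 (es i)).
have [L2 E2] : (forall i j, L1 P (fun w => g (X w) * ((X w i 0 - mu i 0) * (X w j 0 - mu j 0)))) /\
   forall i j, Ex P (fun w => g (X w) * ((X w i 0 - mu i 0) * (X w j 0 - mu j 0))) =
     Ex P (fun w => d2 (es j) (es i) (X w)) + Sigma i j * Ex P (fun w => g (X w)).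
  suff H i j : L1 P (fun w => g (X w) * ((X w i 0 - mu i 0) * (X w j 0 - mu j 0))) /\
    Ex P (fun w => g (X w) * ((X w i 0 - mu i 0) * (X w j 0 - mu j 0))) =
     Ex P (fun w => d2 (es j) (es i) (X w)) + Sigma i j * Ex P (fun w => g (X w)).
    by split => i j; have [] := H i j.
  have [_ [a1 a2]] := gstein (stein_mul (h1 (es j)) (stein_coord mu (es j) i)).
  have e : (fun w => g (X w) * ((X w i 0 - mu i 0) * (X w j 0 - mu j 0))) =
           (fun w => g (X w) * (X w i 0 - mu i 0) * (X w j 0 - mu j 0)).
    by apply/funext => w; rewrite mulrA.
  rewrite e; split => //; rewrite a2.
  have [_ [b1 b2]] := gstein (h2 (es j) (es i)).
  rewrite -b2 esE; under [X in Ex P X = _]eq_fun do rewrite [g _ * _]mulrC.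
  by rewrite ExD ?ExZ //; exact: L1Z.
set c := \sum_i _.
have e : (fun w => g (X w) * quad mu a F c (X w)) = (fun w =>
  (\sum_i a i * (g (X w) * (X w i 0 - mu i 0))) +
  2^-1 * ((\sum_i \sum_j F i j * (g (X w) * ((X w i 0 - mu i 0) * (X w j 0 - mu j 0)))) - c * g (X w))).
  apply/funext => w; rewrite /quad mulrDr; congr (_ + _).
    by rewrite mulr_sumr; apply: eq_bigr => i _; rewrite mulrCA.
  rewrite mulrCA mulrBr; congr (_ * (_ - _)); last by rewrite mulrC.
  by rewrite mulr_sumr; apply: eq_bigr => i _; rewrite mulr_sumr; apply: eq_bigr => j _; rewrite mulrCA.
have La : L1 P (fun w => \sum_i a i * (g (X w) * (X w i 0 - mu i 0))).
  by apply: L1_sum => i _; apply: L1Z.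
have Lb : L1 P (fun w => \sum_i \sum_j F i j * (g (X w) * ((X w i 0 - mu i 0) * (X w j 0 - mu j 0)))).
  by apply: L1_sum => i _; apply: L1_sum => j _; apply: L1Z.
have Lc : L1 P (fun w => c * g (X w)) by exact: L1Z.
have Ld := L1B Lb Lc.
rewrite e; split; first by apply: L1D => //; exact: L1Z.
rewrite ExD //; last exact: L1Z.
rewrite (ExZ _ Ld) (ExB Lb Lc) (ExZ _ L0); congr (_ + _ * _).
  by rewrite Ex_sum => [|i _]; [apply: eq_bigr => i _; rewrite ExZ // E1|exact: L1Z].
rewrite Ex_sum => [|i _]; last by apply: L1_sum => j _; exact: L1Z.
under eq_bigr => i _.
  rewrite Ex_sum => [|j _]; last exact: L1Z.
  under eq_bigr => j _ do rewrite (ExZ _ (L2 i j)) E2 mulrDr mulrA.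
  rewrite big_split /= -mulr_suml.
  over.
by rewrite big_split /= -mulr_suml addrK.
Qed.

Section test_function.
Variable f : 'cV[R]_n -> R.
Hypotheses (sf : smooth f) (cf : compact (supp f)).

Let a i := Ex P (fun w => 'D_(evec i) f (X w)).
Let F := mean_hessian P X f.

Let FE i j : F i j = Ex P (fun w => 'D_(evec i) ('D_(evec j) f) (X w)).
Proof. by rewrite /F mxE fine_expectation; congr Ex; apply/funext => w; rewrite mxE. Qed.

Let reg1 h : stein_regular mu h f ('D_h f). Proof. exact: stein_smooth. Qed.
Let reg2 h h' : stein_regular mu h' ('D_h f) ('D_h' ('D_h f)).
Proof. by apply: stein_smooth; [exact: smooth_derive|exact: compact_supp_derive]. Qed.

Lemma mean_derive h : L1 P (fun w => 'D_h f (X w)) /\ Ex P (fun w => 'D_h f (X w)) = \sum_i h i 0 * a i.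
Proof.
have L i : L1 P (fun w => 'D_(evec i) f (X w)).
  by have [] := stein pSigma dX (reg1 (evec i)).
have e : (fun w => 'D_h f (X w)) = (fun w => \sum_i h i 0 * 'D_(evec i) f (X w)).
  apply/funext => w; rewrite {1}(vec_sum h) C1_sum; last exact: smooth_C1.
  by apply: eq_bigr => i _; rewrite C1_scale //; exact: smooth_C1.
rewrite e; split; first by apply: L1_sum => i _; exact: L1Z.
by rewrite Ex_sum => [|i _]; [apply: eq_bigr => i _; rewrite ExZ|exact: L1Z].
Qed.
End test_function.

Section test_function2.
Variable f : 'cV[R]_n -> R.
Hypotheses (sf : smooth f) (cf : compact (supp f)).

Let a i := Ex P (fun w => 'D_(evec i) f (X w)).
Let F := mean_hessian P X f.

Let FE i j : F i j = Ex P (fun w => 'D_(evec i) ('D_(evec j) f) (X w)).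
Proof. by rewrite /F mxE fine_expectation; congr Ex; apply/funext => w; rewrite mxE. Qed.

Let reg1 h : stein_regular mu h f ('D_h f). Proof. exact: stein_smooth. Qed.
Let reg2 h h' : stein_regular mu h' ('D_h f) ('D_h' ('D_h f)).
Proof. by apply: stein_smooth; [exact: smooth_derive|exact: compact_supp_derive]. Qed.

Let derive_f h x : 'D_h f x = \sum_l h l 0 * 'D_(evec l) f x.
Proof.
rewrite {1}(vec_sum h) C1_sum; last exact: smooth_C1.
by apply: eq_bigr => l _; rewrite C1_scale //; exact: smooth_C1.
Qed.

Let reg3 h h' : stein_regular mu h' ('D_h f) (fun x => \sum_l h l 0 * 'D_h' ('D_(evec l) f) x).
Proof.
have := stein_sum (index_enum 'I_n) (fun l => stein_scale (h l 0) (reg2 (evec l) h')).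
by congr stein_regular; apply/funext => x; rewrite derive_f.
Qed.

Lemma mean_gradE i : mean_grad P X f 0 i = a i.
Proof. by rewrite mxE fine_expectation; congr Ex; apply/funext => w; rewrite mxE. Qed.

Lemma gauss_coord_grad i j : L1 P (fun w => 'D_(evec j) f (X w) * (X w i 0 - mu i 0)) /\
  Ex P (fun w => 'D_(evec j) f (X w) * (X w i 0 - mu i 0)) = (Sigma *m F) i j.
Proof.
have [_ [h1 h2]] := gstein (reg2 (evec j) (es i)); split => //.
rewrite h2 (mean_derive (smooth_derive _ sf) (compact_supp_derive cf) _).2 mxE.
by apply: eq_bigr => k _; rewrite esE -FE -{1}pSigma.1 mxE.
Qed.

(** The mean of [f] times a product of two centred coordinates is computed by Stein's identity in
    both orders; this makes [Sigma *m F *m Sigma] symmetric, and [Sigma] is invertible. *)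
Lemma mean_hessian_sym : F^T = F.
Proof.
have L0 := gauss_L1 (reg1 0).
have H i j : Ex P (fun w => f (X w) * (X w j 0 - mu j 0) * (X w i 0 - mu i 0)) =
  (Sigma *m F *m Sigma) j i + Ex P (fun w => f (X w)) * Sigma j i.
  have [_ [h1 ->]] := gstein (stein_mul (reg1 (es i)) (stein_coord mu (es i) j)).
  have L3 k : L1 P (fun w => es i k 0 * ('D_(evec k) f (X w) * (X w j 0 - mu j 0))).
    by apply: L1Z; have [] := gauss_coord_grad j k.
  have -> : (fun w => 'D_(es i) f (X w) * (X w j 0 - mu j 0) + f (X w) * es i j 0) =
     (fun w => \sum_k es i k 0 * ('D_(evec k) f (X w) * (X w j 0 - mu j 0)) + es i j 0 * f (X w)).
    apply/funext => w; congr (_ + _); last by rewrite mulrC.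
    rewrite {1}(vec_sum (es i)) C1_sum; last exact: smooth_C1.
    rewrite mulr_suml; apply: eq_bigr => k _; rewrite C1_scale ?mulrA //; exact: smooth_C1.
  rewrite ExD; [|by apply: L1_sum => k _; exact: L3|exact: L1Z].
  rewrite ExZ // esE [Sigma j i * _]mulrC; congr (_ + _).
  rewrite Ex_sum => [|k _]; last exact: L3.
  rewrite mxE; apply: eq_bigr => k _.
  by have [h h'] := gauss_coord_grad j k; rewrite (ExZ _ h) h' esE mulrC.
have sym : (Sigma *m F *m Sigma)^T = Sigma *m F *m Sigma.
  apply/matrixP => i j; rewrite mxE.
  have := H i j; have := H j i.
  have -> : (fun w => f (X w) * (X w i 0 - mu i 0) * (X w j 0 - mu j 0)) =
     (fun w => f (X w) * (X w j 0 - mu j 0) * (X w i 0 - mu i 0)).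
    by apply/funext => w; rewrite mulrAC.
  move=> -> /esym; have -> : Sigma i j = Sigma j i by rewrite -{1}pSigma.1 mxE.
  by move/addIr.
move: sym; rewrite !trmx_mul pSigma.1 -mulmxA => /(congr1 (mulmx (invmx Sigma))).
rewrite !mulKmx ?posdef_unit //.
by move=> /(congr1 (fun M => M *m invmx Sigma)); rewrite !mulmxK ?posdef_unit.
Qed.

Definition ell x : R := f x - Ex P (fun w => f (X w)) - quad mu a F (\sum_i \sum_j F i j * Sigma i j) x.

Lemma stein_ell h : stein_regular mu h ell (fun x => 'D_h f x - dquad mu a F h x).
Proof.
have sF := mean_hessian_sym.
have := stein_add (stein_add (reg1 h) (stein_cst mu h (- Ex P (fun w => f (X w)))))
   (stein_scale (-1) (stein_quad mu a (\sum_i \sum_j F i j * Sigma i j) sF h)).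
by congr stein_regular; apply/funext => x; rewrite ?addr0 mulN1r.
Qed.

Lemma Ex_ell : Ex P (fun w => ell (X w)) = 0.
Proof.
have [h1 h2] := @gauss_quad (fun=> 1) (fun _ _ => 0) (fun _ _ _ => 0) a F
  (fun h => stein_cst mu h 1) (fun _ h => stein_cst mu h 0).
have L0 := gauss_L1 (reg1 0).
have e : (fun w => 1 * quad mu a F (\sum_i \sum_j F i j * Sigma i j) (X w)) =
   (fun w => quad mu a F (\sum_i \sum_j F i j * Sigma i j) (X w)) by apply/funext => w; rewrite mul1r.
rewrite e in h1 h2; rewrite ExB //; last by apply: L1B => //; exact: L1_cst.
rewrite ExB //; last exact: L1_cst.
rewrite Ex_cst subrr h2 Ex_cst.
rewrite big1; last by move=> i _; rewrite mulr0.
by rewrite big1 ?mulr0 ?addr0 ?subr0 // => i _; rewrite big1 // => j _; rewrite mulr0.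
Qed.

(** The mean of [f * quad] and the mean of [quad ^+ 2] are the same number [V], so the residual has
    second moment equal to the variance of [f] minus [V]. As a second moment [V] is nonnegative,
    which yields the universal property. *)
Lemma Ex_ell_sqr : L1 P (fun w => ell (X w) ^+ 2) /\ Ex P (fun w => ell (X w) ^+ 2) =
  fine 'V_P[fun w => f (X w)] - (mean_grad P X f *m Sigma *m (mean_grad P X f)^T) ord0 ord0
     - 2^-1 * \tr ((Sigma *m F) *m (Sigma *m F)) /\
  0 <= (mean_grad P X f *m Sigma *m (mean_grad P X f)^T) ord0 ord0 + 2^-1 * \tr ((Sigma *m F) *m (Sigma *m F)).
Proof.
have sF := mean_hessian_sym; set c := \sum_i \sum_j F i j * Sigma i j.
have L0 := gauss_L1 (reg1 0).
have Lff : L1 P (fun w => f (X w) ^+ 2).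
  by have := gauss_L1 (stein_mul (reg1 0) (reg1 0)); congr L1; apply/funext => w; rewrite expr2.
have [q1 q2] := @gauss_quad f (fun h => 'D_h f) (fun h h' x => \sum_l h l 0 * 'D_h' ('D_(evec l) f) x) a F reg1 reg3.
have [r1 r2] := @gauss_quad (quad mu a F c) (dquad mu a F) (fun h h' _ => \sum_i \sum_j F i j * h i 0 * h' j 0) a F
   (fun h => stein_quad mu a c sF h) (fun h h' => stein_dquad mu a F h h').
have [u1 u2] := @gauss_quad (fun=> 1) (fun _ _ => 0) (fun _ _ _ => 0) a F
  (fun h => stein_cst mu h 1) (fun _ h => stein_cst mu h 0).
have {}u2 : Ex P (fun w => quad mu a F c (X w)) = 0.
  have e : (fun w => 1 * quad mu a F c (X w)) = (fun w => quad mu a F c (X w)) by apply/funext => w; rewrite mul1r.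
  rewrite -e u2 Ex_cst big1; last by move=> i _; rewrite mulr0.
  by rewrite big1 ?mulr0 ?addr0 // => i _; rewrite big1 // => j _; rewrite mulr0.
have Lq := gauss_L1 (stein_quad mu a c sF 0).
set E := Ex P (fun w => f (X w)).
set V := (mean_grad P X f *m Sigma *m (mean_grad P X f)^T) ord0 ord0 + 2^-1 * \tr ((Sigma *m F) *m (Sigma *m F)).
have trE : \tr ((Sigma *m F) *m (Sigma *m F)) = \sum_i \sum_j F i j * (Sigma *m F *m Sigma) i j.
  rewrite mulmxA mxtrace_mulC /mxtrace; apply: eq_bigr => i _; rewrite mxE; apply: eq_bigr => j _.
  by congr (_ * _); rewrite -[in LHS]pSigma.1 -[in LHS]sF -!trmx_mul mulmxA mxE.
have EV1 : \sum_i a i * (\sum_k es i k 0 * a k) = (mean_grad P X f *m Sigma *m (mean_grad P X f)^T) ord0 ord0.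
  rewrite mxE; apply: eq_bigr => i _; rewrite !mxE mulrC; congr (_ * _).
    by apply: eq_bigr => k _; rewrite esE mulrC -mean_gradE.
  by rewrite -mean_gradE mxE.
have SFS i j : \sum_l es j l 0 * (\sum_k es i k 0 * F k l) = (Sigma *m F *m Sigma) i j.
  rewrite mxE; apply: eq_bigr => l _; rewrite esE mulrC mxE; congr (_ * _).
  by apply: eq_bigr => k _; rewrite esE -{1}pSigma.1 mxE.
have V1 : Ex P (fun w => f (X w) * quad mu a F c (X w)) = V.
  rewrite q2 /V trE -EV1; congr (_ + _ * _).
    by apply: eq_bigr => i _; rewrite (mean_derive sf cf _).2.
  apply: eq_bigr => i _; apply: eq_bigr => j _; congr (_ * _).
  rewrite -SFS Ex_sum => [|l _]; last by apply: L1Z; have [] := stein pSigma dX (reg2 (evec l) (es i)).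
  apply: eq_bigr => l _; rewrite ExZ; last by have [] := stein pSigma dX (reg2 (evec l) (es i)).
  congr (_ * _); rewrite (mean_derive (smooth_derive _ sf) (compact_supp_derive cf) _).2.
  by apply: eq_bigr => k _; rewrite FE.
have V2 : Ex P (fun w => quad mu a F c (X w) * quad mu a F c (X w)) = V.
  rewrite r2 /V trE -EV1; congr (_ + _ * _).
    apply: eq_bigr => i _; congr (_ * _); rewrite /dquad ExD; last 2 first.
    - exact: L1_cst.
    - by apply: L1_sum => k _; apply: L1_sum => l _; apply: L1Z; exact: (gauss_L1 (stein_coord mu 0 l)).
    rewrite Ex_cst Ex_sum => [|k _]; last first.
      by apply: L1_sum => l _; apply: L1Z; exact: (gauss_L1 (stein_coord mu 0 l)).
    rewrite [X in _ + X]big1 ?addr0 => [|k _]; first by apply: eq_bigr => k _; rewrite mulrC.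
    rewrite Ex_sum => [|l _]; last by apply: L1Z; exact: (gauss_L1 (stein_coord mu 0 l)).
    rewrite big1 // => l _; rewrite ExZ; last exact: (gauss_L1 (stein_coord mu 0 l)).
    by rewrite gauss_mean mulr0.
  apply: eq_bigr => i _; apply: eq_bigr => j _; congr (_ * _); rewrite Ex_cst -SFS.
  apply: eq_bigr => l _; rewrite mulr_sumr; apply: eq_bigr => k _.
  by rewrite -{1}sF mxE; ring.
have e : (fun w => ell (X w) ^+ 2) = (fun w => (f (X w) - E) ^+ 2 - 2 * (f (X w) * quad mu a F c (X w)) + 2 * E * quad mu a F c (X w)
   + quad mu a F c (X w) * quad mu a F c (X w)).
  by apply/funext => w; rewrite /ell -/E -/c; ring.
have Lf2 : L1 P (fun w => (f (X w) - E) ^+ 2).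
  have := L1D (L1B Lff (L1Z (2 * E) L0)) (L1_cst P (E ^+ 2)); congr L1; apply/funext => w; ring.
have La := L1B Lf2 (L1Z 2 q1); have Lb := L1D La (L1Z (2 * E) Lq).
have V0 : 0 <= V by rewrite -V2 Ex_ge0 // => w; rewrite -expr2 sqr_ge0.
rewrite e; split; first exact: L1D.
split => //; rewrite ExD // ExD //; last exact: L1Z.
rewrite ExB //; last exact: L1Z.
rewrite (ExZ _ q1) (ExZ _ Lq) u2 V1 V2.
rewrite variance_Ex //=; last exact: (L1_meas L0).
by rewrite /V -/E; ring.
Qed.

End test_function2.
End gaussian_moments.

(** * Variance of the matched estimator *)

(** Convexity in the form [(x + y)^4 <= 8 (x^4 + y^4)], iterated; the constant only has to depend on
    the length. *)
Lemma sum_pow4_le_sum {R : realType} (I : Type) (s : seq I) (a : I -> R) :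
  (\sum_(i <- s) `|a i|) ^+ 4 <= 8 ^+ size s * \sum_(i <- s) a i ^+ 4.
Proof.
have h4 (x y : R) : (x + y) ^+ 4 <= 8 * (x ^+ 4 + y ^+ 4).
  have h2 (u v : R) : (u + v) ^+ 2 <= 2 * (u ^+ 2 + v ^+ 2) by have := sqr_ge0 (u - v); nra.
  have -> : (x + y) ^+ 4 = ((x + y) ^+ 2) ^+ 2 by rewrite -exprM.
  apply: (@le_trans _ _ ((2 * (x ^+ 2 + y ^+ 2)) ^+ 2)).
    by rewrite ler_pXn2r ?nnegrE ?sqr_ge0 // mulr_ge0 // addr_ge0 // sqr_ge0.
  have := h2 (x ^+ 2) (y ^+ 2); rewrite -!exprM exprMn => h; nra.
elim: s => [|i s IH]; first by rewrite !big_nil expr0n mulr0.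
rewrite !big_cons /= (le_trans (h4 _ _)) // [8 ^+ _.+1]exprS -mulrA ler_pM2l //.
have n4 (x : R) : `|x| ^+ 4 = x ^+ 4 by rewrite -normrX ger0_norm // (exprM x 2 2) sqr_ge0.
rewrite n4 mulrDr lerD // ler_peMl ?exprn_ege1 //; last by rewrite ler1n.
by rewrite (exprM _ 2 2) sqr_ge0.
Qed.

Section variance_perturbation.
Context {R : realType} {d : measure_display} {T : measurableType d} (P : probability T R).

(** The difference of the two sides is twice the covariance of [L] with the remainder, plus the
    variance of the remainder. With [a] of order [N^(-1/2)] and [b] of order [1 / N] the error is
    [N^(-3/2)], a relative error [N^(-1/2)]. *)
Lemma variance_perturb (U L : T -> R) (a b : R) : 0 <= a -> 0 <= b ->
  measurable_fun [set: T] L -> measurable_fun [set: T] U ->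
  L1 P (fun w => L w ^+ 2) -> L1 P (fun w => U w ^+ 2) -> Ex P L = 0 ->
  Ex P (fun w => L w ^+ 2) <= a ^+ 2 ->
  Ex P (fun w => (U w - L w) ^+ 2) <= b ^+ 2 ->
  `|Ex P (fun w => (U w - Ex P U) ^+ 2) - Ex P (fun w => L w ^+ 2)| <= 2 * a * b + 2 * b ^+ 2.
Proof.
move=> a0 b0 mL mU L2 U2 EL La rb.
have L1L := L1_sqr mL L2; have L1U := L1_sqr mU U2.
have LLU := L1_mul mL mU L2 U2.
pose r w := U w - L w.
have mr : measurable_fun [set: T] r by exact: measurable_funB.
have r2 : L1 P (fun w => r w ^+ 2).
  have := L1D (L1B U2 (L1Z 2 LLU)) L2; congr L1; apply/funext => w; rewrite /r; ring.
have LLr := L1_mul mL mr L2 r2.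
have cs := Ex_CS mL mr L2 r2.
have Er : Ex P U = Ex P r by rewrite /r ExB // EL subr0.
have Er2 := Ex_sqr_le mr r2.
rewrite Ex_var // Er.
have -> : Ex P (fun w => U w ^+ 2) = Ex P (fun w => L w ^+ 2) + 2 * Ex P (fun w => L w * r w) + Ex P (fun w => r w ^+ 2).
  rewrite -(ExZ 2 LLr) -ExD //; last exact: L1Z.
  rewrite -ExD //; last by apply: L1D => //; exact: L1Z.
  by congr Ex; apply/funext => w; rewrite /r; ring.
have L20 : 0 <= Ex P (fun w => L w ^+ 2) by apply: Ex_ge0 => w; exact: sqr_ge0.
have r20 : 0 <= Ex P (fun w => r w ^+ 2) by apply: Ex_ge0 => w; exact: sqr_ge0.
have h : `|Ex P (fun w => L w * r w)| <= a * b.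
  rewrite -(@ler_pXn2r _ 2) ?nnegrE ?mulr_ge0 // real_normK ?num_real // exprMn (le_trans cs) //.
  exact: ler_pM.
have -> : forall x y z v : R, x + 2 * y + z - v ^+ 2 - x = 2 * y + (z - v ^+ 2) by move=> *; ring.
rewrite (le_trans (ler_normD _ _)) // normrM normr_nat -mulrA lerD ?ler_pM2l //.
have v0 := sqr_ge0 (Ex P r).
rewrite ger0_norm ?subr_ge0 //; have b2 := sqr_ge0 b; have := rb; rewrite -/(r _).
move: Er2 r20; rewrite /r; lra.
Qed.

End variance_perturbation.

(** * Sample moments over a subset of the indices *)

Section centered_sample.
Context {R : realType} {n : nat}.
Variables (mu : 'cV[R]_n) (Sigma : 'M[R]_n).
Implicit Types (X : nat -> 'cV[R]_n) (Q : pred nat).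

(** Division by [N] even when indices are left out: restoring one index then adds exactly one
    summand of weight [1 / N]. *)
Definition dmean X N Q : 'cV[R]_n := N%:R^-1 *: \sum_(k < N | Q k) (X k - mu).
Definition dcov X N Q : 'M[R]_n := N%:R^-1 *: \sum_(k < N | Q k) ((X k - mu) *m (X k - mu)^T - Sigma).
Definition pmean X N Q : 'cV[R]_n := mu + dmean X N Q.
Definition pcov X N Q : 'M[R]_n := Sigma + dcov X N Q - dmean X N Q *m (dmean X N Q)^T.

Lemma pmean_full X N : (0 < N)%N -> N%:R^-1 *: \sum_(k < N) X k = pmean X N xpredT.
Proof.
move=> N0; rewrite /pmean /dmean sumrB sumr_const card_ord scalerBr.
rewrite -[mu *+ N]scaler_nat scalerA mulVf ?pnatr_eq0 -?lt0n // scale1r.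
by rewrite [mu + _]addrC subrK.
Qed.

Lemma pcov_full X N : (0 < N)%N ->
  N%:R^-1 *: \sum_(k < N) (X k *m (X k)^T) - pmean X N xpredT *m (pmean X N xpredT)^T = pcov X N xpredT.
Proof.
move=> N0; rewrite /pcov /dcov.
have NN : N%:R^-1 * N%:R = 1 :> R by rewrite mulVf // pnatr_eq0 -lt0n.
set m := pmean X N xpredT; have dm : dmean X N xpredT = m - mu by rewrite /m /pmean addrC addrA addNr add0r.
have sX : \sum_(k < N) X k = N%:R *: m by rewrite /m -pmean_full // scalerA mulfV ?scale1r // pnatr_eq0 -lt0n.
rewrite dm sumrB sumr_const card_ord.
have -> : \sum_(k < N) ((X k - mu) *m (X k - mu)^T) = \sum_(k < N) (X k *m (X k)^T)
    - N%:R *: (m *m mu^T) - N%:R *: (mu *m m^T) + N%:R *: (mu *m mu^T).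
  transitivity (\sum_(k < N) (X k *m (X k)^T - X k *m mu^T - mu *m (X k)^T + mu *m mu^T)).
    apply: eq_bigr => k _; rewrite linearB /= mulmxBl !mulmxBr opprB addrA.
    by rewrite -!addrA; congr (_ + (_ + _)); rewrite addrC.
  rewrite big_split /= !sumrB sumr_const card_ord -scaler_nat -mulmx_suml -mulmx_sumr.
  by rewrite -linear_sum /= sX linearZ /= -scalemxAl -scalemxAr.
rewrite scalerBr -[Sigma *+ N]scaler_nat scalerA NN scale1r [Sigma + _]addrC subrK.
rewrite !scalerDr !scalerN !scalerA NN !scale1r.
rewrite linearB /= mulmxBl !mulmxBr; move: (m *m m^T) (m *m mu^T) (mu *m m^T) (mu *m mu^T) (N%:R^-1 *: _).
by move=> c1 c2 c3 c4 c5; apply/matrixP => i j; rewrite !mxE; ring.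
Qed.

Lemma pcov_sym X N Q : Sigma^T = Sigma -> (pcov X N Q)^T = pcov X N Q.
Proof.
move=> sS; rewrite /pcov.
have -> (A B M : 'M[R]_n) : (A + B - M)^T = A^T + B^T - M^T by rewrite linearB linearD.
rewrite trmx_mul trmxK sS /dcov linearZ /= linear_sum /=; congr (_ + _ *: _ - _).
by apply: eq_bigr => k _; rewrite linearB /= trmx_mul trmxK sS.
Qed.

(** With [K] indices kept, the form is [(1 - K / N)] times [Sigma], plus an average of squares minus
    the square of an average, nonnegative by Cauchy-Schwarz. Measurability of the root of a partial
    covariance depends on this. *)
Lemma pcov_psd X N Q : (0 < N)%N -> psd Sigma -> psd (pcov X N Q).
Proof.
move=> N0 [sS pS]; split => [|v]; first exact: pcov_sym.
have NN : N%:R^-1 * N%:R = 1 :> R by rewrite mulVf // pnatr_eq0 -lt0n.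
have iN : 0 <= N%:R^-1 :> R by rewrite invr_ge0.
pose y k := (v^T *m (X k - mu)) 0 0.
have sw (u : 'cV[R]_n) : (u^T *m v) 0 0 = (v^T *m u) 0 0.
  by rewrite !mxE; apply: eq_bigr => i _; rewrite !mxE mulrC.
have ysq k : qform ((X k - mu) *m (X k - mu)^T) v = y k ^+ 2.
  rewrite /qform /bform mulmxA -mulmxA mxE big_ord1 expr2; congr (_ * _).
  exact: sw.
have dm : (v^T *m dmean X N Q) 0 0 = N%:R^-1 * \sum_(k < N | Q k) y k.
  by rewrite /dmean -scalemxAr mxE mulmx_sumr summxE.
have qm : qform (dmean X N Q *m (dmean X N Q)^T) v = (N%:R^-1 * \sum_(k < N | Q k) y k) ^+ 2.
  rewrite /qform /bform mulmxA -mulmxA mxE big_ord1 expr2 -dm; congr (_ * _).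
  exact: sw.
have qd : qform (dcov X N Q) v = N%:R^-1 * \sum_(k < N | Q k) (y k ^+ 2 - qform Sigma v).
  rewrite /dcov qformZm; congr (_ * _); rewrite /qform /bform mulmx_sumr mulmx_suml summxE.
  by apply: eq_bigr => k _; rewrite -[LHS]/(qform _ _) qformB ysq.
rewrite /pcov qformB qformDm qm qd.
set K := \sum_(k < N | Q k) 1 : R.
have K0 : 0 <= K by exact: sumr_ge0.
have KN : K <= N%:R.
  rewrite -[N in leRHS]card_ord -sum1_card natr_sum /K big_mkcond /=.
  by apply: ler_sum => i _; case: (Q i).
set S1 := \sum_(k < N | Q k) y k; set S2 := \sum_(k < N | Q k) y k ^+ 2.
have -> : \sum_(k < N | Q k) (y k ^+ 2 - qform Sigma v) = S2 - K * qform Sigma v.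
  by rewrite sumrB /K mulr_suml; congr (_ - _); apply: eq_bigr => k _; rewrite mul1r.
have cs t : 0 <= S2 - 2 * t * S1 + N%:R * t ^+ 2.
  apply: (@le_trans _ _ (\sum_(k < N | Q k) (y k - t) ^+ 2)); first by apply: sumr_ge0 => k _; exact: sqr_ge0.
  have -> : \sum_(k < N | Q k) (y k - t) ^+ 2 = S2 - 2 * t * S1 + K * t ^+ 2.
    rewrite /S1 /S2 /K mulr_sumr mulr_suml -sumrB -big_split /=; apply: eq_bigr => k _; ring.
  by rewrite lerD2l ler_wpM2r // sqr_ge0.
have := cs (N%:R^-1 * S1); set t := N%:R^-1 * S1 => h.
have tS : S1 = N%:R * t by rewrite /t mulrA [N%:R * _]mulrC NN mul1r.
have h' : N%:R * t ^+ 2 <= S2 by move: h; rewrite tS; nra.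
have h2 : t ^+ 2 <= N%:R^-1 * S2 by have := ler_wpM2l iN h'; rewrite mulrA NN mul1r.
have h3 : N%:R^-1 * (K * qform Sigma v) <= qform Sigma v.
  by rewrite mulrA ler_piMl ?pS // -[leRHS]NN ler_wpM2l.
rewrite mulrBr; lra.
Qed.

End centered_sample.

Section sample_meas.
Context {R : realType} {n : nat} {d : measure_display} {T : measurableType d}.
Variables (Xs : nat -> T -> 'cV[R]_n).
Hypothesis mXs : forall k, mmeas (Xs k).

Lemma mmeas_dmean mu N Q : mmeas (fun w => dmean mu (Xs^~ w) N Q).
Proof.
apply: mmeasZ; first exact: measurable_cst.
by apply: mmeas_sum => k _; apply: mmeasB; [exact: mXs|exact: mmeas_cst].
Qed.

Lemma mmeas_pcov mu Sigma N Q : mmeas (fun w => pcov mu Sigma (Xs^~ w) N Q).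
Proof.
apply: mmeasB; last by apply: mmeasM; [|apply: mmeas_tr]; exact: mmeas_dmean.
apply: mmeasD; first exact: mmeas_cst.
apply: mmeasZ; first exact: measurable_cst.
apply: mmeas_sum => k _; apply: mmeasB; last exact: mmeas_cst.
by apply: mmeasM; [|apply: mmeas_tr]; apply: mmeasB; [exact: mXs|exact: mmeas_cst|exact: mXs|exact: mmeas_cst].
Qed.

Lemma measurable_mmap mu Sigma N Q k (f : 'cV[R]_n -> R) : (0 < N)%N -> psd Sigma -> continuous f ->
  measurable_fun [set: T] (fun w => f (mmap mu Sigma (pcov mu Sigma (Xs^~ w) N Q)
    (pmean mu (Xs^~ w) N Q) (Xs k w))).
Proof.
move=> N0 pS cf; apply: measurable_cont_comp => //.
apply: mmeasD; last exact: mmeas_cst.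
apply: mmeasM; last first.
  apply: mmeasB; first exact: mXs.
  by apply: mmeasD; [exact: mmeas_cst|exact: mmeas_dmean].
apply: mmeasM; first exact: mmeas_cst.
apply: mmeas_inv; apply: mmeas_sqrtmx; last exact: mmeas_pcov.
by move=> w; exact: pcov_psd.
Qed.

Lemma mm2_estimatorE (P : probability T R) (X : T -> 'cV[R]_n) f N w : (0 < N)%N ->
  mm2_estimator P X Xs f N w = N%:R^-1 * \sum_(k < N) f (mmap (mean_vec P X) (cov_mx P X)
     (pcov (mean_vec P X) (cov_mx P X) (Xs^~ w) N xpredT) (pmean (mean_vec P X) (Xs^~ w) N xpredT) (Xs k w)).
Proof.
move=> N0; rewrite /mm2_estimator; congr (_ * _); apply: eq_bigr => k _.
by congr f; rewrite -(pcov_full _ _ _ N0) -(pmean_full _ _ N0).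
Qed.

End sample_meas.

Lemma lyap_norm {R : realType} {n : nat} (S : 'M[R]_n) :
  exists2 C : R, 0 <= C & forall H, `|lyap S H| <= C * `|H|.
Proof.
exists ((n * n)%:R * `|invmx (lyap_mx S)|) => [|H]; first by rewrite mulr_ge0.
have h1 : `|mxvec H| <= `|H|.
  apply: mxnorm_le => // i j; case/mxvec_indexP: j => j k.
  by rewrite ord1 mxvecE; exact: mxnorm_entry.
apply: (@le_trans _ _ `|mxvec H *m invmx (lyap_mx S)|).
  by apply: mxnorm_le => // i j; rewrite mxE; exact: mxnorm_entry.
by apply: (le_trans (mxnormM_le h1 (lexx _))); rewrite mulrAC.
Qed.

Lemma sqr_norm_le {R : realType} {n : nat} (y : 'cV[R]_n) : `|y| ^+ 2 <= \sum_i y i 0 ^+ 2.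
Proof.
have S0 : 0 <= \sum_i y i 0 ^+ 2 by apply: sumr_ge0 => i _; exact: sqr_ge0.
rewrite -[leRHS](sqr_sqrtr S0) ler_pXn2r ?nnegrE ?sqrtr_ge0 //.
apply: mxnorm_le; first exact: sqrtr_ge0.
move=> i j; rewrite ord1 -(sqrtr_sqr (y i 0)) ler_wsqrtr //.
by rewrite (bigD1 i) //= lerDl sumr_ge0 // => k _; exact: sqr_ge0.
Qed.

(** * Linearization of the estimator for Gaussian samples *)

Section gauss_estimator.
Context {R : realType} {n : nat} {d : measure_display} {T : measurableType d}.
Variables (P : probability T R) (X : T -> 'cV[R]_n) (Xs : nat -> T -> 'cV[R]_n).
Variables (mu : 'cV[R]_n) (Sigma : 'M[R]_n).
Hypothesis pSigma : posdef Sigma.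
Hypothesis dX : has_density P X (gauss_pdf mu Sigma).
Variable f : 'cV[R]_n -> R.
Hypotheses (sf : smooth f) (cf : compact (supp f)).
Implicit Types (x : 'cV[R]_n) (y : nat -> 'cV[R]_n).

Let a i := Ex P (fun w => 'D_(evec i) f (X w)).
Let F := mean_hessian P X f.
Let B := Sigma *m F.
Let S := sqrtmx Sigma.
Let pS : posdef S. Proof. exact: (sqrtmxP pSigma).1. Qed.
Let SS : S *m S = Sigma. Proof. exact: (sqrtmxP pSigma).2. Qed.
Let sF : F^T = F. Proof. exact: (mean_hessian_sym pSigma dX sf cf). Qed.
Let Ef := Ex P (fun w => f (X w)).
Notation elf := (ell P X mu Sigma f).

Definition stat_index : finType := (('I_n + 'I_n * 'I_n) + ('I_n + 'I_n * 'I_n))%type.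

(** The centred statistics whose averages control the expansion: first and second moments of the
    sample, the gradient, and the gradient times a coordinate, which multiplies the derivative of
    the root. *)
Definition stat (r : stat_index) x : R :=
  match r with
  | inl (inl i) => x i 0 - mu i 0
  | inl (inr (i, j)) => (x i 0 - mu i 0) * (x j 0 - mu j 0) - Sigma i j
  | inr (inl i) => 'D_(evec i) f x - a i
  | inr (inr (i, j)) => 'D_(evec j) f x * (x i 0 - mu i 0) - B i j
  end.

Lemma stein_stat r : exists dg, stein_regular mu 0 (stat r) dg.
Proof.
have sub (g dg : 'cV[R]_n -> R) c : stein_regular mu 0 g dg -> exists dg', stein_regular mu 0 (fun x => g x - c) dg'.
  by move=> h; eexists; exact: stein_add h (stein_cst mu 0 (- c)).
have reg j : stein_regular mu 0 ('D_(evec j) f) ('D_0 ('D_(evec j) f)).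
  by apply: stein_smooth; [exact: smooth_derive|exact: compact_supp_derive].
case: r => [[i|[i j]]|[i|[i j]]].
- by eexists; exact: (stein_coord mu 0 i).
- exact: sub (stein_mul (stein_coord mu 0 i) (stein_coord mu 0 j)).
- exact: sub (reg i).
- exact: sub (stein_mul (reg j) (stein_coord mu 0 i)).
Qed.

Let L1s r : L1 P (fun w => stat r (X w)).
Proof. by have [dg h] := stein_stat r; exact: (gauss_L1 pSigma dX h). Qed.


Let vs r : vborel (stat r).
Proof. by have [dg []] := stein_stat r. Qed.

Lemma Ex_stat r : Ex P (fun w => stat r (X w)) = 0.
Proof.
have sub (g : T -> R) c : L1 P g -> Ex P g = c -> Ex P (fun w => g w - c) = 0.
  by move=> h e; rewrite ExB ?e ?Ex_cst ?subrr //; exact: L1_cst.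
case: r => [[i|[i j]]|[i|[i j]]] /=.
- exact: (gauss_mean pSigma dX).
- apply: sub; last exact: (gauss_cov pSigma dX).
  exact: (gauss_L1 pSigma dX (stein_mul (stein_coord mu 0 i) (stein_coord mu 0 j))).
- apply: sub => //.
  exact: (gauss_L1 pSigma dX (stein_smooth mu 0 (smooth_derive _ sf) (compact_supp_derive cf))).
- have [h1 h2] := gauss_coord_grad pSigma dX sf cf i j; exact: sub.
Qed.

Definition stat_dev (y : nat -> 'cV[R]_n) N : R := \sum_r `|N%:R^-1 * \sum_(k < N) stat r (y k)|.

Lemma stat_dev_ge0 y N : 0 <= stat_dev y N. Proof. exact: sumr_ge0. Qed.

Lemma stat_dev_ge y N r : `|N%:R^-1 * \sum_(k < N) stat r (y k)| <= stat_dev y N.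
Proof. by rewrite /stat_dev (bigD1 r) //= lerDl sumr_ge0. Qed.

Let g : 'rV[R]_n := \row_i a i.

Lemma dmean_le y N : `|dmean mu y N xpredT| <= stat_dev y N.
Proof.
apply: mxnorm_le; first exact: stat_dev_ge0.
move=> i j; rewrite ord1; apply: le_trans (stat_dev_ge y N (inl (inl i))) => /=.
have -> : dmean mu y N xpredT i 0 = N%:R^-1 * \sum_(k < N) (y k i 0 - mu i 0); last by [].
rewrite /dmean mxE summxE; congr (_ * _); apply: eq_bigr => k _; by rewrite !mxE.
Qed.

Lemma dcov_entry y N i j : dcov mu Sigma y N xpredT i j = N%:R^-1 * \sum_(k < N) stat (inl (inr (i, j))) (y k).
Proof.
rewrite mxE summxE; congr (_ * _); apply: eq_bigr => k _ /=.
by rewrite !mxE big_ord1 !mxE.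
Qed.

Lemma dcov_le y N : `|dcov mu Sigma y N xpredT| <= stat_dev y N.
Proof.
apply: mxnorm_le; first exact: stat_dev_ge0.
by move=> i j; rewrite dcov_entry; exact: stat_dev_ge.
Qed.

Let gbar y N : 'rV[R]_n := N%:R^-1 *: \sum_(k < N) grad f (y k).
Let Bbar y N : 'M[R]_n := N%:R^-1 *: \sum_(k < N) ((y k - mu) *m grad f (y k)).

Let avg_cst N (c : R) : (0 < N)%N -> N%:R^-1 * \sum_(k < N) c = c.
Proof. by move=> N0; rewrite sumr_const card_ord -[c *+ N]mulr_natl mulKf // pnatr_eq0 -lt0n. Qed.

Lemma gbar_le y N : (0 < N)%N -> `|gbar y N - g| <= stat_dev y N.
Proof.
move=> N0; apply: mxnorm_le; first exact: stat_dev_ge0.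
move=> i j; rewrite ord1; apply: le_trans (stat_dev_ge y N (inr (inl j))) => /=.
rewrite sumrB mulrBr avg_cst // !mxE summxE.
by under eq_bigr do rewrite mxE.
Qed.

Lemma Bbar_le y N : (0 < N)%N -> `|Bbar y N - B| <= stat_dev y N.
Proof.
move=> N0; apply: mxnorm_le; first exact: stat_dev_ge0.
move=> i j; apply: le_trans (stat_dev_ge y N (inr (inr (i, j)))) => /=.
rewrite sumrB mulrBr avg_cst // (_ : (Bbar y N - B) i j = Bbar y N i j - B i j); last by rewrite !mxE.
rewrite /Bbar mxE summxE.
under eq_bigr do rewrite mxE big_ord1 !mxE.
by under [in leRHS]eq_bigr do rewrite mulrC.
Qed.

Lemma ell_avg y N : (0 < N)%N -> N%:R^-1 * \sum_(k < N) elf (y k) =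
  N%:R^-1 * (\sum_(k < N) f (y k)) - Ef - (g *m dmean mu y N xpredT) 0 0
   - 2^-1 * \tr (dcov mu Sigma y N xpredT *m F).
Proof.
move=> N0; rewrite /ell /quad.
have -> : \sum_(k < N) (f (y k) - Ex P (fun w => f (X w)) - (\sum_i Ex P (fun w => 'D_(evec i) f (X w)) * (y k i 0 - mu i 0) +
   2^-1 * (\sum_i \sum_j mean_hessian P X f i j * ((y k i 0 - mu i 0) * (y k j 0 - mu j 0)) - \sum_i \sum_j mean_hessian P X f i j * Sigma i j))) =
  \sum_(k < N) f (y k) - \sum_(k < N) Ef - \sum_(k < N) \sum_i a i * (y k i 0 - mu i 0)
   - \sum_(k < N) 2^-1 * \sum_i \sum_j F i j * stat (inl (inr (i, j))) (y k).
  rewrite -!sumrB; apply: eq_bigr => k _; rewrite opprD addrA; congr (_ - _ * _).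
  rewrite -sumrB; apply: eq_bigr => i _; rewrite -sumrB; apply: eq_bigr => j _.
  by rewrite -mulrBr.
rewrite !mulrBr avg_cst //; congr (_ - _ - _).
  rewrite exchange_big /= mxE mulr_sumr; apply: eq_bigr => i _.
  rewrite -mulr_sumr mulrCA mxE; congr (_ * _); rewrite mxE summxE.
  by under [in RHS]eq_bigr do rewrite !mxE.
rewrite -mulr_sumr mulrCA; congr (_ * _).
rewrite mxtrace_mulC /mxtrace exchange_big /= mulr_sumr; apply: eq_bigr => i _.
rewrite mxE exchange_big /= mulr_sumr; apply: eq_bigr => j _.
rewrite -mulr_sumr mulrCA; congr (_ * _); rewrite dcov_entry; congr (_ * _).
by apply: eq_bigr => k _ /=; rewrite mulrC -{1}pSigma.1 mxE.
Qed.

Let est y N : R := N%:R^-1 * \sum_(k < N) f (mmap mu Sigma (pcov mu Sigma y N xpredT) (pmean mu y N xpredT) (y k)).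

(** A deterministic inequality, valid for every sample: probability enters only through the size of
    [stat_dev]. *)
Lemma estimator_linearization : exists2 C : R, 0 <= C & forall y N, (0 < N)%N ->
  `|est y N - Ef - N%:R^-1 * \sum_(k < N) elf (y k)| <= C * stat_dev y N ^+ 2.
Proof.
have [dl [C [dl0 C0 HT]]] := smooth_mmap_taylor mu pSigma sf cf.
have [Cf Cf0 Hf] := smooth_bounded sf cf.
have [Cl Cl0 Hl] := lyap_norm S.
pose n' : R := n%:R; have n0 : 0 <= n' by exact: ler0n.
pose de : R := Num.min 1 (dl / 3).
have de0 : 0 < de by rewrite lt_min ltr01 divr_gt0.
pose trS := `|\tr Sigma|.
pose K1 := C * 9 * (2 + 2 * (n' + trS)).
pose K2 := n' + n' * (n' * (n' * (2 * Cl) * `|invmx S|)) + n' * (n' * (n' * Cl * `|invmx S|) * `|B|).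
pose K3 := (2 * Cf + 2 * `|Ef|) / de ^+ 2 + (n' * `|g| + 2^-1 * (n' * (n' * `|F|))) / de.
have K10 : 0 <= K1 by rewrite /K1 !mulr_ge0 // addr_ge0 // mulr_ge0 // addr_ge0 // normr_ge0.
have K20 : 0 <= K2 by rewrite /K2 !addr_ge0 // !mulr_ge0.
have K30 : 0 <= K3.
  by rewrite /K3 addr_ge0 // divr_ge0 // ?exprn_ge0 ?(ltW de0) // addr_ge0 // !mulr_ge0 // ?invr_ge0.
exists (K1 + K2 + K3) => [|y N N0]; first by apply: addr_ge0 => //; apply: addr_ge0.
have iN : 0 <= N%:R^-1 :> R by rewrite invr_ge0.
set Q := stat_dev y N; have Q0 : 0 <= Q by exact: stat_dev_ge0.
set m := dmean mu y N xpredT; set D := dcov mu Sigma y N xpredT.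
have hm : `|m| <= Q by exact: dmean_le.
have hD : `|D| <= Q by exact: dcov_le.
have hg := gbar_le y N0; have hB := Bbar_le y N0; rewrite -/Q in hg hB.
have Q20 : 0 <= Q ^+ 2 by exact: sqr_ge0.
have avg_le (u : nat -> R) c : (forall k, `|u k| <= c) -> `|N%:R^-1 * \sum_(k < N) u k| <= c.
  move=> h; rewrite normrM (ger0_norm iN) -(avg_cst c N0) ler_wpM2l //.
  by apply: (le_trans (ler_norm_sum _ _ _)); apply: ler_sum => k _.
have gm : `|(g *m m) 0 0| <= n' * `|g| * Q by exact: le_trans (mxnorm_entry _ _ _) (mxnormM_le (lexx _) hm).
have trDF : `|\tr (D *m F)| <= n' * (n' * `|F|) * Q.
  apply: (le_trans (mxtrace_le _)); rewrite -mulrA ler_wpM2l //.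
  by apply: (le_trans (mxnormM_le hD (lexx _))); rewrite mulrAC.
(* When [Q > de] no expansion is available, but all terms are bounded or linear in [Q], hence at
   most a multiple of [Q ^+ 2] since [Q / de > 1]. *)
rewrite ell_avg // -/m -/D; have [hQ|hQ] := leP Q de; last first.
  apply: (@le_trans _ _ (K3 * Q ^+ 2)); last by rewrite ler_wpM2r // lerDr addr_ge0.
  have h1 : `|est y N| <= Cf by exact: (avg_le (fun k => f (mmap mu Sigma (pcov mu Sigma y N xpredT) (pmean mu y N xpredT) (y k))) Cf (fun k => Hf _)).
  have h2 : `|N%:R^-1 * \sum_(k < N) f (y k)| <= Cf by exact: (avg_le (fun k => f (y k)) Cf (fun k => Hf _)).
  have h3 : Q <= Q ^+ 2 / de by rewrite expr2 -mulrA ler_peMr // ler_pdivlMr // mul1r ltW.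
  have h4 : 1 <= Q ^+ 2 / de ^+ 2 by rewrite ler_pdivlMr ?exprn_gt0 // mul1r ler_pXn2r ?nnegrE // ltW.
  have -> : K3 * Q ^+ 2 = (2 * Cf + 2 * `|Ef|) * (Q ^+ 2 / de ^+ 2) + (n' * `|g| + 2^-1 * (n' * (n' * `|F|))) * (Q ^+ 2 / de).
    by rewrite /K3; ring.
  apply: (@le_trans _ _ ((2 * Cf + 2 * `|Ef|) * 1 + (n' * `|g| + 2^-1 * (n' * (n' * `|F|))) * Q)); last first.
    by apply: lerD; apply: ler_wpM2l => //; rewrite addr_ge0 ?mulr_ge0 ?invr_ge0.
  have t3 (p q r s t : R) : `|p - q - (r - q - s - t)| <= `|p| + `|r| + `|s| + `|t|.
    have -> : p - q - (r - q - s - t) = p - r + s + t by ring.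
    by rewrite (le_trans (ler_normD _ _)) // lerD2r (le_trans (ler_normD _ _)) // lerD2r ler_normB.
  apply: (le_trans (t3 _ _ _ _ _)).
  have -> : `|2^-1 * \tr (D *m F)| = 2^-1 * `|\tr (D *m F)| by rewrite normrM ger0_norm // invr_ge0.
  have := normr_ge0 Ef; move: h1 h2 gm trDF; lra.
have Q1 : Q <= 1 by rewrite (le_trans hQ) // ge_min lexx.
have Qdl : 3 * Q <= dl.
  have : Q <= dl / 3 by rewrite (le_trans hQ) // ge_min lexx orbT.
  lra.
have QQ : Q ^+ 2 <= Q by rewrite expr2 ler_piMl.
set A := pcov mu Sigma y N xpredT; set mm := pmean mu y N xpredT.
set H := D - m *m m^T.
have AH : A - Sigma = H by rewrite /A /pcov -/D -/m /H [Sigma + D]addrC addrAC addrK.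
have mmE : mm - mu = m by rewrite /mm /pmean addrC addKr.
have hmm : `|m *m m^T| <= Q ^+ 2.
  have := mxnormM_le hm (_ : `|m^T| <= Q); rewrite mxnorm_tr mul1r -expr2; exact.
have hH : `|H| <= 2 * Q by rewrite (le_trans (ler_normB _ _)) // mulr_natl mulr2n lerD // (le_trans hmm).
have sS := pSigma.1.
have dev : mmap_dev mu Sigma A mm <= 3 * Q.
  rewrite /mmap_dev AH mmE; lra.
have dev0 : 0 <= mmap_dev mu Sigma A mm by rewrite addr_ge0.
set Kp := lyap S H.
have T1 k : `|f (mmap mu Sigma A mm (y k)) - f (y k) + (grad f (y k) *m (m + Kp *m invmx S *m (y k - mu))) 0 0|
    <= C * 9 * Q ^+ 2 * (1 + `|y k - mu|) ^+ 2.
  have hid : mmap_dev mu Sigma Sigma mu <= dl by rewrite mmap_dev_id ltW.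
  have := HT A Sigma mm mu (y k) (pcov_sym _ _ _ _ sS) sS (le_trans dev Qdl) hid.
  rewrite mmap_id // mmap_dev_id addr0 AH mmE => /le_trans; apply.
  apply: ler_wpM2r; first exact: sqr_ge0.
  rewrite -!mulrA ler_wpM2l // -[`|H| + `|m|]/(_ + _).
  have -> : `|H| + `|m| = mmap_dev mu Sigma A mm by rewrite /mmap_dev AH mmE.
  have -> : 9 * Q ^+ 2 = (3 * Q) * (3 * Q) by ring.
  exact: ler_pM.
(* The average weight is read off the trace of the centred second moments, which is bounded once
   [Q <= 1]. *)
have M2 : N%:R^-1 * \sum_(k < N) (1 + `|y k - mu|) ^+ 2 <= 2 + 2 * (n' + trS).
  have h2 (u : R) : (1 + u) ^+ 2 <= 2 + 2 * u ^+ 2 by have := sqr_ge0 (1 - u); nra.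
  apply: (@le_trans _ _ (N%:R^-1 * \sum_(k < N) (2 + 2 * \sum_i (y k - mu) i 0 ^+ 2))).
    rewrite ler_wpM2l // ler_sum // => k _; rewrite (le_trans (h2 _)) // lerD2l ler_pM2l //.
    exact: sqr_norm_le.
  rewrite big_split /= mulrDr avg_cst // lerD2l -mulr_sumr mulrCA ler_pM2l //.
  have -> : N%:R^-1 * (\sum_(k < N) \sum_i (y k - mu) i 0 ^+ 2) = \tr D + \tr Sigma.
    rewrite exchange_big /= mulr_sumr /mxtrace -big_split /=; apply: eq_bigr => i _.
    rewrite /D dcov_entry /= sumrB mulrBr avg_cst // subrK; congr (_ * _); apply: eq_bigr => k _.
    by rewrite !mxE expr2.
  apply: lerD; last exact: ler_norm.
  apply: (le_trans (ler_norm _)); apply: (le_trans (mxtrace_le _)).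
  by rewrite ler_piMr // (le_trans hD).
(* The Taylor sum contains the sample averages [gbar] and [Bbar]; replacing them by [g] and [B]
   costs their deviation, at most [Q], times a factor of order [Q]. *)
pose E1 := est y N - N%:R^-1 * \sum_(k < N) f (y k) + (gbar y N *m m) 0 0 + \tr (Kp *m invmx S *m Bbar y N).
have hE1 : `|E1| <= K1 * Q ^+ 2.
  have -> : E1 = N%:R^-1 * \sum_(k < N) (f (mmap mu Sigma A mm (y k)) - f (y k) + (grad f (y k) *m (m + Kp *m invmx S *m (y k - mu))) 0 0).
    rewrite big_split /= sumrB mulrDr mulrBr /E1 /est -/A -/mm -addrA; congr (_ + _).
    under [in RHS]eq_bigr do rewrite mulmxDr mxE.
    rewrite big_split /= mulrDr; congr (_ + _).
      by rewrite /gbar -scalemxAl mxE mulmx_suml summxE.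
    rewrite /Bbar -scalemxAr linearZ /=; congr (_ * _).
    rewrite mulmx_sumr raddf_sum /=; apply: eq_bigr => k _.
    rewrite (mulmxA (Kp *m invmx S)) (mxtrace_mulC (Kp *m invmx S *m (y k - mu)) (grad f (y k))).
    exact: trace_mx11.
  rewrite normrM (ger0_norm iN).
  apply: (@le_trans _ _ (N%:R^-1 * \sum_(k < N) (C * 9 * Q ^+ 2 * (1 + `|y k - mu|) ^+ 2))).
    by rewrite ler_wpM2l // (le_trans (ler_norm_sum _ _ _)) // ler_sum.
  by rewrite -mulr_sumr /K1 [leRHS]mulrAC mulrCA; apply: ler_wpM2l; rewrite // mulr_ge0 // mulr_ge0.
(* Stein's identity enters here: since [B = Sigma *m F] with [F] symmetric, the derivative of the
   square root collapses to the quadratic term of [ell]. *)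
have trE : 2^-1 * \tr (D *m F) = \tr (lyap S D *m invmx S *m B).
  have sD : D^T = D.
    apply/matrixP => i j; rewrite mxE !dcov_entry; congr (_ * _); apply: eq_bigr => k _ /=.
    by rewrite mulrC -{1}pSigma.1 mxE.
  rewrite -(mxtrace_lyap pS sD sF) /B -SS -!mulmxA; congr (\tr (_ *m _)).
  by rewrite mulKmx // posdef_unit.
rewrite trE.
have -> : est y N - Ef - (N%:R^-1 * \sum_(k < N) f (y k) - Ef - (g *m m) 0 0 - \tr (lyap S D *m invmx S *m B)) =
  E1 - ((gbar y N - g) *m m) 0 0 - \tr (Kp *m invmx S *m (Bbar y N - B)) + \tr (lyap S (m *m m^T) *m invmx S *m B).
  have -> : lyap S (m *m m^T) = lyap S D - Kp by rewrite /Kp /H lyapB opprB addrC subrK.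
  rewrite /E1 mulmxBl mulmxBr [((_ *m m) - _) 0 0]mxE [(- (g *m m)) 0 0]mxE.
  rewrite [in RHS]mulmxBl [in RHS]mulmxBl !raddfB /=; ring.
have t4 (p q r s : R) : `|p - q - r + s| <= `|p| + `|q| + `|r| + `|s|.
  by rewrite (le_trans (ler_normD _ _)) // lerD2r (le_trans (ler_normB _ _)) // lerD2r ler_normB.
apply: (le_trans (t4 _ _ _ _)).
have b1 : `|((gbar y N - g) *m m) 0 0| <= n' * Q ^+ 2.
  by apply: (le_trans (mxnorm_entry _ _ _)); apply: (le_trans (mxnormM_le hg hm)); rewrite -mulrA.
have hKp : `|Kp| <= 2 * Cl * Q by apply: (le_trans (Hl _)); rewrite [leRHS](_ : _ = Cl * (2 * Q)) ?ler_wpM2l //; ring.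
have b2 : `|\tr (Kp *m invmx S *m (Bbar y N - B))| <= n' * (n' * (n' * (2 * Cl) * `|invmx S|)) * Q ^+ 2.
  apply: (le_trans (mxtrace_le _)); rewrite -/n' -mulrA ler_wpM2l //.
  apply: (le_trans (mxnormM_le (mxnormM_le hKp (lexx `|invmx S|)) hB)).
  by rewrite -/n' le_of_eq //; ring.
have hKm : `|lyap S (m *m m^T)| <= Cl * Q ^+ 2 by apply: (le_trans (Hl _)); rewrite ler_wpM2l.
have b3 : `|\tr (lyap S (m *m m^T) *m invmx S *m B)| <= n' * (n' * (n' * Cl * `|invmx S|) * `|B|) * Q ^+ 2.
  apply: (le_trans (mxtrace_le _)); rewrite -/n' -mulrA ler_wpM2l //.
  apply: (le_trans (mxnormM_le (mxnormM_le hKm (lexx `|invmx S|)) (lexx `|B|))).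
  by rewrite -/n' le_of_eq //; ring.
apply: (@le_trans _ _ ((K1 + K2) * Q ^+ 2)); last by rewrite ler_wpM2r // lerDl.
rewrite mulrDl /K2 !mulrDl -!addrA; rewrite !addrA in hE1 b1 b2 b3 *; lra.
Qed.

End gauss_estimator.

Section local_positivity.
Context {R : realType} {n : nat}.
Notation lam := (@lebesgue_tuple R n).

Lemma L1_tcube (c : n.-tuple R) (e : R) : 0 <= e -> L1 lam (\1_(tcube c e) : n.-tuple R -> R).
Proof.
move=> e0; apply/integrableP; split.
  by apply/measurable_EFinP; apply: measurable_indic; exact: measurable_tcube.
rewrite (_ : (fun x => `|(\1_(tcube c e) x)%:E|%E) = (fun x => (\1_(tcube c e) x : R)%:E)).
  rewrite integral_indic //; last exact: measurable_tcube.
  by rewrite setIT [X in (X < _)%E](lebesgue_tcube c e0) ltry.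
by apply/funext => x; rewrite /= ger0_norm // indicE.
Qed.

Lemma Ex_tcube (c : n.-tuple R) (e : R) : 0 <= e -> Ex lam (\1_(tcube c e) : n.-tuple R -> R) = (2 * e) ^+ n.
Proof.
move=> e0; transitivity (fine (\int[lam]_t (\1_(tcube c e) t : R)%:E)%E); first by [].
rewrite integral_indic //; last exact: measurable_tcube.
by rewrite setIT [X in fine X](lebesgue_tcube c e0).
Qed.

Lemma tcube_norm (c : 'cV[R]_n) (t : n.-tuple R) (e : R) : 0 <= e ->
  tcube (tuple_of_col c) e t -> `|col_of_tuple t - c| <= e.
Proof.
move=> e0 h; apply: mxnorm_le => // i j; rewrite ord1 !mxE.
have := h i; rewrite tnth_mktuple => /andP[h1 h2].
by rewrite ler_norml; apply/andP; split; lra.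
Qed.

Lemma Ex_gt0_local (psi : 'cV[R]_n -> R) c (e r : R) : 0 < e -> 0 < r -> (forall x, 0 <= psi x) ->
  L1 lam (fun t => psi (col_of_tuple t)) -> (forall x, `|x - c| <= r -> e <= psi x) ->
  0 < Ex lam (fun t => psi (col_of_tuple t)).
Proof.
move=> e0 r0 psi0 L h.
apply: (@lt_le_trans _ _ (Ex lam (fun t => e * \1_(tcube (tuple_of_col c) r) t))).
  by rewrite ExZ ?L1_tcube ?Ex_tcube ?ltW // mulr_gt0 // exprn_gt0 // mulr_gt0.
apply: Ex_le => //; first by apply: L1Z; rewrite L1_tcube // ltW.
move=> t; rewrite indicE; case: (boolP (_ \in _)) => [/set_mem ht|_] /=; last by rewrite mulr0.
by rewrite mulr1 h // tcube_norm // ltW.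
Qed.

End local_positivity.

Section continuity.
Context {R : realType} {V : topologicalType}.
Implicit Types f g : V -> R.

Lemma contD f g : continuous f -> continuous g -> continuous (fun x => f x + g x).
Proof. by move=> hf hg x; apply: (@continuousD _ R^o); [exact: hf|exact: hg]. Qed.
Lemma contM f g : continuous f -> continuous g -> continuous (fun x => f x * g x).
Proof. by move=> hf hg x; apply: continuousM; [exact: hf|exact: hg]. Qed.
Lemma cont_sum (I : Type) (s : seq I) (F : I -> V -> R) : (forall i, continuous (F i)) ->
  continuous (fun x => \sum_(i <- s) F i x).
Proof.
move=> h; elim: s => [|i s IH].
  by have -> : (fun x => \sum_(i <- [::]) F i x) = (fun=> 0); [apply/funext => x; rewrite big_nil|exact: cst_continuous].
have -> : (fun x => \sum_(i <- i :: s) F i x) = (fun x => F i x + \sum_(i <- s) F i x).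
  by apply/funext => x; rewrite big_cons.
exact: contD.
Qed.

End continuity.

(** * Rate of the variance in the Gaussian case *)

Section part_one.
Context {R : realType} {n : nat} {d : measure_display} {T : measurableType d}.
Variables (P : probability T R) (X : T -> 'cV[R]_n) (Xs : nat -> T -> 'cV[R]_n).
Variables (mu : 'cV[R]_n) (Sigma : 'M[R]_n).
Hypothesis pSigma : posdef Sigma.
Hypothesis dX : has_density P X (gauss_pdf mu Sigma).
Hypothesis iidX : iid_copies P X Xs.
Variable f : 'cV[R]_n -> R.
Hypotheses (sf : smooth f) (cf : compact (supp f)).
Implicit Types (x : 'cV[R]_n).
Notation lam := (@lebesgue_tuple R n).

Let a i := Ex P (fun w => 'D_(evec i) f (X w)).
Let F := mean_hessian P X f.
Let Ef := Ex P (fun w => f (X w)).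
Notation elf := (ell P X mu Sigma f).
Let s2 := Ex P (fun w => elf (X w) ^+ 2).
Let s20 : 0 <= s2. Proof. by apply: Ex_ge0 => w; exact: sqr_ge0. Qed.
Let mXs k : mmeas (Xs k). Proof. by apply: random_vector_mmeas; case: iidX => _ []. Qed.

Lemma gauss_pdf_lb c : exists2 e : R, 0 < e & forall x, `|x - c| <= 1 -> e <= gauss_pdf mu Sigma x.
Proof.
have detS : 0 < Num.sqrt ((pi *+ 2) ^+ n * \det Sigma) \/ Num.sqrt ((pi *+ 2) ^+ n * \det Sigma) = 0.
  by have := sqrtr_ge0 ((pi *+ 2) ^+ n * \det Sigma); rewrite le_eqVlt => /orP[/eqP<-|]; [right|left].
case: detS => [s0|s0]; last first.
  (* a vanishing density would contradict total mass one *)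
  have z : (fun x => gauss_pdf mu Sigma x) = (fun=> 0).
    by apply/funext => x; rewrite /gauss_pdf s0 invr0 mul0r.
  have := density_Ex dX (vborel_cst 1) (L1_cst P 1); rewrite Ex_cst.
  have -> : (fun t : n.-tuple R => 1 * gauss_pdf mu Sigma (col_of_tuple t)) = (fun=> 0).
    by apply/funext => t; rewrite (congr1 (fun h => h (col_of_tuple t)) z) mulr0.
  have -> : Ex lam (fun=> 0) = 0.
    transitivity (fine (\int[lam]_t (0 : R)%:E)%E); first by [].
    by rewrite integral0_eq.
  by move=> /eqP; rewrite oner_eq0.
pose M := n%:R ^+ 2 * `|invmx Sigma| * (n%:R * (1 + `|c - mu|) ^+ 2).
exists ((Num.sqrt ((pi *+ 2) ^+ n * \det Sigma))^-1 * expR (- M / 2)).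
  by rewrite mulr_gt0 ?expR_gt0 // invr_gt0.
move=> x hx; rewrite /gauss_pdf ler_wpM2l ?invr_ge0 ?sqrtr_ge0 // ler_expR ler_pM2r // lerN2.
rewrite -!/(bform _ _ _) -!/(qform _ _) (le_trans (ler_norm _)) // (le_trans (qform_le_mxnorm _ _)) //.
rewrite ler_wpM2l ?mulr_ge0 ?sqr_ge0 // qform1E.
apply: (@le_trans _ _ (\sum_(i < n) (1 + `|c - mu|) ^+ 2)); last first.
  by rewrite sumr_const card_ord mulr_natl.
apply: ler_sum => i _; rewrite -[_ ^+ 2](@ger0_norm) ?sqr_ge0 // normrX ler_pXn2r ?nnegrE ?addr_ge0 //.
rewrite (le_trans (mxnorm_entry _ _ _)) //.
have -> : x - mu = (x - c) + (c - mu) by rewrite addrA subrK.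
by rewrite (le_trans (ler_normD _ _)) // lerD2r.
Qed.

Lemma quad_continuous (b : 'I_n -> R) (M : 'M[R]_n) c : continuous (quad mu b M c).
Proof.
have cc i : continuous (fun y : 'cV[R]_n => y i 0 - mu i 0).
  by move=> x; apply: continuousB; [exact: coord_continuous|exact: cst_continuous].
apply: contD; first by apply: cont_sum => i; apply: contM; [exact: cst_continuous|exact: cc].
apply: contM; first exact: cst_continuous.
apply: contD; last exact: cst_continuous.
apply: cont_sum => i; apply: cont_sum => j; apply: contM; first exact: cst_continuous.
by apply: contM; exact: cc.
Qed.

Lemma ell_eq0 : s2 = 0 -> forall x, elf x = 0.
Proof.
move=> s0 c; apply: contrapT => /eqP nz.
have [e1 e10 h1] := gauss_pdf_lb c.
have cl : continuous elf.
  have -> : elf = (fun x => f x + (- Ef + -1 * quad mu a F (\sum_i \sum_j F i j * Sigma i j) x)).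
    by apply/funext => x; rewrite mulN1r addrA.
  apply: contD; first exact: smooth_cont.
  apply: contD; first exact: cst_continuous.
  by apply: contM; [exact: cst_continuous|exact: quad_continuous].
have e20 : 0 < `|elf c| / 2 by rewrite divr_gt0 // normr_gt0.
have := cl c => /cvgrPdist_lt /(_ _ e20) /nbhs_normP [r /= r0 hr].
have [L1e _] := Ex_ell_sqr pSigma dX sf cf.
have mel : vborel (fun x => elf x ^+ 2) by apply: measurable_funX; exact: (vborel_cont cl).
have : 0 < s2; last by rewrite s0 ltxx.
rewrite /s2 (density_Ex dX mel L1e).
apply: (@Ex_gt0_local _ _ (fun x => elf x ^+ 2 * gauss_pdf mu Sigma x) c ((`|elf c| / 2) ^+ 2 * e1) (Num.min 1 (r / 2))).
- by rewrite mulr_gt0 // exprn_gt0.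
- by rewrite lt_min ltr01 divr_gt0.
- by move=> x; rewrite mulr_ge0 ?sqr_ge0 //; case: dX => _ [].
- exact: (density_L1 dX mel L1e).
move=> x; rewrite le_min => /andP[x1 x2]; apply: ler_pM; rewrite ?sqr_ge0 ?(ltW e10) ?h1 //.
have xr : `|c - x| < r by rewrite distrC (le_lt_trans x2) // ltr_pdivrMr // ltr_pMr // ltr1n.
have := hr x xr => h.
have h2 : `|elf c| / 2 <= `|elf x|.
  have := ler_normB (elf c) (elf x - elf c) => _.
  have : `|elf c| <= `|elf c - elf x| + `|elf x| by rewrite -{1}(subrK (elf x) (elf c)) ler_normD.
  by move: h; lra.
by rewrite -[leRHS]ger0_norm ?sqr_ge0 // normrX ler_pXn2r ?nnegrE // ltW.
Qed.

(** The third finite difference of a polynomial of degree two vanishes. *)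
Lemma quad_difference (b : 'I_n -> R) (M : 'M[R]_n) c x v :
  quad mu b M c x = 3 * quad mu b M c (x + v) - 3 * quad mu b M c (x + 2 *: v) + quad mu b M c (x + 3 *: v).
Proof.
rewrite /quad.
have e1 : \sum_i b i * (x i 0 - mu i 0) = 3 * (\sum_i b i * ((x + v) i 0 - mu i 0))
    - 3 * (\sum_i b i * ((x + 2 *: v) i 0 - mu i 0)) + \sum_i b i * ((x + 3 *: v) i 0 - mu i 0).
  by rewrite !mulr_sumr -sumrB -big_split; apply: eq_bigr => i _ /=; rewrite !mxE; ring.
have e2 : \sum_i \sum_j M i j * ((x i 0 - mu i 0) * (x j 0 - mu j 0)) =
    3 * (\sum_i \sum_j M i j * (((x + v) i 0 - mu i 0) * ((x + v) j 0 - mu j 0)))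
    - 3 * (\sum_i \sum_j M i j * (((x + 2 *: v) i 0 - mu i 0) * ((x + 2 *: v) j 0 - mu j 0)))
    + \sum_i \sum_j M i j * (((x + 3 *: v) i 0 - mu i 0) * ((x + 3 *: v) j 0 - mu j 0)).
  rewrite !mulr_sumr -sumrB -big_split; apply: eq_bigr => i _ /=.
  by rewrite !mulr_sumr -sumrB -big_split; apply: eq_bigr => j _ /=; rewrite !mxE; ring.
rewrite {1}e1 {1}e2; ring.
Qed.

(** The case of a vanishing bracket, where the formula forces the estimator to have variance zero.
    Here [f] is a polynomial of degree at most two; its third difference along a direction with
    large coordinates expresses [f x] by values outside the support, so [f = 0]. In dimension zero
    there is no such direction and [f] is trivially constant. *)
Lemma ell_eq0_cst : s2 = 0 -> exists c, forall x, f x = c.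
Proof.
move=> /ell_eq0 h.
have [n0|n0] := posnP n.
  exists (f 0) => x; congr f; apply/matrixP => -[i hi]; exfalso; by rewrite n0 in hi.
exists 0 => x.
have [M hM] : exists M, forall y, M < `|y| -> f y = 0.
  have := compact_bounded cf => -[M [_ hM]]; exists (M + 1) => y hy; apply: notin_supp.
  have M1 : M < M + 1 by rewrite ltrDl.
  by move=> /(hM _ M1) /=; rewrite leNgt hy.
pose t := `|M| + `|x| + 1.
pose v : 'cV[R]_n := const_mx t.
have t0 : 0 < t by rewrite ltr_wpDl // addr_ge0.
have big (k : R) : 1 <= k -> f (x + k *: v) = 0.
  move=> k1; apply: hM; pose i0 := Ordinal n0.
  apply: lt_le_trans (mxnorm_entry _ i0 0); rewrite !mxE.
  have xi := mxnorm_entry x i0 0; have := ler_norm M.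
  have : t <= k * t by rewrite ler_peMl // ltW.
  move=> p1 p2; apply: (@lt_le_trans _ _ (x i0 0 + k * t)); last exact: ler_norm.
  have tE : t = `|M| + `|x| + 1 by [].
  move: xi; rewrite ler_norml => /andP[xi _]; lra.
have e k : 1 <= k -> quad mu a F (\sum_i \sum_j F i j * Sigma i j) (x + k *: v) = - Ef.
  by move=> k1; have := h (x + k *: v); rewrite /ell (big k k1) -/Ef -/F => /eqP; rewrite sub0r subr_eq0 => /eqP.
have := h x; rewrite /ell -/Ef -/F (quad_difference _ _ _ _ v).
have := e 1; rewrite scale1r => -> //; rewrite !e ?ler1n //; lra.
Qed.

Let est N w := mm2_estimator P X Xs f N w.

Let estE N w : (0 < N)%N -> est N w = N%:R^-1 * \sum_(k < N) f (mmap mu Sigma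
   (pcov mu Sigma (Xs^~ w) N xpredT) (pmean mu (Xs^~ w) N xpredT) (Xs k w)).
Proof. by move=> N0; rewrite /est mm2_estimatorE // (mean_vec_gauss pSigma dX) (cov_mx_gauss pSigma dX). Qed.

Let mest N : (0 < N)%N -> measurable_fun [set: T] (est N).
Proof.
move=> N0; have -> : est N = (fun w => N%:R^-1 * \sum_(k < N) f (mmap mu Sigma
   (pcov mu Sigma (Xs^~ w) N xpredT) (pmean mu (Xs^~ w) N xpredT) (Xs k w))) by apply/funext => w; exact: estE.
apply: measurable_funM; first exact: measurable_cst.
apply: measurable_sumr => k _; apply: measurable_mmap => //; [exact: posdef_psd|exact: smooth_cont].
Qed.

Let best : exists C, forall N w, (0 < N)%N -> `|est N w| <= C.
Proof.
have [C C0 hC] := smooth_bounded sf cf; exists C => N w N0; rewrite estE // normrM ger0_norm ?invr_ge0 //.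
rewrite -[leRHS](@mulKf _ N%:R) ?pnatr_eq0 -?lt0n // ler_wpM2l ?invr_ge0 //.
apply: (le_trans (ler_norm_sum _ _ _)); apply: (@le_trans _ _ (\sum_(k < N) C)); first exact: ler_sum.
by rewrite sumr_const card_ord mulr_natl.
Qed.

Let L1est2 N : (0 < N)%N -> L1 P (fun w => est N w ^+ 2).
Proof.
move=> N0; have [C hC] := best; apply: (@L1_bounded _ _ _ P _ (C ^+ 2)).
  by apply: measurable_funX; exact: mest.
by move=> w; rewrite normrX ler_pXn2r ?nnegrE ?hC // (le_trans (normr_ge0 (est N w))) ?hC.
Qed.

Let Var N := Ex P (fun w => (est N w - Ex P (est N)) ^+ 2).

Let VarE N : (0 < N)%N -> 'V_P[mm2_estimator P X Xs f N] = (Var N)%:E.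
Proof. by move=> N0; rewrite variance_Ex //; [exact: mest|exact: L1est2]. Qed.

Let stat_moment : exists2 K : R, 0 <= K & forall N, (0 < N)%N ->
  L1 P (fun w => stat_dev P X mu Sigma f (Xs^~ w) N ^+ 4) /\
  Ex P (fun w => stat_dev P X mu Sigma f (Xs^~ w) N ^+ 4) <= K / N%:R ^+ 2.
Proof.
pose st r := stat P X mu Sigma f r.
have vs r : vborel (st r) by have [dg []] := stein_stat P X mu Sigma sf cf r.
have L4 r : L1 P (fun w => st r (X w) ^+ 4).
  have [dg h] := stein_stat P X mu Sigma sf cf r; have h2 := stein_mul h h.
  have := gauss_L1 pSigma dX (stein_mul h2 h2); congr L1; apply/funext => w; rewrite /st; ring.
have L1s r : L1 P (fun w => st r (X w)).
  by have [dg h] := stein_stat P X mu Sigma sf cf r; exact: (gauss_L1 pSigma dX h).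
have p4 (z : R) : 0 <= z ^+ 4 by rewrite (exprM z 2 2) sqr_ge0.
pose m4 r := 3 * Ex P (fun w => st r (X w) ^+ 2) ^+ 2 + Ex P (fun w => st r (X w) ^+ 4).
have m40 r : 0 <= m4 r.
  apply: addr_ge0; first by rewrite mulr_ge0 // sqr_ge0.
  by apply: Ex_ge0 => w; exact: p4.
pose I := index_enum (@stat_index n).
exists (8 ^+ size I * \sum_(r <- I) m4 r); first by rewrite mulr_ge0 ?exprn_ge0 // sumr_ge0.
move=> N N0; pose q r w := N%:R^-1 * \sum_(k < N) st r (Xs k w).
have q4 r : L1 P (fun w => q r w ^+ 4) /\ Ex P (fun w => q r w ^+ 4) <= m4 r / N%:R ^+ 2.
  have [h1 h2] := @sum_pow4_le _ _ _ _ P X Xs iidX _ xpredT (vs r) (L1s r) (Ex_stat pSigma dX sf cf r) N (L4 r).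
  have -> : (fun w => q r w ^+ 4) = (fun w => (N%:R^-1) ^+ 4 * (\sum_(k < N) st r (Xs k w)) ^+ 4).
    by apply/funext => w; rewrite exprMn.
  split; first exact: L1Z.
  rewrite ExZ // (le_trans (ler_wpM2l _ h2)) ?exprn_ge0 ?invr_ge0 //.
  by rewrite le_of_eq // /m4; field; rewrite pnatr_eq0 -lt0n.
have dom w : stat_dev P X mu Sigma f (Xs^~ w) N ^+ 4 <= 8 ^+ size I * \sum_(r <- I) q r w ^+ 4.
  exact: (sum_pow4_le_sum I (q^~ w)).
have Ld : L1 P (fun w => 8 ^+ size I * \sum_(r <- I) q r w ^+ 4).
  by apply: L1Z; apply: L1_sum => r _; have [] := q4 r.
have Ls : L1 P (fun w => stat_dev P X mu Sigma f (Xs^~ w) N ^+ 4).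
  apply: (L1_dom _ Ld) => [|w]; last by rewrite ger0_norm ?dom // exprn_ge0 // stat_dev_ge0.
  apply: measurable_funX; apply: measurable_sumr => r _; apply: measurableT_comp => //.
  apply: measurable_funM; first exact: measurable_cst.
  apply: measurable_sumr => k _; apply: (vborel_comp (vs r)); by case: iidX => _ [].
split => //; apply: (le_trans (Ex_le Ls Ld dom)).
rewrite ExZ; last by apply: L1_sum => r _; have [] := q4 r.
rewrite -mulrA ler_wpM2l ?exprn_ge0 // Ex_sum => [|r _]; last by have [] := q4 r.
by rewrite mulr_suml; apply: ler_sum => r _; have [] := q4 r.
Qed.

(** The linear term has variance exactly [s2 / N], and the remainder has second moment of order
    [N^(-2)] by the fourth moments of the statistics; [variance_perturb] combines the two. *)
Lemma variance_rate : exists2 C : R, 0 <= C & forall N, (0 < N)%N -> `|N%:R * Var N - s2| <= C / Num.sqrt N%:R.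
Proof.
have [C C0 HC] := estimator_linearization pSigma dX sf cf.
have [K K0 HK] := stat_moment.
pose k := Num.sqrt (C ^+ 2 * K); have k0 : 0 <= k by exact: sqrtr_ge0.
have kk : k ^+ 2 = C ^+ 2 * K by rewrite sqr_sqrtr // mulr_ge0 // sqr_ge0.
pose s := Num.sqrt s2; have s0 : 0 <= s by exact: sqrtr_ge0.
have ss : s ^+ 2 = s2 by rewrite sqr_sqrtr.
exists (2 * s * k + 2 * k ^+ 2) => [|N N0]; first by rewrite addr_ge0 // !mulr_ge0 // sqr_ge0.
have N1 : 1 <= N%:R :> R by rewrite ler1n.
have N00 : 0 < N%:R :> R by rewrite ltr0n.
set rN := Num.sqrt N%:R; have rr : rN ^+ 2 = N%:R by rewrite sqr_sqrtr // ltW.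
have r1 : 1 <= rN by rewrite -sqrtr1 ler_wsqrtr.
have r0 : 0 < rN by apply: lt_le_trans r1.
have [[L1e _] E0] := (Ex_ell_sqr pSigma dX sf cf, Ex_ell pSigma dX sf cf).
have [me _ _ _] := stein_ell pSigma dX sf cf 0.
have L1l := L1_sqr (vborel_comp me dX.1) L1e.
pose S w := \sum_(j < N) elf (Xs j w).
have [S2 ES2] := @sum_sqr _ _ _ _ P X Xs iidX elf xpredT me L1l E0 N L1e.
pose L w := N%:R^-1 * S w.
have mS : measurable_fun [set: T] S.
  by apply: measurable_sumr => j _; apply: (vborel_comp me); case: iidX => _ [].
have mL : measurable_fun [set: T] L by apply: measurable_funM => //; exact: measurable_cst.
have L2e : (fun w => L w ^+ 2) = (fun w => (N%:R^-1) ^+ 2 * S w ^+ 2) by apply/funext => w; rewrite exprMn.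
have L2 : L1 P (fun w => L w ^+ 2) by rewrite L2e; exact: L1Z.
have EL2 : Ex P (fun w => L w ^+ 2) = s2 / N%:R.
  rewrite L2e ExZ // ES2 -/s2 sumr_const card_ord; by field; rewrite gt_eqF.
have EL : Ex P L = 0.
  rewrite /L ExZ; last by apply: L1_sum => j _; exact: (L1_copy iidX).
  rewrite Ex_sum => [|j _]; last exact: (L1_copy iidX).
  by rewrite big1 ?mulr0 // => j _; rewrite (Ex_copy iidX).
pose U w := est N w - Ef.
have mU : measurable_fun [set: T] U by apply: measurable_funB; [exact: mest|exact: measurable_cst].
have L1est : L1 P (est N) by exact: (L1_sqr (mest N0) (L1est2 N0)).
have U2 : L1 P (fun w => U w ^+ 2).
  have := L1D (L1B (L1est2 N0) (L1Z (2 * Ef) L1est)) (L1_cst P (Ef ^+ 2)).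
  by congr L1; apply/funext => w; rewrite /U; ring.
have [D4 ED4] := HK N N0.
have rb : Ex P (fun w => (U w - L w) ^+ 2) <= (k / N%:R) ^+ 2.
  have mr : measurable_fun [set: T] (fun w => U w - L w) by exact: measurable_funB.
  have dom w : (U w - L w) ^+ 2 <= C ^+ 2 * stat_dev P X mu Sigma f (Xs^~ w) N ^+ 4.
    have := HC (Xs^~ w) N N0; rewrite -estE // -/(U w) -/(S w) -/(L w) => h.
    rewrite -[leLHS]ger0_norm ?sqr_ge0 // normrX (_ : _ * _ = (C * stat_dev P X mu Sigma f (Xs^~ w) N ^+ 2) ^+ 2); last by ring.
    by rewrite ler_pXn2r ?nnegrE // mulr_ge0 // sqr_ge0.
  have Lr : L1 P (fun w => (U w - L w) ^+ 2).
    apply: (L1_dom _ (L1Z (C ^+ 2) D4)); first exact: measurable_funX.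
    by move=> w; rewrite ger0_norm ?sqr_ge0.
  apply: (le_trans (Ex_le Lr (L1Z (C ^+ 2) D4) dom)); rewrite ExZ //.
  have -> : (k / N%:R) ^+ 2 = C ^+ 2 * (K / N%:R ^+ 2) by rewrite exprMn kk exprVn mulrA.
  by rewrite ler_wpM2l // sqr_ge0.
have a0 : 0 <= s / rN by rewrite divr_ge0 // ltW.
have b0 : 0 <= k / N%:R by rewrite divr_ge0.
have La : Ex P (fun w => L w ^+ 2) <= (s / rN) ^+ 2 by rewrite EL2 exprMn exprVn ss rr.
have := variance_perturb a0 b0 mL mU L2 U2 EL La rb.
have -> : Ex P (fun w => (U w - Ex P U) ^+ 2) = Var N.
  congr Ex; apply/funext => w; rewrite /U ExB //; last exact: L1_cst.
  by rewrite Ex_cst; ring.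
rewrite EL2 => h.
have -> : N%:R * Var N - s2 = N%:R * (Var N - s2 / N%:R) by field; rewrite gt_eqF.
rewrite normrM ger0_norm ?(ltW N00) // (le_trans (ler_wpM2l (ltW N00) h)) //.
have -> : N%:R * (2 * (s / rN) * (k / N%:R) + 2 * (k / N%:R) ^+ 2) = 2 * s * k / rN + 2 * k ^+ 2 / N%:R.
  by field; rewrite !gt_eqF.
rewrite [leRHS]mulrDl lerD2l ler_wpM2l ?mulr_ge0 ?sqr_ge0 // lef_pV2 ?posrE //.
by rewrite -rr expr2 ler_peMl // ltW.
Qed.

Lemma gauss_estimator_variance : exists A : nat -> R, one_plus_O_invsqrt A /\ (forall N, 0 <= A N) /\
  forall N, (0 < N)%N -> 'V_P[mm2_estimator P X Xs f N] = (A N / N%:R * s2)%:E.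
Proof.
have [C C0 hC] := variance_rate.
(* No quotient by [s2] is possible here; [f] is then constant and [A N = 1] will do. *)
have [s0|s0] := eqVneq s2 0.
  exists (fun=> 1); split.
    exists 0, 0%N => N _; by rewrite subrr normr0 mul0r.
  split => // N N0; rewrite VarE // s0 mulr0; congr EFin.
  have [c hc] := ell_eq0_cst s0.
  have e : est N = (fun=> c).
    apply/funext => w; rewrite estE //; under eq_bigr do rewrite hc.
    by rewrite sumr_const card_ord -[c *+ N]mulr_natl mulKf // pnatr_eq0 -lt0n.
  transitivity (Ex P (fun=> (0 : R))); last exact: Ex_cst.
  by congr Ex; apply/funext => w; rewrite e Ex_cst subrr expr0n.
have s2p : 0 < s2 by rewrite lt_def s0.
have V0 N : 0 <= Var N by apply: Ex_ge0 => w; exact: sqr_ge0.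
exists (fun N => N%:R * Var N / s2); split; last first.
  split => [N|N N0]; first by rewrite divr_ge0 // mulr_ge0.
  have n0 : N%:R != 0 :> R by rewrite pnatr_eq0 -lt0n.
  by rewrite VarE // mulrAC divfK // [N%:R * _]mulrC mulfK.
exists (C / s2), 1%N => N N1.
have -> : N%:R * Var N / s2 - 1 = (N%:R * Var N - s2) / s2 by field.
rewrite normrM [`|s2^-1|]ger0_norm ?invr_ge0 // mulrAC ler_wpM2r ?invr_ge0 //; exact: hC.
Qed.

End part_one.

Lemma one_plus_O_cvg {R : realType} (A : nat -> R) : one_plus_O_invsqrt A -> A m @[m --> \oo] --> (1 : R).
Proof.
move=> [C [N0 h]]; apply/cvgrPdist_le => e e0.
have [M hM] : exists M : nat, (`|C| / e) ^+ 2 <= M%:R.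
  by exists (Num.bound ((`|C| / e) ^+ 2)); rewrite ltW // archi_boundP // sqr_ge0.
exists (maxn N0 M.+1) => // N /=; rewrite geq_max => /andP[h1 h2].
rewrite distrC (le_trans (h N h1)) //.
have N00 : 0 < N%:R :> R by rewrite ltr0n (leq_trans _ h2).
rewrite ler_pdivrMr ?sqrtr_gt0 // (le_trans (ler_norm C)) //.
rewrite -ler_pdivrMl // mulrC -[leLHS]ger0_norm ?divr_ge0 ?(ltW e0) // -sqrtr_sqr ler_wsqrtr //.
by rewrite (le_trans hM) // ler_nat ltnW.
Qed.

Theorem gaussian_moment_matching {R : realType} {n : nat} {d : measure_display} {T : measurableType d}
  (P : probability T R) (X : T -> 'cV[R]_n) (Xs : nat -> T -> 'cV[R]_n) (mu : 'cV[R]_n) (Sigma : 'M[R]_n) :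
  posdef Sigma -> has_density P X (gauss_pdf mu Sigma) -> iid_copies P X Xs ->
  UMM2 P X Xs (gauss_pdf mu Sigma) /\
  forall f : 'cV[R]_n -> R, smooth f -> compact (supp f) ->
    exists A : nat -> R, one_plus_O_invsqrt A /\
      forall N : nat, (0 < N)%N ->
        'V_P[mm2_estimator P X Xs f N] =
          (A N / N%:R *
            (fine 'V_P[fun w => f (X w)]
             - (mean_grad P X f *m Sigma *m (mean_grad P X f)^T) ord0 ord0
             - 2^-1 * \tr ((Sigma *m mean_hessian P X f)
                           *m (Sigma *m mean_hessian P X f))))%:E.
Proof.
move=> pS dX iidX; split => [f sf cf _|f sf cf]; last first.
  have [A [hA [_ hV]]] := gauss_estimator_variance pS dX iidX sf cf; exists A; split => // N N0.
  by have [_ [<- _]] := Ex_ell_sqr pS dX sf cf; exact: hV.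
have [A [hA [A0 hV]]] := gauss_estimator_variance pS dX iidX sf cf.
exists A; split; first exact: one_plus_O_cvg.
move=> N N0; rewrite hV //.
have [_ [-> V0]] := Ex_ell_sqr pS dX sf cf.
have Lf : L1 P (fun w => f (X w) ^+ 2).
  have := gauss_L1 pS dX (stein_mul (stein_smooth mu 0 sf cf) (stein_smooth mu 0 sf cf)).
  by congr L1; apply/funext => w; rewrite expr2.
have mf : measurable_fun [set: T] (fun w => f (X w)) by apply: (vborel_comp (vborel_cont (smooth_cont sf)) dX.1).
rewrite (variance_Ex mf Lf) -EFinM lee_fin /= ler_wpM2l ?divr_ge0 //.
(* The subtracted terms add up to the second moment of the projection, so the bracket is at most the
   variance of [f]. *)
move: V0; set x := _ ord0 ord0; set y := 2^-1 * _; lra.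
Qed.

(** * The inequality forced by moment matching *)

(** Update of a partial covariance when a sample with centred value [v] enters with weight [c], [D]
    and [u] being the moments without it. *)
Lemma pcov_algebra {R : comNzRingType} {n : nat} (S D : 'M[R]_n) (u v : 'cV[R]_n) (c : R) :
  (S + (D + c *: (v *m v^T - S)) - (u + c *: v) *m (u + c *: v)^T) - (S + D - u *m u^T) =
  c *: (v *m v^T - S - (u *m v^T + v *m u^T + c *: (v *m v^T))).
Proof. by apply/matrixP => i j; rewrite !(mxE, big_ord1); ring. Qed.

(** * The effect of removing one sample *)

Section leave_one_out.
Context {R : realType} {n : nat}.
Variables (mu : 'cV[R]_n) (Sigma : 'M[R]_n).
Hypothesis pSigma : posdef Sigma.
Variable f : 'cV[R]_n -> R.
Hypotheses (sf : smooth f) (cf : compact (supp f)).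
Variables (g : 'rV[R]_n) (B : 'M[R]_n).
Implicit Types (x : 'cV[R]_n) (y : nat -> 'cV[R]_n) (Q : pred nat).

Let S := sqrtmx Sigma.
Let Si := invmx S.

(** The statistics [stat] with free centring constants: outside the Gaussian case the means [g] and
    [B] have no expression by Stein's identity. *)
Definition gstat (r : @stat_index n) x : R :=
  match r with
  | inl (inl i) => x i 0 - mu i 0
  | inl (inr (i, j)) => (x i 0 - mu i 0) * (x j 0 - mu j 0) - Sigma i j
  | inr (inl i) => 'D_(evec i) f x - g 0 i
  | inr (inr (i, j)) => 'D_(evec j) f x * (x i 0 - mu i 0) - B i j
  end.

Definition gdev y N Q : R := \sum_r `|N%:R^-1 * \sum_(k < N | Q k) gstat r (y k)|.
(** Under second moments this weight is integrable, and its higher powers may fail to be; the error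
    bounds are arranged accordingly. *)
Definition wt x : R := 1 + `|x - mu| ^+ 2.
(** The influence function of the estimator: the direct contribution of one sample point, corrected
    by its first order effect on all other terms through the sample mean and covariance. *)
Definition influence x : R :=
  f x - (g *m (x - mu)) 0 0 - \tr (lyap S ((x - mu) *m (x - mu)^T - Sigma) *m Si *m B).

Definition est_part y N Q : R := N%:R^-1 *
  \sum_(k < N | Q k) f (mmap mu Sigma (pcov mu Sigma y N Q) (pmean mu y N Q) (y k)).

Lemma gdev_ge0 y N Q : 0 <= gdev y N Q. Proof. exact: sumr_ge0. Qed.

Lemma gdev_ge y N Q r : `|N%:R^-1 * \sum_(k < N | Q k) gstat r (y k)| <= gdev y N Q.
Proof. by rewrite /gdev (bigD1 r) //= lerDl sumr_ge0. Qed.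

Lemma wt_ge1 x : 1 <= wt x. Proof. by rewrite lerDl sqr_ge0. Qed.

Lemma norm_le_wt x : `|x - mu| <= wt x.
Proof. by rewrite /wt; have := sqr_ge0 (`|x - mu| - 1); have := normr_ge0 (x - mu); nra. Qed.

Lemma outer_le_wt x : `|(x - mu) *m (x - mu)^T| <= `|x - mu| ^+ 2.
Proof.
have := mxnormM_le (lexx `|x - mu|) (lexx `|(x - mu)^T|).
by rewrite mxnorm_tr mul1r -expr2.
Qed.

Let y_le_wt x : `|x - mu| ^+ 2 <= wt x. Proof. by rewrite lerDr. Qed.

Lemma gdmean_le y N Q : `|dmean mu y N Q| <= gdev y N Q.
Proof.
apply: mxnorm_le; first exact: gdev_ge0.
move=> i j; rewrite ord1; apply: le_trans (gdev_ge y N Q (inl (inl i))) => /=.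
have -> : dmean mu y N Q i 0 = N%:R^-1 * \sum_(k < N | Q k) (y k i 0 - mu i 0); last by [].
rewrite /dmean mxE summxE; congr (_ * _); apply: eq_bigr => k _; by rewrite !mxE.
Qed.

Lemma gdcov_entry y N Q i j : dcov mu Sigma y N Q i j = N%:R^-1 * \sum_(k < N | Q k) gstat (inl (inr (i, j))) (y k).
Proof.
rewrite mxE summxE; congr (_ * _); apply: eq_bigr => k _ /=.
by rewrite !mxE big_ord1 !mxE.
Qed.

Lemma gdcov_le y N Q : `|dcov mu Sigma y N Q| <= gdev y N Q.
Proof.
apply: mxnorm_le; first exact: gdev_ge0.
by move=> i j; rewrite gdcov_entry; exact: gdev_ge.
Qed.

Section remove.
Variables (y : nat -> 'cV[R]_n) (N k : nat).
Hypothesis kN : (k < N)%N.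
Let Q : pred nat := fun j => j != k.
Let N00 : 0 < N%:R :> R. Proof. by rewrite ltr0n (leq_ltn_trans _ kN). Qed.
Let iN : 0 <= N%:R^-1 :> R. Proof. by rewrite invr_ge0 ltW. Qed.
Let NN : N%:R^-1 * N%:R = 1 :> R. Proof. by rewrite mulVf // gt_eqF. Qed.

Lemma sum_remove (V : zmodType) (F : nat -> V) : \sum_(j < N) F j = F k + \sum_(j < N | Q j) F j.
Proof.
rewrite (bigD1 (Ordinal kN)) //=; congr (_ + _); apply: eq_bigl => j; by rewrite -val_eqE.
Qed.

Lemma dmean_remove : dmean mu y N xpredT = dmean mu y N Q + N%:R^-1 *: (y k - mu).
Proof. by rewrite /dmean (sum_remove (fun j => y j - mu)) scalerDr addrC. Qed.

Lemma dcov_remove : dcov mu Sigma y N xpredT =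
  dcov mu Sigma y N Q + N%:R^-1 *: ((y k - mu) *m (y k - mu)^T - Sigma).
Proof. by rewrite /dcov (sum_remove (fun j => (y j - mu) *m (y j - mu)^T - Sigma)) scalerDr addrC. Qed.

Let gk : 'rV[R]_n := N%:R^-1 *: \sum_(j < N | Q j) grad f (y j).
Let Bk : 'M[R]_n := N%:R^-1 *: \sum_(j < N | Q j) ((y j - mu) *m grad f (y j)).

Let avg_cst (c : R) : N%:R^-1 * \sum_(j < N | Q j) c = c - N%:R^-1 * c.
Proof.
have := sum_remove (fun=> c); rewrite sumr_const card_ord => /(congr1 (fun z => N%:R^-1 * z)).
by rewrite -[c *+ N]mulr_natl mulrA NN mul1r mulrDr => {2}->; rewrite addrC addrA addNr add0r.
Qed.

Lemma gk_le : `|gk - g| <= gdev y N Q + N%:R^-1 * `|g|.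
Proof.
apply: mxnorm_le; first by rewrite addr_ge0 ?gdev_ge0 // mulr_ge0.
move=> i j; rewrite ord1.
have -> : (gk - g) 0 j = N%:R^-1 * (\sum_(k < N | Q k) gstat (inr (inl j)) (y k)) - N%:R^-1 * g 0 j.
  rewrite /= sumrB mulrBr avg_cst [LHS]mxE [(- g) 0 j]mxE /gk mxE summxE.
  under eq_bigr do rewrite mxE; ring.
rewrite (le_trans (ler_normB _ _)) // lerD ?gdev_ge // normrM (ger0_norm iN) ler_wpM2l //.
exact: mxnorm_entry.
Qed.

Lemma Bk_le : `|Bk - B| <= gdev y N Q + N%:R^-1 * `|B|.
Proof.
apply: mxnorm_le; first by rewrite addr_ge0 ?gdev_ge0 // mulr_ge0.
move=> i j.
have -> : (Bk - B) i j = N%:R^-1 * (\sum_(k < N | Q k) gstat (inr (inr (i, j))) (y k)) - N%:R^-1 * B i j.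
  rewrite /= sumrB mulrBr avg_cst (_ : (Bk - B) i j = Bk i j - B i j); last by rewrite !mxE.
  rewrite /Bk mxE summxE.
  under eq_bigr do rewrite mxE big_ord1 !mxE mulrC; ring.
rewrite (le_trans (ler_normB _ _)) // lerD ?gdev_ge // normrM (ger0_norm iN) ler_wpM2l //.
exact: mxnorm_entry.
Qed.

Lemma avg_wt_le : gdev y N Q <= 1 ->
  N%:R^-1 * \sum_(j < N | Q j) (1 + `|y j - mu|) ^+ 2 <= 2 + 2 * (n%:R + `|\tr Sigma|).
Proof.
move=> q1; have h2 (u : R) : (1 + u) ^+ 2 <= 2 + 2 * u ^+ 2 by have := sqr_ge0 (1 - u); nra.
apply: (@le_trans _ _ (N%:R^-1 * \sum_(j < N | Q j) (2 + 2 * \sum_i (y j - mu) i 0 ^+ 2))).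
  rewrite ler_wpM2l // ler_sum // => j _; rewrite (le_trans (h2 _)) // lerD2l ler_pM2l //.
  exact: sqr_norm_le.
rewrite big_split /= mulrDr avg_cst; apply: lerD; first by rewrite gerBl mulr_ge0.
rewrite -mulr_sumr mulrCA ler_pM2l //.
have -> : N%:R^-1 * (\sum_(j < N | Q j) \sum_i (y j - mu) i 0 ^+ 2) =
    \tr (dcov mu Sigma y N Q) + (1 - N%:R^-1) * \tr Sigma.
  rewrite exchange_big /= mulr_sumr /mxtrace mulr_sumr -big_split /=; apply: eq_bigr => i _.
  rewrite gdcov_entry /= sumrB mulrBr avg_cst mulrBl mul1r subrK; congr (_ * _); apply: eq_bigr => j _.
  by rewrite !mxE expr2.
apply: lerD.
  apply: (le_trans (ler_norm _)); apply: (le_trans (mxtrace_le _)).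
  by rewrite ler_piMr // (le_trans (gdcov_le _ _ _)).
apply: (le_trans (ler_norm _)); rewrite normrM ler_piMl // ger0_norm.
  by rewrite gerBl.
by rewrite subr_ge0 invf_le1 // ler1n (leq_ltn_trans _ kN).
Qed.

Let A := pcov mu Sigma y N xpredT.
Let m := pmean mu y N xpredT.
Let A' := pcov mu Sigma y N Q.
Let m' := pmean mu y N Q.
Let z := y k - mu.
Let dk := dmean mu y N Q.
Let E' := dk *m z^T + z *m dk^T + N%:R^-1 *: (z *m z^T).
Let H := z *m z^T - Sigma - E'.

Lemma pmean_diff : m - m' = N%:R^-1 *: z.
Proof. by rewrite /m /m' /pmean dmean_remove addrA [mu + _ + _]addrC addrK. Qed.

Lemma pcov_diff : A - A' = N%:R^-1 *: H.
Proof.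
rewrite /A /A' /pcov dcov_remove dmean_remove -/dk -/z /H /E'.
exact: pcov_algebra.
Qed.

Lemma est_diff : N%:R * (est_part y N xpredT - est_part y N Q) = f (mmap mu Sigma A m (y k)) +
  \sum_(j < N | Q j) (f (mmap mu Sigma A m (y j)) - f (mmap mu Sigma A' m' (y j))).
Proof.
rewrite /est_part -mulrBr mulrA [N%:R * _]mulrC NN mul1r.
by rewrite (sum_remove (fun j => f (mmap mu Sigma A m (y j)))) sumrB addrA.
Qed.

Lemma linear_sum_loo : \sum_(j < N | Q j) (grad f (y j) *m ((m - m') + lyap S (A - A') *m Si *m (y j - mu))) 0 0 =
  (gk *m z) 0 0 + \tr (lyap S H *m Si *m Bk).
Proof.
rewrite pmean_diff pcov_diff lyapZ.
under eq_bigr do rewrite mulmxDr mxE.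
rewrite big_split /=; congr (_ + _).
  rewrite /gk -scalemxAl mxE mulmx_suml summxE mulr_sumr; apply: eq_bigr => j _.
  by rewrite -scalemxAr mxE.
rewrite /Bk -scalemxAr linearZ /= mulmx_sumr raddf_sum /= mulr_sumr; apply: eq_bigr => j _.
rewrite (mulmxA (lyap S H *m Si)) (mxtrace_mulC (lyap S H *m Si *m (y j - mu)) (grad f (y j))) trace_mx11.
by rewrite -!scalemxAl -scalemxAr mxE.
Qed.

(** Exact splitting of the error: the displacement of the removed point itself, the Taylor
    remainders of the other points, the fluctuations of [gk] and [Bk], and the part [E'] of the
    covariance change beyond [z *m z^T - Sigma]. *)
Lemma loo_error_identity : N%:R * (est_part y N xpredT - est_part y N Q) - influence (y k) =
  (f (mmap mu Sigma A m (y k)) - f (y k)) +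
  \sum_(j < N | Q j) (f (mmap mu Sigma A m (y j)) - f (mmap mu Sigma A' m' (y j)) +
     (grad f (y j) *m ((m - m') + lyap S (A - A') *m Si *m (y j - mu))) 0 0)
  - ((gk - g) *m z) 0 0 - \tr (lyap S H *m Si *m (Bk - B)) + \tr (lyap S E' *m Si *m B).
Proof.
rewrite est_diff [in RHS]big_split /= linear_sum_loo /influence -/z.
have -> : lyap S (z *m z^T - Sigma) = lyap S H + lyap S E' by rewrite -lyapD /H subrK.
rewrite [in RHS]mulmxBl [((_ *m _) - _) 0 0]mxE [(- (g *m z)) 0 0]mxE.
rewrite [in RHS]mulmxBr !mulmxDl !raddfB !raddfD /=; ring.
Qed.

End remove.

Lemma influence_le : exists2 K, 0 <= K & forall x, `|influence x| <= K * wt x.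
Proof.
have [Cf Cf0 Hf] := smooth_bounded sf cf.
have [Cl Cl0 Hl] := lyap_norm S.
pose n' : R := n%:R; have n0 : 0 <= n' by exact: ler0n.
exists (Cf + n' * `|g| + n' * (n' * (n' * (Cl * (1 + `|Sigma|)) * `|Si|) * `|B|)) => [|x].
  by rewrite !addr_ge0 // !mulr_ge0 // addr_ge0.
have w1 := wt_ge1 x; have w0 : 0 <= wt x by apply: le_trans w1.
have t3 (p q r : R) : `|p - q - r| <= `|p| + `|q| + `|r|.
  by rewrite (le_trans (ler_normB _ _)) // lerD2r ler_normB.
apply: (le_trans (t3 _ _ _)); rewrite !mulrDl; apply: lerD; first apply: lerD.
- by rewrite (le_trans (Hf x)) // ler_peMr.
- apply: (le_trans (mxnorm_entry _ _ _)); exact: (mxnormM_le (lexx _) (norm_le_wt x)).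
apply: (le_trans (mxtrace_le _)); rewrite -/n' -[leRHS]mulrA ler_wpM2l //.
have hL : `|lyap S ((x - mu) *m (x - mu)^T - Sigma)| <= Cl * (1 + `|Sigma|) * wt x.
  apply: (le_trans (Hl _)); rewrite -mulrA ler_wpM2l // (le_trans (ler_normB _ _)) // mulrDl mul1r lerD //.
    by rewrite (le_trans (outer_le_wt x)).
  by rewrite ler_peMr.
apply: (le_trans (mxnormM_le (mxnormM_le hL (lexx `|Si|)) (lexx `|B|))).
by rewrite -/n' le_of_eq //; ring.
Qed.

(** The contribution of the removed point to the error is capped at 1, since [wt] has one moment
    only: [wt * min 1 (wt / N)] still has a mean tending to 0, while [wt ^+ 2 / N] may have none. *)
Lemma loo_linearization : exists de C : R, [/\ 0 < de, 0 <= C & forall y N k, (k < N)%N ->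
  let Q := fun j => j != k in gdev y N Q <= de ->
  `|N%:R * (est_part y N xpredT - est_part y N Q) - influence (y k)| <=
     C * wt (y k) * (gdev y N Q + Num.min 1 (wt (y k) / N%:R))].
Proof.
have [dl [C [dl0 C0 HT]]] := smooth_mmap_taylor mu pSigma sf cf.
have [Cf Cf0 Hf] := smooth_bounded sf cf.
have [Cg Cg0 Hg] := smooth_grad_bounded sf cf.
have [Cl Cl0 Hl] := lyap_norm S.
have [Ki Ki0 Hi] := influence_le.
pose n' : R := n%:R; have n0 : 0 <= n' by exact: ler0n.
pose c1 : R := 5 + `|Sigma|; have c10 : 0 <= c1 by rewrite addr_ge0.
pose c2 : R := c1 + 7; have c20 : 0 <= c2 by rewrite addr_ge0.
(* [de] keeps the deviation without the sample below [dl / 2], and [d1] leaves the other half to the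
   change caused by the sample. *)
pose de : R := Num.min 1 (dl / 6).
pose d1 : R := Num.min 1 (dl / (2 * c2)).
have c2p : 0 < c2 by rewrite ltr_wpDl.
have de0 : 0 < de by rewrite lt_min ltr01 divr_gt0.
have d10 : 0 < d1 by rewrite lt_min ltr01 divr_gt0 // mulr_gt0.
have d11 : d1 <= 1 by rewrite ge_min lexx.
pose M : R := 2 + 2 * (n' + `|\tr Sigma|).
pose K1 : R := n' * Cg * (1 + n' * (n' * Cl * `|Si|)) * c2 + C * c2 * dl * 2.
pose K2 : R := C * c2 * c2 * M * 2.
pose K3 : R := n' * (1 + `|g|).
pose K4 : R := n' * (n' * (n' * (Cl * c1) * `|Si|) * (1 + `|B|)).
pose K5 : R := n' * (n' * (n' * (Cl * 2) * `|Si|) * `|B|).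
pose K6 : R := (2 * Cf / d1 + Ki) / d1.
have M0 : 0 <= M by rewrite addr_ge0 // mulr_ge0 // addr_ge0.
have K10 : 0 <= K1.
  by apply: addr_ge0; apply: mulr_ge0 => //; apply: mulr_ge0 => //; [exact: mulr_ge0|rewrite addr_ge0 // !mulr_ge0|exact: mulr_ge0|exact: ltW].
have K20 : 0 <= K2 by do 4 (apply: mulr_ge0 => //).
have K30 : 0 <= K3 by rewrite mulr_ge0 // addr_ge0.
have K40 : 0 <= K4 by rewrite !mulr_ge0 // addr_ge0.
have K50 : 0 <= K5 by rewrite !mulr_ge0.
have K60 : 0 <= K6.
  by apply: divr_ge0; [rewrite addr_ge0 // divr_ge0 ?mulr_ge0 // ltW|exact: ltW].
exists de, (K1 + K2 + K3 + K4 + K5 + K6); split => //; first by do 5 (apply: addr_ge0 => //).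
move=> y N k kN Q hQ.
have N00 : 0 < N%:R :> R by rewrite ltr0n (leq_ltn_trans _ kN).
have iN : 0 <= N%:R^-1 :> R by rewrite invr_ge0 ltW.
have NN : N%:R^-1 * N%:R = 1 :> R by rewrite mulVf // gt_eqF.
set q := gdev y N Q in hQ *; have q0 : 0 <= q by exact: gdev_ge0.
have q1 : q <= 1 by rewrite (le_trans hQ) // ge_min lexx.
set Y := wt (y k); have Y1 : 1 <= Y by exact: wt_ge1.
have Y0 : 0 < Y by apply: lt_le_trans Y1.
set t := Y / N%:R; have t0 : 0 <= t by rewrite divr_ge0 // ltW.
have mint0 : 0 <= Num.min 1 t by rewrite le_min ler01.
(* An outlier: [N] is at most [wt (y k) / d1], so the boundedness of [f] already gives an error of
   the order of the weight. *)
have [ht|ht] := leP t d1; last first.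
  apply: (@le_trans _ _ (K6 * Y * Num.min 1 t)); last first.
    apply: ler_pM => //; [by apply: mulr_ge0 => //; exact: ltW| |by rewrite lerDr].
    by rewrite ler_wpM2r ?(ltW Y0) // lerDr; do 4 (apply: addr_ge0 => //).
  have md : d1 <= Num.min 1 t by rewrite le_min d11 ltW.
  have hN : N%:R <= Y / d1.
    by rewrite ler_pdivlMr // mulrC -ler_pdivlMr // ltW.
  have best Q' : `|est_part y N Q'| <= Cf.
    rewrite normrM (ger0_norm iN); apply: (@le_trans _ _ (N%:R^-1 * (N%:R * Cf))); last by rewrite mulrA NN mul1r.
    rewrite ler_wpM2l // (le_trans (ler_norm_sum _ _ _)) //.
    rewrite -[N in leRHS]card_ord mulr_natl -sumr_const big_mkcond /=; apply: ler_sum => j _.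
    by case: (Q' j).
  apply: (@le_trans _ _ ((2 * Cf / d1 + Ki) * Y)).
    rewrite (le_trans (ler_normB _ _)) // mulrDl lerD ?Hi // normrM (ger0_norm (ltW N00)).
    have -> : 2 * Cf / d1 * Y = (Y / d1) * (2 * Cf) by ring.
    apply: ler_pM => //.
    by rewrite (le_trans (ler_normB _ _)) // mulr_natl mulr2n lerD.
  have -> : K6 * Y * Num.min 1 t = (2 * Cf / d1 + Ki) * Y * (Num.min 1 t / d1) by rewrite /K6; ring.
  rewrite ler_peMr //; last by rewrite ler_pdivlMr // mul1r.
  by apply: mulr_ge0; rewrite ?(ltW Y0) // addr_ge0 // divr_ge0 ?mulr_ge0 // ltW.
have -> : Num.min 1 t = t by apply/min_idPr; rewrite (le_trans ht).
have t1 : t <= 1 by exact: le_trans d11.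
have qt0 : 0 <= q + t by rewrite addr_ge0.
set z := y k - mu; have zY : `|z| <= Y by exact: norm_le_wt.
have z2Y : `|z| ^+ 2 <= Y by rewrite lerDr.
set dk := dmean mu y N Q; have hdk : `|dk| <= q by exact: gdmean_le.
set Dk := dcov mu Sigma y N Q; have hDk : `|Dk| <= q by exact: gdcov_le.
set A := pcov mu Sigma y N xpredT; set m := pmean mu y N xpredT.
set A' := pcov mu Sigma y N Q; set m' := pmean mu y N Q.
pose E' := dk *m z^T + z *m dk^T + N%:R^-1 *: (z *m z^T).
pose H := z *m z^T - Sigma - E'.
have eA : A - A' = N%:R^-1 *: H by exact: (pcov_diff y kN).
have em : m - m' = N%:R^-1 *: z by exact: (pmean_diff y kN).
have hzz : `|z *m z^T| <= Y by rewrite (le_trans (outer_le_wt _)).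
have hE : `|E'| <= 2 * (Y * (q + t)).
  have a1 := mxnormM_le hdk (_ : `|z^T| <= Y); rewrite mxnorm_tr mul1r in a1.
  have a2 := mxnormM_le zY (_ : `|dk^T| <= q); rewrite mxnorm_tr mul1r in a2.
  have a3 : `|N%:R^-1 *: (z *m z^T)| <= Y * t.
    rewrite normrZ (ger0_norm iN) (@le_trans _ _ t) //; last by rewrite ler_peMl.
    by rewrite /t mulrC ler_wpM2r.
  have Yt : 0 <= Y * t by rewrite mulr_ge0 // ltW.
  rewrite (le_trans (ler_normD _ _)) // (le_trans (lerD (ler_normD _ _) (lexx _))) //.
  have := a1 zY; have := a2 hdk; move: a3; nra.
have hH : `|H| <= c1 * Y.
  apply: (le_trans (ler_normB _ _)); apply: (le_trans (lerD (ler_normB _ _) (lexx _))).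
  have : `|Sigma| <= `|Sigma| * Y by rewrite ler_peMr.
  have : 2 * (Y * (q + t)) <= 4 * Y by nra.
  move: hE hzz; rewrite /c1; lra.
have hAA : `|A - A'| <= c1 * t.
  rewrite eA normrZ (ger0_norm iN) (le_trans (ler_wpM2l iN hH)) // le_of_eq // /t; ring.
have hmm : `|m - m'| <= t.
  by rewrite em normrZ (ger0_norm iN) /t mulrC ler_wpM2r.
have mE : m' - mu = dk by rewrite /m' /pmean addrC addKr.
have AE : A' - Sigma = Dk - dk *m dk^T by rewrite /A' /pcov -/Dk -/dk [Sigma + _]addrC addrAC addrK.
have hdd : `|dk *m dk^T| <= q.
  have := mxnormM_le hdk (_ : `|dk^T| <= q); rewrite mxnorm_tr mul1r => /(_ hdk) /le_trans; apply.
  by rewrite ler_piMl.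
have dev' : mmap_dev mu Sigma A' m' <= 3 * q.
  have := le_trans (ler_normB Dk (dk *m dk^T)) (lerD hDk hdd).
  rewrite /mmap_dev AE mE; move: hdk; lra.
have dev : mmap_dev mu Sigma A m <= c2 * (q + t).
  have h1 : `|A - Sigma| <= `|A - A'| + `|A' - Sigma|.
    exact: ler_distD.
  have h2 : `|m - mu| <= `|m - m'| + `|m' - mu|.
    exact: ler_distD.
  have c1q : 0 <= c1 * q by rewrite mulr_ge0.
  move: dev' h1 h2 hAA hmm c1q q0 t0; rewrite /mmap_dev /c2; clear; lra.
have rho : `|A - A'| + `|m - m'| <= c2 * t by move: hAA hmm; rewrite /c2; lra.
have rho0 : 0 <= `|A - A'| + `|m - m'| by rewrite addr_ge0.
have devd0 : 0 <= mmap_dev mu Sigma A m by rewrite addr_ge0.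
have devd0' : 0 <= mmap_dev mu Sigma A' m' by rewrite addr_ge0.
have hqd : 6 * q <= dl.
  have : q <= dl / 6 by rewrite (le_trans hQ) // ge_min lexx orbT.
  lra.
have htd : 2 * (c2 * t) <= dl.
  have : t <= dl / (2 * c2) by rewrite (le_trans ht) // ge_min lexx orbT.
  by rewrite ler_pdivlMr ?mulr_gt0 // mulrC mulrA.
have devdl' : mmap_dev mu Sigma A' m' <= dl by move: dev' hqd q0; clear; lra.
have devdl : mmap_dev mu Sigma A m <= dl.
  have h1 : `|A - Sigma| <= `|A - A'| + `|A' - Sigma|.
    exact: ler_distD.
  have h2 : `|m - mu| <= `|m - m'| + `|m' - mu|.
    exact: ler_distD.
  move: dev' h1 h2 rho htd hqd; rewrite /mmap_dev; clear; lra.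
have eta : mmap_dev mu Sigma A m + mmap_dev mu Sigma A' m' <= 2 * (c2 * (q + t)).
  have c1q : 0 <= c1 * (q + t) by rewrite mulr_ge0.
  move: dev dev' c1q q0 t0; rewrite /c2; clear; lra.
have sS := pSigma.1.
have sA := pcov_sym mu y N xpredT sS; have sA' := pcov_sym mu y N Q sS.
rewrite (loo_error_identity y kN) -/Q -/z -/A -/A' -/m -/m' -/dk -/E' -/H.
set gk := N%:R^-1 *: _; set Bk := N%:R^-1 *: _.
have hgk : `|gk - g| <= q + t * `|g|.
  apply: (le_trans (gk_le y kN)); rewrite lerD2l ler_wpM2r //.
  by rewrite /t ler_peMl.
have hBk : `|Bk - B| <= q + t * `|B|.
  apply: (le_trans (Bk_le y kN)); rewrite lerD2l ler_wpM2r //.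
  by rewrite /t ler_peMl.
have P1 : `|f (mmap mu Sigma A m (y k)) - f (y k)| <= K1 * Y * (q + t).
  have hid : mmap_dev mu Sigma Sigma mu <= dl by rewrite mmap_dev_id ltW.
  have := HT A Sigma m mu (y k) sA sS devdl hid.
  rewrite mmap_id // mmap_dev_id addr0 -/z; set G := (_ *m _) 0 0; set dv := mmap_dev mu Sigma A m in dev devd0 devdl *.
  have -> : `|A - Sigma| + `|m - mu| = dv by [].
  move=> h.
  have hG : `|G| <= n' * Cg * (dv + n' * (n' * (Cl * dv) * `|Si|) * Y).
    have hA : `|A - Sigma| <= dv by rewrite lerDl.
    have hL : `|lyap S (A - Sigma)| <= Cl * dv by rewrite (le_trans (Hl _)) // ler_wpM2l.
    apply: (le_trans (mxnorm_entry _ _ _)); apply: mxnormM_le => //.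
    rewrite (le_trans (ler_normD _ _)) // lerD //; first by rewrite lerDr.
    exact: (mxnormM_le (mxnormM_le hL (lexx `|Si|)) zY).
  have Y2 : (1 + `|z|) ^+ 2 <= 2 * Y by rewrite /Y /wt -/z -subr_ge0 (_ : _ - _ = (1 - `|z|) ^+ 2) ?sqr_ge0 //; ring.
  have hR : C * dv * dv * (1 + `|z|) ^+ 2 <= C * (c2 * (q + t)) * dl * (2 * Y).
    apply: ler_pM; rewrite ?mulr_ge0 ?sqr_ge0 //; apply: ler_pM; rewrite ?mulr_ge0 //.
    exact: ler_wpM2l.
  have hG2 : n' * Cg * (dv + n' * (n' * (Cl * dv) * `|Si|) * Y) <= n' * Cg * (1 + n' * (n' * Cl * `|Si|)) * (c2 * (q + t)) * Y.
    pose u := n' * (n' * Cl * `|Si|); have u0 : 0 <= u by rewrite !mulr_ge0.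
    rewrite [leLHS](_ : _ = n' * Cg * (dv + u * dv * Y)); last by rewrite /u; ring.
    rewrite [leRHS](_ : _ = n' * Cg * ((1 + u) * (c2 * (q + t)) * Y)); last by rewrite /u; ring.
    rewrite ler_wpM2l ?mulr_ge0 //; apply: (@le_trans _ _ ((1 + u) * dv * Y)).
      by rewrite !mulrDl mul1r lerD // ler_peMr.
    by rewrite ler_wpM2r ?(ltW Y0) // ler_wpM2l // addr_ge0.
  have -> : f (mmap mu Sigma A m (y k)) - f (y k) = (f (mmap mu Sigma A m (y k)) - f (y k) + G) - G by rewrite addrK.
  apply: (le_trans (ler_normB _ _)); apply: (le_trans (lerD (le_trans h hR) (le_trans hG hG2))).
  by rewrite le_of_eq // /K1; ring.
have P2 : `|\sum_(j < N | Q j) (f (mmap mu Sigma A m (y j)) - f (mmap mu Sigma A' m' (y j)) +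
     (grad f (y j) *m ((m - m') + lyap S (A - A') *m Si *m (y j - mu))) 0 0)| <= K2 * Y * (q + t).
  apply: (le_trans (ler_norm_sum _ _ _)).
  apply: (@le_trans _ _ (\sum_(j < N | Q j) (C * (c2 * t) * (2 * (c2 * (q + t)))) * (1 + `|y j - mu|) ^+ 2)).
    apply: ler_sum => j _; apply: (le_trans (HT A A' m m' (y j) sA sA' devdl devdl')).
    apply: ler_wpM2r; first exact: sqr_ge0.
    by apply: ler_pM => //; rewrite ?mulr_ge0 ?addr_ge0 //; exact: ler_wpM2l.
  rewrite -mulr_sumr.
  have := avg_wt_le kN q1; rewrite -/n' -/M => hM.
  have : \sum_(j < N | Q j) (1 + `|y j - mu|) ^+ 2 <= N%:R * M by rewrite -ler_pdivrMl.
  have cc : 0 <= C * (c2 * t) * (2 * (c2 * (q + t))).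
    by apply: mulr_ge0; [apply: mulr_ge0 => //; exact: mulr_ge0|apply: mulr_ge0 => //; exact: mulr_ge0].
  move=> /(ler_wpM2l cc) h; apply: (le_trans h).
  by rewrite le_of_eq // /K2 /t; field; rewrite gt_eqF.
have P3 : `|((gk - g) *m z) 0 0| <= K3 * Y * (q + t).
  apply: (le_trans (mxnorm_entry _ _ _)); apply: (le_trans (mxnormM_le hgk zY)).
  rewrite -/n' [leLHS](_ : _ = n' * ((q + t * `|g|) * Y)); last by ring.
  rewrite [leRHS](_ : _ = n' * ((1 + `|g|) * (q + t) * Y)); last by rewrite /K3; ring.
  have g0 : 0 <= `|g| * q by rewrite mulr_ge0.
  rewrite ler_wpM2l // ler_wpM2r ?(ltW Y0) //; move: g0 q0 t0; clear; lra.
have P4 : `|\tr (lyap S H *m Si *m (Bk - B))| <= K4 * Y * (q + t).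
  have hL : `|lyap S H| <= Cl * (c1 * Y) by rewrite (le_trans (Hl _)) // ler_wpM2l.
  apply: (le_trans (mxtrace_le _)); rewrite -/n'.
  apply: (le_trans (ler_wpM2l n0 (mxnormM_le (mxnormM_le hL (lexx `|Si|)) hBk))); rewrite -/n'.
  have -> : K4 * Y * (q + t) = n' * (n' * (n' * (Cl * (c1 * Y)) * `|Si|) * ((1 + `|B|) * (q + t))) by rewrite /K4; ring.
  rewrite ler_wpM2l // ler_wpM2l //; first by rewrite !mulr_ge0 // ltW.
  have : 0 <= `|B| * q by rewrite mulr_ge0.
  move: q0 t0; clear; lra.
have P5 : `|\tr (lyap S E' *m Si *m B)| <= K5 * Y * (q + t).
  have hL : `|lyap S E'| <= Cl * (2 * (Y * (q + t))) by rewrite (le_trans (Hl _)) // ler_wpM2l.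
  apply: (le_trans (mxtrace_le _)); rewrite -/n'.
  apply: (le_trans (ler_wpM2l n0 (mxnormM_le (mxnormM_le hL (lexx `|Si|)) (lexx `|B|)))); rewrite -/n'.
  by rewrite le_of_eq // /K5; ring.
have t5 (p a b c e : R) : `|p + a - b - c + e| <= `|p| + `|a| + `|b| + `|c| + `|e|.
  rewrite (le_trans (ler_normD _ _)) // lerD2r (le_trans (ler_normB _ _)) // lerD2r.
  by rewrite (le_trans (ler_normB _ _)) // lerD2r ler_normD.
apply: (le_trans (t5 _ _ _ _ _)).
have Z0 : 0 <= K6 * Y * (q + t) by apply: mulr_ge0 => //; apply: mulr_ge0 => //; exact: ltW.
move: P1 P2 P3 P4 P5 Z0; clear; lra.
Qed.

End leave_one_out.

(** * Correlation of the estimator with a truncated sum *)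

Section key_inequality.
Context {R : realType} {n : nat} {d : measure_display} {T : measurableType d}.
Variables (P : probability T R) (X : T -> 'cV[R]_n) (Xs : nat -> T -> 'cV[R]_n).
Hypothesis iidX : iid_copies P X Xs.
Let mu := mean_vec P X.
Let Sigma := cov_mx P X.
Hypothesis pSigma : posdef Sigma.
Hypothesis L2 : forall i, L1 P (fun w => X w i 0 ^+ 2).
Variable f : 'cV[R]_n -> R.
Hypotheses (sf : smooth f) (cf : compact (supp f)).
Implicit Types (x : 'cV[R]_n) (k l N : nat) (Q : pred nat).

Let S := sqrtmx Sigma.
Let rvX : random_vector X. Proof. by case: iidX. Qed.
Let rvXs k : random_vector (Xs k). Proof. by case: iidX => _ []. Qed.

Definition wgrad : 'rV[R]_n := \row_i Ex P (fun w => 'D_(evec i) f (X w)).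
Definition wcoord_grad : 'M[R]_n :=
  \matrix_(i, j) Ex P (fun w => 'D_(evec j) f (X w) * (X w i 0 - mu i 0)).
Let g := wgrad.
Let B := wcoord_grad.
Definition lyap_coef i j : R := \tr (lyap S (delta_mx i j) *m invmx S *m B).
Definition linear_part x : R := \sum_i g 0 i * (x i 0 - mu i 0) +
  \sum_i \sum_j lyap_coef i j * ((x i 0 - mu i 0) * (x j 0 - mu j 0) - Sigma i j).

Notation infl := (influence mu Sigma f g B).
Notation gst := (gstat mu Sigma f g B).
Notation W := (wt mu).
Notation gd Q := (fun N w => gdev mu Sigma f g B (Xs^~ w) N Q).

Lemma influenceE x : infl x = f x - linear_part x.
Proof.
rewrite /influence /linear_part opprD addrA; congr (_ - _ - _).
  by rewrite mxE; apply: eq_bigr => i _; rewrite !mxE.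
set M := _ - Sigma; rewrite {1}(matrix_sum_delta M) lyap_sum mulmx_suml mulmx_suml raddf_sum /=.
apply: eq_bigr => i _; rewrite lyap_sum mulmx_suml mulmx_suml raddf_sum /=.
apply: eq_bigr => j _; rewrite lyapZ -!scalemxAl linearZ /= /lyap_coef mulrC; congr (_ * _).
by rewrite /M !(mxE, big_ord1).
Qed.

Let L1X i : L1 P (fun w => X w i 0).
Proof. by apply: L1_sqr => //; exact: random_vector_mmeas. Qed.
Let L1y i : L1 P (fun w => X w i 0 - mu i 0). Proof. by apply: L1B => //; exact: L1_cst. Qed.
Let L2y i : L1 P (fun w => (X w i 0 - mu i 0) ^+ 2).
Proof.
have := L1D (L1B (L2 i) (L1Z (2 * mu i 0) (L1X i))) (L1_cst P (mu i 0 ^+ 2)).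
by congr L1; apply/funext => w; ring.
Qed.
Let my i : measurable_fun [set: T] (fun w => X w i 0 - mu i 0). Proof. exact: (L1_meas (L1y i)). Qed.
Let L1yy i j : L1 P (fun w => (X w i 0 - mu i 0) * (X w j 0 - mu j 0)). Proof. exact: L1_mul. Qed.
Let muE i : mu i 0 = Ex P (fun w => X w i 0). Proof. by rewrite /mu mxE fine_expectation. Qed.
Let Ey i : Ex P (fun w => X w i 0 - mu i 0) = 0.
Proof. by rewrite ExB ?Ex_cst ?muE ?subrr //; exact: L1_cst. Qed.
Let Eyy i j : Ex P (fun w => (X w i 0 - mu i 0) * (X w j 0 - mu j 0)) = Sigma i j.
Proof.
have -> : Sigma i j = fine (covariance P (fun w => X w i ord0) (fun w => X w j ord0)) by rewrite /Sigma mxE.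
rewrite covariance.unlock fine_expectation; congr Ex; apply/funext => w /=.
by rewrite !fine_expectation -!muE.
Qed.

Let vcoord i : vborel (fun x => x i 0 - mu i 0).
Proof. by apply: measurable_funB; [exact: mmeas_col_of_tuple|exact: measurable_cst]. Qed.
Let vderiv i : vborel ('D_(evec i) f).
Proof. exact: (vborel_cont (smooth_cont (smooth_derive _ sf))). Qed.
Let vgst r : vborel (gst r).
Proof.
case: r => [[i|[i j]]|[i|[i j]]] /=.
- exact: vcoord.
- by apply: measurable_funB; [apply: measurable_funM; exact: vcoord|exact: measurable_cst].
- by apply: measurable_funB; [exact: vderiv|exact: measurable_cst].
- by apply: measurable_funB; [apply: measurable_funM; [exact: vderiv|exact: vcoord]|exact: measurable_cst].
Qed.

Let bderiv i : exists C, forall x, `|'D_(evec i) f x| <= C.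
Proof.
by have [C C0 hC] := smooth_bounded (smooth_derive (evec i) sf) (compact_supp_derive (v := evec i) cf); exists C.
Qed.
Let L1d i : L1 P (fun w => 'D_(evec i) f (X w)).
Proof. by have [C hC] := bderiv i; apply: (@L1_bounded _ _ _ P _ C) => //; exact: (vborel_comp (vderiv i)). Qed.
Let L1dy i j : L1 P (fun w => 'D_(evec j) f (X w) * (X w i 0 - mu i 0)).
Proof.
by have [C hC] := bderiv j; apply: (@L1_mul_bounded _ _ _ _ _ _ C) => //; exact: (vborel_comp (vderiv j)).
Qed.

Let L1gst r : L1 P (fun w => gst r (X w)).
Proof.
by case: r => [[i|[i j]]|[i|[i j]]] /=; rewrite // L1B // L1_cst.
Qed.
Let Egst r : Ex P (fun w => gst r (X w)) = 0.
Proof.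
case: r => [[i|[i j]]|[i|[i j]]] /=; first exact: Ey.
- by rewrite ExB ?Ex_cst ?Eyy ?subrr //; exact: L1_cst.
- by rewrite ExB ?Ex_cst // ?mxE ?subrr //; exact: L1_cst.
- by rewrite ExB ?Ex_cst // ?mxE ?subrr //; exact: L1_cst.
Qed.

Let vW : vborel W.
Proof.
apply: measurable_funD; first exact: measurable_cst.
apply: measurable_funX; apply: measurable_norm.
by apply: mmeasB; [exact: mmeas_col_of_tuple|exact: mmeas_cst].
Qed.
Let L1W : L1 P (fun w => W (X w)).
Proof.
apply: (L1_dom (vborel_comp vW rvX) (L1D (L1_cst P 1) (L1_sum (index_enum 'I_n) (fun i _ => L2y i)))) => w.
rewrite ger0_norm; last by rewrite (le_trans ler01) // wt_ge1.
rewrite lerD2l (le_trans (sqr_norm_le _)) //; apply: ler_sum => i _; by rewrite !mxE.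
Qed.

Let vlin : vborel linear_part.
Proof.
apply: measurable_funD; first by apply: measurable_sumr => i _; apply: measurable_funM; [exact: measurable_cst|exact: vcoord].
apply: measurable_sumr => i _; apply: measurable_sumr => j _; apply: measurable_funM; first exact: measurable_cst.
exact: (vgst (inl (inr (i, j)))).
Qed.
Let vf : vborel f. Proof. exact: (vborel_cont (smooth_cont sf)). Qed.
Let vinfl : vborel infl.
Proof.
have -> : infl = (fun x => f x - linear_part x) by apply/funext => x; exact: influenceE.
exact: measurable_funB.
Qed.
Let L1lin : L1 P (fun w => linear_part (X w)).
Proof.
apply: L1D; first by apply: L1_sum => i _; exact: L1Z.
by apply: L1_sum => i _; apply: L1_sum => j _; apply: L1Z; exact: (L1gst (inl (inr (i, j)))).
Qed.
Let Elin : Ex P (fun w => linear_part (X w)) = 0.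
Proof.
rewrite ExD; last 2 first.
- by apply: L1_sum => i _; exact: L1Z.
- by apply: L1_sum => i _; apply: L1_sum => j _; apply: L1Z; exact: (L1gst (inl (inr (i, j)))).
rewrite Ex_sum => [|i _]; last exact: L1Z.
rewrite big1 ?add0r => [|i _]; last by rewrite ExZ // Ey mulr0.
rewrite Ex_sum => [|i _]; last by apply: L1_sum => j _; apply: L1Z; exact: (L1gst (inl (inr (i, j)))).
rewrite big1 // => i _; rewrite Ex_sum => [|j _]; last by apply: L1Z; exact: (L1gst (inl (inr (i, j)))).
by rewrite big1 // => j _; rewrite (ExZ _ (L1gst (inl (inr (i, j))))) (Egst (inl (inr (i, j)))) mulr0.
Qed.

Let Ef := Ex P (fun w => f (X w)).
Let xi x := f x - Ef.
Let vxi : vborel xi. Proof. by apply: measurable_funB => //; exact: measurable_cst. Qed.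
Let L1f : L1 P (fun w => f (X w)).
Proof.
by have [C C0 hC] := smooth_bounded sf cf; apply: (@L1_bounded _ _ _ P _ C) => //; exact: (vborel_comp vf).
Qed.
Let L1xi : L1 P (fun w => xi (X w)). Proof. by apply: L1B => //; exact: L1_cst. Qed.
Let Exi : Ex P (fun w => xi (X w)) = 0.
Proof. by rewrite ExB ?Ex_cst ?subrr //; exact: L1_cst. Qed.
Let bxi : exists2 c, 0 <= c & forall x, `|xi x| <= c.
Proof.
have [C C0 hC] := smooth_bounded sf cf; exists (C + `|Ef|) => [|x]; first by rewrite addr_ge0.
by rewrite (le_trans (ler_normB _ _)) // lerD2r.
Qed.


Lemma est_part_ext y y' N Q : (forall j, Q j -> y j = y' j) ->
  est_part mu Sigma f y N Q = est_part mu Sigma f y' N Q.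
Proof.
move=> e; rewrite /est_part; congr (_ * _).
have e1 : dmean mu y N Q = dmean mu y' N Q by congr (_ *: _); apply: eq_bigr => j Qj; rewrite e.
have e2 : dcov mu Sigma y N Q = dcov mu Sigma y' N Q by congr (_ *: _); apply: eq_bigr => j Qj; rewrite e.
by apply: eq_bigr => j Qj; rewrite /pcov /pmean e1 e2 e.
Qed.

Let mgd_others k N Q : (forall j, Q j -> j != k) ->
  measurable_fun [set: othersType Xs k] (gd Q N : othersType Xs k -> R).
Proof.
move=> Qk; apply: measurable_sumr => r _; apply: measurableT_comp => //.
apply: measurable_funM; first exact: measurable_cst.
by apply: measurable_sumr => j Qj; apply: vborel_others => //; exact: Qk.
Qed.

Let mest_others k N : (0 < N)%N ->
  measurable_fun [set: othersType Xs k]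
    ((fun w => est_part mu Sigma f (Xs^~ w) N (fun j => j != k)) : othersType Xs k -> R).
Proof.
(* The partial estimator does not look at the [k]-th copy, so this copy may be replaced by the
   constant [mu]; all remaining ingredients are measurable for the other copies. *)
move=> N0; pose Z j : othersType Xs k -> 'cV[R]_n := if j == k then fun=> mu else Xs j.
have mZ j : mmeas (Z j) by rewrite /Z; case: (eqVneq j k) => [_|jk]; [exact: mmeas_cst|exact: mmeas_others].
have -> : (fun w => est_part mu Sigma f (Xs^~ w) N (fun j => j != k)) =
   (fun w : othersType Xs k => est_part mu Sigma f (Z^~ w) N (fun j => j != k)).
  by apply/funext => w; apply: est_part_ext => j jk; rewrite /Z (negbTE jk).
apply: measurable_funM; first exact: measurable_cst.
apply: measurable_sumr => j _; apply: measurable_mmap => //; [exact: posdef_psd|exact: smooth_cont].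
Qed.

Let mest N : (0 < N)%N -> measurable_fun [set: T] (fun w => est_part mu Sigma f (Xs^~ w) N xpredT).
Proof.
move=> N0; apply: measurable_funM; first exact: measurable_cst.
apply: measurable_sumr => j _; apply: measurable_mmap => //; [|exact: posdef_psd|exact: smooth_cont].
by move=> i; exact: random_vector_mmeas.
Qed.

Let best : exists2 C, 0 <= C & forall y N Q, (0 < N)%N -> `|est_part mu Sigma f y N Q| <= C.
Proof.
have [C C0 hC] := smooth_bounded sf cf; exists C => // y N Q N0.
have N00 : 0 < N%:R :> R by rewrite ltr0n.
rewrite normrM ger0_norm ?invr_ge0 ?(ltW N00) // ler_pdivrMl // (le_trans (ler_norm_sum _ _ _)) //.
rewrite -[N in leRHS]card_ord mulr_natl -sumr_const big_mkcond /=; apply: ler_sum => j _.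
by case: (Q j).
Qed.

Lemma gdev_small (e : R) : 0 < e -> exists N0, forall N Q, (N0 <= N)%N ->
  L1 P (gd Q N) /\ Ex P (gd Q N) <= e.
Proof.
move=> e0; pose K : R := #|@stat_index n|%:R + 1.
have K0 : 0 < K by rewrite ltr_wpDl.
have h r : exists N0, forall N Q, (N0 <= N)%N ->
   L1 P (fun w => `|N%:R^-1 * \sum_(j < N | Q j) gst r (Xs j w)|) /\
   Ex P (fun w => `|N%:R^-1 * \sum_(j < N | Q j) gst r (Xs j w)|) <= e / K.
  have [N0 hN] := lln iidX (vgst r) (L1gst r) (divr_gt0 e0 K0); exists N0 => N Q hQ.
  have := hN N Q hQ; rewrite Egst.
  by under eq_fun do under eq_bigr do rewrite subr0.
have [N0 hN] := choice h; exists (\max_r N0 r)%N => N Q NN.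
have hr r := hN r N Q (leq_trans (leq_bigmax r) NN).
split; first by apply: L1_sum => r _; case: (hr r).
rewrite Ex_sum => [|r _]; last by case: (hr r).
apply: (@le_trans _ _ (\sum_(r : @stat_index n) e / K)); first by apply: ler_sum => r _; case: (hr r).
rewrite sumr_const -mulr_natl mulrCA ler_piMr ?(ltW e0) // ler_pdivrMr // mul1r /K lerDl //.
Qed.

(** Dominated convergence with the integrable majorant [W] replaces the missing fourth moments of
    [X]. *)
Lemma weight_tail (e : R) : 0 < e -> exists N0, forall N, (N0 <= N)%N ->
  L1 P (fun w => W (X w) * Num.min 1 (W (X w) / N%:R)) /\
  Ex P (fun w => W (X w) * Num.min 1 (W (X w) / N%:R)) <= e.
Proof.
move=> e0; have W0 x : 0 <= W x by rewrite (le_trans ler01) // wt_ge1.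
pose F N w := W (X w) * Num.min 1 (W (X w) / N%:R).
have mWX : measurable_fun [set: T] (fun w => W (X w)) by exact: (vborel_comp vW).
have mF N : measurable_fun [set: T] (F N).
  apply: measurable_funM => //; apply: measurable_minr; first exact: measurable_cst.
  by apply: measurable_funM => //; exact: measurable_cst.
have m0 N w : 0 <= Num.min 1 (W (X w) / N%:R) by rewrite le_min ler01 divr_ge0.
have dom N w : `|F N w| <= W (X w).
  by rewrite ger0_norm ?mulr_ge0 // ler_piMr // ge_min lexx.
have lim w : F N w @[N --> \oo] --> 0.
  apply: (@squeeze_cvgr _ _ _ _ (fun=> 0) (fun N => W (X w) ^+ 2 * N%:R^-1)).
  - near=> N; rewrite mulr_ge0 //= expr2 -mulrA ler_wpM2l // ge_min lexx orbT //.
  - exact: cvg_cst.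
  - rewrite -[X in _ --> X](mulr0 (W (X w) ^+ 2)); apply: cvgM; first exact: cvg_cst.
    by apply/gtr0_cvgV0; [near=> N; rewrite ltr0n; near: N; exact: nbhs_infty_gt|exact: cvgr_idn].
have [_ c] := Ex_dominated mF lim L1W dom.
have := c; rewrite (Ex_cst P 0) => /cvgrPdist_le /(_ e e0) [N0 _ hN]; exists N0 => N NN; split.
  by apply: (L1_dom (mF N) L1W).
by have := hN N NN; rewrite /= sub0r normrN => /(le_trans (ler_norm _)).
Unshelve. all: by end_near.
Qed.

Section fixed_size.
Variables (de C : R).
Hypotheses (de0 : 0 < de) (C0 : 0 <= C).
Hypothesis lin : forall y N k, (k < N)%N -> gdev mu Sigma f g B y N (fun j => j != k) <= de ->
  `|N%:R * (est_part mu Sigma f y N xpredT - est_part mu Sigma f y N (fun j => j != k)) - infl (y k)| <=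
     C * W (y k) * (gdev mu Sigma f g B y N (fun j => j != k) + Num.min 1 (W (y k) / N%:R)).
Variable c : R.
Hypotheses (c0 : 0 <= c) (xc : forall x, `|xi x| <= c).

(* Lipschitz, and supported where the leave-one-out linearization holds; for Q = {j <> k} it is independent of X(k). *)
Definition cutoff N Q w : R := Num.max 0 (1 - gd Q N w / de).

Let cut01 N Q w : 0 <= cutoff N Q w <= 1.
Proof.
rewrite /cutoff le_max lexx ge_max ler01 /= gerBl divr_ge0 ?(ltW de0) //; exact: gdev_ge0.
Qed.

Let mcut_others k N Q : (forall j, Q j -> j != k) ->
  measurable_fun [set: othersType Xs k] (cutoff N Q : othersType Xs k -> R).
Proof.
move=> Qk; apply: measurable_maxr; first exact: measurable_cst.
apply: measurable_funB; first exact: measurable_cst.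
by apply: measurable_funM; [exact: mgd_others|exact: measurable_cst].
Qed.

Let mcut N Q : measurable_fun [set: T] (cutoff N Q).
Proof.
apply: measurable_maxr; first exact: measurable_cst.
apply: measurable_funB; first exact: measurable_cst.
apply: measurable_funM; last exact: measurable_cst.
apply: measurable_sumr => r _; apply: measurableT_comp => //.
apply: measurable_funM; first exact: measurable_cst.
by apply: measurable_sumr => j Qj; exact: (vborel_comp (vgst r)).
Qed.

Variable N : nat.
Hypothesis N0 : (0 < N)%N.
Let N00 : 0 < N%:R :> R. Proof. by rewrite ltr0n. Qed.

Let Qk k : pred nat := fun j => j != k.
Let Z k := cutoff N (Qk k).
Let mxik k : measurable_fun [set: T] (fun w => xi (Xs k w)). Proof. exact: (vborel_comp vxi). Qed.
Let L1xik k : L1 P (fun w => xi (Xs k w)). Proof. exact: (L1_copy iidX). Qed.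

Let xi_mul k (V : T -> R) : measurable_fun [set: othersType Xs k] (V : othersType Xs k -> R) ->
  L1 P V -> L1 P (fun w => xi (Xs k w) * V w) /\ Ex P (fun w => xi (Xs k w) * V w) = 0.
Proof.
move=> mV LV; have [h1 h2] := indep_mul iidX vxi mV (L1xik k) LV; split => //.
by rewrite h2 (Ex_copy iidX k vxi L1xi) Exi mul0r.
Qed.

Let bounded_L1 (V : T -> R) b : measurable_fun [set: T] V -> (forall w, `|V w| <= b) -> L1 P V.
Proof. by move=> h1 h2; exact: (L1_bounded P h1 h2). Qed.

Let gst_norm x := \sum_r `|gst r x| / de.
Let vgn : vborel gst_norm.
Proof.
apply: measurable_sumr => r _; apply: measurable_funM; last exact: measurable_cst.
by apply: measurableT_comp => //; exact: vgst.
Qed.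
Let L1gn : L1 P (fun w => gst_norm (X w)).
Proof.
apply: L1_sum => r _; have := L1Z de^-1 (L1_abs (L1gst r)).
by congr L1; apply/funext => w; rewrite mulrC.
Qed.
Let h1 := Ex P (fun w => gst_norm (X w)).

Let max_lip (a b : R) : `|Num.max 0 (1 - a) - Num.max 0 (1 - b)| <= `|a - b|.
Proof.
have [ha|ha] := leP 0 (1 - a); have [hb|hb] := leP 0 (1 - b);
  have := ler_norm (a - b); have := ler_norm (b - a); rewrite [`|b - a|]distrC ler_norml => *;
  apply/andP; split; lra.
Qed.

(** The positive part is 1-Lipschitz, and removing the index [l] changes each average by a single
    summand of weight [1 / N]. *)
Let cut_remove Q l w : (l < N)%N -> Q l ->
  `|cutoff N Q w - cutoff N (fun j => Q j && (j != l)) w| <= gst_norm (Xs l w) / N%:R.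
Proof.
move=> lN Ql; apply: (le_trans (max_lip _ _)).
rewrite -mulrBl /gdev -sumrB normrM [`|de^-1|]ger0_norm ?invr_ge0 ?(ltW de0) //.
rewrite /gst_norm mulr_suml [leLHS]mulrC -ler_pdivlMl ?invr_gt0 // invrK mulr_sumr.
apply: (le_trans (ler_norm_sum _ _ _)); apply: ler_sum => r _.
apply: (le_trans (ler_dist_dist _ _)); rewrite -mulrBr.
have -> : \sum_(j < N | Q j) gst r (Xs j w) - \sum_(j < N | Q j && (j != l :> nat)) gst r (Xs j w) = gst r (Xs l w).
  rewrite (bigD1 (Ordinal lN)) //= [X in _ + X - _](eq_bigl (fun j : 'I_N => Q j && (j != l :> nat))) ?addrK //.
rewrite normrM ger0_norm ?invr_ge0 ?(ltW N00) // le_of_eq //.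
by field; rewrite !gt_eqF.
Qed.

(** [Z k] depends on the [l]-th copy and [Z l] on the [k]-th, so the two terms are not exactly
    uncorrelated. With [z] the cutoff ignoring both copies, [Z k * Z l] is [(Z k - z) (Z l - z) + z
    (Z k - z) + z (Z l - z) + z^2]. In each of the last three products one of the centred factors
    [xi] is independent of all the rest; the first is of order [N^(-2)] by [cut_remove]. *)
Let offdiag k l : (k < N)%N -> (l < N)%N -> k != l ->
  L1 P (fun w => (xi (Xs k w) * Z k w) * (xi (Xs l w) * Z l w)) /\
  Ex P (fun w => (xi (Xs k w) * Z k w) * (xi (Xs l w) * Z l w)) <= c ^+ 2 * h1 ^+ 2 / N%:R ^+ 2.
Proof.
move=> kN lN kl.
pose z := cutoff N (fun j => Qk k j && (j != l)).
have zE : z = cutoff N (fun j => Qk l j && (j != k)).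
  apply/funext => w; rewrite /z /cutoff; congr (Num.max 0 (1 - _ / de)).
  apply: eq_bigr => r _; congr (`|_ * _|); apply: eq_bigl => j; by rewrite /Qk andbC.
have b1 (V : T -> R) w : 0 <= V w <= 1 -> `|V w| <= 1 by move=> /andP[v0 v1]; rewrite ger0_norm.
have bz Q w : `|cutoff N Q w| <= 1 by exact: b1 (cut01 N Q w).
have bzz Q Q' w : `|cutoff N Q w - cutoff N Q' w| <= 1.
  by have /andP[u0 u1] := cut01 N Q w; have /andP[v0 v1] := cut01 N Q' w; rewrite ler_norml; apply/andP; split; lra.
have mzk : measurable_fun [set: othersType Xs k] (z : othersType Xs k -> R).
  by apply: mcut_others => j /andP[].
have mzl : measurable_fun [set: othersType Xs l] (z : othersType Xs l -> R).
  by apply: mcut_others => j /andP[].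
have mZk : measurable_fun [set: othersType Xs k] (Z k : othersType Xs k -> R) by exact: mcut_others.
have mZl : measurable_fun [set: othersType Xs l] (Z l : othersType Xs l -> R) by exact: mcut_others.
have mxl : measurable_fun [set: othersType Xs k] ((fun w => xi (Xs l w)) : othersType Xs k -> R).
  by apply: vborel_others => //; rewrite eq_sym.
have mxk : measurable_fun [set: othersType Xs l] ((fun w => xi (Xs k w)) : othersType Xs l -> R).
  by apply: vborel_others.
have bd (a b e : R) : `|a| <= c -> `|b| <= 1 -> `|e| <= 1 -> `|a * (b * e)| <= c.
  by move=> ha hb he; rewrite !normrM -[leRHS]mulr1 ler_pM // -[leRHS]mulr1 ler_pM.
have [p1 p2] : L1 P (fun w => xi (Xs k w) * (xi (Xs l w) * (z w * (Z k w - z w)))) /\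
   Ex P (fun w => xi (Xs k w) * (xi (Xs l w) * (z w * (Z k w - z w)))) = 0.
  apply: xi_mul.
    by apply: measurable_funM => //; apply: measurable_funM => //; apply: measurable_funB.
  apply: (bounded_L1 (b := c)) => [|w]; last by apply: bd => //; [exact: bz|exact: bzz].
  by apply: measurable_funM => //; apply: measurable_funM => //; [|apply: measurable_funB]; exact: mcut.
have [q1 q2] : L1 P (fun w => xi (Xs l w) * (xi (Xs k w) * (z w * (Z l w - z w)))) /\
   Ex P (fun w => xi (Xs l w) * (xi (Xs k w) * (z w * (Z l w - z w)))) = 0.
  apply: xi_mul.
    by apply: measurable_funM => //; apply: measurable_funM => //; apply: measurable_funB.
  apply: (bounded_L1 (b := c)) => [|w]; last by apply: bd => //; [exact: bz|exact: bzz].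
  by apply: measurable_funM => //; apply: measurable_funM => //; [|apply: measurable_funB]; exact: mcut.
have [r1 r2] : L1 P (fun w => xi (Xs k w) * (xi (Xs l w) * (z w * z w))) /\
   Ex P (fun w => xi (Xs k w) * (xi (Xs l w) * (z w * z w))) = 0.
  apply: xi_mul.
    by apply: measurable_funM => //; apply: measurable_funM.
  apply: (bounded_L1 (b := c)) => [|w]; last by apply: bd => //; exact: bz.
  by apply: measurable_funM => //; apply: measurable_funM => //; exact: mcut.
pose D w := xi (Xs k w) * xi (Xs l w) * ((Z k w - z w) * (Z l w - z w)).
have mD : measurable_fun [set: T] D.
  apply: measurable_funM; first by apply: measurable_funM.
  by apply: measurable_funM; apply: measurable_funB; exact: mcut.
have LD : L1 P D.
  apply: (bounded_L1 (b := c * c)) => // w; rewrite /D normrM -[leRHS]mulr1 ler_pM //.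
    by rewrite normrM ler_pM.
  by rewrite normrM -[leRHS]mulr1 ler_pM // bzz.
have e : (fun w => (xi (Xs k w) * Z k w) * (xi (Xs l w) * Z l w)) = (fun w => D w +
   xi (Xs k w) * (xi (Xs l w) * (z w * (Z k w - z w))) + xi (Xs l w) * (xi (Xs k w) * (z w * (Z l w - z w))) +
   xi (Xs k w) * (xi (Xs l w) * (z w * z w))).
  by apply/funext => w; rewrite /D; ring.
have La := L1D LD p1; have Lb := L1D La q1.
rewrite e; split; first exact: L1D.
rewrite (ExD Lb r1) (ExD La q1) (ExD LD p1) p2 q2 r2 !addr0.
have mgo : measurable_fun [set: othersType Xs k] ((fun w => gst_norm (Xs l w)) : othersType Xs k -> R).
  by apply: vborel_others => //; rewrite eq_sym.
have [s1 s2] := indep_mul iidX vgn mgo (L1_copy iidX k vgn L1gn) (L1_copy iidX l vgn L1gn).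
have e1 : Ex P (fun w => gst_norm (Xs k w)) = h1 := Ex_copy iidX k vgn L1gn.
have e2 : Ex P (fun w => gst_norm (Xs l w)) = h1 := Ex_copy iidX l vgn L1gn.
rewrite e1 e2 in s2.
have dom w : D w <= (c ^+ 2 / N%:R ^+ 2) * (gst_norm (Xs k w) * gst_norm (Xs l w)).
  apply: (le_trans (ler_norm _)); rewrite /D normrM.
  have -> : c ^+ 2 / N%:R ^+ 2 * (gst_norm (Xs k w) * gst_norm (Xs l w)) =
    c ^+ 2 * ((gst_norm (Xs l w) / N%:R) * (gst_norm (Xs k w) / N%:R)) by field; rewrite gt_eqF.
  apply: ler_pM => //; first by rewrite normrM expr2 ler_pM.
  rewrite normrM; apply: ler_pM => //.
    by apply: cut_remove => //; rewrite /Qk eq_sym.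
  by rewrite zE; apply: cut_remove => //.
apply: (le_trans (Ex_le LD (L1Z _ s1) dom)); rewrite (ExZ _ s1) s2.
by rewrite le_of_eq //; ring.
Qed.

Let Wt w := N%:R^-1 * \sum_(k < N) xi (Xs k w) * Z k w.
Let bterm k w : `|xi (Xs k w) * Z k w| <= c.
Proof.
have /andP[u0 u1] := cut01 N (Qk k) w.
by rewrite normrM -[leRHS]mulr1 ler_pM // ger0_norm.
Qed.
Let mterm k : measurable_fun [set: T] (fun w => xi (Xs k w) * Z k w).
Proof. by apply: measurable_funM => //; exact: mcut. Qed.
Let Lterm k : L1 P (fun w => xi (Xs k w) * Z k w).
Proof. by apply: (bounded_L1 (b := c)). Qed.
Let Eterm k : Ex P (fun w => xi (Xs k w) * Z k w) = 0.
Proof.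
have mZk : measurable_fun [set: othersType Xs k] (Z k : othersType Xs k -> R) by exact: mcut_others.
have LZ : L1 P (Z k).
  apply: (bounded_L1 (b := 1)) => [|w]; first exact: mcut.
  by have /andP[u0 u1] := cut01 N (Qk k) w; rewrite ger0_norm.
by have [] := xi_mul mZk LZ.
Qed.
Let mW : measurable_fun [set: T] Wt.
Proof. by apply: measurable_funM; [exact: measurable_cst|exact: measurable_sumr]. Qed.
Let vf2 := Ex P (fun w => xi (X w) ^+ 2).
Let Lxi2 : L1 P (fun w => xi (X w) ^+ 2).
Proof.
apply: (bounded_L1 (b := c ^+ 2)) => [|w].
  by apply: measurable_funX; exact: (vborel_comp vxi).
by rewrite normrX ler_pXn2r ?nnegrE.
Qed.

(** The diagonal contributes at most the variance of [f], and the off-diagonal terms, of order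
    [N^(-2)] each, contribute [O(1 / N)] after normalization. *)
Let W2 : L1 P (fun w => Wt w ^+ 2) /\ N%:R * Ex P (fun w => Wt w ^+ 2) <= vf2 + c ^+ 2 * h1 ^+ 2 / N%:R.
Proof.
have e : (fun w => Wt w ^+ 2) = (fun w => (N%:R^-1) ^+ 2 * \sum_(k < N) \sum_(l < N) (xi (Xs k w) * Z k w) * (xi (Xs l w) * Z l w)).
  by apply/funext => w; rewrite /Wt exprMn; congr (_ * _); rewrite expr2 mulr_suml; apply: eq_bigr => k _; rewrite mulr_sumr.
have Lkl k l : L1 P (fun w => (xi (Xs k w) * Z k w) * (xi (Xs l w) * Z l w)).
  apply: (bounded_L1 (b := c * c)) => [|w]; first exact: measurable_funM.
  by rewrite normrM ler_pM.
have LS : L1 P (fun w => \sum_(k < N) \sum_(l < N) (xi (Xs k w) * Z k w) * (xi (Xs l w) * Z l w)).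
  by apply: L1_sum => k _; apply: L1_sum => l _.
rewrite e; split; first exact: L1Z.
rewrite (ExZ _ LS) Ex_sum => [|k _]; last by apply: L1_sum.
under eq_bigr do rewrite Ex_sum //.
set K := c ^+ 2 * h1 ^+ 2; have K0 : 0 <= K by rewrite mulr_ge0 ?sqr_ge0.
have hk (k : 'I_N) : \sum_(l < N) Ex P (fun w => (xi (Xs k w) * Z k w) * (xi (Xs l w) * Z l w)) <= vf2 + K / N%:R.
  rewrite (bigD1 k) //=; apply: lerD.
    have vx2 : vborel (fun x => xi x ^+ 2) by exact: measurable_funX.
    rewrite /vf2 -(Ex_copy iidX k vx2 Lxi2); apply: Ex_le => //; first exact: (L1_copy iidX k vx2).
    move=> w; have /andP[u0 u1] := cut01 N (Qk k) w; rewrite -expr2 exprMn ler_piMr ?sqr_ge0 //.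
    by rewrite expr_le1.
  apply: (@le_trans _ _ (\sum_(l < N) K / N%:R ^+ 2)); last first.
    by rewrite sumr_const card_ord -mulr_natl le_of_eq //; field; rewrite gt_eqF.
  rewrite big_mkcond /=; apply: ler_sum => l _; case: ifPn => [lk|_]; last by rewrite divr_ge0 ?sqr_ge0.
  have kl : (k : nat) != l by rewrite val_eqE eq_sym.
  by have [] := offdiag (ltn_ord k) (ltn_ord l) kl.
apply: (@le_trans _ _ (N%:R * (N%:R^-1 ^+ 2 * \sum_(k < N) (vf2 + K / N%:R)))).
  by rewrite ler_pM2l // ler_wpM2l ?sqr_ge0 // ler_sum.
by rewrite sumr_const card_ord -[_ *+ N]mulr_natl le_of_eq //; field; rewrite gt_eqF.
Qed.

Let est w := est_part mu Sigma f (Xs^~ w) N xpredT.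
Let estk k w := est_part mu Sigma f (Xs^~ w) N (Qk k).
Let v := Ex P (fun w => infl (X w) * xi (X w)).
Variable eta : R.
Hypothesis eta0 : 0 <= eta.
Hypothesis hgd : forall Q, L1 P (gd Q N) /\ Ex P (gd Q N) <= eta.
Hypothesis htail : L1 P (fun w => W (X w) * Num.min 1 (W (X w) / N%:R)) /\
  Ex P (fun w => W (X w) * Num.min 1 (W (X w) / N%:R)) <= eta.

Let L1ix : L1 P (fun w => infl (X w) * xi (X w)).
Proof.
under eq_fun do rewrite mulrC; apply: (@L1_mul_bounded _ _ _ _ _ _ c) => //.
- exact: (vborel_comp vxi).
- by under eq_fun do rewrite influenceE; exact: L1B.
Qed.

(** By independence [estk k], which ignores the [k]-th copy, can be subtracted from [est] without
    changing the mean. Where the cutoff is nonzero, [N (est - estk k)] is the influence of that copy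
    up to the linearization error, and the main term factorizes into [v] times the mean of the
    cutoff, which is at least [1 - eta / de]. *)
Let term_ge k : (k < N)%N ->
  v - (`|v| / de + c * C * (Ex P (fun w => W (X w)) + 1)) * eta <=
  N%:R * Ex P (fun w => est w * (xi (Xs k w) * Z k w)).
Proof.
move=> kN; have [C1 C10 hb] := best.
have mZk : measurable_fun [set: othersType Xs k] (Z k : othersType Xs k -> R) by exact: mcut_others.
have LZ : L1 P (Z k).
  apply: (bounded_L1 (b := 1)) => [|w]; first exact: mcut.
  by have /andP[u0 u1] := cut01 N (Qk k) w; rewrite ger0_norm.
have mek : measurable_fun [set: othersType Xs k] (estk k : othersType Xs k -> R) by exact: mest_others.
have LeZ : L1 P (fun w => estk k w * Z k w).
  apply: (bounded_L1 (b := C1)) => [|w]; first by apply: measurable_funM; [exact: (others_meas iidX mek)|exact: mcut].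
  have /andP[u0 u1] := cut01 N (Qk k) w; rewrite normrM -[leRHS]mulr1 ler_pM ?hb // ger0_norm //.
have [a1 a2] := xi_mul (measurable_funM mek mZk) LeZ.
have LE : L1 P (fun w => est w * (xi (Xs k w) * Z k w)).
  apply: (bounded_L1 (b := C1 * c)) => [|w]; first by apply: measurable_funM => //; exact: mest.
  by rewrite normrM ler_pM // hb.
have vix : vborel (fun x => infl x * xi x) by exact: measurable_funM.
have [b1 b2] := indep_mul iidX vix mZk (L1_copy iidX k vix L1ix) LZ.
rewrite (Ex_copy iidX k vix L1ix) -/v in b2.
have vwt : vborel (fun x => W x * Num.min 1 (W x / N%:R)).
  apply: measurable_funM => //; apply: measurable_minr; first exact: measurable_cst.
  by apply: measurable_funM => //; exact: measurable_cst.
have [g1 g2] := hgd (Qk k); have [t1 t2] := htail.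
have mgk : measurable_fun [set: othersType Xs k] (gd (Qk k) N : othersType Xs k -> R) by exact: mgd_others.
have [w1 w2] := indep_mul iidX vW mgk (L1_copy iidX k vW L1W) g1.
have t1k := L1_copy iidX k vwt t1.
have Eb : N%:R * Ex P (fun w => est w * (xi (Xs k w) * Z k w)) =
   Ex P (fun w => N%:R * (est w * (xi (Xs k w) * Z k w) - xi (Xs k w) * (estk k w * Z k w))).
  by rewrite ExZ; [rewrite ExB // a2 subr0|exact: L1B].
have Lbnd : L1 P (fun w => c * C * (W (Xs k w) * gd (Qk k) N w) + c * C * (W (Xs k w) * Num.min 1 (W (Xs k w) / N%:R))).
  by apply: L1D; exact: L1Z.
have pw w : infl (Xs k w) * xi (Xs k w) * Z k w - (c * C * (W (Xs k w) * gd (Qk k) N w) + c * C * (W (Xs k w) * Num.min 1 (W (Xs k w) / N%:R)))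
   <= N%:R * (est w * (xi (Xs k w) * Z k w) - xi (Xs k w) * (estk k w * Z k w)).
  rewrite -subr_ge0.
  set u := gd (Qk k) N w; set tt := Num.min 1 _.
  have W0 : 0 <= W (Xs k w) by rewrite (le_trans ler01) // wt_ge1.
  have tt0 : 0 <= tt by rewrite le_min ler01 divr_ge0 // ltW.
  have u0 : 0 <= u by exact: gdev_ge0.
  have e : N%:R * (est w * (xi (Xs k w) * Z k w) - xi (Xs k w) * (estk k w * Z k w)) - (infl (Xs k w) * xi (Xs k w) * Z k w - (c * C * (W (Xs k w) * u) + c * C * (W (Xs k w) * tt)))
    = c * (C * W (Xs k w) * (u + tt)) + xi (Xs k w) * Z k w * (N%:R * (est w - estk k w) - infl (Xs k w)) by ring.
  rewrite e; set x := xi (Xs k w) * Z k w * _.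
  suff : `|x| <= c * (C * W (Xs k w) * (u + tt)) by rewrite ler_norml => /andP[]; lra.
  rewrite /x normrM; have /andP[z0 z1] := cut01 N (Qk k) w.
  have [zz|zz] := eqVneq (Z k w) 0.
    by rewrite zz mulr0 normr0 mul0r !mulr_ge0 // addr_ge0.
  apply: ler_pM => //; apply: lin => //.
  have : 0 < Z k w by rewrite lt_def zz.
  by rewrite /Z /cutoff lt_max ltxx /= subr_gt0 ltr_pdivrMr // mul1r => /ltW.
have LB : L1 P (fun w => N%:R * (est w * (xi (Xs k w) * Z k w) - xi (Xs k w) * (estk k w * Z k w))).
  by apply: L1Z; exact: L1B.
rewrite Eb; apply: le_trans (Ex_le (L1B b1 Lbnd) LB pw).
rewrite (ExB b1 Lbnd) b2 (ExD (L1Z _ w1) (L1Z _ t1k)) (ExZ _ w1) (ExZ _ t1k) w2.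
rewrite (Ex_copy iidX k vW L1W) (Ex_copy iidX k vwt t1).
have EZ1 : Ex P (Z k) <= 1.
  rewrite -[leRHS](Ex_cst P 1); apply: Ex_le => //; first exact: L1_cst.
  by move=> w; have /andP[] := cut01 N (Qk k) w.
have EZ : 1 - eta / de <= Ex P (Z k).
  apply: (@le_trans _ _ (Ex P (fun w => 1 - de^-1 * gd (Qk k) N w))).
    rewrite ExB; [|exact: L1_cst|exact: L1Z].
    by rewrite Ex_cst ExZ // lerD2l lerN2 mulrC ler_wpM2r ?invr_ge0 // ltW.
  apply: Ex_le => //; first by apply: L1B; [exact: L1_cst|exact: L1Z].
  by move=> w; rewrite /Z /cutoff le_max mulrC lexx orbT.
have vZ : v - `|v| / de * eta <= v * Ex P (Z k).
  have q1 : 0 <= eta / de by rewrite divr_ge0 // ltW.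
  rewrite mulrAC -mulrA -subr_ge0.
  have -> : v * Ex P (Z k) - (v - `|v| * (eta / de)) = `|v| * (eta / de) - v * (1 - Ex P (Z k)) by ring.
  have r0 : 0 <= 1 - Ex P (Z k) by rewrite subr_ge0.
  rewrite subr_ge0 (le_trans (ler_wpM2r r0 (ler_norm v))) // ler_wpM2l //; lra.
have EW0 : 0 <= Ex P (fun w => W (X w)).
  by apply: Ex_ge0 => w; rewrite (le_trans ler01) // wt_ge1.
have cC : 0 <= c * C by rewrite mulr_ge0.
have u1 : c * C * (Ex P (fun w => W (X w)) * Ex P (gd (Qk k) N)) <= c * C * (Ex P (fun w => W (X w)) * eta).
  by rewrite ler_wpM2l // ler_wpM2l.
have u2 := ler_wpM2l cC t2.
move: vZ u1 u2; set a := Ex P (gd _ N); lra.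
Qed.

(** Summing [term_ge] bounds the correlation of [est] with the centred sum [Wt] from below; from
    above it is at most half the sum of their second moments about the mean. *)
Lemma loo_lower_bound : v - (`|v| / de + c * C * (Ex P (fun w => W (X w)) + 1)) * eta <=
  2^-1 * (N%:R * Ex P (fun w => (est w - Ex P est) ^+ 2) + vf2 + c ^+ 2 * h1 ^+ 2 / N%:R).
Proof.
have [C1 C10 hb] := best.
have me : measurable_fun [set: T] est by exact: mest.
have Le : L1 P est by apply: (bounded_L1 (b := C1)) => // w; exact: hb.
have bW w : `|Wt w| <= c.
  rewrite normrM ger0_norm ?invr_ge0 ?(ltW N00) // ler_pdivrMl // (le_trans (ler_norm_sum _ _ _)) //.
  rewrite -[N in leRHS]card_ord mulr_natl -sumr_const; exact: ler_sum.
have LW : L1 P Wt by apply: (bounded_L1 (b := c)).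
have LeW : L1 P (fun w => est w * Wt w).
  apply: (bounded_L1 (b := C1 * c)) => [|w]; first exact: measurable_funM.
  by rewrite normrM ler_pM // hb.
have EW : Ex P Wt = 0.
  rewrite ExZ; last by apply: L1_sum => k _; exact: Lterm.
  by rewrite Ex_sum => [|k _]; [rewrite big1 ?mulr0|exact: Lterm].
have Lek k : L1 P (fun w => est w * (xi (Xs k w) * Z k w)).
  apply: (bounded_L1 (b := C1 * c)) => [|w]; first exact: measurable_funM.
  by rewrite normrM ler_pM // hb.
have lower : v - (`|v| / de + c * C * (Ex P (fun w => W (X w)) + 1)) * eta <= N%:R * Ex P (fun w => est w * Wt w).
  have -> : (fun w => est w * Wt w) = (fun w => N%:R^-1 * \sum_(k < N) est w * (xi (Xs k w) * Z k w)).
    by apply/funext => w; rewrite /Wt mulrCA mulr_sumr.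
  rewrite ExZ; last by apply: L1_sum => k _.
  rewrite mulrA mulfV ?gt_eqF // mul1r Ex_sum //.
  set q := v - _; have -> : q = \sum_(k < N) q / N%:R.
    by rewrite sumr_const card_ord -[_ *+ N]mulr_natl mulrCA mulfV ?mulr1 // gt_eqF.
  apply: ler_sum => k _; rewrite ler_pdivrMr // mulrC; exact: term_ge.
apply: (le_trans lower).
have [LW2 hW2] := W2.
pose E := Ex P est.
have Le2 : L1 P (fun w => (est w - E) ^+ 2).
  apply: (bounded_L1 (b := (C1 + `|E|) ^+ 2)) => [|w].
    by apply: measurable_funX; apply: measurable_funB => //; exact: measurable_cst.
  by rewrite normrX ler_pXn2r ?nnegrE ?addr_ge0 // (le_trans (ler_normB _ _)) // lerD2r hb.
have am : Ex P (fun w => est w * Wt w) <= 2^-1 * (Ex P (fun w => (est w - E) ^+ 2) + Ex P (fun w => Wt w ^+ 2)).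
  have -> : Ex P (fun w => est w * Wt w) = Ex P (fun w => (est w - E) * Wt w).
    have -> : (fun w => (est w - E) * Wt w) = (fun w => est w * Wt w - E * Wt w) by apply/funext => w; ring.
    by rewrite (ExB LeW (L1Z E LW)) (ExZ E LW) EW mulr0 subr0.
  rewrite -ExD // -ExZ; last exact: L1D.
  apply: Ex_le.
  - have := L1B LeW (L1Z E LW); congr L1; apply/funext => w; ring.
  - by apply: L1Z; exact: L1D.
  - by move=> w; have := sqr_ge0 (est w - E - Wt w); nra.
have := ler_wpM2l (ltW N00) am; rewrite -/E; move: hW2; lra.
Qed.

End fixed_size.

(** Under the variance bound, both second moments in [loo_lower_bound] are asymptotically at most
    [vf2 / N], so [v <= vf2]. A single [eta] controls [gdev], the tail of the weight, [A N - 1] and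
    [1 / N] at once. *)
Theorem key_inequality (A : nat -> R) : A m @[m --> \oo] --> (1 : R) ->
  (forall N, (0 < N)%N -> ('V_P[mm2_estimator P X Xs f N] <= (A N / N%:R)%:E * 'V_P[fun w => f (X w)])%E) ->
  0 <= Ex P (fun w => f (X w) * linear_part (X w)).
Proof.
move=> A1 hV.
have [de [C [de0 C0 hlin]]] := loo_linearization mu pSigma sf cf g B.
have [c c0 xc] := bxi.
have [C1 C10 hb] := best.
set v := Ex P (fun w => infl (X w) * xi (X w)).
set vf2 := Ex P (fun w => xi (X w) ^+ 2).
set h1 := Ex P (fun w => \sum_r `|gst r (X w)| / de).
set EW := Ex P (fun w => W (X w)).
have vf20 : 0 <= vf2 by apply: Ex_ge0 => w; exact: sqr_ge0.
have EW0 : 0 <= EW by apply: Ex_ge0 => w; rewrite (le_trans ler01) // wt_ge1.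
pose K := `|v| / de + c * C * (EW + 1) + vf2 + c ^+ 2 * h1 ^+ 2.
have K0 : 0 <= K.
  rewrite /K; apply: addr_ge0; last by rewrite mulr_ge0 ?sqr_ge0.
  apply: addr_ge0 => //; apply: addr_ge0; first by rewrite divr_ge0 // ltW.
  by apply: mulr_ge0; [exact: mulr_ge0|rewrite addr_ge0].
have bound eta : 0 < eta -> v <= vf2 + K * eta.
  move=> eta0.
  have [N1 hN1] := gdev_small eta0; have [N2 hN2] := weight_tail eta0.
  have := A1 => /cvgrPdist_le /(_ _ eta0) [N3 _ hN3].
  pose N := (maxn (maxn N1 N2) (maxn N3 (Num.bound eta^-1).+1)).
  have n1 : (N1 <= N)%N by rewrite /N !leq_max leqnn.
  have n2 : (N2 <= N)%N by rewrite /N !leq_max leqnn orbT.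
  have n3 : (N3 <= N)%N by rewrite /N !leq_max leqnn !orbT.
  have n4 : ((Num.bound eta^-1).+1 <= N)%N by rewrite /N !leq_max leqnn !orbT.
  have N0 : (0 < N)%N by exact: leq_ltn_trans n4.
  have N00 : 0 < N%:R :> R by rewrite ltr0n.
  have iN : N%:R^-1 <= eta.
    rewrite -[leRHS]invrK lef_pV2 ?posrE ?invr_gt0 // ltW // (lt_le_trans (archi_boundP _)) ?invr_ge0 ?ltW //.
    by rewrite ltr_nat.
  have lb := loo_lower_bound de0 C0 hlin c0 xc N0 (ltW eta0) (fun Q => hN1 N Q n1) (hN2 N n2).
  rewrite -/v -/vf2 -/h1 -/EW in lb.
  pose est w := est_part mu Sigma f (Xs^~ w) N xpredT.
  rewrite -[fun w : T => est_part _ _ _ _ _ _]/est in lb.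
  have estE : mm2_estimator P X Xs f N = est by apply/funext => w; rewrite mm2_estimatorE.
  have me : measurable_fun [set: T] est by exact: mest.
  have Le2 : L1 P (fun w => est w ^+ 2).
    apply: (L1_bounded P (c := C1 ^+ 2)); first exact: measurable_funX.
    by move=> w; rewrite normrX ler_pXn2r ?nnegrE ?hb // (le_trans (normr_ge0 _) (hb (Xs^~ w) N xpredT N0)).
  have Lf2 : L1 P (fun w => f (X w) ^+ 2).
    have [Cf Cf0 hf] := smooth_bounded sf cf.
    apply: (L1_bounded P (c := Cf ^+ 2)); first by apply: measurable_funX; exact: (vborel_comp vf).
    by move=> w; rewrite normrX ler_pXn2r ?nnegrE.
  have := hV N N0; rewrite estE (variance_Ex me Le2) (variance_Ex (vborel_comp vf rvX) Lf2) -EFinM lee_fin.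
  rewrite -/Ef -/vf2 => hv.
  have hv2 : N%:R * Ex P (fun w => (est w - Ex P est) ^+ 2) <= A N * vf2.
    rewrite (le_trans (ler_wpM2l (ltW N00) hv)) // le_of_eq //; field; by rewrite gt_eqF.
  have hA : A N <= 1 + eta.
    have := hN3 N n3; rewrite /= distrC ler_norml => /andP[_]; lra.
  have hAv : A N * vf2 <= (1 + eta) * vf2 by rewrite ler_wpM2r.
  have hh : c ^+ 2 * h1 ^+ 2 / N%:R <= c ^+ 2 * h1 ^+ 2 * eta by rewrite ler_wpM2l // mulr_ge0 ?sqr_ge0.
  have hh0 : 0 <= c ^+ 2 * h1 ^+ 2 * eta by rewrite mulr_ge0 ?(ltW eta0) // mulr_ge0 ?sqr_ge0.
  have hve : 0 <= vf2 * eta by rewrite mulr_ge0 // ltW.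
  move: lb hv2 hAv hh hh0 hve; rewrite /K; lra.
have vle : v <= vf2.
  apply/ler_addgt0Pr => e e0.
  have eK : 0 < e / (K + 1) by rewrite divr_gt0 // ltr_wpDl.
  apply: (le_trans (bound _ eK)); rewrite lerD2l mulrA ler_pdivrMr ?ltr_wpDl // mulrC ler_wpM2l ?(ltW e0) // lerDl //.
have Lfl : L1 P (fun w => f (X w) * linear_part (X w)).
  have [Cf Cf0 hf] := smooth_bounded sf cf.
  by apply: (@L1_mul_bounded _ _ _ _ _ _ Cf) => //; exact: (vborel_comp vf).
have Lxi2 : L1 P (fun w => xi (X w) ^+ 2).
  apply: (L1_bounded P (c := c ^+ 2)); first by apply: measurable_funX; exact: (vborel_comp vxi).
  by move=> w; rewrite normrX ler_pXn2r ?nnegrE.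
(* [influence] is [f - linear_part], and both [xi] and [linear_part] are centred. *)
have : v = vf2 - Ex P (fun w => f (X w) * linear_part (X w)); last by move: vle; lra.
have -> : v = Ex P (fun w => xi (X w) ^+ 2 + Ef * xi (X w) - f (X w) * linear_part (X w) + Ef * linear_part (X w)).
  by congr Ex; apply/funext => w; rewrite influenceE /xi; ring.
have La := L1D Lxi2 (L1Z Ef L1xi); have Lb := L1B La Lfl.
by rewrite (ExD Lb (L1Z Ef L1lin)) (ExB La Lfl) (ExD Lxi2 (L1Z Ef L1xi)) !ExZ // Exi Elin !mulr0 !addr0.
Qed.

End key_inequality.

(** * Localization by bumps *)

Section flat_functions.
Context {R : realType}.

(** The factors [t^-k] turn the classical [exp (-1 / t)], extended by 0, into a family closed under
    differentiation up to linear combinations. *)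
Definition flat (k : nat) (t : R) : R := if 0 < t then t^-1 ^+ k * expR (- t^-1) else 0.

Lemma flat_ge0 k t : 0 <= flat k t.
Proof. by rewrite /flat; case: ifPn => // t0; rewrite mulr_ge0 ?expR_ge0 // exprn_ge0 // invr_ge0 ltW. Qed.

(** From [exp u >= u^(k + 2) / (k + 2)!] at [u = 1 / t]. A quadratic bound is what makes the
    derivative at 0 vanish. *)
Lemma flat_bound k : exists2 C : R, 0 <= C & forall t, `|flat k t| <= C * t ^+ 2.
Proof.
exists (k.+2)`!%:R => // t; rewrite ger0_norm ?flat_ge0 // /flat; case: ifPn => t0; last by rewrite mulr_ge0 ?sqr_ge0.
set u := t^-1; have u0 : 0 < u by rewrite invr_gt0.
have h := expR_ge1Dxn k.+1 (ltW u0).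
have f0 : 0 < (k.+2)`!%:R :> R by rewrite ltr0n fact_gt0.
have h1 : u ^+ k.+2 <= (k.+2)`!%:R * expR u.
  rewrite -ler_pdivrMl // mulrC (le_trans _ h) // lerDr //.
have tu : t = u^-1 by rewrite invrK.
clearbody u; rewrite tu exprVn ler_pdivlMr ?exprn_gt0 // mulrAC -exprD addn2.
by rewrite expRN ler_pdivrMr ?expR_gt0.
Qed.

Lemma is_derive_flat k (t : R) : is_derive t 1 (flat k) (flat k.+2 t - k%:R * flat k.+1 t).
Proof.
have [t0|t0|->] := ltgtP t 0.
- have e k' : flat k' t = 0 by rewrite /flat ltNge (ltW t0).
  rewrite !e mulr0 subr0.
  have h0 : is_derive t (1 : R) (cst (0 : R) : R -> R) 0 by exact: is_derive_cst.
  apply: near_eq_is_derive h0.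
  near=> s; rewrite /flat ltNge ltW //; near: s; exact: lt_nbhsl.
- have tn0 : t != 0 by rewrite gt_eqF.
  have dV : is_derive t 1 (fun s : R => s^-1) (- t ^- 2 *: 1) by exact: is_deriveV.
  have dX : is_derive t 1 ((fun s : R => s^-1) ^+ k) ((k%:R * t^-1 ^+ k.-1) *: (- t ^- 2 *: 1)).
    exact: is_deriveX.
  have dE : is_derive t 1 (expR \o (fun s : R => - s^-1)) (expR (- t^-1) * - (- t ^- 2 *: 1)).
    by apply: is_derive1_comp; exact: is_deriveN.
  have dM := is_deriveM dX dE.
  have eG : (fun s : R => s^-1) ^+ k * (expR \o (fun s : R => - s^-1)) = (fun s : R => s^-1 ^+ k * expR (- s^-1)).
    by apply/funext => s; rewrite /= !fctE.
  rewrite eG in dM.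
  suff <- : ((fun s : R => s^-1) ^+ k) t *: (expR (- t^-1) * - (- t ^- 2 *: 1)) + (expR \o (fun s : R => - s^-1)) t *: ((k%:R * t^-1 ^+ k.-1) *: (- t ^- 2 *: 1)) = flat k.+2 t - k%:R * flat k.+1 t.
    apply: near_eq_is_derive dM; near=> s; rewrite /flat ifT //; near: s; exact: lt_nbhsr.
  rewrite /flat t0 !fctE /GRing.scale /= mulr1 opprK -!exprVn.
  case: k {dX dM eG} => [|k] /=; first by rewrite !mul0r subr0 !expr0 !expr2 mul1r; ring.
  by rewrite !exprS; ring.
have e k' : flat k' 0 = 0 by rewrite /flat ltxx.
have [C C0 hC] := flat_bound k.
have lim : h^-1 *: (flat k (h *: 1 + 0) - flat k 0) @[h --> (0 : R)^'] --> (0 : R).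
  apply/cvgrPdist_le => eps eps0; near=> h.
  have h0 : h != 0 by near: h; exact: nbhs_dnbhs_neq.
  rewrite sub0r normrN e subr0 addr0 /GRing.scale /= mulr1 normrM normfV ler_pdivrMl ?normr_gt0 //.
  rewrite (le_trans (hC h)) // -[h ^+ 2]ger0_norm ?sqr_ge0 // normrX expr2 mulrCA ler_wpM2l //.
  apply: (@le_trans _ _ ((C + 1) * `|h|)); first by rewrite ler_wpM2r // lerDl.
  rewrite -ler_pdivlMl ?ltr_wpDl // mulrC; near: h.
  apply: dnbhs0_le; by rewrite divr_gt0 // ltr_wpDl.
rewrite !e mulr0 subr0; split; first by apply/cvg_ex; exists 0; exact: lim.
exact: cvg_lim lim.
Unshelve. all: by end_near. Qed.

Lemma flat_continuous k : continuous (flat k).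
Proof. by move=> t; apply: differentiable_continuous; apply/derivable1_diffP; case: (is_derive_flat k t). Qed.

End flat_functions.

(** * Smooth bumps and their integrals *)

Section smooth_class.
Context {R : realType} {n : nat}.
Notation vec := 'cV[R]_n.
Implicit Types (f g : vec -> R) (x v c : vec).

(** [smooth] speaks of all iterated directional derivatives; a syntactic class reduces it to one
    differentiation step per constructor. The affine argument in [sc_flat] makes the class stable
    under dilations and translations. *)
Inductive smooth_class : (vec -> R) -> Prop :=
| sc_cst a : smooth_class (fun=> a)
| sc_coord i : smooth_class (fun x => x i 0)
| sc_flat k s a i : smooth_class (fun x => flat k (s * x i 0 + a))
| sc_add f g : smooth_class f -> smooth_class g -> smooth_class (fun x => f x + g x)
| sc_mul f g : smooth_class f -> smooth_class g -> smooth_class (fun x => f x * g x).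

Lemma is_derive_of_line f x v (d : R) : is_derive (0 : R) 1 (fun s : R => f (x + s *: v)) d -> is_derive x v f d.
Proof.
move=> [h1 h2]; have h3 := (derivable_line f x v).2 h1.
by split => //; rewrite derive_line.
Qed.

Lemma smooth_class_derive f : smooth_class f ->
  continuous f /\ forall v, exists2 df, smooth_class df & forall x, is_derive x v f (df x).
Proof.
elim=> {f} [a|i|k s a i|f g _ [cf df] _ [cg dg]|f g hf [cf df] hg [cg dg]].
- split => [|v]; first exact: cst_continuous.
  by exists (fun=> 0) => [|x]; [exact: sc_cst|exact: is_derive_cst].
- split => [|v]; first exact: coord_continuous.
  exists (fun=> v i 0) => [|x]; first exact: sc_cst.
  apply: is_derive_of_line.
  have -> : (fun s : R => (x + s *: v) i 0) = (fun s => x i 0 + s * v i 0) by apply/funext => s; rewrite !mxE.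
  by apply: is_derive_eq; rewrite /GRing.scale /=; ring.
- split => [x|v].
    apply: (@continuous_comp _ _ _ (fun y : vec => s * y i 0 + a) (flat k)); last exact: flat_continuous.
    apply: (@contD R vec); last exact: cst_continuous.
    by apply: (@contM R vec); [exact: cst_continuous|exact: coord_continuous].
  exists (fun x => (s * v i 0) * (flat k.+2 (s * x i 0 + a) + - k%:R * flat k.+1 (s * x i 0 + a))) => [|x].
    apply: sc_mul; first exact: sc_cst.
    apply: sc_add; first exact: sc_flat.
    by apply: sc_mul; [exact: sc_cst|exact: sc_flat].
  apply: is_derive_of_line.
  pose u := s * x i 0 + a.
  have -> : (fun t : R => flat k (s * (x + t *: v) i 0 + a)) = flat k \o (fun t => u + t * (s * v i 0)).
    by apply/funext => t /=; rewrite !mxE /u; congr flat; ring.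
  have du : is_derive (0 : R) 1 (fun t : R => u + t * (s * v i 0)) (s * v i 0).
    by apply: is_derive_eq; rewrite /GRing.scale /=; ring.
  have df : is_derive (u + 0 * (s * v i 0)) 1 (flat k) (flat k.+2 u - k%:R * flat k.+1 u).
    by rewrite mul0r addr0; exact: is_derive_flat.
  apply: (is_derive_eq (@is_derive1_comp R (flat k) (fun t : R => u + t * (s * v i 0)) 0 _ _ df du)); rewrite -/u; ring.
- split => [|v]; first exact: contD.
  have [f' sf' hf'] := df v; have [g' sg' hg'] := dg v.
  exists (fun x => f' x + g' x) => [|x]; first exact: sc_add.
  exact: is_deriveD (hf' x) (hg' x).
- split => [|v]; first exact: contM.
  have [f' sf' hf'] := df v; have [g' sg' hg'] := dg v.
  exists (fun x => f x * g' x + g x * f' x) => [|x]; first by apply: sc_add; exact: sc_mul.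
  exact: is_deriveM (hf' x) (hg' x).
Qed.

Lemma smooth_class_smooth f : smooth_class f -> smooth f.
Proof.
move=> hf vs; have : smooth_class (iter_deriv vs f).
  elim: vs => [//|v vs IH] /=; have [_ /(_ v) [df sdf h]] := smooth_class_derive IH.
  have -> : 'D_v (iter_deriv vs f) = df by apply/funext => x; have hx := h x; rewrite derive_val.
  exact: sdf.
move=> /smooth_class_derive [cg dg]; split => // x v.
by have [df _ /(_ x) []] := dg v.
Qed.

Lemma smooth_class_sum (I : Type) (s : seq I) (F : I -> vec -> R) :
  (forall i, smooth_class (F i)) -> smooth_class (fun x => \sum_(i <- s) F i x).
Proof.
move=> h; elim: s => [|i s IH].
  by under eq_fun do rewrite big_nil; exact: sc_cst.
by under eq_fun do rewrite big_cons; exact: sc_add.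
Qed.

Lemma smooth_class_prod (I : Type) (s : seq I) (F : I -> vec -> R) :
  (forall i, smooth_class (F i)) -> smooth_class (fun x => \prod_(i <- s) F i x).
Proof.
move=> h; elim: s => [|i s IH].
  by under eq_fun do rewrite big_nil; exact: sc_cst.
by under eq_fun do rewrite big_cons; exact: sc_mul.
Qed.

Lemma smooth_class_affine f (s : R) c : smooth_class f -> smooth_class (fun x => f (s *: (x - c))).
Proof.
have e i x : (s *: (x - c)) i 0 = s * x i 0 + - (s * c i 0) by rewrite !mxE; ring.
elim=> {f} [a|i|k t a i|f g _ IHf _ IHg|f g _ IHf _ IHg].
- exact: sc_cst.
- under eq_fun do rewrite e.
  by apply: sc_add; [apply: sc_mul; [exact: sc_cst|exact: sc_coord]|exact: sc_cst].
- have -> : (fun x => flat k (t * (s *: (x - c)) i 0 + a)) = (fun x => flat k (t * s * x i 0 + (a - t * (s * c i 0)))).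
    by apply/funext => x; rewrite e; congr flat; ring.
  exact: sc_flat.
- exact: sc_add.
- exact: sc_mul.
Qed.


Definition unit_bump x : R := \prod_i (flat 0 (1 * x i 0 + 1) * flat 0 (-1 * x i 0 + 1)).
Definition bump c (e : R) x : R := unit_bump (e^-1 *: (x - c)).

Lemma smooth_class_unit_bump : smooth_class unit_bump.
Proof. by apply: smooth_class_prod => i; apply: sc_mul; exact: sc_flat. Qed.

Lemma smooth_class_bump c e : smooth_class (bump c e).
Proof. exact: smooth_class_affine smooth_class_unit_bump. Qed.

Lemma unit_bump_ge0 x : 0 <= unit_bump x.
Proof. by apply: prodr_ge0 => i _; rewrite mulr_ge0 // flat_ge0. Qed.

Lemma bump_ge0 c e x : 0 <= bump c e x. Proof. exact: unit_bump_ge0. Qed.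

Lemma unit_bump_supp x : unit_bump x != 0 -> `|x| <= 1.
Proof.
move=> nz; apply: mxnorm_le => // i j; rewrite ord1.
have : flat 0 (1 * x i 0 + 1) * flat 0 (-1 * x i 0 + 1) != 0.
  by apply: contraNneq nz => z; rewrite /unit_bump (bigD1 i) //= z mul0r.
rewrite mulf_eq0 negb_or => /andP[]; rewrite /flat.
case: ifPn => [h1 _|_]; last by rewrite eqxx.
case: ifPn => [h2 _|_]; last by rewrite eqxx.
rewrite ler_norml; apply/andP; split; lra.
Qed.

Lemma bump_supp c e x : 0 < e -> bump c e x != 0 -> `|x - c| <= e.
Proof.
move=> e0 /unit_bump_supp; rewrite normrZ ger0_norm ?invr_ge0 ?(ltW e0) //.
by rewrite ler_pdivrMl // mulr1.
Qed.

Let m0 : R := (expR (-2) * expR (-2)) ^+ n.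

Lemma unit_bump_lb x : `|x| <= 2^-1 -> m0 <= unit_bump x.
Proof.
move=> hx; rewrite /m0 -[n in _ ^+ n]card_ord -prodr_const; apply: ler_prod => i _.
rewrite mulr_ge0 ?expR_ge0 //=; have hi : `|x i 0| <= 2^-1 by exact: le_trans (mxnorm_entry _ _ _) hx.
have h (t : R) : 2^-1 <= t -> expR (-2) <= flat 0 t.
  move=> ht; have t0 : 0 < t by apply: lt_le_trans ht; rewrite invr_gt0.
  rewrite /flat t0 expr0 mul1r ler_expR lerN2 -[leRHS]invrK lef_pV2 // posrE invr_gt0 //.
by move: hi; rewrite ler_norml => /andP[h1 h2]; apply: ler_pM; rewrite ?expR_ge0 // h //; lra.
Qed.

Lemma compact_bounded_supp f (r : R) : (forall x, f x != 0 -> `|x| <= r) -> compact (supp f).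
Proof.
move=> h.
(* Compactness is obtained for closed bounded sets of row vectors and carried over by
   transposition. *)
have ct : continuous (fun v : 'rV[R]_n => (v^T : vec)).
  move=> v A [Q hQ QA]; exists (fun i j => Q j i) => [i j|w hw].
    by have := hQ j i; rewrite mxE.
  by apply: QA => i j; rewrite mxE; exact: hw.
have -> : supp f = (fun v : 'rV[R]_n => v^T) @` [set v : 'rV[R]_n | supp f v^T].
  apply/seteqP; split => [x hx|x [v hv <-] //]; by exists x^T; rewrite /= ?trmxK.
apply: continuous_compact; first exact: continuous_subspaceT.
apply: bounded_closed_compact.
  exists r; split; first exact: num_real.
  move=> M rM v /= hv; rewrite -mxnorm_tr; apply: le_trans (ltW rM).
  have cl : closed [set x : vec | `|x| <= r].
    rewrite (_ : [set x : vec | _] = (fun x : vec => `|x|) @^-1` [set y : R | y <= r]) //.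
    apply: closed_comp; last exact: closed_le.
    by move=> x _; exact: norm_continuous.
  by move: hv; rewrite /supp => hv; have := closure_subset h hv; rewrite -(closure_id _).1.
by apply: closed_comp => [v _|]; [exact: ct|exact: closed_closure].
Qed.

Lemma bump_compact c e : 0 < e -> compact (supp (bump c e)).
Proof.
move=> e0; apply: (@compact_bounded_supp _ (`|c| + e)) => x /(bump_supp e0) h.
have -> : x = c + (x - c) by rewrite addrC subrK.
by rewrite (le_trans (ler_normD _ _)) // lerD2l.
Qed.

Lemma bump_derive_le : exists2 M : R, 0 <= M & forall c e x i, 0 < e -> `|'D_(evec i) (bump c e) x| <= M / e.
Proof.
have su := smooth_class_smooth smooth_class_unit_bump.
have [M M0 hM] := smooth_grad_bounded su (compact_bounded_supp unit_bump_supp).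
exists M => // c e x i e0.
have db : derivable (bump c e) x (evec i) by exact: (smooth_C1 (smooth_class_smooth (smooth_class_bump c e))).1.
rewrite (derive_line db).
have -> : (fun s : R => bump c e (x + s *: evec i)) = (fun s : R => unit_bump (e^-1 *: (x - c) + s *: (e^-1 *: evec i))).
  by apply/funext => s; rewrite /bump addrAC scalerDr !scalerA [s * _]mulrC.
rewrite -derive_line; last exact: (smooth_C1 su).1.
rewrite C1_scale; last exact: smooth_C1.
rewrite normrM ger0_norm ?invr_ge0 ?(ltW e0) // mulrC ler_wpM2r ?invr_ge0 ?(ltW e0) //.
apply: le_trans (hM (e^-1 *: (x - c))).
by apply: le_trans (mxnorm_entry _ 0 i); rewrite mxE.
Qed.

Notation lam := (@lebesgue_tuple R n).
Notation vint h := (Ex lam (fun t => h (col_of_tuple t))).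
Notation vL1 h := (L1 lam (fun t => h (col_of_tuple t))).

Lemma vint_bounded (h : vec -> R) c (e K : R) : vborel h -> 0 < e -> 0 <= K ->
  (forall x, `|h x| <= K) -> (forall x, e < `|x - c| -> h x = 0) ->
  vL1 h /\ `|vint h| <= K * (4 * e) ^+ n.
Proof.
move=> mh e0 K0 hK h0.
have e2 : 0 <= 2 * e by rewrite mulr_ge0 // ltW.
have dom t : `|h (col_of_tuple t)| <= K * \1_(tcube (tuple_of_col c) (2 * e)) t.
  have [ht|ht] := leP `|col_of_tuple t - c| e; last by rewrite h0 // normr0 mulr_ge0 // indicE.
  rewrite indicE mem_set ?mulr1 // => i; rewrite tnth_mktuple.
  have := le_trans (mxnorm_entry (col_of_tuple t - c) i 0) ht; rewrite !mxE ler_norml => /andP[h1 h2].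
  by apply/andP; split; lra.
have LK : L1 lam (fun t => K * \1_(tcube (tuple_of_col c) (2 * e)) t) by apply: L1Z; exact: L1_tcube.
have L : vL1 h by exact: (L1_dom mh LK dom).
split => //; apply: (le_trans (Ex_abs L)); apply: (le_trans (Ex_le (L1_abs L) LK dom)).
rewrite ExZ ?L1_tcube // Ex_tcube // mulrA le_of_eq //; congr (_ * (_ * _) ^+ n); ring.
Qed.

(** Difference quotients integrate to 0 by translation invariance; they are bounded by the Lipschitz
    constant and supported in a fixed cube, so the limit may be taken inside the integral. *)
Lemma vint_derive0 f v : smooth f -> compact (supp f) ->
  vL1 ('D_v f) /\ vint ('D_v f) = 0.
Proof.
move=> sf cf; have [L L0 hL] := smooth_lipschitz sf cf.
have vf : vborel f by exact: (vborel_cont (smooth_cont sf)).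
have [r r0 hr] : exists2 r : R, 0 < r & forall y, r < `|y| -> f y = 0.
  have := compact_bounded cf => -[M [_ hM]]; exists (`|M| + 1); first by rewrite ltr_wpDl.
  move=> y hy; apply: notin_supp => hs.
  have M1 : M < `|M| + 1 by rewrite (le_lt_trans (ler_norm M)) // ltrDl.
  by move: (hM _ M1 y hs); rewrite /= leNgt hy.
pose D m x := (stepR m)^-1 * (f (x + stepR m *: v) - f x) : R.
have mD m : vborel (D m).
  apply: measurable_funM; first exact: measurable_cst.
  by apply: measurable_funB => //; exact: vborel_shift.
pose r' := r + `|v| + 1; have r'0 : 0 < r' by rewrite ltr_wpDl // addr_ge0 // ltW.
have Dle m x : `|D m x| <= L * `|v|.
  rewrite /D normrM ger0_norm ?invr_ge0 ?(ltW (stepR_gt0 m)) // ler_pdivrMl ?stepR_gt0 //.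
  rewrite (le_trans (hL _ _)) // addrAC subrr add0r normrZ (ger0_norm (ltW (stepR_gt0 m))).
  by rewrite le_of_eq //; ring.
have D0 m x : r' < `|x - 0| -> D m x = 0.
  rewrite subr0 => hx; rewrite /D !hr ?subr0 ?mulr0 //.
    by apply: le_lt_trans hx; rewrite /r' -addrA lerDl addr_ge0.
  have : `|x| <= `|x + stepR m *: v| + `|stepR m *: v|.
    by rewrite -{1}(addrK (stepR m *: v) x) ler_normB.
  have : `|stepR m *: v| <= `|v| by rewrite normrZ (ger0_norm (ltW (stepR_gt0 m))) ler_piMl // stepR_le1.
  by move: hx; rewrite /r'; lra.
have LD m := (vint_bounded (mD m) r'0 (mulr_ge0 L0 (normr_ge0 v)) (Dle m) (D0 m)).1.
have e2 : 0 <= 2 * r' by rewrite mulr_ge0 // ltW.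
have dom m t : `|D m (col_of_tuple t)| <= L * `|v| * \1_(tcube (tuple_of_col 0) (2 * r')) t.
  have [ht|ht] := leP `|col_of_tuple t - 0| r'; last by rewrite D0 // normr0 !mulr_ge0 // indicE.
  rewrite indicE mem_set ?mulr1 // => i; rewrite tnth_mktuple.
  have := le_trans (mxnorm_entry (col_of_tuple t - 0) i 0) ht; rewrite !mxE ler_norml => /andP[h1 h2].
  by apply/andP; split; lra.
have lim t : D m (col_of_tuple t) @[m --> \oo] --> 'D_v f (col_of_tuple t).
  by apply: derivable_step; exact: (smooth_C1 sf).1.
have [h1 h2] := Ex_dominated mD lim (L1Z (L * `|v|) (L1_tcube (tuple_of_col 0) e2)) dom.
split => //; apply: cvg_unique h2 _ => //.
have Lf : vL1 f.
  have [C C0 hC] := smooth_bounded sf cf.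
  apply: (vint_bounded (c := 0) vf r0 C0 hC _).1 => x; rewrite subr0; exact: hr.
have -> : (fun m => Ex lam (fun t => D m (col_of_tuple t))) = (fun=> 0).
  apply/funext => m; rewrite /D ExZ; last by apply: L1B => //; exact: (L1_shift (stepR m *: v) vf Lf).
  rewrite ExB //; last exact: (L1_shift (stepR m *: v) vf Lf).
  by rewrite (Ex_shift (stepR m *: v) vf Lf) subrr mulr0.
exact: cvg_cst.
Qed.

(** The lower bound integrates the minimum [m0] over a cube of side [e] around [c], where the
    rescaled argument stays within [2^-1]. *)
Lemma bump_mass c e : 0 < e -> vL1 (bump c e) /\ m0 * e ^+ n <= vint (bump c e).
Proof.
move=> e0; have sb := smooth_class_smooth (smooth_class_bump c e).
have vb : vborel (bump c e) by exact: (vborel_cont (smooth_cont sb)).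
have [C C0 hC] := smooth_bounded sb (bump_compact e0).
have [L _] : vL1 (bump c e) /\ `|vint (bump c e)| <= C * (4 * e) ^+ n.
  apply: (vint_bounded (c := c) vb e0 C0 hC) => x hx; apply/eqP; apply: contraTT hx => /(bump_supp e0).
  by rewrite -leNgt.
split => //; have e2 : 0 <= e / 2 by rewrite divr_ge0 // ltW.
have m00 : 0 <= m0 by rewrite exprn_ge0 // mulr_ge0 // expR_ge0.
have -> : m0 * e ^+ n = Ex lam (fun t => m0 * \1_(tcube (tuple_of_col c) (e / 2)) t).
  by rewrite ExZ ?L1_tcube // Ex_tcube //; congr (_ * _ ^+ n); field.
apply: Ex_le => //; first by apply: L1Z; exact: L1_tcube.
move=> t; rewrite indicE; case: (boolP (_ \in _)) => [/set_mem ht|_] /=; last by rewrite mulr0 bump_ge0.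
rewrite mulr1; apply: unit_bump_lb; rewrite normrZ ger0_norm ?invr_ge0 ?(ltW e0) //.
by rewrite ler_pdivrMl //; exact: (tcube_norm e2 ht).
Qed.

(** An approximate identity at [c], normalized by its own integral. *)
Definition nbump c m x : R := (vint (bump c (stepR m)))^-1 * bump c (stepR m) x.

Let mass_gt0 c m : 0 < vint (bump c (stepR m)).
Proof.
apply: lt_le_trans (bump_mass c (stepR_gt0 m)).2.
by rewrite mulr_gt0 // exprn_gt0 ?stepR_gt0 // mulr_gt0 // expR_gt0.
Qed.

Lemma smooth_class_nbump c m : smooth_class (nbump c m).
Proof. by apply: sc_mul; [exact: sc_cst|exact: smooth_class_bump]. Qed.

Lemma nbump_supp c m x : nbump c m x != 0 -> `|x - c| <= stepR m.
Proof. by rewrite mulf_eq0 negb_or => /andP[_]; exact/bump_supp/stepR_gt0. Qed.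

Lemma nbump_derive_supp c m x v : stepR m < `|x - c| -> 'D_v (nbump c m) x = 0.
Proof.
move=> hx; apply: near_derive0; near=> y; apply/eqP; apply: contraTT (hx) => /nbump_supp hy.
exfalso; have : stepR m < `|y - c|; last by rewrite ltNge hy.
near: y; apply: (@cvgr_gt _ _ _ _ _ `|x - c|) => //.
by apply: cvg_norm; apply: cvgB; [exact: cvg_id|exact: cvg_cst].
Unshelve. all: by end_near. Qed.

Lemma nbump_compact c m : compact (supp (nbump c m)).
Proof.
apply: (@compact_bounded_supp _ (`|c| + 1)) => x /nbump_supp h.
have -> : x = c + (x - c) by rewrite addrC subrK.
by rewrite (le_trans (ler_normD _ _)) // lerD2l (le_trans h) // stepR_le1.
Qed.


(* The derivative of the normalized bump has mass of order 1/stepR m, spread over a cube of that size. *)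
Lemma nbump_derive_int : exists2 K : R, 0 <= K & forall c m i (h : vec -> R) (e : R), 0 <= e -> vborel h ->
  (forall x, `|x - c| <= stepR m -> `|h x| <= e * stepR m) ->
  vL1 (fun x => h x * 'D_(evec i) (nbump c m) x) /\ `|vint (fun x => h x * 'D_(evec i) (nbump c m) x)| <= e * K.
Proof.
have [M M0 hM] := bump_derive_le.
have m00 : 0 < m0 by rewrite exprn_gt0 // mulr_gt0 // expR_gt0.
exists (M * 4 ^+ n / m0) => [|c m i h e e0 vh hh]; first by rewrite divr_ge0 ?(ltW m00) // mulr_ge0 // exprn_ge0.
set s := stepR m in hh *; have s0 : 0 < s by exact: stepR_gt0.
set N := vint (bump c s); have N0 : 0 < N by exact: mass_gt0.
have hN : m0 * s ^+ n <= N by exact: (bump_mass c s0).2.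
have snb := smooth_class_smooth (smooth_class_nbump c m).
have D x : 'D_(evec i) (nbump c m) x = N^-1 * 'D_(evec i) (bump c s) x.
  have db : derivable (bump c s) x (evec i) by exact: (smooth_C1 (smooth_class_smooth (smooth_class_bump c s))).1.
  have hb : is_derive x (evec i) (bump c s) ('D_(evec i) (bump c s) x) by exact: DeriveDef db erefl.
  have hd := is_deriveM (is_derive_cst (N^-1) x (evec i)) hb.
  rewrite /nbump -/s -/N.
  have -> : (fun y => N^-1 * bump c s y) = (cst N^-1 : vec -> R) * bump c s by [].
  by rewrite derive_val /GRing.scale /= mulr0 addr0.
have vD : vborel ('D_(evec i) (nbump c m)) by exact: (vborel_cont (smooth_cont (smooth_derive _ snb))).
have K0 : 0 <= e * s * (N^-1 * (M / s)).
  by rewrite mulr_ge0 // ?mulr_ge0 ?invr_ge0 ?(ltW s0) ?(ltW N0) // divr_ge0 // ltW.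
have [L hL] : vL1 (fun x => h x * 'D_(evec i) (nbump c m) x) /\
   `|vint (fun x => h x * 'D_(evec i) (nbump c m) x)| <= e * s * (N^-1 * (M / s)) * (4 * s) ^+ n.
  apply: (@vint_bounded (fun x => h x * 'D_(evec i) (nbump c m) x) c s) => // [|x|x hx]; first exact: measurable_funM.
    have [hx|hx] := leP `|x - c| s; last by rewrite nbump_derive_supp // mulr0 normr0.
    rewrite normrM; apply: ler_pM => //; first exact: hh.
    by rewrite D normrM ger0_norm ?invr_ge0 ?(ltW N0) // ler_wpM2l ?invr_ge0 ?(ltW N0) // hM.
  by rewrite nbump_derive_supp // mulr0.
split => //; apply: (le_trans hL).
have -> : e * s * (N^-1 * (M / s)) * (4 * s) ^+ n = e * (M * 4 ^+ n * (s ^+ n / N)).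
  by rewrite exprMn; field; rewrite !gt_eqF.
rewrite ler_wpM2l // ler_wpM2l ?mulr_ge0 ?exprn_ge0 // ler_pdivrMr // mulrC -ler_pdivrMr ?invr_gt0 //.
by rewrite invrK mulrC.
Qed.

Lemma nbump_int1 c m : vL1 (nbump c m) /\ vint (nbump c m) = 1.
Proof.
have [L _] := bump_mass c (stepR_gt0 m); split; first exact: L1Z.
by rewrite /nbump ExZ // mulVf // gt_eqF.
Qed.

Lemma nbump_int_value c (h : vec -> R) : vborel h -> {for c, continuous h} ->
  vint (fun x => h x * nbump c m x) @[m --> \oo] --> h c.
Proof.
move=> vh ch; apply/cvgrPdist_le => e e0.
have /cvgrPdist_le /(_ e e0) /nbhs_ballP [r /= r0 hr] := ch.
have /cvgrPdist_lt /(_ r r0) [M _ hM] := @stepR_cvg R.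
exists M => // m Mm.
have sr : stepR m < r by have := hM m Mm; rewrite /= sub0r normrN ger0_norm // ltW // stepR_gt0.
have [L1n En] := nbump_int1 c m.
have n0 x : 0 <= nbump c m x by rewrite mulr_ge0 ?bump_ge0 // invr_ge0 ltW.
have vn : vborel (nbump c m) by exact: (vborel_cont (smooth_cont (smooth_class_smooth (smooth_class_nbump c m)))).
have dom x : `|(h c - h x) * nbump c m x| <= e * nbump c m x.
  rewrite normrM [`|nbump c m x|]ger0_norm //.
  have [z|z] := eqVneq (nbump c m x) 0; first by rewrite z !mulr0.
  by rewrite ler_wpM2r // hr // -ball_normE /= distrC (le_lt_trans (nbump_supp z)).
have vhn : vborel (fun x => (h c - h x) * nbump c m x).
  by apply: measurable_funM => //; apply: measurable_funB => //; exact: measurable_cst.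
have L1d : vL1 (fun x => (h c - h x) * nbump c m x).
  by apply: (L1_dom vhn (L1Z e L1n)) => t; exact: dom.
have -> : h c - vint (fun x => h x * nbump c m x) = vint (fun x => (h c - h x) * nbump c m x).
  have L1h : vL1 (fun x => h x * nbump c m x).
    have := L1B (L1Z (h c) L1n) L1d; congr L1; apply/funext => t; ring.
  rewrite -[X in X - _ = _]mulr1 -En -(ExZ (h c) L1n) -(ExB (L1Z (h c) L1n) L1h).
  by congr Ex; apply/funext => t; rewrite mulrBl.
apply: (le_trans (Ex_abs L1d)); rewrite -[leRHS]mulr1 -En -(ExZ e L1n).
by apply: Ex_le => [||t]; [exact: L1_abs|exact: L1Z|exact: dom].
Qed.

(** Integration by parts for an [h] that is differentiable at [c] only. Against the derivative of
    the bump the constant part of [h] gives 0, the linear part gives the limit exactly, and the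
    remainder [o(|x - c|)] is multiplied by a derivative of total mass [O(1 / stepR m)] on a set of
    radius [stepR m]. *)
Lemma nbump_int_derive c (h : vec -> R) (dh : 'I_n -> R) i : vborel h ->
  (forall e, 0 < e -> \forall x \near c, `|h x - h c - \sum_j dh j * (x j 0 - c j 0)| <= e * `|x - c|) ->
  vint (fun x => h x * 'D_(evec i) (nbump c m) x) @[m --> \oo] --> - dh i.
Proof.
move=> vh dfh; have [K K0 hK] := nbump_derive_int.
apply/cvgrPdist_le => e e0.
have eK : 0 < e / (K + 1) by rewrite divr_gt0 // ltr_wpDl.
have /nbhs_normP [r /= r0 hr] := dfh _ eK.
have /cvgrPdist_lt /(_ r r0) [M _ hM] := @stepR_cvg R.
exists M => // m Mm.
have sr : stepR m < r by have := hM m Mm; rewrite /= sub0r normrN ger0_norm // ltW // stepR_gt0.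
pose q x := h x - h c - \sum_j dh j * (x j 0 - c j 0).
have vc j : vborel (fun x : vec => x j 0 - c j 0).
  by apply: measurable_funB; [exact: mmeas_col_of_tuple|exact: measurable_cst].
have vq : vborel q.
  apply: measurable_funB; first by apply: measurable_funB => //; exact: measurable_cst.
  by apply: measurable_sumr => j _; apply: measurable_funM; [exact: measurable_cst|exact: vc].
have [Lq hq] : vL1 (fun x => q x * 'D_(evec i) (nbump c m) x) /\ `|vint (fun x => q x * 'D_(evec i) (nbump c m) x)| <= e / (K + 1) * K.
  apply: hK => //; first exact: ltW.
  move=> x hx; have xr : `|c - x| < r by rewrite distrC (le_lt_trans hx).
  by rewrite (le_trans (hr x xr)) // ler_wpM2l // ltW.
have sn := smooth_class_nbump c m; have snb := smooth_class_smooth sn.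
have [L0 E0] := vint_derive0 (evec i) snb (@nbump_compact c m).
have Ec j : vL1 (fun x => (x j 0 - c j 0) * 'D_(evec i) (nbump c m) x) /\
   vint (fun x => (x j 0 - c j 0) * 'D_(evec i) (nbump c m) x) = - (i == j)%:R.
  (* The integral of the derivative of this product is 0, which evaluates the linear part
     exactly. *)
  pose p x := (x j 0 + - c j 0) * nbump c m x.
  have sp : smooth p.
    apply: smooth_class_smooth; apply: sc_mul => //.
    by apply: sc_add; [exact: sc_coord|exact: sc_cst].
  have cp : compact (supp p).
    apply: (@compact_bounded_supp _ (`|c| + 1)) => x; rewrite mulf_eq0 negb_or => /andP[_ /nbump_supp h'].
    have -> : x = c + (x - c) by rewrite addrC subrK.
    by rewrite (le_trans (ler_normD _ _)) // lerD2l (le_trans h') // stepR_le1.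
  have [Lp Ep] := vint_derive0 (evec i) sp cp.
  have [Ln En] := nbump_int1 c m.
  have e1 : (fun t => 'D_(evec i) p (col_of_tuple t)) = (fun t => (col_of_tuple t j 0 - c j 0) * 'D_(evec i) (nbump c m) (col_of_tuple t)
      + (i == j)%:R * nbump c m (col_of_tuple t)).
    apply/funext => t; set x := col_of_tuple t.
    have [dn _] := smooth_C1 snb; have dnx := dn x (evec i).
    have hd : is_derive x (evec i) p ((x j 0 - c j 0) * 'D_(evec i) (nbump c m) x + (i == j)%:R * nbump c m x).
      have d1 : is_derive x (evec i) (fun y : vec => y j 0 + - c j 0) (i == j)%:R.
        apply: is_derive_of_line.
        have -> : (fun s : R => (x + s *: evec i) j 0 + - c j 0) = (fun s => (x j 0 - c j 0) + s * (i == j)%:R).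
          by apply/funext => s; rewrite !mxE eqxx andbT eq_sym; ring.
        by apply: is_derive_eq; rewrite /GRing.scale /=; ring.
      have d2 : is_derive x (evec i) (nbump c m) ('D_(evec i) (nbump c m) x) by split.
      have d3 := is_deriveM d1 d2.
      apply: is_derive_eq; rewrite /GRing.scale /=; ring.
    by rewrite derive_val.
  rewrite e1 in Lp Ep.
  have Ln' : L1 lam (fun t => (i == j)%:R * nbump c m (col_of_tuple t)) by exact: L1Z.
  have L : vL1 (fun x => (x j 0 - c j 0) * 'D_(evec i) (nbump c m) x).
    by have := L1B Lp Ln'; congr L1; apply/funext => t; rewrite addrK.
  split => //; move: Ep; rewrite (ExD L Ln') (ExZ _ Ln) En mulr1 => /eqP.
  by rewrite addr_eq0 => /eqP.
have Lcd j : L1 lam (fun t => dh j * ((col_of_tuple t j 0 - c j 0) * 'D_(evec i) (nbump c m) (col_of_tuple t))).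
  by apply: L1Z; case: (Ec j).
have LS : L1 lam (fun t => \sum_j dh j * ((col_of_tuple t j 0 - c j 0) * 'D_(evec i) (nbump c m) (col_of_tuple t))).
  by apply: L1_sum => j _.
have LZ := L1Z (h c) L0.
have eh : vint (fun x => h x * 'D_(evec i) (nbump c m) x) = vint (fun x => q x * 'D_(evec i) (nbump c m) x) - dh i.
  have -> : (fun t => h (col_of_tuple t) * 'D_(evec i) (nbump c m) (col_of_tuple t)) = (fun t =>
     q (col_of_tuple t) * 'D_(evec i) (nbump c m) (col_of_tuple t) + h c * 'D_(evec i) (nbump c m) (col_of_tuple t)
     + \sum_j dh j * ((col_of_tuple t j 0 - c j 0) * 'D_(evec i) (nbump c m) (col_of_tuple t))).
    apply/funext => t; rewrite /q; set x := col_of_tuple t; set D := 'D_ _ _ x.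
    have -> : \sum_j dh j * ((x j 0 - c j 0) * D) = (\sum_j dh j * (x j 0 - c j 0)) * D.
      by rewrite mulr_suml; apply: eq_bigr => j _; rewrite mulrA.
    by ring.
  rewrite (ExD (L1D Lq LZ) LS) (ExD Lq LZ) (ExZ (h c) L0) E0 mulr0 addr0; congr (_ + _).
  rewrite Ex_sum // (bigD1 i) //= big1 => [|j ji].
    by rewrite ExZ; [rewrite (Ec i).2 eqxx mulrN1 addr0|case: (Ec i)].
  by rewrite ExZ; [rewrite (Ec j).2 eq_sym (negbTE ji) oppr0 mulr0|case: (Ec j)].
rewrite eh opprB addrA addNr add0r normrN (le_trans hq) // -mulrA ler_piMr ?(ltW e0) //.
by rewrite mulrC ler_pdivrMr ?ltr_wpDl // mul1r lerDl.
Qed.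

End smooth_class.

Lemma differentiable_near {R : realType} {n : nat} (h : 'cV[R]_n -> R) (c : 'cV[R]_n) (e : R) :
  differentiable h c -> 0 < e ->
  \forall x \near c, `|h x - h c - \sum_j 'D_(evec j) h c * (x j 0 - c j 0)| <= e * `|x - c|.
Proof.
move=> dh e0; have /eqaddoP H := diff_locally dh.
have /nbhs_normP [r /= r0 hr] := H e e0.
apply/nbhs_normP; exists r => //= x xr.
have xr' : `|0 - (x - c)| < r by rewrite sub0r normrN distrC.
have := hr (x - c) xr'; rewrite /= !fctE /= subrK opprD addrA; congr (`|_ - _| <= _).
rewrite -deriveE //.
have -> : 'D_(x - c) h c = \sum_j (x - c) j 0 * 'D_(evec j) h c.
  rewrite deriveE // {1}(vec_sum (x - c)) linear_sum; apply: eq_bigr => j _.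
  by rewrite linearZ /= deriveE.
by apply: eq_bigr => j _; rewrite mulrC !mxE.
Qed.

(** * The limiting quadratic form and its null weights *)

Section kernel.
Context {R : realType} {n : nat} {d : measure_display} {T : measurableType d}.
Variables (P : probability T R) (X : T -> 'cV[R]_n) (p : 'cV[R]_n -> R).
Hypothesis dX : has_density P X p.
Hypothesis dp : forall x, differentiable p x.
Hypothesis L2 : forall i, L1 P (fun w => X w i 0 ^+ 2).
Let mu := mean_vec P X.
Let Sigma := cov_mx P X.
Hypothesis key : forall f, smooth f -> compact (supp f) -> supp f `<=` interior (supp p) ->
  0 <= Ex P (fun w => f (X w) * linear_part P X f (X w)).
Implicit Types (x c v : 'cV[R]_n) (h : 'cV[R]_n -> R).
Notation lam := (@lebesgue_tuple R n).
Notation vint h := (Ex lam (fun t => h (col_of_tuple t))).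

Let rvX : random_vector X. Proof. by case: dX. Qed.
Let p0 x : 0 <= p x. Proof. by case: dX => _ []. Qed.
Let vp : vborel p. Proof. by case: dX => _ [_ []]. Qed.
Let cp : continuous p. Proof. by move=> x; exact: differentiable_continuous. Qed.

Let L1X i : L1 P (fun w => X w i 0).
Proof. by apply: L1_sqr => //; exact: random_vector_mmeas. Qed.
Let L1y i : L1 P (fun w => X w i 0 - mu i 0). Proof. by apply: L1B => //; exact: L1_cst. Qed.
Let L2y i : L1 P (fun w => (X w i 0 - mu i 0) ^+ 2).
Proof.
have := L1D (L1B (L2 i) (L1Z (2 * mu i 0) (L1X i))) (L1_cst P (mu i 0 ^+ 2)).
by congr L1; apply/funext => w; ring.
Qed.
Let my i : measurable_fun [set: T] (fun w => X w i 0 - mu i 0). Proof. exact: (L1_meas (L1y i)). Qed.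
Let L1yy i j : L1 P (fun w => (X w i 0 - mu i 0) * (X w j 0 - mu j 0)). Proof. exact: L1_mul. Qed.

Definition cent i x : R := x i 0 - mu i 0.
Definition cprod i j x : R := cent i x * cent j x - Sigma i j.

Let vcent i : vborel (cent i).
Proof. by apply: measurable_funB; [exact: mmeas_col_of_tuple|exact: measurable_cst]. Qed.
Let vcprod i j : vborel (cprod i j).
Proof. by apply: measurable_funB; [apply: measurable_funM; exact: vcent|exact: measurable_cst]. Qed.
Let L1cprod i j : L1 P (fun w => cprod i j (X w)).
Proof. by apply: L1B; [exact: L1yy|exact: L1_cst]. Qed.

Let ccent i : continuous (cent i).
Proof. by move=> x; apply: (@continuousB _ R^o); [exact: coord_continuous|exact: cst_continuous]. Qed.
Let ccprod i j : continuous (cprod i j).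
Proof.
have -> : cprod i j = (fun x => cent i x * cent j x + - Sigma i j) by [].
by apply: contD; [apply: contM; exact: ccent|exact: cst_continuous].
Qed.
Let dcent i x : differentiable (cent i) x.
Proof. by apply: differentiableB; [exact: differentiable_coord|exact: differentiable_cst]. Qed.

Lemma Ex_bump_value h c : vborel h -> L1 P (fun w => h (X w)) -> continuous h ->
  Ex P (fun w => nbump c m (X w) * h (X w)) @[m --> \oo] --> h c * p c.
Proof.
move=> vh Lh ch.
have vhp : vborel (fun x => h x * p x) by exact: measurable_funM.
have e m : Ex P (fun w => nbump c m (X w) * h (X w)) = vint (fun x => h x * p x * nbump c m x).
  have sn := smooth_class_smooth (smooth_class_nbump c m).
  have [C C0 hC] := smooth_bounded sn (@nbump_compact _ _ c m).
  have vn : vborel (nbump c m) by exact: (vborel_cont (smooth_cont sn)).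
  have vnh : vborel (fun x => nbump c m x * h x) by exact: measurable_funM.
  rewrite (density_Ex dX vnh); last first.
    by apply: (@L1_mul_bounded _ _ _ _ _ _ C) => //; exact: (vborel_comp vn).
  by congr Ex; apply/funext => t; ring.
have -> : (fun m => Ex P (fun w => nbump c m (X w) * h (X w))) = (fun m => vint (fun x => h x * p x * nbump c m x)) by apply/funext.
by apply: (nbump_int_value vhp); apply: contM.
Qed.

Lemma Ex_bump_derive h c i : vborel h -> L1 P (fun w => h (X w)) -> differentiable h c ->
  Ex P (fun w => 'D_(evec i) (nbump c m) (X w) * h (X w)) @[m --> \oo] -->
    - 'D_(evec i) (fun x => h x * p x) c.
Proof.
move=> vh Lh dh.
have vhp : vborel (fun x => h x * p x) by exact: measurable_funM.
have e m : Ex P (fun w => 'D_(evec i) (nbump c m) (X w) * h (X w)) = vint (fun x => h x * p x * 'D_(evec i) (nbump c m) x).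
  have sn := smooth_class_smooth (smooth_class_nbump c m).
  have sd := smooth_derive (evec i) sn.
  have [C C0 hC] := smooth_bounded sd (compact_supp_derive (v := evec i) (@nbump_compact _ _ c m)).
  have vn : vborel ('D_(evec i) (nbump c m)) by exact: (vborel_cont (smooth_cont sd)).
  have vnh : vborel (fun x => 'D_(evec i) (nbump c m) x * h x) by exact: measurable_funM.
  rewrite (density_Ex dX vnh); last first.
    by apply: (@L1_mul_bounded _ _ _ _ _ _ C) => //; exact: (vborel_comp vn).
  by congr Ex; apply/funext => t; ring.
have -> : (fun m => Ex P (fun w => 'D_(evec i) (nbump c m) (X w) * h (X w))) =
  (fun m => vint (fun x => h x * p x * 'D_(evec i) (nbump c m) x)) by apply/funext.
apply: (@nbump_int_derive R n c (fun x => h x * p x) (fun j => 'D_(evec j) (fun x => h x * p x) c) i vhp) => eps eps0.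
by apply: differentiable_near => //; exact: differentiableM.
Qed.

Definition lyap_form (B : 'M[R]_n) i j : R :=
  \tr (lyap (sqrtmx Sigma) (delta_mx i j) *m invmx (sqrtmx Sigma) *m B).

Lemma lyap_formE B i j : lyap_form B i j =
  \sum_k \sum_l (lyap (sqrtmx Sigma) (delta_mx i j) *m invmx (sqrtmx Sigma)) k l * B l k.
Proof. by apply: eq_bigr => k _; rewrite mxE. Qed.

Lemma lyap_formD B B' i j : lyap_form (B + B') i j = lyap_form B i j + lyap_form B' i j.
Proof. by rewrite /lyap_form mulmxDr raddfD. Qed.
Lemma lyap_formZ s B i j : lyap_form (s *: B) i j = s * lyap_form B i j.
Proof. by rewrite /lyap_form -scalemxAr linearZ. Qed.

Section family.
Variables (k : nat) (a : 'I_k -> R) (y : 'I_k -> 'cV[R]_n).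
Hypothesis py : forall t, 0 < p (y t).

Definition fam_grad i : R := \sum_t a t * - 'D_(evec i) p (y t).
Definition fam_cgrad : 'M[R]_n := \matrix_(i, j) \sum_t a t * - 'D_(evec j) (fun x => cent i x * p x) (y t).
Definition fam_cent i : R := \sum_t a t * (cent i (y t) * p (y t)).
Definition fam_cprod i j : R := \sum_t a t * (cprod i j (y t) * p (y t)).

Let F m x := \sum_t a t * nbump (y t) m x.

Let scF m : smooth_class (F m).
Proof. by apply: smooth_class_sum => t; apply: sc_mul; [exact: sc_cst|exact: smooth_class_nbump]. Qed.

Let F_near m x : F m x != 0 -> exists t, `|x - y t| <= stepR m.
Proof.
move=> nz; apply: contrapT => /forallNP H; move/eqP: nz; apply.
rewrite /F big1 // => t _; have [->|z] := eqVneq (nbump (y t) m x) 0; first by rewrite mulr0.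
by case: (H t); exact: nbump_supp.
Qed.

Let F_compact m : compact (supp (F m)).
Proof.
apply: (@compact_bounded_supp _ _ _ (\sum_t `|y t| + 1)) => x /F_near [t ht].
have -> : x = y t + (x - y t) by rewrite addrC subrK.
rewrite (le_trans (ler_normD _ _)) // lerD //; last by rewrite (le_trans ht) // stepR_le1.
by rewrite (bigD1 t) //= lerDl sumr_ge0.
Qed.

Let U_interior x : 0 < p x -> interior (supp p) x.
Proof.
move=> px; rewrite /interior; have /cvgr_gt /(_ _ px) := @cp x; apply: filterS => z pz.
by apply: subset_closure; rewrite /= gt_eqF.
Qed.

Let F_supp : exists M, forall m, (M <= m)%N -> supp (F m) `<=` interior (supp p).
Proof.
have ht t : exists M, forall m, (M <= m)%N -> forall x, `|x - y t| <= 2 * stepR m -> 0 < p x.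
  have /cvgr_gt /(_ _ (py t)) /nbhs_normP [r /= r0 hr] := @cp (y t).
  have r2 : 0 < r / 2 by rewrite divr_gt0.
  have /cvgrPdist_lt /(_ _ r2) [M _ hM] := @stepR_cvg R; exists M => m Mm x hx.
  apply: (hr x); rewrite /= distrC (le_lt_trans hx) //.
  have := hM m Mm; rewrite /= sub0r normrN ger0_norm ?(ltW (stepR_gt0 m)) //; lra.
have [M hM] := choice ht; exists (\max_t M t)%N => m Mm x hx.
(* A point of the closed support is within [stepR m] of a point where the sum is nonzero, itself
   within [stepR m] of a centre; hence the radius [2 * stepR m] above. *)
have /hx [z [/= Fz]] : nbhs x (ball x (stepR m)) by apply: nbhsx_ballx; exact: stepR_gt0.
rewrite -ball_normE /= => xz; have [t tz] := F_near Fz.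
apply: U_interior; apply: (hM t m); first exact: leq_trans (leq_bigmax t) Mm.
have -> : x - y t = (x - z) + (z - y t) by rewrite addrA subrK.
by rewrite (le_trans (ler_normD _ _)) // mulr_natl mulr2n lerD // ltW.
Qed.

Let snb c m := smooth_class_smooth (smooth_class_nbump (R := R) c m).
Let derive_F m i x : 'D_(evec i) (F m) x = \sum_t a t * 'D_(evec i) (nbump (y t) m) x.
Proof.
have dF t : is_derive x (evec i) (fun z => a t * nbump (y t) m z) (a t * 'D_(evec i) (nbump (y t) m) x).
  have hb : is_derive x (evec i) (nbump (y t) m) ('D_(evec i) (nbump (y t) m) x).
    by apply: DeriveDef; [exact: (smooth_C1 (snb _ _)).1|].
  have hd := is_deriveM (is_derive_cst (a t) x (evec i)) hb.
  by apply: is_derive_eq; rewrite /GRing.scale /= mulr0 addr0.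
have := is_derive_sum dF => h.
have -> : F m = \sum_t (fun z => a t * nbump (y t) m z) by apply/funext => z; rewrite fct_sumE.
by rewrite derive_val.
Qed.

Let bnd_nb c m : exists C, forall x, `|nbump c m x| <= C.
Proof. by have [C _ hC] := smooth_bounded (snb c m) (@nbump_compact _ _ c m); exists C. Qed.
Let bnd_dnb c m i : exists C, forall x, `|'D_(evec i) (nbump c m) x| <= C.
Proof.
by have [C _ hC] := smooth_bounded (smooth_derive (evec i) (snb c m)) (compact_supp_derive (v := evec i) (@nbump_compact _ _ c m)); exists C.
Qed.

Let L1nb c m h : vborel h -> L1 P (fun w => h (X w)) -> L1 P (fun w => nbump c m (X w) * h (X w)).
Proof.
move=> vh Lh; have [C hC] := bnd_nb c m; apply: (@L1_mul_bounded _ _ _ _ _ _ C) => //.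
exact: (vborel_comp (vborel_cont (smooth_cont (snb c m)))).
Qed.
Let L1dnb c m i h : vborel h -> L1 P (fun w => h (X w)) -> L1 P (fun w => 'D_(evec i) (nbump c m) (X w) * h (X w)).
Proof.
move=> vh Lh; have [C hC] := bnd_dnb c m i; apply: (@L1_mul_bounded _ _ _ _ _ _ C) => //.
exact: (vborel_comp (vborel_cont (smooth_cont (smooth_derive (evec i) (snb c m))))).
Qed.

Let L1F m h : vborel h -> L1 P (fun w => h (X w)) -> L1 P (fun w => F m (X w) * h (X w)).
Proof.
move=> vh Lh; have : L1 P (fun w => \sum_t a t * (nbump (y t) m (X w) * h (X w))).
  by apply: L1_sum => t _; apply: L1Z; exact: L1nb.
by congr L1; apply/funext => w; rewrite /F mulr_suml; apply: eq_bigr => t _; rewrite mulrA.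
Qed.

Let F_value h : vborel h -> L1 P (fun w => h (X w)) -> continuous h ->
  Ex P (fun w => F m (X w) * h (X w)) @[m --> \oo] --> \sum_t a t * (h (y t) * p (y t)).
Proof.
move=> vh Lh ch.
have -> : (fun m => Ex P (fun w => F m (X w) * h (X w))) = (fun m => \sum_t a t * Ex P (fun w => nbump (y t) m (X w) * h (X w))).
  apply/funext => m; transitivity (Ex P (fun w => \sum_t a t * (nbump (y t) m (X w) * h (X w)))).
    by congr Ex; apply/funext => w; rewrite /F mulr_suml; apply: eq_bigr => t _; rewrite mulrA.
  rewrite Ex_sum => [|t _]; last by apply: L1Z; exact: L1nb.
  by apply: eq_bigr => t _; rewrite ExZ //; exact: L1nb.
apply: cvg_sumr => t _; apply: cvgM; first exact: cvg_cst.
exact: Ex_bump_value.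
Qed.

Let F_derive h i : vborel h -> L1 P (fun w => h (X w)) -> (forall x, differentiable h x) ->
  Ex P (fun w => 'D_(evec i) (F m) (X w) * h (X w)) @[m --> \oo] -->
    \sum_t a t * - 'D_(evec i) (fun x => h x * p x) (y t).
Proof.
move=> vh Lh dh.
have -> : (fun m => Ex P (fun w => 'D_(evec i) (F m) (X w) * h (X w))) =
   (fun m => \sum_t a t * Ex P (fun w => 'D_(evec i) (nbump (y t) m) (X w) * h (X w))).
  apply/funext => m; transitivity (Ex P (fun w => \sum_t a t * ('D_(evec i) (nbump (y t) m) (X w) * h (X w)))).
    by congr Ex; apply/funext => w; rewrite derive_F mulr_suml; apply: eq_bigr => t _; rewrite mulrA.
  rewrite Ex_sum => [|t _]; last by apply: L1Z; exact: L1dnb.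
  by apply: eq_bigr => t _; rewrite ExZ //; exact: L1dnb.
apply: cvg_sumr => t _; apply: cvgM; first exact: cvg_cst.
exact: Ex_bump_derive.
Qed.

(** In the limit a bump evaluates [h * p] at its centre, and the derivative of a bump evaluates
    minus the derivative of [h * p]; this is where the signs in [fam_grad] and [fam_cgrad] come
    from. *)
Lemma kernel_ge0 : 0 <= \sum_i fam_grad i * fam_cent i + \sum_i \sum_j lyap_form fam_cgrad i j * fam_cprod i j.
Proof.
pose Q m := \sum_i Ex P (fun w => 'D_(evec i) (F m) (X w) * 1) * Ex P (fun w => F m (X w) * cent i (X w)) +
  \sum_i \sum_j (\sum_k \sum_l (lyap (sqrtmx Sigma) (delta_mx i j) *m invmx (sqrtmx Sigma)) k l *
    Ex P (fun w => 'D_(evec k) (F m) (X w) * cent l (X w))) * Ex P (fun w => F m (X w) * cprod i j (X w)).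
have QE m : Q m = Ex P (fun w => F m (X w) * linear_part P X (F m) (X w)).
  rewrite /linear_part.
  have LF1 i := L1F m (vcent i) (L1y i); have LF2 i j := L1F m (vcprod i j) (L1cprod i j).
  have -> : (fun w => F m (X w) * (\sum_i wgrad P X (F m) 0 i * (X w i 0 - mean_vec P X i 0) +
     \sum_i \sum_j lyap_coef P X (F m) i j * ((X w i 0 - mean_vec P X i 0) * (X w j 0 - mean_vec P X j 0) - cov_mx P X i j))) =
    (fun w => \sum_i wgrad P X (F m) 0 i * (F m (X w) * cent i (X w)) +
     \sum_i \sum_j lyap_coef P X (F m) i j * (F m (X w) * cprod i j (X w))).
    apply/funext => w; rewrite mulrDr; congr (_ + _).
      by rewrite mulr_sumr; apply: eq_bigr => i _; rewrite mulrCA.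
    by rewrite mulr_sumr; apply: eq_bigr => i _; rewrite mulr_sumr; apply: eq_bigr => j _; rewrite mulrCA.
  rewrite ExD; last 2 first.
  - by apply: L1_sum => i _; apply: L1Z; exact: LF1.
  - by apply: L1_sum => i _; apply: L1_sum => j _; apply: L1Z; exact: LF2.
  congr (_ + _).
    rewrite Ex_sum => [|i _]; last by apply: L1Z; exact: LF1.
    apply: eq_bigr => i _; rewrite (ExZ _ (L1F m (vcent i) (L1y i))) mxE; congr (Ex P _ * _).
    by apply/funext => w; rewrite mulr1.
  rewrite Ex_sum => [|i _]; last by apply: L1_sum => j _; apply: L1Z; exact: LF2.
  apply: eq_bigr => i _; rewrite Ex_sum => [|j _]; last by apply: L1Z; exact: LF2.
  apply: eq_bigr => j _; rewrite (ExZ _ (L1F m (vcprod i j) (L1cprod i j))); congr (_ * _).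
  rewrite /lyap_coef /mxtrace; apply: eq_bigr => k' _; rewrite mxE; apply: eq_bigr => l _.
  by rewrite [wcoord_grad _ _ _ _ _]mxE.
have v1 : vborel (fun _ : 'cV[R]_n => 1 : R) by exact: measurable_cst.
have lim : Q m @[m --> \oo] --> \sum_i fam_grad i * fam_cent i + \sum_i \sum_j lyap_form fam_cgrad i j * fam_cprod i j.
  apply: cvgD.
    apply: cvg_sumr => i _; apply: cvgM; last exact: (F_value (@vcent i) (L1y i) (@ccent i)).
    have -> : fam_grad i = \sum_t a t * - 'D_(evec i) (fun x => 1 * p x) (y t).
      apply: eq_bigr => t _; congr (_ * - _); congr derive; apply/funext => x; by rewrite mul1r.
    apply: F_derive => //; exact: L1_cst.
  apply: cvg_sumr => i _; apply: cvg_sumr => j _; apply: cvgM; last exact: (F_value (@vcprod i j) (L1cprod i j) (@ccprod i j)).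
  rewrite lyap_formE; apply: cvg_sumr => k' _; apply: cvg_sumr => l _; apply: cvgM; first exact: cvg_cst.
  have -> : fam_cgrad l k' = \sum_t a t * - 'D_(evec k') (fun x => cent l x * p x) (y t) by rewrite mxE.
  exact: (F_derive (@vcent l) (L1y l) (@dcent l)).
have [M hM] := F_supp.
apply: (cvgr_to_ge lim); exists M => // m Mm; rewrite QE; apply: key.
- exact: smooth_class_smooth.
- exact: F_compact.
- exact: hM.
Qed.

End family.

(* Add a point x with weight s: the form of kernel_ge0 becomes s q(x) p(x) + O(s^2) with q quadratic in x, so q vanishes
   on {p > 0}, and with it the linear part of q, which is fam_grad. *)
Lemma family_null (k : nat) (a : 'I_k -> R) (y : 'I_k -> 'cV[R]_n) : (forall t, 0 < p (y t)) ->
  (forall i, \sum_t a t * (cent i (y t) * p (y t)) = 0) ->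
  (forall i j, \sum_t a t * (cprod i j (y t) * p (y t)) = 0) ->
  forall i, \sum_t a t * 'D_(evec i) p (y t) = 0.
Proof.
move=> py Z1 Z2 i.
(* A nonempty family is needed below, as the source of a point where [p] is positive. *)
case: k a y py Z1 Z2 => [|k] a y py Z1 Z2; first by rewrite big_ord0.
set G := fam_grad a y; set B := fam_cgrad a y.
pose q x := \sum_i G i * cent i x + \sum_i \sum_j lyap_form B i j * cprod i j x.
have q0 x : 0 < p x -> q x = 0.
  move=> px.
  pose y' (t : 'I_k.+2) := if unlift ord0 t is Some t' then y t' else x.
  have py' t : 0 < p (y' t) by rewrite /y'; case: (unlift ord0 t).
  pose G' i := - 'D_(evec i) p x.
  pose B' : 'M[R]_n := \matrix_(i, j) - 'D_(evec j) (fun z => cent i z * p z) x.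
  pose l := q x * p x.
  pose l' := \sum_i G' i * (cent i x * p x) + \sum_i \sum_j lyap_form B' i j * (cprod i j x * p x).
  have pos s : 0 <= s * l + s ^+ 2 * l'.
    pose a' (t : 'I_k.+2) := if unlift ord0 t is Some t' then a t' else s.
    have ext (H : 'cV[R]_n -> R) : \sum_t a' t * H (y' t) = s * H x + \sum_t a t * H (y t).
      rewrite big_ord_recl /a' /y' unlift_none; congr (_ + _).
      by apply: eq_bigr => t _; rewrite liftK.
    have := kernel_ge0 a' py'.
    have e1 j : fam_grad a' y' j = s * G' j + G j by exact: (ext (fun z => - 'D_(evec j) p z)).
    have e2 j : fam_cent a' y' j = s * (cent j x * p x).
      by rewrite /fam_cent (ext (fun z => cent j z * p z)) Z1 addr0.
    have e3 j l0 : fam_cprod a' y' j l0 = s * (cprod j l0 x * p x).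
      by rewrite /fam_cprod (ext (fun z => cprod j l0 z * p z)) Z2 addr0.
    have e4 : fam_cgrad a' y' = s *: B' + B.
      apply/matrixP => j l0; rewrite !mxE.
      exact: (ext (fun z => - 'D_(evec l0) (fun z => cent j z * p z) z)).
    rewrite e4; under eq_bigr do rewrite e1 e2.
    under [X in _ + X]eq_bigr do under eq_bigr do rewrite lyap_formD lyap_formZ e3.
    have -> : \sum_j (s * G' j + G j) * (s * (cent j x * p x)) =
        s * ((\sum_j G j * cent j x) * p x) + s ^+ 2 * \sum_j G' j * (cent j x * p x).
      rewrite mulr_suml !mulr_sumr -big_split; apply: eq_bigr => j _ /=; ring.
    have -> : \sum_j \sum_l0 (s * lyap_form B' j l0 + lyap_form B j l0) * (s * (cprod j l0 x * p x)) =
        s * ((\sum_j \sum_l0 lyap_form B j l0 * cprod j l0 x) * p x) +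
        s ^+ 2 * \sum_j \sum_l0 lyap_form B' j l0 * (cprod j l0 x * p x).
      rewrite mulr_suml !mulr_sumr -big_split; apply: eq_bigr => j _ /=.
      rewrite mulr_suml !mulr_sumr -big_split; apply: eq_bigr => l0 _ /=; ring.
    by rewrite addrACA -!mulrDr -mulrDl.
  have l0 : l = 0.
    apply/eqP; apply: contraT => lN.
    (* A small weight of sign opposite to [l], for which the linear term beats the quadratic one and
       the form becomes negative. *)
    pose s := - l / (2 * (`|l'| + 1)).
    have L0 : 0 < 2 * (`|l'| + 1) by rewrite mulr_gt0 // ltr_wpDl.
    have := pos s; have -> : s * l + s ^+ 2 * l' = (l ^+ 2 / (2 * (`|l'| + 1)) ^+ 2) * (l' - 2 * (`|l'| + 1)).
      by rewrite /s; field; rewrite gt_eqF.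
    have c0 : 0 < l ^+ 2 / (2 * (`|l'| + 1)) ^+ 2 by apply: divr_gt0; [rewrite exprn_even_gt0|exact: exprn_gt0].
    rewrite (pmulr_rge0 _ c0).
    have := ler_norm l'; have := normr_ge0 l'; lra.
  by move/eqP: l0; rewrite mulf_eq0 (gt_eqF px) orbF => /eqP.
set x0 := y ord0; have px0 : 0 < p x0 by exact: py.
have [r r0 hr] : exists2 r, 0 < r & forall h : 'cV[R]_n, `|h| <= r -> q (x0 + h) = 0.
  have /cvgr_gt /(_ _ px0) /nbhs_normP [r /= r0 hr] := @cp x0; exists (r / 2); first by rewrite divr_gt0.
  move=> h hh; apply: q0; apply: hr; rewrite /= opprD addrA subrr add0r normrN (le_lt_trans hh) //.
  by rewrite ltr_pdivrMr // ltr_pMr // ltr1n.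
pose bil (u v : 'cV[R]_n) := \sum_i \sum_j lyap_form B i j * (u i 0 * v j 0).
pose lin (u : 'cV[R]_n) := \sum_i G i * u i 0.
have bilD u v w : bil (u + v) w = bil u w + bil v w.
  rewrite /bil -big_split; apply: eq_bigr => j _; rewrite -big_split; apply: eq_bigr => l _ /=; rewrite mxE; ring.
have bilD' u v w : bil w (u + v) = bil w u + bil w v.
  rewrite /bil -big_split; apply: eq_bigr => j _; rewrite -big_split; apply: eq_bigr => l _ /=; rewrite mxE; ring.
have bilZ s u v : bil (s *: u) (s *: v) = s ^+ 2 * bil u v.
  rewrite /bil mulr_sumr; apply: eq_bigr => j _; rewrite mulr_sumr; apply: eq_bigr => l _; rewrite !mxE; ring.
have bilN u v : bil u (- v) = - bil u v.
  rewrite /bil -sumrN; apply: eq_bigr => j _; rewrite -sumrN; apply: eq_bigr => l _; rewrite !mxE; ring.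
have bilN' u v : bil (- u) v = - bil u v.
  rewrite /bil -sumrN; apply: eq_bigr => j _; rewrite -sumrN; apply: eq_bigr => l _; rewrite !mxE; ring.
have linN u : lin (- u) = - lin u by rewrite /lin -sumrN; apply: eq_bigr => j _; rewrite mxE; ring.
have qE (x h : 'cV[R]_n) : q (x + h) = q x + lin h + bil (x - mu) h + bil h (x - mu) + bil h h.
  have e1 : \sum_i G i * cent i (x + h) = \sum_i G i * cent i x + lin h.
    by rewrite /lin -big_split; apply: eq_bigr => j _; rewrite /cent !mxE /=; ring.
  have e2 : \sum_i \sum_j lyap_form B i j * cprod i j (x + h) = \sum_i \sum_j lyap_form B i j * cprod i j x +
      bil (x - mu) h + bil h (x - mu) + bil h h.
    rewrite /bil -!big_split; apply: eq_bigr => j _; rewrite -!big_split; apply: eq_bigr => l _ /=.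
    rewrite /cprod /cent !mxE; ring.
  by rewrite /q e1 e2; ring.
have bil0 (h : 'cV[R]_n) : bil h h = 0.
  (* [h] is scaled into the ball where [q] vanishes; adding the values at opposite points then
     isolates the quadratic part. *)
  pose s := r / (`|h| + 1); have h1 : 0 < `|h| + 1 by rewrite ltr_wpDl.
  have s0 : 0 < s by rewrite divr_gt0.
  have hs : `|s *: h| <= r.
    rewrite normrZ ger0_norm ?(ltW s0) // /s -mulrA ler_piMr ?(ltW r0) // mulrC ler_pdivrMr // mul1r lerDl //.
  have := hr _ hs; have hs' : `|- (s *: h)| <= r by rewrite normrN.
  have := hr _ hs'; have := hr 0; rewrite normr0 addr0 => /(_ (ltW r0)) z0.
  rewrite !qE z0 linN !bilN !bilN' opprK bilZ => z1 z2.
  have : s ^+ 2 * bil h h = 0 by lra.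
  by move/eqP; rewrite mulf_eq0 gt_eqF ?exprn_gt0 //= => /eqP.
have lin0 (h : 'cV[R]_n) : `|h| <= r -> lin h = 0.
  move=> hh; have := hr h hh; have := hr 0; rewrite normr0 addr0 => /(_ (ltW r0)) z0.
  rewrite qE z0 bil0 add0r addr0 => z1.
  (* Polarization: the cross terms of [qE] cancel too, which leaves the linear part alone. *)
  have z2 z : bil z h + bil h z = 0 by have := bil0 (z + h); rewrite bilD !bilD' !bil0; lra.
  by move: z1 (z2 (x0 - mu)); lra.
have : lin (r *: evec i) = 0.
  apply: lin0; rewrite normrZ ger0_norm ?(ltW r0) // ler_piMr ?(ltW r0) //.
  by apply: mxnorm_le => // i' j'; rewrite mxE; case: (_ && _); rewrite ?normr1 ?normr0.
have -> : lin (r *: evec i) = r * G i.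
  rewrite /lin (bigD1 i) //= big1 => [|j ji]; first by rewrite !mxE !eqxx /=; ring.
  by rewrite !mxE (negbTE ji) /= !mulr0.
move/eqP; rewrite mulf_eq0 gt_eqF //= /G /fam_grad => /eqP h.
apply/eqP; rewrite -oppr_eq0 -sumrN; apply/eqP; rewrite -[RHS]h.
by apply: eq_bigr => t _; rewrite mulrN.
Qed.

Let D : finType := ('I_n + 'I_n * 'I_n)%type.
Definition score_basis (r : D) x : R :=
  match r with inl i => cent i x | inr (i, j) => cprod i j x end.

(* At points where the rows score_basis * p have maximal rank, the row at any other x is a combination of theirs; by
   family_null the gradient of p is then the same combination. *)
Lemma score_ex : exists theta : D -> 'I_n -> R, forall x, 0 < p x ->
  forall i, 'D_(evec i) p x = p x * \sum_r theta r i * score_basis r x.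
Proof.
pose row_of x : 'rV[R]_#|D| := \row_j (score_basis (enum_val j) x * p x).
pose mat k (y : 'I_k -> 'cV[R]_n) : 'M[R]_(k, #|D|) := \matrix_(t, j) row_of (y t) 0 j.
pose Pr r := `[< exists k (y : 'I_k -> 'cV[R]_n), (forall t, 0 < p (y t)) /\ \rank (mat k y) = r >].
have exP : exists r, Pr r.
  exists (\rank (mat 0%N (fun=> 0))); apply/asboolP; exists 0%N, (fun=> 0); split => // -[] //.
have bP r : Pr r -> (r <= #|D|)%N by move=> /asboolP [k [y [_ <-]]]; exact: rank_leq_col.
case: (ex_maxnP exP bP) => r /asboolP [k [y [py rk]]] maxr.
set V := mat k y in rk.
pose dmat : 'M[R]_(k, n) := \matrix_(t, i) 'D_(evec i) p (y t).
exists (fun r i => (pinvmx V *m dmat) (enum_rank r) i) => x px i.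
pose y' (t : 'I_k.+1) := if unlift ord0 t is Some t' then y t' else x.
have py' t : 0 < p (y' t) by rewrite /y'; case: (unlift ord0 t).
set V' := mat k.+1 y'.
have sub : (V <= V')%MS.
  apply/row_subP => t; have -> : row t V = row (lift ord0 t) V'.
    by apply/rowP => j; rewrite !mxE /y' liftK.
  exact: row_sub.
have rk' : (\rank V' <= r)%N by apply: maxr; apply/asboolP; exists k.+1, y'.
have eqV : (V' <= V)%MS.
  by have := mxrank_leqif_sup sub => -[h1 <-]; rewrite eqn_leq h1 rk rk'.
have sx : (row_of x <= V)%MS.
  apply: submx_trans eqV; have -> : row_of x = row ord0 V'.
    by apply/rowP => j; rewrite !mxE /y' unlift_none.
  exact: row_sub.
pose a := row_of x *m pinvmx V; have aV : a *m V = row_of x by exact: mulmxKpV.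
(* Weights on the enlarged family that annihilate every row: the coefficients of the combination on
   the old points and [-1] on the new one. *)
pose a' (t : 'I_k.+1) := if unlift ord0 t is Some t' then a 0 t' else -1.
have ext (H : 'cV[R]_n -> R) : \sum_t a' t * H (y' t) = - H x + \sum_t a 0 t * H (y t).
  rewrite big_ord_recl /a' /y' unlift_none mulN1r; congr (_ + _).
  by apply: eq_bigr => t _; rewrite liftK.
have hv s : \sum_t a' t * (score_basis s (y' t) * p (y' t)) = 0.
  rewrite (ext (fun z => score_basis s z * p z)).
  have -> : score_basis s x * p x = row_of x 0 (enum_rank s) by rewrite mxE enum_rankK.
  rewrite -aV mxE addrC; apply/eqP; rewrite subr_eq0; apply/eqP/eq_bigr => t _.
  by rewrite [V _ _]mxE [row_of _ _ _]mxE enum_rankK.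
have := family_null py' (fun i => hv (inl i)) (fun i j => hv (inr (i, j))) i.
rewrite (ext ('D_(evec i) p)) => /eqP; rewrite addrC subr_eq0 => /eqP <-.
have -> : \sum_t a 0 t * 'D_(evec i) p (y t) = (row_of x *m (pinvmx V *m dmat)) 0 i.
  by rewrite mulmxA mxE; apply: eq_bigr => t _; rewrite [dmat _ _]mxE.
rewrite mxE mulr_sumr (reindex (@enum_val D D)) /=; last first.
  by exists enum_rank => ? _; [exact: enum_valK|exact: enum_rankK].
apply: eq_bigr => j _; rewrite mxE enum_valK; ring.
Qed.

End kernel.

(** * Densities with a quadratic score *)

(** The exponential of minus the antiderivative is an integrating factor; no positivity of [phi] is
    involved, so zeros of the density are allowed. *)
Lemma quadratic_ode {R : realType} (phi : R -> R) (a b c : R) :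
  (forall t : R, is_derive t 1 phi (phi t * (a + b * t + c * t ^+ 2))) ->
  phi 1 = phi 0 * expR (a + b / 2 + c / 3).
Proof.
move=> dphi.
pose g t : R := - (a * t + b / 2 * t ^+ 2 + c / 3 * t ^+ 3).
have dg t : is_derive t (1 : R) g (- (a + b * t + c * t ^+ 2)).
  have d1 := is_deriveX 2 (is_derive_id t (1 : R)).
  have d2 := is_deriveX 3 (is_derive_id t (1 : R)).
  have := is_deriveN (is_deriveD (is_deriveD (is_deriveZ a (is_derive_id t 1)) (is_deriveZ (b / 2) d1)) (is_deriveZ (c / 3) d2)).
  have -> : g = - (a \*: id + b / 2 \*: (id ^+ 2) + c / 3 \*: (id ^+ 3)) by apply/funext => s.
  by move=> h; apply: is_derive_eq; rewrite /GRing.scale /=; field.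
pose psi t := phi t * expR (g t).
have dpsi t : is_derive t (1 : R) psi 0.
  have de := @is_derive1_comp R expR g t _ _ (is_derive_expR (g t)) (dg t).
  have := is_deriveM (dphi t) de => h; apply: is_derive_eq; rewrite /GRing.scale /=; ring.
have := is_derive_0_is_cst 1 0 dpsi.
have -> : psi 0 = phi 0 by rewrite /psi [g 0](_ : _ = 0) ?expR0 ?mulr1 // /g; ring.
have -> : psi 1 = phi 1 * expR (- (a + b / 2 + c / 3)) by congr (_ * expR _); rewrite /g; ring.
by move=> <-; rewrite -mulrA -expRD addNr expR0 mulr1.
Qed.

(** A zero of a nonnegative function is a minimum on every line. This extends the score equation
    from the positivity set of the density to the whole space. *)
Lemma derive_min0 {R : realType} {V : normedModType R} (f : V -> R) x v :
  (forall y, derivable f y v) -> (forall y, 0 <= f y) -> f x = 0 -> 'D_v f x = 0.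
Proof.
move=> df f0 fx.
have dl (t : R) : is_derive t (1 : R) (fun s : R => f (x + s *: v)) ('D_v f (x + t *: v)) by exact: is_derive_line.
have I0 : (0 : R) \in `](-1), 1[ by rewrite in_itv /= ltr01 andbT oppr_lt0.
have d0 : is_derive (0 : R) 1 (fun s : R => f (x + s *: v)) 0.
  have le : (-1 : R) <= 1 by lra.
  have dl' t : t \in `](-1), 1[%R -> derivable (fun s : R => f (x + s *: v)) t 1 by have [] := dl t.
  by apply: (derive1_at_min le dl' I0) => t _; rewrite scale0r addr0 fx.
by case: d0 => _; case: (dl 0) => _ ->; rewrite scale0r addr0.
Qed.

Section quadratic_score.
Context {R : realType} {n : nat}.
Variables (p : 'cV[R]_n -> R) (mu beta : 'cV[R]_n) (A : 'M[R]_n) (C : 'I_n -> 'M[R]_n).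
Notation lam := (@lebesgue_tuple R n).
Notation vint h := (Ex lam (fun t => h (col_of_tuple t))).
Hypothesis dp : forall x, differentiable p x.
Hypothesis p0 : forall x, 0 <= p x.
Hypothesis vp : vborel p.
Hypothesis L1p : L1 lam (fun t => p (col_of_tuple t)).
Hypothesis Ip : vint p = 1.
Hypothesis L1xp : forall i, L1 lam (fun t => col_of_tuple t i 0 * p (col_of_tuple t)).
Implicit Types (u v h x : 'cV[R]_n).

Let tri h u v := \sum_i h i 0 * bform (C i) u v.
Hypothesis score : forall u i, 'D_(evec i) p (mu + u) = p (mu + u) * (beta i 0 + (A *m u) i 0 + bform (C i) u u).

Let lin h := (h^T *m beta) 0 0.
Let triZ s h u v : tri (s *: h) u v = s * tri h u v.
Proof. by rewrite /tri mulr_sumr; apply: eq_bigr => i _; rewrite mxE mulrA. Qed.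
Let triDl h u v w : tri h (u + v) w = tri h u w + tri h v w.
Proof. by rewrite /tri -big_split; apply: eq_bigr => i _; rewrite bformDl mulrDr. Qed.
Let triDr h u v w : tri h w (u + v) = tri h w u + tri h w v.
Proof. by rewrite /tri -big_split; apply: eq_bigr => i _; rewrite bformDr mulrDr. Qed.
Let triZl s h u v : tri h (s *: u) v = s * tri h u v.
Proof. by rewrite /tri mulr_sumr; apply: eq_bigr => i _; rewrite bformZl mulrCA. Qed.
Let triZr s h u v : tri h u (s *: v) = s * tri h u v.
Proof. by rewrite /tri mulr_sumr; apply: eq_bigr => i _; rewrite bformZr mulrCA. Qed.
Let linZ s h : lin (s *: h) = s * lin h.
Proof. by rewrite /lin linearZ /= -scalemxAl mxE. Qed.

(** Along [t -> mu + u + t h] the logarithmic derivative is [rho0 + rho1 t + tri h h h t^2]. *)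
Let rho0 u h := lin h + bform A h u + tri h u u.
Let rho1 u h := bform A h h + tri h u h + tri h h u.

Let score_dir u h : 'D_h p (mu + u) = p (mu + u) * rho0 u h.
Proof.
rewrite deriveE // {1}(vec_sum h) linear_sum.
transitivity (\sum_i h i 0 * (p (mu + u) * (beta i 0 + (A *m u) i 0 + bform (C i) u u))).
  by apply: eq_bigr => i _; rewrite linearZ /= -deriveE // score.
rewrite /rho0 /lin /bform /tri -mulmxA !mxE -!big_split mulr_sumr; apply: eq_bigr => i _ /=.
by rewrite [h^T _ _]mxE /bform; ring.
Qed.

Let p_shift u h : p (mu + u + h) = p (mu + u) * expR (rho0 u h + rho1 u h / 2 + tri h h h / 3).
Proof.
have := @quadratic_ode R (fun t => p (mu + u + t *: h)) (rho0 u h) (rho1 u h) (tri h h h).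
rewrite scale1r scale0r addr0; apply => t.
have df : derivable p (mu + u + t *: h) h by exact: diff_derivable.
have := is_derive_line df => hd; apply: is_derive_eq.
rewrite -addrA score_dir; congr (_ * _).
rewrite /rho0 /rho1 bformDr bformZr !(triDl, triDr, triZl, triZr); ring.
Qed.

(* AM-GM for h and -h cancels the odd part of the exponent. *)
Let p_sym u h t : p (mu + u) * expR (t ^+ 2 * rho1 u h / 2) <=
  2^-1 * (p (mu + u + t *: h) + p (mu + u + (- t) *: h)).
Proof.
rewrite !p_shift.
have e0 s : rho0 u (s *: h) = s * rho0 u h by rewrite /rho0 linZ bformZl triZ; ring.
have e1 s : rho1 u (s *: h) = s ^+ 2 * rho1 u h.
  by rewrite /rho1 bformZl bformZr !triZ !triZl !triZr; ring.
have e2 s : tri (s *: h) (s *: h) (s *: h) = s ^+ 3 * tri h h h by rewrite triZ triZl triZr; ring.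
rewrite !e0 !e1 !e2.
set D := t * rho0 u h + t ^+ 3 * tri h h h / 3.
have -> : t * rho0 u h + t ^+ 2 * rho1 u h / 2 + t ^+ 3 * tri h h h / 3 = t ^+ 2 * rho1 u h / 2 + D by rewrite /D; ring.
have -> : - t * rho0 u h + (- t) ^+ 2 * rho1 u h / 2 + (- t) ^+ 3 * tri h h h / 3 = t ^+ 2 * rho1 u h / 2 - D by rewrite /D; ring.
rewrite !(expRD (t ^+ 2 * rho1 u h / 2)); set E := expR (t ^+ 2 * _ / 2).
have -> : 2^-1 * (p (mu + u) * (E * expR D) + p (mu + u) * (E * expR (- D))) = p (mu + u) * E * ((expR D + expR (- D)) / 2) by ring.
rewrite ler_peMr ?mulr_ge0 ?expR_ge0 //.
have := expR_ge1Dx D; have := expR_ge1Dx (- D); lra.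
Qed.

Let cp : continuous p. Proof. by move=> x; exact: differentiable_continuous. Qed.

Let rho1_le0 u h : rho1 u h <= 0.
Proof.
rewrite leNgt; apply/negP => r0.
pose g x := rho1 (x - mu) h.
have cg : continuous g.
  have -> : g = (fun x => rho1 (- mu) h + (\sum_i h i 0 * (\sum_j (C i *m h) j 0 * x j 0) +
      \sum_i h i 0 * (\sum_j (h^T *m C i) 0 j * x j 0))).
    apply/funext => x; rewrite /g /rho1 triDl triDr.
    have -> : tri h x h = \sum_i h i 0 * (\sum_j (C i *m h) j 0 * x j 0).
      apply: eq_bigr => i _; rewrite /bform -mulmxA mxE; congr (_ * _); apply: eq_bigr => j _.
      by rewrite [x^T _ _]mxE mulrC.
    have -> : tri h h x = \sum_i h i 0 * (\sum_j (h^T *m C i) 0 j * x j 0).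
      by apply: eq_bigr => i _; rewrite /bform mxE.
    ring.
  have cl (B : 'I_n -> 'I_n -> R) : continuous (fun x : 'cV[R]_n => \sum_i h i 0 * (\sum_j B i j * x j 0)).
    apply: cont_sum => i; apply: contM; first exact: cst_continuous.
    by apply: cont_sum => j; apply: contM; [exact: cst_continuous|exact: coord_continuous].
  apply: contD; first exact: cst_continuous.
  by apply: contD; exact: cl.
(* the positive part of rho1, times p: its mass is at most 2 / t^2 for all t *)
pose psi x := 2^-1 * (`|g x| + g x) * p x.
have psi0 x : 0 <= psi x.
  have h1 := ler_norm (- g x); rewrite normrN in h1.
  by rewrite /psi mulr_ge0 // mulr_ge0 //; move: h1; lra.
have cpsi : continuous psi.
  apply: contM => //; apply: contM; first exact: cst_continuous.
  by apply: contD; [move=> x; exact: (continuous_comp (@cg x) (@norm_continuous _ R^o _))|exact: cg].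
have psi_le x t : t ^+ 2 / 2 * psi x <= 2^-1 * (p (x + t *: h) + p (x + (- t) *: h)).
  have := p_sym (x - mu) h t; rewrite subrKC; apply: le_trans; rewrite /psi -/(g x).
  rewrite [X in X <= _](_ : _ = p x * (2^-1 * (`|g x| + g x) * (t ^+ 2 / 2))); last by ring.
  rewrite ler_wpM2l //; have [g0|g0] := leP 0 (g x).
    rewrite ger0_norm //; have := expR_ge1Dx (t ^+ 2 * g x / 2).
    have -> : 2^-1 * (g x + g x) * (t ^+ 2 / 2) = t ^+ 2 * g x / 2 by field.
    lra.
  by rewrite ltr0_norm // addNr mulr0 mul0r expR_ge0.
have vpsi : vborel psi by exact: vborel_cont.
have L1s t : L1 lam (fun w => 2^-1 * (p (col_of_tuple w + t *: h) + p (col_of_tuple w + (- t) *: h))).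
  by apply: L1Z; apply: L1D; exact: L1_shift.
have L1psi : L1 lam (fun w => psi (col_of_tuple w)).
  apply: (L1_dom vpsi (L1Z 2 (L1s 1))) => w; rewrite ger0_norm //.
  have := psi_le (col_of_tuple w) 1; rewrite expr1n; lra.
have Ipsi t : t ^+ 2 / 2 * vint psi <= 1.
  rewrite -ExZ //; apply: (le_trans (Ex_le (L1Z _ L1psi) (L1s t) (fun w => psi_le _ _))).
  rewrite ExZ; last by apply: L1D; exact: L1_shift.
  by rewrite ExD ?(Ex_shift _ vp L1p) ?Ip; [lra|exact: L1_shift|exact: L1_shift].
have Ipsi0 : vint psi <= 0.
  rewrite leNgt; apply/negP => I0.
  have := Ipsi (Num.sqrt (4 / vint psi)); rewrite sqr_sqrtr ?divr_ge0 ?(ltW I0) //.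
  have -> : 4 / vint psi / 2 * vint psi = 2 by field; rewrite gt_eqF.
  lra.
(* By [p_shift] a zero of [p] would spread to every point, against total mass one. *)
have pmu x : 0 < p x.
  rewrite lt_def p0 andbT; apply/eqP => px0.
  have pz y : p y = 0.
    have := p_shift (x - mu) (y - x); rewrite subrKC subrKC => ->; rewrite px0 mul0r //.
  move: Ip; have -> : (fun t => p (col_of_tuple t)) = (fun t => 0 * p (col_of_tuple t)).
    by apply/funext => t; rewrite pz mulr0.
  by rewrite ExZ // mul0r => /eqP; rewrite eq_sym oner_eq0.
have psiu : 0 < psi (mu + u).
  have gE : g (mu + u) = rho1 u h by rewrite /g addrAC subrr add0r.
  by rewrite /psi mulr_gt0 // mulr_gt0 // gE ger0_norm ?(ltW r0) // addr_gt0.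
have p2 : 0 < psi (mu + u) / 2 by rewrite divr_gt0.
have /cvgr_gt /(_ (psi (mu + u) / 2)) /(_ _) /nbhs_normP [|r /= rr0 hr] := @cpsi (mu + u).
  by rewrite ltr_pdivrMr // ltr_pMr // ltr1n.
have := @Ex_gt0_local R n psi (mu + u) (psi (mu + u) / 2) (r / 2) p2 _ psi0 L1psi.
rewrite divr_gt0 // ltNge Ipsi0 => /(_ isT) H; suff : false by [].
apply: H => x hx; apply/ltW/hr => /=; rewrite distrC (le_lt_trans hx) //.
by rewrite ltr_pdivrMr // ltr_pMr // ltr1n.
Qed.

Let tri0 h v : tri h v h + tri h h v = 0.
Proof.
apply/eqP; apply: contraT => nz.
(* This multiple of [v] is chosen to give [rho1] the value 1. *)
have := rho1_le0 (((1 - bform A h h) / (tri h v h + tri h h v)) *: v) h.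
rewrite /rho1 triZl triZr -addrA -mulrDr divfK // addrCA subrr addr0 => h1.
by move: h1; rewrite leNgt ltr01.
Qed.

Let M := - 2^-1 *: (A + A^T).

Lemma quadratic_score_exp :
  [/\ psd M, 0 < p mu & forall u, p (mu + u) = p mu * expR ((u^T *m beta) 0 0 - qform M u / 2)].
Proof.
have qM u : qform M u = - bform A u u.
  rewrite /qform /bform /M -scalemxAr -scalemxAl mxE mulmxDr mulmxDl mxE.
  have -> : (u^T *m A^T *m u) 0 0 = (u^T *m A *m u) 0 0.
    have -> : u^T *m A^T *m u = (u^T *m A *m u)^T by rewrite !trmx_mul trmxK mulmxA.
    by rewrite mxE.
  by field.
have E u : p (mu + u) = p mu * expR ((u^T *m beta) 0 0 - qform M u / 2).
  have := p_shift 0 u; rewrite addr0 => ->; congr (_ * expR _).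
  have z3 : tri u u u = 0 by have := tri0 u u; lra.
  have z0 (S : 'M[R]_n) v : bform S v 0 = 0 by rewrite /bform mulmx0 mxE.
  have -> : rho1 0 u = bform A u u by rewrite /rho1 -addrA tri0 addr0.
  have -> : rho0 0 u = lin u.
    by rewrite /rho0 z0 /tri big1 ?addr0 // => i _; rewrite z0 mulr0.
  by rewrite z3 qM /lin; ring.
split=> //.
- split=> [|v].
    by rewrite /M linearZ /= linearD /= trmxK addrC.
  rewrite qM oppr_ge0; have := rho1_le0 0 v; rewrite /rho1 -addrA tri0 addr0 //.
- rewrite lt_def p0 andbT; apply/eqP => pz; move: Ip.
  have -> : (fun t => p (col_of_tuple t)) = (fun t => 0 * p (col_of_tuple t)).
    by apply/funext => t; rewrite -{1}(subrKC mu (col_of_tuple t)) E pz !mul0r.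
  by rewrite ExZ // mul0r => /eqP; rewrite eq_sym oner_eq0.
Qed.

Lemma quadratic_score_posdef : posdef M.
Proof.
have [pM pmu E] := quadratic_score_exp; have [sM M0] := pM.
split=> // h hN; rewrite -/(bform M h h) -/(qform M h) lt_def M0 andbT; apply/eqP => q0.
have b0 u : bform M u h = 0.
  have := psd_CS u h pM; rewrite q0 mulr0 => h1; apply/eqP; rewrite -sqrf_eq0; apply/eqP/le_anti.
  by rewrite h1 sqr_ge0.
have ph x : p (x + h) = expR ((h^T *m beta) 0 0) * p x.
  rewrite -(subrKC mu x) -addrA !E qformD // b0 q0 mulr0 !addr0 raddfD /= mulmxDl mxE mulrCA; congr (_ * _).
  by rewrite -expRD; congr expR; ring.
(* [p (x + h)] is a constant multiple of [p x]; comparing total masses, the constant is 1. *)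
have c1 : expR ((h^T *m beta) 0 0) = 1.
  have := Ex_shift h vp L1p; rewrite Ip => <-; rewrite -[LHS]mulr1 -Ip -ExZ //.
  by congr Ex; apply/funext => t; rewrite ph.
pose phi x := (h^T *m x) 0 0 * p x.
have phiE x : phi x = \sum_i h i 0 * (x i 0 * p x).
  by rewrite /phi mxE mulr_suml; apply: eq_bigr => i _; rewrite mxE mulrA.
have vphi : vborel phi.
  apply: measurable_funM => //; apply: (eq_measurable_fun (fun t => \sum_i h i 0 * col_of_tuple t i 0)) => [t _|].
    by rewrite [RHS]mxE; apply: eq_bigr => i _; rewrite [h^T _ _]mxE.
  apply: measurable_sumr => i _; apply: measurable_funM; [exact: measurable_cst|exact: mmeas_col_of_tuple].
have L1phi : L1 lam (fun t => phi (col_of_tuple t)).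
  have : L1 lam (fun t => \sum_i h i 0 * (col_of_tuple t i 0 * p (col_of_tuple t))).
    by apply: L1_sum => i _; exact: L1Z.
  by congr L1; apply/funext => t; rewrite phiE.
(* Translation by [h] preserves the integral of [(h . x) p(x)], yet increases it by [|h|^2], so
   [h = 0]. *)
have := Ex_shift h vphi L1phi.
have -> : (fun t => phi (col_of_tuple t + h)) = (fun t => phi (col_of_tuple t) + (h^T *m h) 0 0 * p (col_of_tuple t)).
  by apply/funext => t; rewrite /phi ph c1 mul1r mulmxDr mxE mulrDl.
rewrite ExD //; last exact: L1Z.
rewrite ExZ // Ip mulr1 => /eqP; rewrite -subr_eq0 addrAC subrr add0r mxE => /eqP h0.
move/eqP: hN; apply; apply/colP => i; rewrite mxE.
have := @psumr_eq0P R _ predT (fun j => h^T 0 j * h j 0) _ h0 i isT.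
rewrite mxE => /(_ _) /eqP; rewrite mulf_eq0 orbb => H; apply/eqP; apply: H => j _.
by rewrite mxE -expr2 sqr_ge0.
Qed.

Lemma quadratic_score_gauss : exists nu (K : R), 0 < K /\
  forall x, p x = K * expR (- qform M (x - nu) / 2).
Proof.
have [pM pmu E] := quadratic_score_exp; have [sM M0] := pM.
have uM := posdef_unit quadratic_score_posdef.
(* Completing the square: the centre of the Gaussian is [mu + w]. *)
pose w := invmx M *m beta.
exists (mu + w), (p mu * expR (qform M w / 2)); split; first by rewrite mulr_gt0 ?expR_gt0.
move=> x; rewrite -{1}(subrKC mu x) E -mulrA -expRD; congr (_ * expR _).
rewrite opprD addrA; set u := x - mu.
have -> : qform M (u - w) = qform M u - 2 * bform M u w + qform M w.
  rewrite qformD // -[- w]scaleN1r bformZr qformZ; ring.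
have -> : bform M u w = (u^T *m beta) 0 0 by rewrite /bform /w mulmxA mulmxK.
by field.
Qed.

End quadratic_score.

(** * The Gaussian normalizing constant *)

Section gaussian_integral.
Context {R : realType}.

Lemma integral_expR_sqr (s : R) : 0 < s ->
  (\int[@lebesgue_measure R]_x (expR (- (s * x ^+ 2) / 2))%:E = (Num.sqrt (pi *+ 2 / s))%:E)%E.
Proof.
move=> s0; pose sg := Num.sqrt s^-1.
have sg2 : sg ^+ 2 = s^-1 by rewrite sqr_sqrtr // invr_ge0 ltW.
have sg0 : sg != 0 by rewrite -sqrf_eq0 sg2 invr_eq0 gt_eqF.
have c0 : 0 < Num.sqrt (pi *+ 2 / s) by rewrite sqrtr_gt0 divr_gt0 // mulrn_wgt0 // pi_gt0.
have h := integral_normal_pdf 0 sg.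
have e x : normal_pdf 0 sg x = (Num.sqrt (pi *+ 2 / s))^-1 * expR (- (s * x ^+ 2) / 2).
  rewrite /normal_pdf (negbTE sg0) /normal_peak /normal_fun sg2 subr0; congr (_^-1 * expR _).
    by congr Num.sqrt; rewrite mulrC -mulrnAl.
  by field; rewrite gt_eqF.
have h' : (((Num.sqrt (pi *+ 2 / s))^-1)%:E * \int[@lebesgue_measure R]_x (expR (- (s * x ^+ 2) / 2))%:E = 1)%E.
  rewrite -ge0_integralZl_EFin ?invr_ge0 ?(ltW c0) //.
  - by rewrite -[RHS]h; apply: eq_integral => x _; rewrite e.
  - apply/measurable_EFinP; apply: measurableT_comp => //; apply: measurable_funM; last exact: measurable_cst.
    by apply: measurableT_comp => //; apply: measurable_funM; [exact: measurable_cst|exact: measurable_funX].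
rewrite -[LHS]mul1e -[X in (X%:E * _)%E](divff (x := Num.sqrt (pi *+ 2 / s))) ?gt_eqF //.
by rewrite EFinM -muleA h' mule1.
Qed.

Lemma vborel_expR_qform n (M : 'M[R]_n) : vborel (fun x => expR (- qform M x / 2)).
Proof.
have h : mmeas (fun t : n.-tuple R => (col_of_tuple t)^T *m M *m col_of_tuple t).
  apply: mmeasM; last exact: mmeas_col_of_tuple.
  by apply: mmeasM; [apply: mmeas_tr; exact: mmeas_col_of_tuple|exact: mmeas_cst].
apply: measurableT_comp => //; apply: measurable_funM; last exact: measurable_cst.
by apply: measurableT_comp => //; exact: h.
Qed.

Lemma qform_block m (M : 'M[R]_(1 + m)) (x : R) (y : 'cV[R]_m) : M^T = M ->
  qform M (col_mx x%:M y) = ulsubmx M 0 0 * x ^+ 2 + 2 * x * (y^T *m dlsubmx M) 0 0 + qform (drsubmx M) y.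
Proof.
move=> sM; have ur : ursubmx M = (dlsubmx M)^T by rewrite trmx_dlsub sM.
rewrite /qform /bform -{1}(submxK M) tr_col_mx mul_row_block mul_row_col.
rewrite tr_scalar_mx mul_scalar_mx mul_mx_scalar [LHS]mxE mulmxDl [X in _ + X]mxE.
have -> : (x%:M *m ursubmx M *m y) 0 0 = x * (y^T *m dlsubmx M) 0 0.
  rewrite mul_scalar_mx -scalemxAl mxE; congr (_ * _).
  have -> : ursubmx M *m y = (y^T *m dlsubmx M)^T by rewrite trmx_mul trmxK ur.
  by rewrite mxE.
have Z (u : 'M[R]_1) : (x *: u) 0 0 = x * u 0 0 by rewrite mxE.
have A (u v : 'M[R]_1) : (u + v) 0 0 = u 0 0 + v 0 0 by rewrite mxE.
by rewrite Z A Z; ring.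
Qed.

Lemma col_of_tuple_cons m (x : R) (y : m.-tuple R) :
  col_of_tuple [tuple of x :: y] = col_mx x%:M (col_of_tuple y) :> 'cV[R]_(1 + m).
Proof.
apply/colP => i; rewrite !mxE (tnth_nth x); case: splitP => j ->.
  by rewrite !ord1 mxE.
by rewrite mxE (tnth_nth x).
Qed.

(** Induction following the iterated integral, which peels off the first coordinate: the quadratic
    form and the determinant both split along the corresponding block decomposition. *)
Lemma iint_gauss m (M : 'M[R]_m) : posdef M ->
  0 < \det M /\ iint_tuple (fun t : m.-tuple R => (expR (- qform M (col_of_tuple t) / 2))%:E) =
    (Num.sqrt ((pi *+ 2) ^+ m / \det M))%:E.
Proof.
elim: m M => [|m IH] M pM.
  by rewrite /= /qform /bform mxE big_ord0 oppr0 mul0r expR0 expr0 det_mx00 divr1 sqrtr1; split.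
move: M pM; change (m.+1) with (1 + m)%N => M pM.
have [sM M0] := pM.
set D := drsubmx M; set c := dlsubmx M; pose a := ulsubmx M 0 0.
have qM x y : qform M (col_mx x%:M y) = a * x ^+ 2 + 2 * x * (y^T *m c) 0 0 + qform D y by exact: qform_block.
have sD : D^T = D by rewrite /D trmx_drsub sM.
have pD : posdef D.
  split=> // v vN; have := M0 (col_mx 0%:M v); rewrite -/(bform _ _ _) -/(qform _ _) qM expr0n /= !(mulr0, mul0r, add0r).
  apply; apply: contra vN => /eqP e; apply/eqP/colP => i.
  by have := congr1 (fun z : 'cV[R]_(1 + m) => z (rshift 1 i) 0) e; rewrite col_mxEd !mxE.
have uD := posdef_unit pD; have [dD0 ID] := IH D pD.
(* [s] is the Schur complement of [D]. For fixed [x] the inner integrand is that of [D] translated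
   by [x *: w], so the inner integral depends on [x] through a scalar factor only. *)
pose w := invmx D *m c; pose s := a - (c^T *m w) 0 0.
have bw y : bform D y w = (y^T *m c) 0 0 by rewrite /bform /w mulmxA mulmxK.
have qE x y : qform M (col_mx x%:M y) = s * x ^+ 2 + qform D (y + x *: w).
  rewrite qM qformD // qformZ bformZr bw.
  have -> : qform D w = (c^T *m w) 0 0.
    rewrite /qform bw; have -> : w^T *m c = (c^T *m w)^T by rewrite [RHS]trmx_mul trmxK.
    by rewrite mxE.
  rewrite /s; ring.
have s0 : 0 < s.
  have := M0 (col_mx 1%:M (- w)); rewrite -/(bform _ _ _) -/(qform _ _) qE scale1r addNr expr1n mulr1.
  have -> : qform D 0 = 0 by rewrite /qform /bform mulmx0 mxE.
  rewrite addr0; apply; apply/eqP => e.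
  have := congr1 (fun z : 'cV[R]_(1 + m) => z (lshift m 0) 0) e; rewrite col_mxEu !mxE /= => /eqP.
  by rewrite oner_eq0.
have detM : \det M = s * \det D.
  have -> : M = block_mx s%:M c^T 0 D *m block_mx 1%:M 0 w 1%:M.
    rewrite mulmx_block !mulmx1 !mulmx0 !add0r /w mulKVmx // -/w -{1}(submxK M).
    have -> : ursubmx M = c^T by rewrite trmx_dlsub sM.
    congr (block_mx _ _ _ _); apply/matrixP => i j.
    by rewrite !ord1 [RHS]mxE [s%:M _ _]mxE eqxx mulr1n /s subrK.
  by rewrite det_mulmx det_ublock det_lblock !det1 !mulr1 det_scalar1.
split; first by rewrite detM mulr_gt0.
pose K := Num.sqrt ((pi *+ 2) ^+ m / \det D).
pose g (y : m.-tuple R) : \bar R := (expR (- qform D (col_of_tuple y) / 2))%:E.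
have mg : measurable_fun [set: m.-tuple R] g by apply/measurable_EFinP; exact: vborel_expR_qform.
have g0 y : (0 <= g y)%E by rewrite lee_fin expR_ge0.
rewrite /=.
have inner (x : R) : iint_tuple (fun y : m.-tuple R => (expR (- qform M (col_of_tuple [tuple of x :: y]) / 2))%:E) =
    (K%:E * (expR (- (s * x ^+ 2) / 2))%:E)%E.
  have e (y : m.-tuple R) : (expR (- qform M (col_of_tuple [tuple of x :: y]) / 2))%:E =
      ((expR (- (s * x ^+ 2) / 2))%:E * g (tadd y (tuple_of_col (x *: w))))%E.
    rewrite /g -EFinM -expRD; congr (expR _)%:E; rewrite (col_of_tuple_cons x y) qE.
    have -> : col_of_tuple (tadd y (tuple_of_col (x *: w))) = col_of_tuple y + x *: w.
      by apply/colP => i; rewrite !mxE !tnth_mktuple !mxE.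
    ring.
  rewrite (_ : (fun y => _) = (fun y => (expR (- (s * x ^+ 2) / 2))%:E * g (tadd y (tuple_of_col (x *: w))))%E); last by apply/funext.
  have mgs : measurable_fun [set: m.-tuple R] (fun y => g (tadd y (tuple_of_col (x *: w)))).
    exact: measurableT_comp (measurable_tadd _).
  rewrite iint_tupleE; last 2 first.
  - exact: emeasurable_funM.
  - by move=> t; rewrite mule_ge0 // lee_fin expR_ge0.
  rewrite ge0_integralZl_EFin ?expR_ge0 //.
  by rewrite -iint_tupleE // iint_tuple_shift // ID muleC.
rewrite (_ : (fun x => _) = (fun x => K%:E * (expR (- (s * x ^+ 2) / 2))%:E)%E); last by apply/funext.
rewrite ge0_integralZl_EFin ?sqrtr_ge0 //; last first.
  apply/measurable_EFinP; apply: measurableT_comp => //; apply: measurable_funM; last exact: measurable_cst.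
  by apply: measurableT_comp => //; apply: measurable_funM; [exact: measurable_cst|exact: measurable_funX].
rewrite integral_expR_sqr // -EFinM /K -sqrtrM; last first.
  by rewrite divr_ge0 ?(ltW dD0) // exprn_ge0 // mulrn_wge0 // pi_ge0.
rewrite detM exprS; congr (Num.sqrt _)%:E; rewrite invfM; ring.
Qed.

End gaussian_integral.

(** * From the quadratic score to the normal law *)

Section converse.
Context {R : realType} {n : nat} {d : measure_display} {T : measurableType d}.
Variables (P : probability T R) (X : T -> 'cV[R]_n).
Implicit Types (u x : 'cV[R]_n).

Lemma L1_coord_sqr : random_vector X -> ('E_P[fun w => (\sum_i X w i ord0 ^+ 2)%R] < +oo)%E ->
  forall i, L1 P (fun w => X w i 0 ^+ 2).
Proof.
move=> rvX fin i.
have mX j : measurable_fun [set: T] (fun w => X w j 0 ^+ 2).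
  by apply: measurable_funX; exact: random_vector_mmeas.
have s0 w : 0 <= \sum_j X w j 0 ^+ 2 by apply: sumr_ge0 => j _; exact: sqr_ge0.
have L : L1 P (fun w => \sum_j X w j 0 ^+ 2).
  apply/integrableP; split.
    by apply/measurable_EFinP; apply: measurable_sumr => j _; exact: mX.
  move: fin; rewrite unlock; congr (_ < _)%E; apply: eq_integral => w _ /=.
  by rewrite ger0_norm.
apply: (L1_dom (mX i) L) => w; rewrite ger0_norm ?sqr_ge0 // (bigD1 i) //= lerDl sumr_ge0 // => j _.
exact: sqr_ge0.
Qed.

Hypothesis rvX : random_vector X.
Hypothesis L2 : forall i, L1 P (fun w => X w i 0 ^+ 2).

Lemma cov_mx_psd : psd (cov_mx P X).
Proof.
have mX i : measurable_fun [set: T] (fun w => X w i 0) by exact: random_vector_mmeas.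
have LX i : L1 P (fun w => X w i 0) by exact: L1_sqr.
pose Y i w := X w i 0 - Ex P (fun w => X w i 0).
have mY i : measurable_fun [set: T] (Y i) by apply: measurable_funB => //; exact: measurable_cst.
have LY2 i : L1 P (fun w => Y i w ^+ 2).
  have := L1D (L1B (L2 i) (L1Z (2 * Ex P (fun w => X w i 0)) (LX i))) (L1_cst P (Ex P (fun w => X w i 0) ^+ 2)).
  by congr L1; apply/funext => w; rewrite /Y; ring.
have LY i j : L1 P (fun w => Y i w * Y j w) by exact: L1_mul.
have E i j : cov_mx P X i j = Ex P (fun w => Y i w * Y j w).
  by rewrite mxE covariance.unlock !fine_expectation; congr Ex; apply/funext => w.
split=> [|v]; first by apply/matrixP => i j; rewrite mxE !E; congr Ex; apply/funext => w; rewrite mulrC.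
have -> : qform (cov_mx P X) v = Ex P (fun w => (\sum_i v i 0 * Y i w) ^+ 2).
  transitivity (Ex P (fun w => \sum_j \sum_i v i 0 * v j 0 * (Y i w * Y j w))).
    rewrite Ex_sum => [|j _]; last by apply: L1_sum => i _; exact: L1Z.
    rewrite /qform /bform mxE; apply: eq_bigr => j _.
    rewrite Ex_sum => [|i _]; last exact: L1Z.
    by rewrite mxE mulr_suml; apply: eq_bigr => i _; rewrite ExZ // E mxE; ring.
  congr Ex; apply/funext => w; rewrite expr2 mulr_sumr; apply: eq_bigr => j _.
  by rewrite mulr_suml; apply: eq_bigr => i _; ring.
by apply: Ex_ge0 => w; exact: sqr_ge0.
Qed.

Variables (p : 'cV[R]_n -> R).
Hypothesis dX : has_density P X p.
Hypothesis dp : forall x, differentiable p x.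
Hypothesis key : forall f, smooth f -> compact (supp f) -> supp f `<=` interior (supp p) ->
  0 <= Ex P (fun w => f (X w) * linear_part P X f (X w)).

Lemma density_gauss_form : exists M nu (K : R), [/\ posdef M, 0 < K &
  forall x, p x = K * expR (- qform M (x - nu) / 2)].
Proof.
have [theta hth] := score_ex dX dp L2 key.
have [_ [p0 [vp _]]] := dX.
have v1 : vborel (fun _ : 'cV[R]_n => 1 : R) by exact: measurable_cst.
have Lp : L1 (lebesgue_tuple n) (fun t => p (col_of_tuple t)).
  by have := density_L1 dX v1 (L1_cst P 1); congr L1; apply/funext => t; rewrite mul1r.
have Ip : Ex (lebesgue_tuple n) (fun t => p (col_of_tuple t)) = 1.
  rewrite -(Ex_cst P 1) (density_Ex dX v1 (L1_cst P 1)); congr Ex; apply/funext => t; by rewrite mul1r.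
have Lxp i : L1 (lebesgue_tuple n) (fun t => col_of_tuple t i 0 * p (col_of_tuple t)).
  have vi : vborel (fun x : 'cV[R]_n => x i 0) by exact: vborel_coord.
  by apply: (density_L1 dX vi); apply: L1_sqr; [exact: random_vector_mmeas|exact: L2].
pose mu := mean_vec P X.
(* Coefficients of the score as a polynomial in [u = x - mu]; its constant term comes from the
   centring of the products by the covariance. *)
pose beta : 'cV[R]_n := \col_i - \sum_j \sum_k theta (inr (j, k)) i * cov_mx P X j k.
pose A : 'M[R]_n := \matrix_(i, j) theta (inl j) i.
pose C i : 'M[R]_n := \matrix_(j, k) theta (inr (j, k)) i.
have score u i : 'D_(evec i) p (mu + u) = p (mu + u) * (beta i 0 + (A *m u) i 0 + bform (C i) u u).
  have [px|px] := ltP 0 (p (mu + u)); last first.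
    (* Where [p] vanishes both sides of the score equation are 0, by [derive_min0]. *)
    have pz : p (mu + u) = 0 by apply/eqP; rewrite eq_le px p0.
    by rewrite pz mul0r; apply: derive_min0 => // y; exact: diff_derivable.
  rewrite hth //; congr (_ * _); rewrite big_sumType /= [RHS]addrAC [RHS]addrC; congr (_ + _).
    by rewrite mxE; apply: eq_bigr => j _; rewrite mxE /cent mxE addrAC subrr add0r.
  have -> : bform (C i) u u = \sum_j \sum_k theta (inr (j, k)) i * (u j 0 * u k 0).
    rewrite /bform -mulmxA mxE; apply: eq_bigr => j _; rewrite [(C i *m u) _ _]mxE mulr_sumr.
    by apply: eq_bigr => k _; rewrite !mxE; ring.
  have -> : beta i 0 = - \sum_j \sum_k theta (inr (j, k)) i * cov_mx P X j k by rewrite mxE.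
  rewrite addrC -sumrB.
  transitivity (\sum_j \sum_k theta (inr (j, k)) i * cprod P X j k (mu + u)).
    by rewrite pair_bigA; apply: eq_bigr => -[].
  apply: eq_bigr => j _; rewrite -sumrB; apply: eq_bigr => k _.
  by rewrite /cprod /cent !mxE; ring.
have pM := quadratic_score_posdef dp p0 vp Lp Ip Lxp score.
have [nu [K [K0 h]]] := quadratic_score_gauss dp p0 vp Lp Ip Lxp score.
by exists (- 2^-1 *: (A + A^T)), nu, K.
Qed.

(** Total mass one and [iint_gauss] determine [K], and the value is the constant in [gauss_pdf] for
    the covariance [invmx M]. *)
Lemma gauss_form_density M nu (K : R) : posdef M -> 0 < K ->
  (forall x, p x = K * expR (- qform M (x - nu) / 2)) -> p = gauss_pdf nu (invmx M).
Proof.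
move=> pM K0 E; have [dM IM] := iint_gauss pM.
pose h (t : n.-tuple R) : \bar R := (expR (- qform M (col_of_tuple t) / 2))%:E.
have mh : measurable_fun [set: n.-tuple R] h by apply/measurable_EFinP; exact: vborel_expR_qform.
have h0 t : (0 <= h t)%E by rewrite lee_fin expR_ge0.
have H : (K%:E * (Num.sqrt ((pi *+ 2) ^+ n / \det M))%:E = 1)%E.
  rewrite -IM iint_tupleE // -(integral_tuple_shift (tuple_of_col (- nu)) mh h0).
  have mhs : measurable_fun [set: n.-tuple R] (fun t => h (tadd t (tuple_of_col (- nu)))).
    exact: measurableT_comp (measurable_tadd _).
  rewrite -ge0_integralZl_EFin ?(ltW K0) //.
  have m1 : measurable_fun [set: n.-tuple R] (fun=> 1%:E : \bar R) by exact: measurable_cst.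
  have := density_integral dX m1 (fun=> lee01).
  have -> : (\int[P]__ 1 = 1)%E by rewrite integral_cst // mul1e; exact: probability_setT.
  move=> ->; apply: eq_integral => t _.
  rewrite mul1e E EFinM; congr (_ * (expR (- qform M _ / 2))%:E)%E.
  by apply/colP => i; rewrite !mxE !tnth_mktuple !mxE.
have {H} KE : K = (Num.sqrt ((pi *+ 2) ^+ n * \det (invmx M)))^-1.
  move/eqP: H; rewrite -EFinM eqe det_inv => /eqP H.
  have s0 : Num.sqrt ((pi *+ 2) ^+ n / \det M) != 0 by apply/eqP => e; move: H; rewrite e mulr0 => /eqP; rewrite eq_sym oner_eq0.
  by apply: (mulIf s0); rewrite mulVf.
by apply/funext => x; rewrite E /gauss_pdf invmxK -KE.
Qed.

End converse.

Theorem theorem2p4 (R : realType) (n : nat) (d : measure_display)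
  (T : measurableType d) (P : probability T R) :
  (* (i) normal X *)
  (forall (X : T -> 'cV[R]_n) (Xs : nat -> T -> 'cV[R]_n)
          (mu : 'cV[R]_n) (Sigma : 'M[R]_n),
     posdef Sigma ->
     has_density P X (gauss_pdf mu Sigma) ->
     iid_copies P X Xs ->
     UMM2 P X Xs (gauss_pdf mu Sigma) /\
     forall f : 'cV[R]_n -> R, smooth f -> compact (supp f) ->
       exists A : nat -> R, one_plus_O_invsqrt A /\
         forall N : nat, (0 < N)%N ->
           'V_P[mm2_estimator P X Xs f N] =
             (A N / N%:R *
               (fine 'V_P[fun w => f (X w)]
                - (mean_grad P X f *m Sigma *m (mean_grad P X f)^T) ord0 ord0
                - 2^-1 * \tr ((Sigma *m mean_hessian P X f)
                              *m (Sigma *m mean_hessian P X f))))%:E)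
  /\
  (* (ii) converse *)
  (forall (X : T -> 'cV[R]_n) (Xs : nat -> T -> 'cV[R]_n) (p : 'cV[R]_n -> R),
     has_density P X p ->
     (forall x, differentiable p x) ->
     ('E_P[fun w => (\sum_i X w i ord0 ^+ 2)%R] < +oo)%E ->
     cov_mx P X \in unitmx ->
     iid_copies P X Xs ->
     UMM2 P X Xs p ->
     exists (mu : 'cV[R]_n) (Sigma : 'M[R]_n),
       posdef Sigma /\ has_density P X (gauss_pdf mu Sigma)).
Proof.
split=> [X Xs mu Sigma pS dX iidX|X Xs p dX dp fin uS iidX umm].
  exact: gaussian_moment_matching.
have rvX : random_vector X by case: dX.
have L2 := L1_coord_sqr rvX fin.
have pS : posdef (cov_mx P X) by apply: psd_unit_posdef => //; exact: cov_mx_psd.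
have key f : smooth f -> compact (supp f) -> supp f `<=` interior (supp p) ->
    0 <= Ex P (fun w => f (X w) * linear_part P X f (X w)).
  move=> sf cf hf; have [A [A1 AN]] := umm f sf cf hf.
  exact: (key_inequality iidX pS L2 sf cf A1 AN).
have [M [nu [K [pM K0 E]]]] := density_gauss_form rvX L2 dX dp key.
exists nu, (invmx M); split; first exact: posdef_inv.
by rewrite -(gauss_form_density dX pM K0 E).
Qed.
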